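(* Let $n\ge 2$. Let $\mathcal{R}$ be a ring in $\overline{\mathbb{R}}^n$ separating a given point $x_0\in\mathbb{R}^n$ and $\infty$ and satisfying the condition $\operatorname{mod}\mathcal{R}>A_n$. Then there exists an annular subring $\mathcal{A}$ of $\mathcal{R}$ centered at $x_0$ with $$\operatorname{mod}\mathcal{A}\ \ge\ \operatorname{mod}\mathcal{R}-A_n .$$ The constant $A_n$ is sharp (it cannot be replaced by a smaller constant in this assertion). Moreover, the number $A_n$ admits the estimate $$A_n\le 2\log\frac{(1+\sqrt2)\lambda_n}{2}=\log\frac{(3+2\sqrt2)\lambda_n^2}{4}.$$
   Context: $\overline{\mathbb{R}}^n=\mathbb{R}^n\cup\{\infty\}$. For a family $\Gamma$ of curves in $\overline{\mathbb{R}}^n$, a Borel function $\rho\ge 0$ on $\mathbb{R}^n$ is admissible if $\int_\gamma\rho\,|dx|\ge 1$ for every locally rectifiable $\gamma\in\Gamma$; the conformal modulus is $\mathsf{M}(\Gamma)=\inf_\rho\int_{\mathbb{R}^n}\rho^n\,dm$ over admissible $\rho$ ($m$ is Lebesgue measure). A continuum is a nonempty connected compact set; a continuum $C\subsetneq\overline{\mathbb{R}}^n$ is filled if $\overline{\mathbb{R}}^n\setminus C$ is connected. For disjoint filled continua $C_0,C_1$ the domain $\mathcal{R}=\mathcal{R}(C_0,C_1)=\overline{\mathbb{R}}^n\setminus(C_0\cup C_1)$ is called a ring. It separates a set $E$ if $\mathcal{R}\cap E=\varnothing$ and $C_j\cap E\neq\varnothing$ for $j=0,1$; ''separating $x_0$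 and $\infty$'' means separating $E=\{x_0,\infty\}$. Let $\Gamma_{\mathcal{R}}$ be the family of all curves joining $C_0$ and $C_1$ in $\mathcal{R}$, and $$\operatorname{mod}\mathcal{R}=\left[\frac{\omega_{n-1}}{\mathsf{M}(\Gamma_{\mathcal{R}})}\right]^{1/(n-1)},$$ where $\omega_{n-1}$ is the area of the unit sphere in $\mathbb{R}^n$. A ring $\mathcal{R}'$ is a subring of $\mathcal{R}$ if $\mathcal{R}'\subset\mathcal{R}$ and each component of $\overline{\mathbb{R}}^n\setminus\mathcal{R}'$ intersects $\overline{\mathbb{R}}^n\setminus\mathcal{R}$. An annular ring centered at $a\in\mathbb{R}^n$ is a ring $\{x\in\mathbb{R}^n: r_0<|x-a|<r_1\}$ with $0<r_0<r_1<\infty$; its modulus is $\log(r_1/r_0)$. With $e_1=(1,0,\dots,0)$: the Teichmüller ring is $R_{T,n}(t)=\mathcal{R}([-e_1,0],[te_1,\infty])$, $t>0$, and the Grötzsch ring is $R_{G,n}(s)=\mathcal{R}(\overline{\mathbb{B}}^n,[se_1,\infty])$, $s>1$ ($\overline{\mathbb{B}}^n$ is the closed unit ball centered at the origin; $[se_1,\infty]$ denotes the ray $\{ue_1:u\ge s\}\cup\{\infty\}$). Define $$A_n=\sup_{1<t<\infty}\big[\operatorname{mod}R_{T,n}(t)-\log t\big],$$ $\Phi_n(s)=\exp(\operatorname{mod}R_{G,n}(s))$, and the Grötzsch constant $\lambda_n=\lim_{s\to\infty}\Phi_n(s)/s$ (the limit exists and is finite).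
   Formalization: The ring R is also assumed to have finite modulus (M(Γ_R) > 0); this excludes rings with a one-point complementary component, whose modulus is infinite while every annular ring has finite modulus, so that the assertion fails for them. *)

(* Defs.v *)
From HB Require Import structures.
From mathcomp Require Import all_boot all_order all_algebra.
From mathcomp Require Import all_classical all_reals all_analysis.
From mathcomp Require Import measurable_realfun.
Set Implicit Arguments.
Unset Strict Implicit.
Unset Printing Implicit Defensive.
Import Order.TTheory GRing.Theory Num.Theory.
Import numFieldNormedType.Exports.
Local Open Scope classical_set_scope.
Local Open Scope ring_scope.

Definition enorm {R : realType} {n : nat} (x : 'rV[R]_n) : R :=
  Num.sqrt (\sum_i x ord0 i ^+ 2).

(* The first basis vector; for n = 0 it is the only vector. *)
Definition e1 {R : realType} {n : nat} : 'rV[R]_n :=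
  \row_j ((j : nat) == 0%N)%:R.

Definition borel_rV (R : realType) (n : nat) :=
  g_sigma_algebraType (@open 'rV[R]_n).

Definition row_of_tuple {R : realType} {n : nat} (t : n.-tuple R)
  : borel_rV R n := \row_i tnth t i.

Fixpoint lebesgue_tuple (R : realType) (n : nat) : set (n.-tuple R) -> \bar R :=
  match n with
  | 0 => \d_([tuple] : 0.-tuple R)
  | n'.+1 => pushforward
      (@lebesgue_measure R \x @lebesgue_tuple R n')%E
      (fun p : R * n'.-tuple R => [the n'.+1.-tuple R of p.1 :: p.2])
  end.

(* Lebesgue measure on the Borel subsets of R^n, as the n-fold product of the
   Lebesgue measure of the line *)
Definition lebesgue_rV (R : realType) (n : nat)
  : set (borel_rV R n) -> \bar R :=
  pushforward (@lebesgue_tuple R n) row_of_tuple.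

(* Points of R^n are [Some x]; the point at infinity is [None]. *)
Definition Rbar (R : realType) (n : nat) :=
  one_point_compactification 'rV[R]_n.

Section Modulus.
Context {R : realType} {n : nat}.
Local Notation Rn := 'rV[R]_n.
Local Notation Rbn := (Rbar R n).

Record curve := Curve {
  curve_dom : interval R;
  curve_fun :> R -> Rbn;
  curve_continuous : {within [set` curve_dom], continuous curve_fun} }.

(* Only used on arcs that avoid the point at infinity. *)
Definition finite_part (g : R -> Rbn) (t : R) : Rn := odflt 0 (g t).

Definition curve_length (c d : R) (f : R -> Rn) : \bar R :=
  ereal_sup [set (\sum_(0 <= k < size s)
                   enorm (f (nth d (c :: s) k.+1) - f (nth d (c :: s) k)))%:E
            | s in [set s | itv_partition c d s]].

Definition rectifiable (c d : R) (g : R -> Rbn) :=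
  (forall t, t \in `[c, d] -> g t <> None) /\
  (curve_length c d (finite_part g) < +oo)%E.

Definition locally_rectifiable (g : curve) :=
  forall c d : R, c <= d -> [set` `[c, d]] `<=` [set` curve_dom g] ->
    rectifiable c d g.

(* The parametrization by arc length of f on [c, d]: its value at s is the
   value of f at any t such that f has length s on [c, t], which does not
   depend on t. *)
Definition arclength_param (c d : R) (f : R -> Rn) (s : R) : Rn :=
  f (get [set t | t \in `[c, d] /\ curve_length c t f = s%:E]).

Definition arc_integral (rho : Rn -> \bar R) (c d : R) (f : R -> Rn)
    : \bar R :=
  (\int[lebesgue_measure]_(s in `[0%R, fine (curve_length c d f)])
     rho (arclength_param c d f s))%E.

(* For a locally rectifiable curve g, the supremum over its closed subarcs;
   it is reached at the whole curve when the domain of g is compact. *)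
Definition line_integral (rho : Rn -> \bar R) (g : curve) : \bar R :=
  ereal_sup [set arc_integral rho cd.1 cd.2 (finite_part g)
            | cd in [set cd : R * R | cd.1 <= cd.2 /\
                       [set` `[cd.1, cd.2]] `<=` [set` curve_dom g]]].

Definition admissible (Gamma : set curve) (rho : borel_rV R n -> \bar R) :=
  [/\ measurable_fun [set: borel_rV R n] rho,
      (forall x, 0 <= rho x)%E &
      forall g, Gamma g -> locally_rectifiable g ->
        (1 <= line_integral rho g)%E].

Definition modulus (Gamma : set curve) : \bar R :=
  ereal_inf [set (\int[@lebesgue_rV R n]_x (rho x ^+ n))%E
            | rho in admissible Gamma].

(* Surface measure on the unit sphere: n times the volume of the cone
   over A (polar coordinates). *)
Definition sphere_measure (A : set Rn) : \bar R :=
  (n%:R%:E * @lebesgue_rV R n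
     [set t *: u | t in [set t | 0 < t <= 1] & u in A]%R)%E.

Definition sphere_area : \bar R :=
  sphere_measure [set u | enorm u = 1].

Definition continuum (C : set Rbn) :=
  [/\ C !=set0, connected C & compact C].

Definition filled_continuum (C : set Rbn) :=
  [/\ continuum C, C <> setT & connected (~` C)].

Definition ring_pair (C0 C1 : set Rbn) :=
  [/\ filled_continuum C0, filled_continuum C1 & C0 `&` C1 = set0].

Definition ring_dom (C0 C1 : set Rbn) : set Rbn := ~` (C0 `|` C1).

Definition ring_separates (C0 C1 E : set Rbn) :=
  [/\ ring_dom C0 C1 `&` E = set0, C0 `&` E !=set0 & C1 `&` E !=set0].

Definition ring_curves (C0 C1 : set Rbn) : set curve :=
  [set g | exists a b : R,
    [/\ a < b, curve_dom g = `[a, b],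
        (C0 (g a) /\ C1 (g b)) \/ (C1 (g a) /\ C0 (g b)) &
        forall t, a < t < b -> ring_dom C0 C1 (g t)]].

(* Infinite when the modulus of the curve family vanishes. *)
Definition ring_mod (C0 C1 : set Rbn) : \bar R :=
  ((sphere_area / modulus (ring_curves C0 C1)) `^ (n.-1%:R^-1)%R)%E.

Definition subring_dom (D' D : set Rbn) :=
  D' `<=` D /\
  forall x, (~` D') x -> connected_component (~` D') x `&` ~` D !=set0.

Definition annulus (a : Rn) (r0 r1 : R) : set Rbn :=
  Some @` [set x : Rn | r0 < enorm (x - a) < r1].

Definition ray (s : R) : set Rbn :=
  Some @` [set u *: (e1 : Rn) | u in [set u | s <= u]] `|` [set None].

Definition teichmuller_mod (t : R) : \bar R :=
  ring_mod (Some @` [set u *: (e1 : Rn) | u in [set u | -1 <= u <= 0]])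
           (ray t).

Definition groetzsch_mod (s : R) : \bar R :=
  ring_mod (Some @` [set x : Rn | enorm x <= 1]) (ray s).

End Modulus.

Definition teichmuller_constant (R : realType) (n : nat) : \bar R :=
  ereal_sup [set (@teichmuller_mod R n t - (ln t)%:E)%E
            | t in [set t | 1 < t]].

Definition groetzsch_Phi (R : realType) (n : nat) (s : R) : \bar R :=
  expeR (@groetzsch_mod R n s).

(* [fine] because the limit, taken in \bar R, is known to be finite. *)
Definition groetzsch_constant (R : realType) (n : nat) : R :=
  fine (lim ((groetzsch_Phi n s / s%:E)%E @[s --> +oo])).

(* Finiteness of the modulus excludes the rings with a one-point complementary
   component: these contain annuli of arbitrarily large modulus, but no
   annulus has infinite modulus. *)
Definition annular_subring_property (R : realType) (n : nat)
    (x0 : 'rV[R]_n) (c : \bar R) :=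
  forall C0 C1 : set (Rbar R n),
    ring_pair C0 C1 ->
    ring_separates C0 C1 [set Some x0; None] ->
    (ring_mod C0 C1 < +oo)%E ->
    (c < ring_mod C0 C1)%E ->
    exists r0 r1 : R, exists D0 D1 : set (Rbar R n),
      [/\ 0 < r0 < r1, ring_pair D0 D1,
          ring_dom D0 D1 = annulus x0 r0 r1,
          subring_dom (ring_dom D0 D1) (ring_dom C0 C1) &
          (ring_mod C0 C1 - c <= ring_mod D0 D1)%E].

(* Main.v *)
(* Moduli are computed with Lipschitz potentials [u] and Borel upper gradients
   [g]. Averaging an admissible density over small cubes yields a Lipschitz
   potential; a Morrey-type estimate on good coordinate slices attaches the
   cubes to the continua at small cost, so no energy is lost in the limit.

   Polarizing a potential in all hyperplanes through the origin shows that,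
   when [C_0] joins 0 to the sphere of radius [a] and [C_1] joins the sphere of
   radius [b] to infinity, [mod R(C_0, C_1) <= mod R_T(b / a)]. With [a] the
   largest distance from [x0] in [C_0] and [b] the smallest one in [C_1], this
   is at most [A_n + log (b / a)], and [log (b / a)] is the modulus of the
   annulus between the two spheres. Teichmuller rings give sharpness.

   The odd reflection [u - u o I] in a sphere centered at [-e_1] gives
   [mod R_T(t) <= 2 mod R_G(sqrt (1 + t))]. An inversion maps [R_G(s)] to the
   ring between [[-a e_1, a e_1]] and the unit sphere, with
   [a = s - sqrt (s^2 - 1)]. The modulus of the latter plus [log a] grows as [a]
   decreases and converges to [log (lambda_n / 2)], whence
   [mod R_G(s) <= log (lambda_n (s + sqrt (s^2 - 1)) / 2)]; finally
   [sqrt (1 + t) + sqrt t <= (1 + sqrt 2) sqrt t] for [t >= 1]. *)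
From HB Require Import structures.
Require Import Defs.
From mathcomp Require Import all_boot all_order all_algebra.
From mathcomp Require Import all_classical all_reals all_analysis.
From mathcomp Require Import measurable_realfun.
From mathcomp Require Import perm ring lra zify.
Set Implicit Arguments.
Unset Strict Implicit.
Unset Printing Implicit Defensive.
Import Order.TTheory GRing.Theory Num.Theory.
Import numFieldNormedType.Exports.
Local Open Scope classical_set_scope.
Local Open Scope ring_scope.

(** * Lebesgue measure on row vectors *)

Section euclidean_norm.
Context {R : realType} {n : nat}.
Implicit Types x y z : 'rV[R]_n.

(** An upper gradient bounds difference quotients at every scale below a fixed one, so no derivative
    of a potential is ever taken. The price is that cutting off, inverting or averaging a potential
    costs a little energy; moduli are therefore tested on reals strictly below them, and the slack
    pays for the loss. The tangent line of x^n replaces Holder's inequality. Polarization acts on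
    values, not on gradients, so the energy is discretized: the integral of (sup of v over the
    h-ball - v)^n decreases by a two-point inequality. Instead of a convergent sequence of
    polarizations, a minimizer of a linear functional is taken in a compact class stable under all
    of them; polarizing it cannot help, so it is sorted by the first coordinate on each sphere. Its
    difference quotients at scale h already form an admissible density, and h tends to 0 only in the
    numerical bound. The finiteness of lambda_n is proved too: it amounts to a bound log (1/a) + C
    for the modulus of the unit ball slit along [-a e_1, a e_1], obtained from radial segments
    issued from a shell where the potential is small on average. *)

Definition dot x y : R := \sum_i x ord0 i * y ord0 i.

Lemma dotC x y : dot x y = dot y x.
Proof. by apply: eq_bigr => i _; rewrite mulrC. Qed.

Lemma dotDl x y z : dot (x + y) z = dot x z + dot y z.
Proof. by rewrite -big_split; apply: eq_bigr => i _; rewrite mxE mulrDl. Qed.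

Lemma dotZl a x z : dot (a *: x) z = a * dot x z.
Proof. by rewrite mulr_sumr; apply: eq_bigr => i _; rewrite mxE mulrA. Qed.

Lemma dotNl x z : dot (- x) z = - dot x z.
Proof. by rewrite -scaleN1r dotZl mulN1r. Qed.

Lemma dotDr x y z : dot z (x + y) = dot z x + dot z y.
Proof. by rewrite dotC dotDl !(dotC _ z). Qed.

Lemma dotZr a x z : dot z (a *: x) = a * dot z x.
Proof. by rewrite dotC dotZl (dotC _ z). Qed.

Lemma dotNr x z : dot z (- x) = - dot z x.
Proof. by rewrite dotC dotNl (dotC _ z). Qed.

Lemma dot_ge0 x : 0 <= dot x x.
Proof. by apply: sumr_ge0 => i _; rewrite -expr2 sqr_ge0. Qed.

Lemma enorm_sqr x : enorm x ^+ 2 = dot x x.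
Proof.
rewrite sqr_sqrtr; last by apply: sumr_ge0 => i _; exact: sqr_ge0.
by apply: eq_bigr => i _; rewrite expr2.
Qed.

Lemma enorm_ge0 x : 0 <= enorm x. Proof. exact: sqrtr_ge0. Qed.

Lemma enorm_eq x y : dot x x = dot y y -> enorm x = enorm y.
Proof.
by rewrite -!enorm_sqr => /eqP; rewrite eqrXn2 ?enorm_ge0// => /eqP.
Qed.

Lemma enorm0 : enorm (0 : 'rV[R]_n) = 0.
Proof. by apply/eqP; rewrite -sqrf_eq0 enorm_sqr -(scale0r 0) dotZl mul0r. Qed.

Lemma coord_le_enorm x i : `|x ord0 i| <= enorm x.
Proof.
rewrite -(@ler_pXn2r _ 2) ?nnegrE ?enorm_ge0// enorm_sqr -normrX ger0_norm ?sqr_ge0//.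
rewrite /dot (bigD1 i)//= expr2 lerDl; apply: sumr_ge0 => j _.
by rewrite -expr2 sqr_ge0.
Qed.

Lemma enorm_eq0 x : (enorm x == 0) = (x == 0).
Proof.
apply/eqP/eqP => [x0|->]; last exact: enorm0.
apply/rowP => i; rewrite mxE; apply/eqP; rewrite -normr_le0 -x0.
exact: coord_le_enorm.
Qed.

Lemma enorm_gt0 x : (0 < enorm x) = (x != 0).
Proof. by rewrite lt0r enorm_ge0 enorm_eq0 andbT. Qed.

Lemma enormZ a x : enorm (a *: x) = `|a| * enorm x.
Proof.
apply/eqP; rewrite -(@eqrXn2 _ 2) ?mulr_ge0 ?enorm_ge0//.
by rewrite exprMn !enorm_sqr dotZl dotZr mulrA -expr2 real_normK ?num_real.
Qed.

Lemma enormN x : enorm (- x) = enorm x.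
Proof. by rewrite -scaleN1r enormZ normrN1 mul1r. Qed.

Lemma enormC x y : enorm (x - y) = enorm (y - x).
Proof. by rewrite -enormN opprB. Qed.

Lemma cauchy_schwarz x y : dot x y <= enorm x * enorm y.
Proof.
have [->|x0] := eqVneq x 0.
  by rewrite -(scale0r 0) dotZl mul0r mulr_ge0 ?enorm_ge0.
have [->|y0] := eqVneq y 0.
  by rewrite -(scale0r 0) dotZr mul0r mulr_ge0 ?enorm_ge0.
have h := dot_ge0 (enorm y *: x - enorm x *: y).
rewrite !(dotDl, dotDr, dotNl, dotNr, dotZl, dotZr) -!enorm_sqr (dotC y x) in h.
rewrite -enorm_gt0 in x0; rewrite -enorm_gt0 in y0.
by have := mulr_gt0 x0 y0; nra.
Qed.

Lemma enormD x y : enorm (x + y) <= enorm x + enorm y.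
Proof.
rewrite -(@ler_pXn2r _ 2) ?nnegrE ?addr_ge0 ?enorm_ge0//.
rewrite enorm_sqr !(dotDl, dotDr) -!enorm_sqr (dotC y x).
by have := cauchy_schwarz x y; nra.
Qed.

Lemma enorm_triangle y x z : enorm (x - z) <= enorm (x - y) + enorm (y - z).
Proof. by apply: le_trans (enormD _ _); rewrite addrA subrK. Qed.

Lemma enorm_dist x y : `|enorm x - enorm y| <= enorm (x - y).
Proof.
rewrite ler_norml; apply/andP; split.
  by have := enorm_triangle 0 y x; have := enormD x (y - x); rewrite addrC subrK (enormC y x); lra.
by have := enormD y (x - y); rewrite addrC subrK; lra.
Qed.

Lemma norm_le_enorm x : `|x| <= enorm x.
Proof.
rewrite /Num.norm /= mx_normrE; apply/bigmax_leP; split=> [|[i j] _] /=.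
  exact: enorm_ge0.
by rewrite ord1; exact: coord_le_enorm.
Qed.

Lemma coord_le_norm x i : `|x ord0 i| <= `|x|.
Proof.
rewrite [leRHS]/Num.norm /= mx_normrE.
exact: (@le_bigmax _ _ _ 0 (fun ij : 'I_1 * 'I_n => `|x ij.1 ij.2|) (ord0, i)).
Qed.

Lemma norm_le_coord x r : 0 <= r -> (forall i, `|x ord0 i| <= r) -> `|x| <= r.
Proof.
move=> r0 h; rewrite /Num.norm /= mx_normrE; apply/bigmax_leP; split=> [//|[i j] _] /=.
by rewrite ord1.
Qed.

Lemma enorm_le_norm x : enorm x <= n%:R * `|x|.
Proof.
apply: (@le_trans _ _ (\sum_i `|x ord0 i|)); last first.
  rewrite (_ : n%:R * _ = \sum_(i < n) `|x|); last by rewrite sumr_const card_ord mulr_natl.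
  by apply: ler_sum => i _; exact: coord_le_norm.
rewrite -(@ler_pXn2r _ 2) ?nnegrE ?enorm_ge0 ?sumr_ge0// enorm_sqr expr2 big_distrl /=.
apply: ler_sum => i _; rewrite -expr2 -(real_normK (num_real _)) expr2.
rewrite ler_wpM2l// (bigD1 i)//= lerDl sumr_ge0//.
Qed.

(** The topology of row vectors comes from the supremum norm; [enorm_le_norm] converts Euclidean
    Lipschitz bounds into continuity for it. *)
Lemma lipschitz_rV_continuous (f : 'rV[R]_n -> R) (K : R) :
  (forall x y, `|f x - f y| <= K * enorm (x - y)) -> continuous f.
Proof.
move=> fK x; apply/(@cvgrPdist_le _ _ _ (nbhs x) _ f (f x)) => e e0 /=.
have K0 : 0 < `|K| + 1 by rewrite ltr_pwDr.
near=> y; apply: le_trans (fK _ _) _.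
apply: (@le_trans _ _ ((`|K| + 1) * (n.+1%:R * `|x - y|))).
  apply: (@le_trans _ _ ((`|K| + 1) * enorm (x - y))).
    by rewrite ler_wpM2r ?enorm_ge0// (le_trans (ler_norm _))// lerDl.
  rewrite ler_wpM2l ?(ltW K0)//.
  by apply: le_trans (enorm_le_norm _) _; rewrite ler_wpM2r// ler_nat.
rewrite mulrA -ler_pdivlMl ?mulr_gt0// mulrC; near: y.
apply: (@cvgr_dist_le _ _ _ (nbhs x) _ id x) => //; by apply: divr_gt0 => //; exact: mulr_gt0.
Unshelve. all: by end_near. Qed.

Lemma enorm_sub_continuous (c : 'rV[R]_n) : continuous (fun x => enorm (x - c)).
Proof.
apply: (@lipschitz_rV_continuous _ 1) => x y; rewrite mul1r.
by apply: le_trans (enorm_dist _ _) _; rewrite opprB addrA subrK.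
Qed.

Lemma enorm_continuous : continuous (@enorm R n).
Proof.
by apply: (@lipschitz_rV_continuous _ 1) => x y; rewrite mul1r enorm_dist.
Qed.

End euclidean_norm.

(** * Borel sets and measurable maps of R^n *)

Section borel_measurability.
Context {R : realType} {n : nat}.
Local Notation Rn := (borel_rV R n).

Lemma open_rV_measurable (A : set 'rV[R]_n) :
  open A -> measurable (A : set Rn).
Proof. by move=> oA; exact: sub_sigma_algebra. Qed.

Lemma closed_rV_measurable (A : set 'rV[R]_n) :
  closed A -> measurable (A : set Rn).
Proof.
move=> cA; rewrite -(setCK A); apply: measurableC.
by apply: open_rV_measurable; exact: closed_openC.
Qed.

Lemma lsc_rV_measurable (f : 'rV[R]_n -> R) :
  (forall a, open [set x | a < f x]) -> measurable_fun [set: Rn] f.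
Proof.
move=> of_; apply: (measurability _ (RGenOInfty.measurableE R)).
move=> _ [_ [a ->] <-]; rewrite setTI.
rewrite (_ : _ @^-1` _ = [set x | a < f x]); first exact: open_rV_measurable.
by apply/seteqP; split=> x /=; rewrite in_itv /= andbT.
Qed.

Lemma continuous_rV_measurable (f : 'rV[R]_n -> R) :
  continuous f -> measurable_fun [set: Rn] f.
Proof.
move=> cf; apply: lsc_rV_measurable => a.
rewrite (_ : mkset _ = f @^-1` [set x | a < x]) //.
by apply: open_comp; [by move=> x _; exact: cf | exact: open_gt].
Qed.

Lemma coord_rV_measurable (i : 'I_n) :
  measurable_fun [set: Rn] (fun x : 'rV[R]_n => x ord0 i).
Proof. by apply: continuous_rV_measurable; exact: coord_continuous. Qed.

Lemma ball_rVE (x y : 'rV[R]_n) (e : R) : 0 < e ->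
  ball x e y <-> forall i, `|x ord0 i - y ord0 i| < e.
Proof.
by move=> e0; split=> [[_ + i] | h]; [exact | split=> // i j; rewrite ord1; exact: h].
Qed.

Lemma ball_rV_rat (U : set 'rV[R]_n) (x : 'rV[R]_n) : open U -> U x ->
  exists q : 'rV[rat]_n * nat,
    ball (map_mx ratr q.1 : 'rV[R]_n) q.2.+1%:R^-1 x /\
    ball (map_mx ratr q.1 : 'rV[R]_n) q.2.+1%:R^-1 `<=` U.
Proof.
move=> oU Ux.
have /nbhs_ballP [e /= e0 eU] : nbhs x U by exact: open_nbhs_nbhs.
have [k] := ltr_add_invr (ltac:(lra) : 0 < e / 2); rewrite add0r => ke.
have k0 : 0 < k.+1%:R^-1 :> R by rewrite invr_gt0 ltr0n.
have h2 (a b : R) : 0 < b -> a - b < a + b by move=> *; lra.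
have hq i : exists q : rat, `|ratr q - x ord0 i| < k.+1%:R^-1.
  have [q] := rat_in_itvoo (h2 (x ord0 i) _ k0).
  by rewrite in_itv /= => /andP[h3 h4]; exists q; rewrite ltr_norml ltrBrDl h3 ltrBlDl.
have [q hq'] := choice hq.
exists (\row_i q i, k) => /=; split.
  by apply/ball_rVE => // i; rewrite !mxE.
move=> y /ball_rVE; move/(_ k0) => yk; apply: eU; apply/ball_rVE => // i.
have := yk i; rewrite !mxE => h; have := hq' i.
move: h ke; set a := ratr _; set b := _^-1; move=> h ke h'.
apply: (@le_lt_trans _ _ (`|a - x ord0 i| + `|a - y ord0 i|)); last by lra.
by rewrite (distrC a (x ord0 i)); apply: le_trans (ler_normD _ _); rewrite addrA subrK.
Qed.

(** An open set is the countable union of the rational balls that it contains, and a ball of the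
    supremum norm is a finite intersection of conditions on single coordinates. *)
Lemma measurable_fun_rV d (T : measurableType d) (f : T -> 'rV[R]_n) :
  (forall i, measurable_fun [set: T] (fun t => f t ord0 i)) ->
  measurable_fun [set: T] (f : T -> Rn).
Proof.
move=> mf; apply: (@measurability _ _ T Rn setT f (@open 'rV[R]_n) erefl).
move=> _ [U oU <-]; rewrite setTI.
pose B (q : 'rV[rat]_n * nat) := ball (map_mx ratr q.1 : 'rV[R]_n) q.2.+1%:R^-1.
pose F q := if `[< B q `<=` U >] then f @^-1` B q else set0.
rewrite (_ : _ @^-1` _ = \bigcup_q F q); last first.
  apply/seteqP; split=> [t /= Ut|t [q _]].
    have [q [qt qU]] := ball_rV_rat oU Ut.
    by exists q => //; rewrite /F asboolT.
  by rewrite /F; case: asboolP => // qU /qU.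
apply: countable_bigcupT_measurable; first exact: countableP.
move=> q; rewrite /F; case: asboolP => // _.
rewrite (_ : _ @^-1` _ = \bigcap_(i in [set: 'I_n])
  ((fun t => f t ord0 i) @^-1` ball (ratr (q.1 ord0 i) : R) q.2.+1%:R^-1)).
  apply: fin_bigcap_measurable => // i _; rewrite -[X in measurable X]setTI.
  by apply: mf => //; exact: measurable_ball.
apply/seteqP; split=> [t /ball_rVE h i _|t h] /=.
  by have := h ltac:(by rewrite invr_gt0 ltr0n) i; rewrite mxE.
apply/ball_rVE => [|i]; first by rewrite invr_gt0 ltr0n.
by have := h i I; rewrite mxE.
Qed.

Lemma measurable_rVD d (T : measurableType d) (f g : T -> 'rV[R]_n) :
  measurable_fun [set: T] (f : T -> Rn) -> measurable_fun [set: T] (g : T -> Rn) ->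
  measurable_fun [set: T] (fun t => f t + g t : Rn).
Proof.
move=> mf mg; apply: measurable_fun_rV => i.
have h (k : T -> 'rV[R]_n) : measurable_fun [set: T] (k : T -> Rn) ->
    measurable_fun [set: T] (fun t => k t ord0 i).
  by move=> mk; exact: measurableT_comp (coord_rV_measurable i) mk.
by under eq_fun do rewrite mxE; apply: measurable_funD; exact: h.
Qed.

Lemma measurable_rVZ d (T : measurableType d) (a : T -> R) (g : T -> 'rV[R]_n) :
  measurable_fun [set: T] a -> measurable_fun [set: T] (g : T -> Rn) ->
  measurable_fun [set: T] (fun t => a t *: g t : Rn).
Proof.
move=> ma mg; apply: measurable_fun_rV => i.
under eq_fun do rewrite mxE; apply: measurable_funM => //.
exact: measurableT_comp (coord_rV_measurable i) mg.
Qed.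

Lemma measurable_rV_sub (p : 'rV[R]_n) : measurable_fun [set: Rn] (fun x : Rn => (x : 'rV[R]_n) - p : Rn).
Proof. by apply: measurable_rVD; [exact: measurable_id|exact: measurable_cst]. Qed.

Lemma measurable_rV_homothety (c p : 'rV[R]_n) (t : R) :
  measurable_fun [set: Rn] (fun x : Rn => c + t *: ((x : 'rV[R]_n) - p) : Rn).
Proof.
apply: measurable_rVD; first exact: measurable_cst.
by apply: measurable_rVZ; [exact: measurable_cst|exact: measurable_rV_sub].
Qed.

Lemma measurable_rVN d (T : measurableType d) (g : T -> 'rV[R]_n) :
  measurable_fun [set: T] (g : T -> Rn) ->
  measurable_fun [set: T] (fun t => - g t : Rn).
Proof.
move=> mg; under eq_fun do rewrite -scaleN1r.
by apply: (@measurable_rVZ _ T (fun=> -1) g) => //; exact: measurable_cst.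
Qed.

Lemma row_of_tuple_measurable :
  measurable_fun [set: n.-tuple R] (@row_of_tuple R n).
Proof.
apply: measurable_fun_rV => i; under eq_fun do rewrite mxE.
exact: measurable_tnth.
Qed.

Definition tuple_of_row (x : Rn) : n.-tuple R := [tuple (x : 'rV[R]_n) ord0 i | i < n].

Lemma tuple_of_row_measurable : measurable_fun [set: Rn] tuple_of_row.
Proof.
apply/measurable_fun_tnthP => i.
rewrite (_ : _ \o _ = fun x : 'rV[R]_n => x ord0 i); first exact: coord_rV_measurable.
by apply/funext => x /=; rewrite tnth_mktuple.
Qed.

Lemma row_of_tupleK : cancel (@row_of_tuple R n) tuple_of_row.
Proof. by move=> t; apply: eq_from_tnth => i; rewrite tnth_mktuple mxE. Qed.

Lemma tuple_of_rowK : cancel tuple_of_row (@row_of_tuple R n).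
Proof. by move=> t; apply/rowP => i; rewrite mxE tnth_mktuple. Qed.

End borel_measurability.

Lemma continuous_rV_rV_measurable (R : realType) m n (f : 'rV[R]_m -> 'rV[R]_n) :
  continuous f -> measurable_fun [set: borel_rV R m] (f : borel_rV R m -> borel_rV R n).
Proof.
move=> cf; apply: (@measurability _ _ (borel_rV R m) (borel_rV R n) setT f (@open 'rV[R]_n) erefl).
move=> _ [U oU <-]; rewrite setTI.
have oF : open (f @^-1` (U : set 'rV[R]_n)) by apply: open_comp => // x _; exact: cf.
exact: (open_rV_measurable oF).
Qed.

Local Notation pushforward_measure :=
  measure_function_pushforward__canonical__measure_function_Measure.

(** * Sigma-finiteness of Lebesgue measure *)

Section lebesgue_rV_measure.
Context {R : realType}.

(** [lebesgue_rV] is a bare set function built from [pushforward], so its measure structure has to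
    be transported. The existence of an equal measure is a form with which the induction on the
    dimension can rewrite. *)
Lemma sigma_finite_pushforward d1 d2 (T1 : measurableType d1) (T2 : measurableType d2)
    (mu : {measure set T1 -> \bar R}) (f : T1 -> T2) (g : T2 -> T1) :
  sigma_finite setT mu ->
  measurable_fun setT f -> measurable_fun setT g -> cancel f g -> cancel g f ->
  exists nu : {sigma_finite_measure set T2 -> \bar R},
    pushforward mu f = nu :> (set T2 -> \bar R).
Proof.
move=> smu mf mg fK gK.
pose nu0 : {measure set T2 -> \bar R} :=
  pushforward_measure mu mf.
have sf : sigma_finite setT nu0.
  have [F F1 F2] := smu; exists (fun i => g @^-1` F i).
    by rewrite -preimage_bigcup -F1.
  move=> i; have [mF Foo] := F2 i; split.
    by rewrite -[X in measurable X]setTI; exact: mg.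
  rewrite /= /pushforward (_ : _ @^-1` _ = F i) //.
  by apply/seteqP; split=> x /=; rewrite fK.
pose nu : {sigma_finite_measure set T2 -> \bar R} :=
  HB.pack_for {sigma_finite_measure set T2 -> \bar R} (pushforward mu f) nu0
    (Measure_isSigmaFinite.Build _ _ _ (pushforward mu f) sf).
by exists (nu mf mf mf).
Qed.
End lebesgue_rV_measure.

Lemma sigma_finite_pushforward_prod (R : realType) d1 d2 d3 (T1 : measurableType d1)
    (T2 : measurableType d2) (T3 : measurableType d3)
    (m1 : {sigma_finite_measure set T1 -> \bar R})
    (m2 : {sigma_finite_measure set T2 -> \bar R})
    (f : T1 * T2 -> T3) (g : T3 -> T1 * T2) :
  measurable_fun setT f -> measurable_fun setT g -> cancel f g -> cancel g f ->
  exists nu : {sigma_finite_measure set T3 -> \bar R},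
    pushforward (m1 \x m2)%E f = nu :> (set T3 -> \bar R).
Proof.
move=> mf mg fK gK.
have sf : sigma_finite setT (m1 \x m2)%E.
  have /sigma_finiteP[F [TF ndF Foo]] := sigma_finiteT m1.
  have /sigma_finiteP[G [TG ndG Goo]] := sigma_finiteT m2.
  exists (fun k => F k `*` G k).
    rewrite -setXTT TF TG; apply/seteqP; split=> -[x y] /=.
      move=> [[i _ Fx] [j _ Gy]]; exists (maxn i j) => //; split.
        by have /subsetPset := ndF _ _ (leq_maxl i j); exact.
      by have /subsetPset := ndG _ _ (leq_maxr i j); exact.
    by move=> [k _ []] /=; split; exists k.
  move=> k; have [? ?] := Foo k; have [? ?] := Goo k.
  split; first exact: measurableX.
  by rewrite product_measure1E// lte_mul_pinfty// ge0_fin_numE.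
exact: (@sigma_finite_pushforward R _ _ _ _ (m1 \x m2)%E f g sf).
Qed.

Section lebesgue_rV_measure2.
Context {R : realType}.
Lemma cons_tuple_measurable n :
  measurable_fun [set: R * n.-tuple R]
    (fun p : R * n.-tuple R => [the n.+1.-tuple R of p.1 :: p.2]).
Proof. by apply: measurable_cons. Qed.

Lemma uncons_tuple_measurable n :
  measurable_fun [set: n.+1.-tuple R]
    (fun t : n.+1.-tuple R => (thead t, [tuple of behead t])).
Proof.
apply/measurable_fun_pairP; split; first exact: measurable_tnth.
exact: measurable_behead.
Qed.

Lemma lebesgue_tuple_sigma_finite n :
  exists nu : {sigma_finite_measure set (n.-tuple R) -> \bar R},
    @lebesgue_tuple R n = nu :> (set _ -> \bar R).
Proof.
elim: n => [|n [nu IH]].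
  by exists [the {sigma_finite_measure set (0.-tuple R) -> \bar R} of \d_([tuple] : 0.-tuple R)].
rewrite /= IH.
have [||||mu emu] := @sigma_finite_pushforward_prod R _ _ _ _ _ _ lebesgue_measure nu
  (fun p => [the n.+1.-tuple R of p.1 :: p.2]) (fun t => (thead t, [tuple of behead t])).
- exact: cons_tuple_measurable.
- exact: uncons_tuple_measurable.
- by move=> [a t]; congr pair; apply: val_inj.
- by move=> t; apply: val_inj; rewrite [in RHS](tuple_eta t).
by exists mu; rewrite -emu.
Qed.

Lemma lebesgue_rV_sigma_finite n :
  exists nu : {sigma_finite_measure set (borel_rV R n) -> \bar R},
    @lebesgue_rV R n = nu :> (set _ -> \bar R).
Proof.
have [nu e] := lebesgue_tuple_sigma_finite n.
rewrite /lebesgue_rV e.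
exact: (sigma_finite_pushforward (sigma_finiteT nu) row_of_tuple_measurable tuple_of_row_measurable
 row_of_tupleK tuple_of_rowK).
Qed.

Lemma lebesgue_rV0 n : @lebesgue_rV R n set0 = 0%E.
Proof. by have [nu ->] := lebesgue_rV_sigma_finite n; exact: measure0. Qed.
Lemma lebesgue_rV_ge0 n A : (0 <= @lebesgue_rV R n A)%E.
Proof. by have [nu ->] := lebesgue_rV_sigma_finite n; exact: measure_ge0. Qed.
Lemma lebesgue_rV_sigma_additive n : semi_sigma_additive (@lebesgue_rV R n).
Proof. by have [nu ->] := lebesgue_rV_sigma_finite n; exact: measure_semi_sigma_additive. Qed.
Lemma lebesgue_rV_sigma_finiteT n : sigma_finite setT (@lebesgue_rV R n).
Proof. by have [nu ->] := lebesgue_rV_sigma_finite n; exact: sigma_finiteT. Qed.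

HB.instance Definition _ n := isMeasure.Build _ _ _ (@lebesgue_rV R n)
  (lebesgue_rV0 n) (@lebesgue_rV_ge0 n) (@lebesgue_rV_sigma_additive n).
HB.instance Definition _ n := Measure_isSigmaFinite.Build _ _ _ (@lebesgue_rV R n)
  (@lebesgue_rV_sigma_finiteT n).
End lebesgue_rV_measure2.

(** * Uniqueness of translation-invariant measures *)

Section haar.
Context {R : realType} {n : nat}.
Local Notation Rn := (borel_rV R n).

Definition translate (y : 'rV[R]_n) : Rn -> Rn := fun x => (x : 'rV[R]_n) + y.

Lemma translate_measurable (y : 'rV[R]_n) : measurable_fun [set: Rn] (translate y).
Proof. by apply: measurable_rVD => //; exact: measurable_cst. Qed.

Definition translation_invariant (m : set Rn -> \bar R) :=
  forall y A, measurable A -> m (translate y @^-1` A) = m A.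

Lemma ge0_integral_translate (m : {measure set Rn -> \bar R}) :
  translation_invariant m ->
  forall (f : Rn -> \bar R) y, measurable_fun setT f -> (forall x, 0 <= f x)%E ->
  (\int[m]_x f (translate y x) = \int[m]_x f x)%E.
Proof.
move=> mT f y mf f0.
have := ge0_integral_pushforward (translate_measurable y) m measurableT mf (fun x _ => f0 x).
rewrite preimage_setT => <-.
apply: eq_measure_integral => /= [|_ C mC _]; first exact: translate_measurable.
by rewrite -[RHS](mT y C mC).
Qed.

(* Tonelli shows [mu A * nu B = nu A * mu (- B)] for translation-invariant measures. *)
Lemma haar_rV_eq (mu nu : {sigma_finite_measure set Rn -> \bar R}) (B : set Rn)
    (mB : measurable B) :
  (forall x : 'rV[R]_n, B (- x) <-> B x) -> mu B = nu B -> (0 < nu B < +oo)%E ->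
  translation_invariant mu -> translation_invariant nu ->
  forall A, measurable A -> mu A = nu A.
Proof.
move=> BN munuB /andP[nuB0 nuBoo] muT nuT A mA.
pose I (C : set Rn) (x : Rn) : \bar R := (\1_C x)%:E.
have I0 C x : (0 <= I C x)%E by rewrite lee_fin.
have mI C : measurable C -> measurable_fun setT (I C).
  by move=> mC; apply/measurable_EFinP; exact: measurable_indic.
have intI (m : {measure set Rn -> \bar R}) C : measurable C -> (\int[m]_x I C x = m C)%E.
  by move=> mC; rewrite integral_indic// setIT.
have m2 : measurable_fun setT (fun p : Rn * Rn => p.2) by exact: measurable_snd.
have mD : measurable_fun setT (fun p : Rn * Rn => (p.1 : 'rV[R]_n) + p.2 : Rn).
  exact: measurable_rVD.
have mS : measurable_fun setT (fun p : Rn * Rn => (p.2 : 'rV[R]_n) - p.1 : Rn).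
  by apply: measurable_rVD => //; exact: measurable_rVN.
have E1 : (\int[mu]_x \int[nu]_y (I A (translate y x) * I B y) = mu A * nu B)%E.
  rewrite (@fubini_tonelli _ _ Rn Rn R mu nu
    (fun p => I A (translate p.2 p.1) * I B p.2)%E) /=; last 2 first.
  - by apply: emeasurable_funM; [exact: measurableT_comp (mI A mA) mD|
      exact: measurableT_comp (mI B mB) m2].
  - by move=> p; rewrite mule_ge0.
  rewrite (eq_integral (fun y => mu A * I B y)%E); last first.
    move=> y _; rewrite ge0_integralZr//; last first.
      exact: measurableT_comp (mI A mA) (translate_measurable y).
    by rewrite ge0_integral_translate//; [rewrite intI|exact: mI].
  by rewrite ge0_integralZl//; [rewrite intI|exact: mI].
have E2 : (\int[mu]_x \int[nu]_y (I A (translate y x) * I B y) = nu A * mu B)%E.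
  rewrite (eq_integral (fun x : Rn => (\int[nu]_y (I A y * I B (translate (- (x : 'rV[R]_n)) y)))%E)); last first.
    move=> x _.
    rewrite -(@ge0_integral_translate nu nuT
      (fun y => I A y * I B (translate (- (x : 'rV[R]_n)) y))%E x) //=; last 2 first.
    - apply: emeasurable_funM; first exact: mI.
      exact: measurableT_comp (mI B mB) (translate_measurable _).
    - by move=> y; rewrite mule_ge0.
    apply: eq_integral => y _; rewrite /translate addrK.
    by rewrite [X in I A X]addrC.
  rewrite (@fubini_tonelli _ _ Rn Rn R mu nu
    (fun p => I A p.2 * I B (translate (- (p.1 : 'rV[R]_n)) p.2))%E) /=; last 2 first.
  - by apply: emeasurable_funM; [exact: measurableT_comp (mI A mA) m2|
      exact: measurableT_comp (mI B mB) mS].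
  - by move=> p; rewrite mule_ge0.
  rewrite (eq_integral (fun y => I A y * mu B)%E); last first.
    move=> y _; rewrite ge0_integralZl//; last first.
      apply: measurableT_comp (mI B mB) _.
      by apply: measurable_rVD; [exact: measurable_cst|exact: measurable_rVN].
    congr (_ * _)%E; rewrite -(intI mu B mB) -(ge0_integral_translate muT (- (y : 'rV[R]_n)) (mI B mB))//.
    apply: eq_integral => x _; rewrite /I !indicE; congr ((nat_of_bool _)%:R%:E).
    rewrite /translate; apply/idP/idP; rewrite !inE => h.
      by apply/BN; rewrite opprB.
    by move/BN : h; rewrite opprB.
  by rewrite ge0_integralZr//; [rewrite intI|exact: mI].
have := E2; rewrite E1 munuB; set b := nu B => /(congr1 (fun z => z * (fine b)^-1%:E)%E).
have bf : b \is a fin_num by rewrite ge0_fin_numE// ltW.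
rewrite -!muleA -(fineK bf) -EFinM divff ?mule1//.
by rewrite gt_eqF// fine_gt0// nuB0.
Qed.

End haar.

Section lebesgue_R.
Context {R : realType}.
Local Open Scope ereal_scope.
Lemma lebesgue_measureD (a : R) (A : set R) : measurable A ->
  lebesgue_measure ((fun x : R => x + a)%R @^-1` A) = lebesgue_measure A.
Proof.
move=> mA.
have mf : measurable_fun setT ((fun x => x + a)%R : measurableTypeR R -> measurableTypeR R).
  exact: measurable_funD.
apply/esym.
apply: (@lebesgue_measure_unique R (pushforward_measure lebesgue_measure mf)) => //.
move=> _ [[b c]] _ <-; rewrite /= /pushforward.
rewrite (_ : _ @^-1` _ = [set` `](b - a)%R, (c - a)%R]]).
  rewrite !lebesgue_measure_itv /= !lte_fin ltrD2r; case: ifP => // _.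
  by rewrite -!EFinB; congr (_%:E); ring.
by apply/seteqP; split=> x /=; rewrite !in_itv/= ltrBlDr lerBrDr.
Qed.

Lemma lebesgue_measureZ (a : R) (A : set R) : measurable A -> (0 < a)%R ->
  lebesgue_measure ((fun x : R => a * x)%R @^-1` A) = a^-1%:E * lebesgue_measure A.
Proof.
move=> mA a0.
have mf : measurable_fun setT ((fun x => a * x)%R : measurableTypeR R -> measurableTypeR R).
  exact: measurable_funM.
have a0' : (0 <= a)%R by exact: ltW.
pose nu := mscale (NngNum a0') (pushforward_measure lebesgue_measure mf).
have -> : lebesgue_measure A = nu A.
  apply: lebesgue_measure_unique => //.
  move=> _ [[b c]] _ <-; rewrite /= /nu /mscale /= /pushforward.
  rewrite (_ : _ @^-1` _ = [set` `](b / a)%R, (c / a)%R]]).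
    rewrite !lebesgue_measure_itv /= !lte_fin ltr_pM2r ?invr_gt0//; case: ifP => // _.
      by rewrite -!EFinB -EFinM; congr (_%:E); field; rewrite gt_eqF.
    by rewrite mule0.
  apply/seteqP; split=> x /=; rewrite !in_itv/=.
    by rewrite ltr_pdivrMr// ler_pdivlMr// ![(x * a)%R]mulrC.
  by rewrite ltr_pdivrMr// ler_pdivlMr// ![(x * a)%R]mulrC.
by rewrite /nu /mscale /= /pushforward muleA -EFinM mulVf ?mul1e// gt_eqF.
Qed.
End lebesgue_R.

(** * Slicing by the first coordinate *)

Section slicing.
Context {R : realType} {n : nat}.

Definition rVcons (s : R) (y : 'rV[R]_n) : 'rV[R]_n.+1 :=
  \row_i oapp (fun j => y ord0 j) s (unlift ord0 i).

Lemma rVcons0 s y : rVcons s y ord0 ord0 = s.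
Proof. by rewrite mxE unlift_none. Qed.

Lemma rVconsS s y j : rVcons s y ord0 (lift ord0 j) = y ord0 j.
Proof. by rewrite mxE liftK. Qed.

Lemma rVconsP (x : 'rV[R]_n.+1) : exists s y, x = rVcons s y.
Proof.
exists (x ord0 ord0), (\row_j x ord0 (lift ord0 j)); apply/rowP => i.
by rewrite mxE; case: unliftP => [j ->|->] //=; rewrite mxE.
Qed.

Lemma rVcons_add s y s' y' : rVcons s y + rVcons s' y' = rVcons (s + s') (y + y').
Proof. by apply/rowP => i; rewrite !mxE; case: unliftP => [j _|_] /=; rewrite ?mxE. Qed.

Lemma rVcons_scale a s y : a *: rVcons s y = rVcons (a * s) (a *: y).
Proof. by apply/rowP => i; rewrite !mxE; case: unliftP => [j _|_] /=; rewrite ?mxE. Qed.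

Lemma rVcons_opp s y : - rVcons s y = rVcons (- s) (- y).
Proof. by apply/rowP => i; rewrite !mxE; case: unliftP => [j _|_] /=; rewrite ?mxE. Qed.

Lemma rVcons_measurable : measurable_fun setT
  (fun p : measurableTypeR R * borel_rV R n => rVcons p.1 p.2 : borel_rV R n.+1).
Proof.
apply: measurable_fun_rV => i; rewrite /rVcons.
under eq_fun do rewrite mxE; case: unliftP => [j _|_] /=.
  exact: measurableT_comp (coord_rV_measurable j) measurable_snd.
exact: measurable_fst.
Qed.

Lemma lebesgue_rVS : @lebesgue_rV R n.+1 =
  pushforward (@lebesgue_measure R \x @lebesgue_rV R n)%E
    (fun p : R * borel_rV R n => rVcons p.1 p.2 : borel_rV R n.+1).
Proof.
apply/funext => A; rewrite /lebesgue_rV /= /pushforward /product_measure1 /=.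
apply: eq_integral => s _ /=; congr lebesgue_tuple.
have e t : row_of_tuple (cons_tuple s t) = rVcons s (row_of_tuple t) :> 'rV[R]_n.+1.
  apply/rowP => i; rewrite !mxE; case: unliftP => [j ->|->] /=; rewrite ?mxE //.
  by rewrite tnthS.
by apply/seteqP; split=> t; rewrite /xsection /= !inE /= e.
Qed.

Lemma lebesgue_rV_dim0 : @lebesgue_rV R 0 setT = 1%E.
Proof. by rewrite /lebesgue_rV /pushforward /= diracE in_setT. Qed.

Opaque lebesgue_rV.
Local Open Scope ereal_scope.

Lemma ge0_integral_lebesgue_rVS (f : borel_rV R n.+1 -> \bar R) :
  measurable_fun setT f -> (forall x, 0 <= f x) ->
  \int[@lebesgue_rV R n.+1]_x f x =
  \int[@lebesgue_measure R]_s \int[@lebesgue_rV R n]_y f (rVcons s y).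
Proof.
move=> mf f0.
pose g (p : measurableTypeR R * borel_rV R n) := f (rVcons p.1 p.2).
have mg : measurable_fun setT g by exact: (measurableT_comp mf rVcons_measurable).
have g0 p : 0 <= g p by exact: f0.
have e1 := ge0_integral_pushforward rVcons_measurable (@lebesgue_measure R \x @lebesgue_rV R n)%E measurableT mf (fun x _ => f0 x).
have e2 := @fubini_tonelli1 _ _ (measurableTypeR R) (borel_rV R n) R lebesgue_measure (@lebesgue_rV R n) g mg g0.
rewrite preimage_setT in e1.
apply: etrans e2; apply: etrans e1.
apply: eq_measure_integral => /= [|_ C mC _]; first exact: rVcons_measurable.
by rewrite lebesgue_rVS.
Qed.

Lemma rVcons_measurable2 (s : R) :
  measurable_fun setT (fun y : borel_rV R n => rVcons s y : borel_rV R n.+1).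
Proof.
apply: measurable_fun_rV => i; rewrite /rVcons.
under eq_fun do rewrite mxE; case: unliftP => [j _|_] /=; last exact: measurable_cst.
exact: coord_rV_measurable.
Qed.

Lemma measurable_slice (f : borel_rV R n.+1 -> \bar R) (s : R) :
  measurable_fun setT f -> measurable_fun setT (fun y : borel_rV R n => f (rVcons s y)).
Proof. by move=> mf; exact: (measurableT_comp mf (rVcons_measurable2 s)). Qed.

Lemma measurable_slice_int (f : borel_rV R n.+1 -> \bar R) :
  measurable_fun setT f -> (forall x, 0 <= f x) ->
  measurable_fun setT (fun s : measurableTypeR R => \int[@lebesgue_rV R n]_y f (rVcons s y)).
Proof.
move=> mf f0.
pose g (p : measurableTypeR R * borel_rV R n) := f (rVcons p.1 p.2).
have mg : measurable_fun setT g by exact: (measurableT_comp mf rVcons_measurable).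
have g0 p : 0 <= g p by exact: f0.
exact: (@measurable_fun_fubini_tonelli_F _ _ (measurableTypeR R) (borel_rV R n) R (@lebesgue_rV R n) g mg g0).
Qed.

End slicing.

Section lebesgue_R_integral.
Context {R : realType}.
Local Open Scope ereal_scope.
Local Notation mu := (@lebesgue_measure R).

Lemma ge0_integral_lebesgueD (f : R -> \bar R) (a : R) :
  measurable_fun [set: R] f -> (forall x, 0 <= f x) ->
  \int[mu]_x f (x + a)%R = \int[mu]_x f x.
Proof.
move=> mf f0.
have ms : measurable_fun setT ((fun x => x + a)%R : measurableTypeR R -> measurableTypeR R).
  exact: measurable_funD.
have := ge0_integral_pushforward ms mu measurableT mf (fun x _ => f0 x).
rewrite preimage_setT => <-.
apply: eq_measure_integral => C mC _.
exact: lebesgue_measureD.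
Qed.

Lemma ge0_integral_lebesgueN (f : R -> \bar R) :
  measurable_fun [set: R] f -> (forall x, 0 <= f x) ->
  \int[mu]_x f (- x)%R = \int[mu]_x f x.
Proof.
move=> mf f0.
have ms : measurable_fun setT ((fun x => - x)%R : measurableTypeR R -> measurableTypeR R).
  exact: measurable_funN.
have := ge0_integral_pushforward ms mu measurableT mf (fun x _ => f0 x).
rewrite preimage_setT => <-.
apply: eq_measure_integral => C mC _.
exact: lebesgue_measureN.
Qed.

Lemma ge0_integral_lebesgueZ (f : R -> \bar R) (a : R) : (0 < a)%R ->
  measurable_fun [set: R] f -> (forall x, 0 <= f x) ->
  \int[mu]_x f (a * x)%R = a^-1%:E * \int[mu]_x f x.
Proof.
move=> a0 mf f0.
have ms : measurable_fun setT ((fun x => a * x)%R : measurableTypeR R -> measurableTypeR R).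
  exact: measurable_funM.
have := ge0_integral_pushforward ms mu measurableT mf (fun x _ => f0 x).
rewrite preimage_setT => <-.
have a0' : (0 <= a^-1)%R by rewrite invr_ge0 ltW.
have e := @ge0_integral_mscale _ _ _ mu setT measurableT (NngNum a0') f mf (fun x _ => f0 x).
apply: etrans e; apply: eq_measure_integral => C mC _.
exact: lebesgue_measureZ.
Qed.

End lebesgue_R_integral.

(** * Translations, dilations and isometries *)

Section lebesgue_rV_invariance.
Context {R : realType}.
Local Open Scope ereal_scope.

Lemma lebesgue_rV_translation n : translation_invariant (@lebesgue_rV R n).
Proof.
elim: n => [|n IH] y A mA.
  have e x : translate y x = x by rewrite [LHS]thinmx0 [RHS]thinmx0.
  by congr lebesgue_rV; apply/seteqP; split=> x; rewrite /= e.
have [s0 [y0 ->]] := rVconsP y.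
pose f (x : borel_rV R n.+1) : \bar R := (\1_A x)%:E.
have mf : measurable_fun setT f by apply/measurable_EFinP; exact: measurable_indic.
have f0 x : 0 <= f x by rewrite lee_fin.
have mA' : measurable (translate (rVcons s0 y0) @^-1` A).
  by rewrite -[X in measurable X]setTI; exact: translate_measurable.
have <- : \int[@lebesgue_rV R n.+1]_x f x = lebesgue_rV A by rewrite integral_indic// setIT.
have <- : \int[@lebesgue_rV R n.+1]_x f (translate (rVcons s0 y0) x) =
    lebesgue_rV (translate (rVcons s0 y0) @^-1` A).
  by rewrite -[in RHS](setIT (_ @^-1` _)) -integral_indic.
have e1 := ge0_integral_lebesgue_rVS mf f0.
have e2 := ge0_integral_lebesgue_rVS
  (measurableT_comp mf (translate_measurable (rVcons s0 y0))) (fun=> f0 _).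
rewrite [RHS]e1 [LHS]e2 {e1 e2}.
have h := @ge0_integral_lebesgueD R (fun s => \int[@lebesgue_rV R n]_y1 f (rVcons s y1)) s0
  (measurable_slice_int mf f0) (fun s => integral_ge0 _ (fun y1 _ => f0 _)).
apply: etrans _ h; apply: eq_integral => s _.
apply: etrans _ (ge0_integral_translate IH y0 (measurable_slice (s + s0) mf) (fun=> f0 _)).
by apply: eq_integral => y' _; rewrite /translate -rVcons_add.
Qed.

Lemma ge0_integral_rVD n (f : borel_rV R n -> \bar R) (y : 'rV[R]_n) :
  measurable_fun setT f -> (forall x, 0 <= f x) ->
  \int[@lebesgue_rV R n]_x f ((x : 'rV[R]_n) + y)%R = \int[@lebesgue_rV R n]_x f x.
Proof. exact: (ge0_integral_translate (@lebesgue_rV_translation n)). Qed.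

Lemma scale_rV_measurable n (a : R) :
  measurable_fun setT (fun x : borel_rV R n => a *: (x : 'rV[R]_n) : borel_rV R n).
Proof. by apply: measurable_rVZ => //; exact: measurable_cst. Qed.

Lemma ge0_integral_rVZ n (a : R) (f : borel_rV R n -> \bar R) : (0 < a)%R ->
  measurable_fun setT f -> (forall x, 0 <= f x) ->
  \int[@lebesgue_rV R n]_x f (a *: (x : 'rV[R]_n)) = (a ^- n)%:E * \int[@lebesgue_rV R n]_x f x.
Proof.
move=> a0; elim: n f => [|n IH] f mf f0.
  rewrite expr0 invr1 mul1e; apply: eq_integral => x _.
  by have -> : a *: (x : 'rV[R]_0) = x by rewrite [LHS]thinmx0 [RHS]thinmx0.
have e1 := ge0_integral_lebesgue_rVS mf f0.
have e2 := ge0_integral_lebesgue_rVS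
  (measurableT_comp mf (scale_rV_measurable a)) (fun=> f0 _).
rewrite [X in _ * X]e1 [LHS]e2 {e1 e2}.
rewrite exprS invfM EFinM -muleA muleCA -ge0_integral_lebesgueZ //; last 2 first.
- exact: measurable_slice_int.
- by move=> s; exact: integral_ge0.
rewrite -ge0_integralZl //; last 3 first.
- apply: measurableT_comp (measurable_slice_int mf f0) _.
  exact: measurable_funM.
- by move=> s _; exact: integral_ge0.
- by rewrite lee_fin invr_ge0 exprn_ge0// ltW.
apply: eq_integral => s _.
rewrite -IH; [|exact: measurable_slice|by []].
by apply: eq_integral => y _ /=; rewrite -rVcons_scale.
Qed.

Lemma lebesgue_cube n (c : 'rV[R]_n) (r : R) : (0 < r)%R ->
  @lebesgue_rV R n [set x : 'rV[R]_n | forall i, (`|x ord0 i - c ord0 i| < r)%R] = ((2 * r) ^+ n)%:E.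
Proof.
move=> r0; elim: n c => [|n IH] c.
  rewrite (_ : mkset _ = setT); last by apply/seteqP; split=> // x _ [].
  by rewrite lebesgue_rV_dim0 expr0.
have [s [y ->]] := rVconsP c.
set C := mkset _.
have CE : C = [set x : 'rV[R]_n.+1 | (`|x ord0 ord0 - s| < r)%R /\
    forall j, (`|x ord0 (lift ord0 j) - y ord0 j| < r)%R].
  apply/seteqP; split=> x.
    move=> h; split; first by have := h ord0; rewrite rVcons0.
    by move=> j; have := h (lift ord0 j); rewrite rVconsS.
  move=> [h1 h2] i; case: (unliftP ord0 i) => [j ->|->].
    by rewrite rVconsS; exact: h2.
  by rewrite rVcons0.
rewrite lebesgue_rVS /pushforward CE.
rewrite (_ : _ @^-1` _ = [set x | `|x - s| < r]%R `*` [set x : 'rV[R]_n | forall i, (`|x ord0 i - y ord0 i| < r)%R]).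
  rewrite product_measure1E//; last 2 first.
  - rewrite (_ : mkset _ = ball s r); first exact: measurable_ball.
    by apply/seteqP; split=> x; rewrite /ball/= distrC.
  - apply: open_rV_measurable.
    have -> : [set x : 'rV[R]_n | forall i, (`|x ord0 i - y ord0 i| < r)%R] = ball y r.
      by apply/seteqP; split=> x /=; [move=> h; apply/ball_rVE => // i; rewrite distrC; exact: h|move/ball_rVE => h i; rewrite distrC; exact: h].
    exact: ball_open.
  rewrite exprS EFinM; congr (_ * _); last exact: IH.
  rewrite (_ : mkset _ = ball s r); last by apply/seteqP; split=> x; rewrite /ball/= distrC.
  apply: etrans (lebesgue_measure_ball _ (ltW r0)) _.
  by rewrite mulr_natl.
apply/seteqP; split=> -[a b] /=; rewrite rVcons0 => -[h1 h2]; split=> // j.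
  by have := h2 j; rewrite rVconsS.
by rewrite rVconsS.
Qed.
End lebesgue_rV_invariance.

Section lebesgue_rV_isometry.
Context {R : realType} {n : nat}.
Local Open Scope ereal_scope.
Local Notation mu := (@lebesgue_rV R n).

Lemma lebesgue_ball (c : 'rV[R]_n) (r : R) : (0 < r)%R -> mu (ball c r) = ((2 * r) ^+ n)%:E.
Proof.
move=> r0; rewrite -(lebesgue_cube c r0); congr lebesgue_rV.
by apply/seteqP; split=> x /=; [move/ball_rVE => h i; rewrite distrC; exact: h|
  move=> h; apply/ball_rVE => // i; rewrite distrC; exact: h].
Qed.

Definition eball (c : 'rV[R]_n) (r : R) : set (borel_rV R n) :=
  [set x : 'rV[R]_n | (enorm (x - c) <= r)%R].

Lemma eball_closed c r : closed (eball c r : set 'rV[R]_n).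
Proof.
rewrite (_ : eball c r = (fun x : 'rV[R]_n => enorm (x - c)) @^-1` [set y | y <= r]%R)//.
apply: closed_comp; last exact: closed_le.
by move=> x _; exact: enorm_sub_continuous.
Qed.

Lemma eball_measurable c r : measurable (eball c r).
Proof. by apply: closed_rV_measurable; exact: eball_closed. Qed.

Lemma lebesgue_eball_fin c r : mu (eball c r) < +oo.
Proof.
apply: (@le_lt_trans _ _ (mu (ball c (`|r| + 1)))); last by rewrite lebesgue_ball// ltry.
apply: le_measure; rewrite ?inE; first exact: eball_measurable.
  by apply: open_rV_measurable; exact: ball_open.
move=> x /= h; apply/ball_rVE => // i; rewrite distrC.
have := coord_le_enorm (x - c) i; rewrite !mxE => h'.
apply: (le_lt_trans h'); apply: (le_lt_trans h).
by apply: (le_lt_trans (ler_norm r)); rewrite ltrDl.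
Qed.

Lemma lebesgue_eball_gt0 c r : (0 < r)%R -> 0 < mu (eball c r).
Proof.
move=> r0; have n0 : (0 < r / n.+1%:R)%R by rewrite divr_gt0// ltr0n.
apply: (@lt_le_trans _ _ (mu (ball c (r / n.+1%:R)))).
  by rewrite lebesgue_ball// lte_fin exprn_gt0// mulr_gt0.
apply: le_measure; rewrite ?inE; last first.
- move=> x /ball_rVE => /(_ n0) h /=; apply: (le_trans (enorm_le_norm _)).
  apply: (@le_trans _ _ (n%:R * (r / n.+1%:R))%R).
    rewrite ler_wpM2l//; apply: norm_le_coord; first exact: ltW.
    by move=> i; rewrite !mxE distrC ltW.
  by rewrite mulrCA ger_pMr// ler_pdivrMr ?ltr0n// mul1r ler_nat.
- exact: eball_measurable.
- by apply: open_rV_measurable; exact: ball_open.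
Qed.

Lemma lebesgue_rV_isometry (f g : 'rV[R]_n -> 'rV[R]_n) :
  (forall x y, f (x + y) = f x + f y)%R -> continuous f -> continuous g ->
  cancel f g -> cancel g f -> (forall x, enorm (f x) = enorm x) ->
  forall h : borel_rV R n -> \bar R, measurable_fun setT h -> (forall x, 0 <= h x) ->
  \int[mu]_x h (f x) = \int[mu]_x h x.
Proof.
move=> fD cf cg fK gK fE h mh h0.
have mf := continuous_rV_rV_measurable cf.
have mg := continuous_rV_rV_measurable cg.
have [nu nuE] := sigma_finite_pushforward (sigma_finiteT mu) mf mg fK gK.
have H := @haar_rV_eq R n nu mu (eball 0 1) (eball_measurable 0 1).
have {}H : forall A, measurable A -> nu A = mu A.
  apply: H.
  - by move=> x; rewrite /eball /= !subr0 enormN.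
  - rewrite -nuE /pushforward; congr lebesgue_rV.
    by apply/seteqP; split=> x; rewrite /eball /= !subr0 fE.
  - by rewrite lebesgue_eball_gt0//= lebesgue_eball_fin.
  - move=> y A mA; rewrite -nuE /pushforward.
    rewrite -[RHS](@lebesgue_rV_translation R n (g y)); last first.
      by rewrite -[X in measurable X]setTI; exact: mf.
    congr lebesgue_rV; apply/seteqP; split=> x; rewrite /translate /= fD gK //.
  - exact: lebesgue_rV_translation.
have e := ge0_integral_pushforward mf mu measurableT mh (fun x _ => h0 x).
rewrite preimage_setT in e; apply: etrans (esym e) _.
apply: eq_measure_integral => C mC _.
by rewrite -[RHS]H// -nuE.
Qed.

End lebesgue_rV_isometry.

Opaque lebesgue_rV.

(** * Polar coordinates and inversion *)

Section change_of_variable_R.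
Context {R : realType}.
Local Open Scope ereal_scope.
Local Notation leb := (@lebesgue_measure R).

Lemma measure_R_unique (m1 m2 : {measure set (measurableTypeR R) -> \bar R}) :
  (forall a b : R, (a < b)%R -> m1 [set` `]a, b]%R] = m2 [set` `]a, b]%R]) ->
  (forall a b : R, (a < b)%R -> m1 [set` `]a, b]%R] < +oo) ->
  forall A, measurable A -> m1 A = m2 A.
Proof.
move=> m12 m1oo A mA.
apply: (@measure_unique _ R (measurableTypeR R) (@ocitv R) (fun k => [set` `](- k%:R)%R, k%:R]%R])) => //.
- exact: ocitvI.
- by move=> k; exact: is_ocitv.
- apply/seteqP; split=> // x _.
  exists (Num.truncn `|x|).+1 => //=; rewrite in_itv /=.
  have h : (`|x| < (Num.truncn `|x|).+1%:R)%R by rewrite truncnS_gt.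
  by rewrite ltrNl (le_lt_trans _ h) ?ler_normr ?lexx ?orbT//= (le_trans (ler_norm x))// ltW.
- move=> X /ocitvP[->|[[a b] /= ab ->]]; first by rewrite !measure0.
  exact: m12.
- move=> k; have [k0|k0] := leP (k%:R : R) (- k%:R)%R.
    by rewrite set_itv_ge ?measure0// bnd_simp -leNgt.
  exact: m1oo.
Qed.

Import HBNNSimple.
Variables (D : set R) (mD : measurable D) (w : R -> R).
Hypotheses (mw : measurable_fun [set: R] w) (w0 : forall x, (0 <= w x)%R).

(** A weighted integral is turned into an integral against a measure, so that changes of variables
    follow from the uniqueness of measures on intervals. *)
Definition density_measure (A : set (measurableTypeR R)) : \bar R :=
  \int[leb]_(x in A `&` D) (w x)%:E.

Let density0 : density_measure set0 = 0.
Proof. by rewrite /density_measure set0I integral_set0. Qed.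

Let density_ge0 A : 0 <= density_measure A.
Proof. by apply: integral_ge0 => x _; rewrite lee_fin. Qed.

Let density_sigma_additive : semi_sigma_additive density_measure.
Proof.
move=> F mF tF mUF; rewrite /density_measure setI_bigcupl ge0_integral_bigcup//.
- apply: is_cvg_ereal_nneg_natsum_cond => // n _ _.
  by apply: integral_ge0 => x _; rewrite lee_fin.
- by move=> k; apply: measurableI.
- exact/measurable_EFinP/measurable_funTS.
- by move=> x _; rewrite lee_fin.
- exact: trivIset_setIr.
Qed.

HB.instance Definition _ := isMeasure.Build _ _ _ density_measure
  density0 density_ge0 density_sigma_additive.

Definition density_meas : {measure set (measurableTypeR R) -> \bar R} := density_measure.

Lemma ge0_integral_density (f : R -> \bar R) (mf : measurable_fun [set: R] f) :
  (forall x, 0 <= f x) ->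
  \int[density_measure]_x f x = \int[leb]_(x in D) (f x * (w x)%:E).
Proof.
move=> f0.
have mT : measurable [set: measurableTypeR R] by [].
have mnuT : measurable_fun [set: measurableTypeR R] f by exact: mf.
pose f_ := nnsfun_approx mT mnuT.
have mw' : measurable_fun D (EFin \o w) by exact/measurable_EFinP/measurable_funTS.
have mfn k : measurable_fun D (fun x => (f_ k x)%:E * (w x)%:E).
  have h : measurable_fun [set: measurableTypeR R] (f_ k) by [].
  apply: emeasurable_funM => //; apply/measurable_EFinP.
  by apply: (@measurable_funS _ _ _ _ setT) => //; exact: h.
have fcvg x : (f_ n x)%:E @[n --> \oo] --> f x by apply: cvg_nnsfun_approx => // y _; exact: f0.
transitivity (limn (fun k => \int[density_measure]_x (f_ k x)%:E)).
  rewrite -monotone_convergence//.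
  - by apply: eq_integral => x _; apply/esym/cvg_lim.
  - by move=> k; exact/measurable_EFinP.
  - by move=> k x _; rewrite lee_fin.
  - move=> x _ a b ab; rewrite lee_fin; have /lefP := nd_nnsfun_approx mT mnuT ab; exact.
transitivity (limn (fun k => \int[leb]_(x in D) ((f_ k x)%:E * (w x)%:E))); last first.
  rewrite -monotone_convergence//.
  - apply: eq_integral => x _; apply/cvg_lim => //.
    exact: cvgeZr.
  - by move=> k x _; rewrite mule_ge0// lee_fin.
  - move=> x _ a b ab; rewrite lee_wpmul2r// lee_fin//; have /lefP := nd_nnsfun_approx mT mnuT ab; exact.
congr (limn _); apply/funext => k.
rewrite integralT_nnsfun sintegralE.
transitivity (\int[leb]_(x in D) \sum_(r \in range (f_ k)) (r%:E * ((\1_(f_ k @^-1` [set r]) x)%:E * (w x)%:E))).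
  rewrite ge0_integral_fsum//; last 2 first.
  - move=> r; apply: measurable_funeM; apply: emeasurable_funM => //.
    by apply/measurable_EFinP/measurable_funTS; exact: measurable_indic.
  - move=> r x _; have [r0|r0] := leP 0%R r.
      by apply: mule_ge0; [rewrite lee_fin|apply: mule_ge0; rewrite lee_fin].
    by rewrite preimage_nnfun0// indic0 mul0e mule0.
  apply: eq_fsbigr => r /[!inE] -[y _ <-].
  rewrite ge0_integralZl//; last 3 first.
  - apply: emeasurable_funM => //.
    by apply/measurable_EFinP/measurable_funTS; exact: measurable_indic.
  - by move=> x _; rewrite mule_ge0// lee_fin.
  - by rewrite lee_fin.
  transitivity ((f_ k y)%:E * \int[leb]_(x in (f_ k @^-1` [set f_ k y]) `&` D) (w x)%:E); first by [].
  congr (_ * _); rewrite integral_mkcondl.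
  apply: eq_integral => x _; rewrite /patch indicE.
  by case: ifP => _; rewrite ?mul1e ?mul0e.
apply: eq_integral => x _.
rewrite [in RHS]fimfunE -fsumEFin// ge0_mule_fsuml; last first.
  move=> r; have [r0|r0] := leP 0%R r; first by rewrite lee_fin mulr_ge0.
  by rewrite preimage_nnfun0// indic0 mulr0.
by apply: eq_fsbigr => r _; rewrite EFinM muleA.
Qed.

End change_of_variable_R.

(** * One-dimensional substitutions *)

Section substitution_R.
Context {R : realType}.
Local Open Scope ereal_scope.
Local Notation leb := (@lebesgue_measure R).
Local Notation pos := [set` `]0%R, +oo[%R].

Lemma itv_oc_setI_pos (a b : R) : [set` `]a, b]%R] `&` pos = [set` `](Num.max a 0)%R, b]%R].
Proof.
apply/seteqP; split=> x /=; rewrite !in_itv/= andbT gt_max.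
  by move=> [/andP[-> ->] ->].
by move=> /andP[/andP[-> ->] ->].
Qed.

(** The hypothesis on the sets [a < phi x <= b] says that [phi] carries the measure w dx to Lebesgue
    measure on the half line, tested on intervals; uniqueness of measures does the rest, and no
    derivative of [phi] occurs. *)
Lemma ge0_integration_by_substitution_Borel (phi w : R -> R) (f : R -> \bar R) :
  measurable_fun [set: R] phi -> measurable_fun [set: R] w -> (forall x, 0 <= w x)%R ->
  (forall x, 0 < x -> 0 < phi x)%R ->
  (forall a b : R, (0 <= a)%R -> (a < b)%R ->
    \int[leb]_(x in [set x | a < phi x <= b]%R `&` pos) (w x)%:E = (b - a)%:E) ->
  measurable_fun [set: R] f -> (forall x, 0 <= f x) ->
  \int[leb]_(x in pos) (f (phi x) * (w x)%:E) = \int[leb]_(x in pos) f x.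
Proof.
move=> mphi mw w0 phi0 H mf f0.
have mpos : measurable (pos : set R) by [].
rewrite -(ge0_integral_density mpos mw w0 (f := fun x => f (phi x))) //; last first.
  exact: measurableT_comp mf mphi.
pose nu : {measure set (measurableTypeR R) -> \bar R} :=
  density_meas mpos mw w0.
have mphi' : measurable_fun [set: measurableTypeR R] (phi : measurableTypeR R -> measurableTypeR R) by [].
have e := ge0_integral_pushforward mphi' nu measurableT mf (fun x _ => f0 x).
rewrite preimage_setT in e; apply: etrans (esym e) _.
have m1 : measurable_fun [set: R] (cst (1%R : R)) by exact: measurable_cst.
have i1 (x : R) : (0 <= cst (1 : R) x)%R by [].
have e1 : \int[leb]_(x in pos) f x = \int[density_measure pos (cst 1%R)]_x f x.
  apply: etrans (esym (ge0_integral_density mpos m1 i1 mf f0)).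
  by apply: eq_integral => x _; rewrite mule1.
apply: etrans _ (esym e1).
have ic (C : set R) : measurable C -> \int[leb]_(x in C) (cst 1%R x)%:E = leb C.
  by move=> mC; apply: etrans (integral_cst leb mC 1%E) _; rewrite mul1e.
have key (a b : R) : (a < b)%R ->
  \int[leb]_(x in (phi @^-1` [set` `]a, b]%R]) `&` pos) (w x)%:E =
  \int[leb]_(x in [set` `]a, b]%R] `&` pos) (cst 1%R x)%:E.
  move=> ab; have mab : measurable ([set` `]a, b]%R] `&` pos) by exact: measurableI.
  rewrite [RHS](ic _ mab).
  have [b0|b0] := leP b 0%R.
    rewrite (_ : _ `&` pos = set0); last first.
      rewrite -subset0 => x [] /=; rewrite !in_itv/= andbT => /andP[_ h] /phi0.
      by rewrite ltNge (le_trans h).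
    rewrite (_ : _ `&` pos = set0) ?measure0 ?integral_set0//.
    rewrite -subset0 => x [] /=; rewrite !in_itv/= andbT => /andP[_ h].
    by rewrite ltNge (le_trans h).
  (* [phi] is positive on the half line, so only the positive part of ]a, b] is seen. *)
  pose a' := Num.max a 0%R.
  have a'0 : (0 <= a')%R by rewrite le_max lexx orbT.
  have a'b : (a' < b)%R by rewrite gt_max ab.
  have -> : (phi @^-1` [set` `]a, b]%R]) `&` pos = [set x | a' < phi x <= b]%R `&` pos.
    apply/seteqP; split=> x [] /=; rewrite !in_itv/= andbT => h x0; split=> //.
      by move: h => /andP[h ->]; rewrite gt_max h phi0.
    by move: h => /andP[]; rewrite gt_max => /andP[-> _] ->.
  rewrite H//.
  by rewrite itv_oc_setI_pos -/a' lebesgue_measure_itv/= lte_fin a'b EFinB.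
apply: eq_measure_integral => C mC _.
apply: (measure_R_unique (m1 := pushforward_measure
    nu mphi')) => // a b ab.
rewrite /= /pushforward /density_measure key// ic; last exact: measurableI.
have h : leb [set` `]a, b]%R] < +oo.
  by rewrite lebesgue_measure_itv/= lte_fin ab -EFinB ltry.
exact: (le_lt_trans (measureIl _ _ _) h).
Qed.

Lemma FTC2_is_derive (F f : R -> R) (a b : R) : (a < b)%R ->
  (forall x, a <= x <= b -> {for x, continuous f})%R ->
  (forall x, (a <= x <= b)%R -> is_derive x 1%R F (f x)) ->
  \int[leb]_(x in [set` `[a, b]%R]) (f x)%:E = (F b - F a)%:E.
Proof.
move=> ab cf dF; rewrite EFinB.
have cF x : (a <= x <= b)%R -> {for x, continuous F}.
  move=> h; apply: differentiable_continuous; apply/derivable1_diffP.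
  by have [] := dF x h.
apply: continuous_FTC2 => //.
- apply/continuous_within_itvP => //; split.
  + move=> x; rewrite in_itv/= => /andP[/ltW h1 /ltW h2].
    by apply: cf; rewrite h1 h2.
  + by apply: cvg_at_right_filter; apply: cf; rewrite lexx ltW.
  + by apply: cvg_at_left_filter; apply: cf; rewrite lexx ltW.
- split.
  + move=> x; rewrite in_itv/= => /andP[/ltW h1 /ltW h2].
    by have [] := dF x ltac:(by rewrite h1 h2).
  + by apply: cvg_at_right_filter; apply: cF; rewrite lexx ltW.
  + by apply: cvg_at_left_filter; apply: cF; rewrite lexx ltW.
- move=> x; rewrite in_itv/= => /andP[/ltW h1 /ltW h2].
  by rewrite derive1E; have [_ ->] := dF x ltac:(by rewrite h1 h2).
Qed.

Lemma nth_root (n : nat) (a : R) : (0 <= a)%R -> exists2 c : R, (0 <= c)%R & (c ^+ n.+1)%R = a.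
Proof.
move=> a0; exists (a `^ (n.+1%:R^-1))%R; first exact: powR_ge0.
by rewrite -powR_mulrn ?powR_ge0// -powRrM mulVf ?pnatr_eq0// powRr1.
Qed.

Lemma substitution_expn n (f : R -> \bar R) : measurable_fun [set: R] f -> (forall x, 0 <= f x) ->
  \int[leb]_(x in pos) (f (x ^+ n.+1)%R * (n.+1%:R * x ^+ n)%:E) = \int[leb]_(x in pos) f x.
Proof.
move=> mf f0.
(* The truncation makes the weight nonnegative on the whole line without changing it on the half
   line. *)
pose w (x : R) := (n.+1%:R * (Num.max x 0) ^+ n)%R.
have mw : measurable_fun [set: R] w.
  apply: measurable_funM; first exact: measurable_cst.
  by apply: measurable_funX; apply: measurable_maxr => //; exact: measurable_cst.
transitivity (\int[leb]_(x in pos) (f (x ^+ n.+1)%R * (w x)%:E)).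
  apply: eq_integral => x /[!inE] /=; rewrite in_itv/= andbT => x0.
  by rewrite /w max_l// ltW.
apply: (@ge0_integration_by_substitution_Borel (fun x => x ^+ n.+1)%R w) => //.
- by move=> x; rewrite mulr_ge0// exprn_ge0// le_max lexx orbT.
- by move=> x x0; exact: exprn_gt0.
- move=> a b a0 ab.
  have [c c0 ca] := nth_root n a0.
  have [d d0 db] := nth_root n (le_trans a0 (ltW ab)).
  have cd : (c < d)%R by rewrite -(@ltr_pXn2r _ n.+1)// ?nnegrE// ca db.
  rewrite (_ : _ `&` _ = [set` `]c, d]%R]); last first.
    apply/seteqP; split=> x /=; rewrite !in_itv/= andbT.
      move=> [+ x0]; rewrite -ca -db ltr_pXn2r ?nnegrE ?(ltW x0)//.
      by rewrite ler_pXn2r ?nnegrE ?(ltW x0).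
    move=> /andP[h1 h2]; have x0 : (0 < x)%R by rewrite (le_lt_trans c0).
    split=> //; rewrite -ca -db ltr_pXn2r ?nnegrE ?(ltW x0)//.
    by rewrite ler_pXn2r ?nnegrE ?(ltW x0)// h1.
  rewrite integral_itv_obnd_cbnd; last exact/measurable_EFinP/measurable_funTS.
  transitivity (\int[leb]_(x in [set` `[c, d]%R]) (n.+1%:R * x ^+ n)%:E).
    apply: eq_integral => x /[!inE] /=; rewrite in_itv/= => /andP[h1 h2].
    by rewrite /w max_l// (le_trans c0).
  rewrite -ca -db; apply: (FTC2_is_derive (F := fun x => x ^+ n.+1)%R) => // x _.
    by apply: cvgM; [exact: cvg_cst|exact: exprn_continuous].
  have h := is_deriveX n.+1 (is_derive_id x 1%R).
  rewrite [X in is_derive _ _ _ X]mulr1 /= in h.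
  rewrite (_ : (fun y => y ^+ n.+1)%R = ((id : R -> R) ^+ n.+1)%R)//.
  by apply/funext => y; elim: (n.+1) => [//|k IH]; rewrite !exprS IH.
Qed.

Lemma measurable_invr : measurable_fun [set: R] (fun x : R => x^-1)%R.
Proof.
have h : [set: R] = [set x | x != 0]%R `|` [set 0%R].
  by apply/seteqP; split=> // x _; have [->|] := eqVneq x 0%R; [right|left].
rewrite h; apply/measurable_funU => //; first exact: open_measurable.
split.
  apply: open_continuous_measurable_fun => // x /[!inE] /= x0.
  exact: inv_continuous.
exact: measurable_fun_set1.
Qed.

Lemma substitution_inv (f : R -> \bar R) : measurable_fun [set: R] f -> (forall x, 0 <= f x) ->
  \int[leb]_(x in pos) (f (x^-1)%R * (x ^- 2)%:E) = \int[leb]_(x in pos) f x.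
Proof.
move=> mf f0.
have mi : measurable_fun [set: R] (fun x : R => x^-1)%R by exact: measurable_invr.
have dF (x : R) : (0 < x)%R -> is_derive x 1%R (fun x => - x^-1)%R (x ^- 2)%R.
  move=> x0; have x1 : id x != 0%R by rewrite gt_eqF.
  have h := is_deriveV x1 (is_derive_id x 1%R).
  have := is_deriveN h; rewrite /GRing.scale /= mulr1 opprK; exact.
have cf (x : R) : (0 < x)%R -> {for x, continuous (fun x : R => x ^- 2)%R}.
  move=> x0; apply: (@continuous_comp _ _ _ (fun x : R => x ^+ 2)%R GRing.inv).
    exact: exprn_continuous.
  by apply: inv_continuous; rewrite gt_eqF// exprn_gt0.
have mw : measurable_fun [set: R] (fun x : R => x ^- 2)%R.
  by apply: (measurableT_comp mi); exact: exprn_measurable.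
apply: (@ge0_integration_by_substitution_Borel (fun x => x^-1)%R (fun x => x ^- 2)%R) => //.
- by move=> x; rewrite invr_ge0 sqr_ge0.
- by move=> x; rewrite invr_gt0.
- move=> a b a0 ab.
  have b0 : (0 < b)%R by exact: le_lt_trans ab.
  have [a1|] := ltP 0%R a.
    rewrite (_ : _ `&` _ = [set` `[b^-1, a^-1[%R]); last first.
      apply/seteqP; split=> x /=; rewrite !in_itv/= andbT.
        move=> [/andP[h1 h2] x0]; rewrite -[x]invrK.
        by rewrite lef_pV2 ?posrE ?invr_gt0// ltf_pV2 ?posrE ?invr_gt0// h1 h2.
      move=> /andP[h1 h2]; have x0 : (0 < x)%R by rewrite (lt_le_trans _ h1)// invr_gt0.
      by split=> //; rewrite -[a]invrK -[b]invrK lef_pV2 ?posrE ?invr_gt0// ltf_pV2 ?posrE ?invr_gt0// h1 h2.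
    rewrite integral_itv_bndo_bndc; last exact/measurable_EFinP/measurable_funTS.
    have h (x : R) : (b^-1 <= x <= a^-1)%R -> (0 < x)%R.
      by move=> /andP[h1 _]; rewrite (lt_le_trans _ h1)// invr_gt0.
    rewrite (_ : (b - a = (fun x => - x^-1) a^-1 - (fun x => - x^-1) b^-1)%R); last first.
      by rewrite !invrK opprK addrC.
    apply: (FTC2_is_derive (F := fun x => - x^-1)%R).
    - by rewrite ltf_pV2 ?posrE.
    - by move=> x /h; exact: cf.
    - by move=> x /h; exact: dF.
  move=> a1; have {a1 a0 ab} -> : a = 0%R by apply/eqP; rewrite eq_le a0 a1.
  (* For a = 0 the preimage is the unbounded interval from 1/b, and the primitive -1/x tends to 0 at
     infinity. *)
  rewrite (_ : _ `&` _ = [set` `[b^-1, +oo[%R]); last first.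
    apply/seteqP; split=> x /=; rewrite !in_itv/= !andbT.
      by move=> [/andP[h1 h2] x0]; rewrite -[x]invrK lef_pV2 ?posrE ?invr_gt0.
    move=> h1; have x0 : (0 < x)%R by rewrite (lt_le_trans _ h1)// invr_gt0.
    by split=> //; rewrite invr_gt0 x0 -[b]invrK lef_pV2 ?posrE ?invr_gt0.
  have h (x : R) : (b^-1 <= x)%R -> (0 < x)%R.
    by move=> h1; rewrite (lt_le_trans _ h1)// invr_gt0.
  rewrite (_ : (b - 0)%:E = 0%:E - ((fun x => - x^-1) b^-1)%R%:E); last first.
    by rewrite sub0e -EFinN invrK opprK subr0.
  apply: (@ge0_continuous_FTC2y R (fun x => x ^- 2) (fun x => - x^-1) b^-1 0)%R.
  - by move=> x _; rewrite invr_ge0 sqr_ge0.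
  - apply/continuous_within_itvcyP; split.
      move=> x; rewrite in_itv/= andbT => /ltW /h; exact: cf.
    by apply: cvg_at_right_filter; apply: cf; exact: h.
  - rewrite -oppr0; apply: cvgN; apply/gtr0_cvgV0; last exact: cvg_id.
    by near=> x; near: x; exact: nbhs_pinfty_gt.
  - by move=> x /ltW /h /dF [].
  - apply: cvg_at_right_filter; apply: cvgN; apply: inv_continuous.
    by rewrite gt_eqF// invr_gt0.
  - move=> x; rewrite in_itv/= andbT => /ltW /h /dF [_ e].
    by rewrite derive1E e.
Unshelve. all: by end_near. Qed.
End substitution_R.

(** * Polar coordinates *)

Section polar_coordinates.
Context {R : realType} {m : nat}.
Local Notation n := m.+1.
Local Open Scope ereal_scope.
Local Notation leb := (@lebesgue_measure R).
Local Notation mu := (@lebesgue_rV R n).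
Local Notation pos := [set` `]0%R, +oo[%R].

Lemma lebesgue_rV_set1 (x : 'rV[R]_n) : mu [set x] = 0.
Proof.
apply/eqP; rewrite eq_le measure_ge0 andbT; apply/lee_addgt0Pr => e e0; rewrite add0e.
have [c c0 ce] := nth_root m (ltW e0).
have c1 : (0 < c)%R.
  by rewrite lt_neqAle c0 andbT; apply: contraTneq e0 => h; rewrite -ce -h expr0n /= ltxx.
apply: (@le_trans _ _ (mu (ball x (c / 2)))); last first.
  by rewrite lebesgue_ball ?divr_gt0// mulrC divfK// ce.
apply: le_measure; rewrite ?inE.
- rewrite (_ : [set x] = eball x 0); first exact: eball_measurable.
  apply/seteqP; split=> y; rewrite /eball /=; first by move=> ->; rewrite subrr enorm0.
  move=> h; apply/eqP; rewrite -subr_eq0 -enorm_eq0 eq_le h /=; exact: enorm_ge0.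
- by apply: open_rV_measurable; exact: ball_open.
- by move=> _ ->; apply: ballxx; exact: divr_gt0.
Qed.

(** The inverse of 0 is 0, so the origin has direction 0; this keeps [polarK] true everywhere. *)
Definition direction (x : borel_rV R n) : borel_rV R n := ((enorm x)^-1 *: (x : 'rV[R]_n))%R.

Lemma enorm_measurable : measurable_fun [set: borel_rV R n] (@enorm R n).
Proof. by apply: continuous_rV_measurable; exact: enorm_continuous. Qed.

Lemma direction_measurable : measurable_fun setT direction.
Proof.
apply: measurable_rVZ => //.
exact: (measurableT_comp measurable_invr enorm_measurable).
Qed.

Lemma directionZ (c : R) (x : 'rV[R]_n) : (0 < c)%R -> direction (c *: x)%R = direction x.
Proof.
move=> c0; rewrite /direction enormZ gtr0_norm// scalerA invfM.
by rewrite mulrAC mulVf ?mul1r// gt_eqF.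
Qed.

Definition punctured_ball : set (borel_rV R n) := [set x : 'rV[R]_n | 0 < enorm x <= 1]%R.

Lemma norm_itv_measurable (i : interval R) :
  measurable ([set x : 'rV[R]_n | enorm x \in i] : set (borel_rV R n)).
Proof.
rewrite (_ : mkset _ = @enorm R n @^-1` [set` i]) // -[X in measurable X]setTI.
exact: enorm_measurable.
Qed.

Lemma punctured_ball_measurable : measurable punctured_ball.
Proof.
rewrite (_ : punctured_ball = [set x : 'rV[R]_n | enorm x \in `]0, 1]%R]).
  exact: norm_itv_measurable.
by apply/seteqP; split=> x /=; rewrite /punctured_ball /= in_itv/=.
Qed.

(* [cone_measure A] is the volume of the cone over [A], with the direction of
   [x] standing for its projection to the sphere. *)
Definition cone_measure := pushforward (mrestr mu punctured_ball_measurable) direction.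

Definition cone_meas : {measure set (borel_rV R n) -> \bar R} :=
  pushforward_measure
    (mrestr mu punctured_ball_measurable) direction_measurable.

Lemma cone_measure_fin A : measurable A -> cone_measure A < +oo.
Proof.
move=> mA; rewrite /cone_measure /pushforward /mrestr.
apply: (@le_lt_trans _ _ (mu (eball 0 1))); last exact: lebesgue_eball_fin.
apply: le_measure; rewrite ?inE.
- apply: measurableI; last exact: punctured_ball_measurable.
  by rewrite -[X in measurable X]setTI; exact: direction_measurable.
- exact: eball_measurable.
- by move=> x [_ /andP[_]]; rewrite /eball /= subr0.
Qed.

Lemma cone_measure_scale (A : set (borel_rV R n)) (b : R) : measurable A -> (0 < b)%R ->
  mu [set x : 'rV[R]_n | (0 < enorm x <= b)%R /\ A (direction x)] = (b ^+ n)%:E * cone_measure A.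
Proof.
move=> mA b0; set B := mkset _.
have mB : measurable (B : set (borel_rV R n)).
  rewrite (_ : B = [set x : 'rV[R]_n | enorm x \in `]0%R, b]%R] `&` direction @^-1` A).
    apply: measurableI; first exact: norm_itv_measurable.
    by rewrite -[X in measurable X]setTI; exact: direction_measurable.
  by apply/seteqP; split=> x /=; rewrite in_itv/=.
have mI : measurable_fun setT (fun x : borel_rV R n => (\1_B x)%:E : \bar R).
  by apply/measurable_EFinP; exact: measurable_indic.
have h := @ge0_integral_rVZ R n b (fun x => (\1_B x)%:E : \bar R) b0 mI (fun x => ltac:(by rewrite lee_fin)).
have hB : \int[mu]_x (\1_B x)%:E = mu B by rewrite integral_indic// setIT.
rewrite hB in h.
have -> : cone_measure A = (b ^- n)%:E * mu B.
  rewrite -h /cone_measure /pushforward /mrestr.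
  have mC : measurable ((direction @^-1` A) `&` punctured_ball).
    apply: measurableI; last exact: punctured_ball_measurable.
    by rewrite -[X in measurable X]setTI; exact: direction_measurable.
  have -> : mu ((direction @^-1` A) `&` punctured_ball) =
      \int[mu]_x (\1_((direction @^-1` A) `&` punctured_ball) x)%:E.
    by rewrite integral_indic// setIT.
  apply: eq_integral => x _; rewrite !indicE; congr ((nat_of_bool _)%:R%:E).
  have e : (enorm (b *: (x : 'rV[R]_n)) = b * enorm x)%R by rewrite enormZ gtr0_norm.
  apply/idP/idP; rewrite !inE /B /punctured_ball /=.
    by move=> [h1 /andP[h2 h3]]; rewrite e directionZ// pmulr_rgt0// h2 ger_pMr.
  by rewrite e directionZ// pmulr_rgt0// ger_pMr// => -[].
by rewrite muleA -EFinM divff ?mul1e// expf_neq0// gt_eqF.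
Qed.

Let cone_fin : fin_num_fun cone_meas.
Proof. by move=> A mA; rewrite ge0_fin_numE//; exact: cone_measure_fin. Qed.

HB.instance Definition _ := Measure.copy cone_measure cone_meas.
HB.instance Definition _ := Measure_isFinite.Build _ _ _ cone_measure cone_fin.

(** The radial coordinate is |x|^n and not |x|: a cone cut at |x|^n <= r has r times the volume of
    the cone cut at 1, so Lebesgue measure becomes exactly the product of Lebesgue measure on the
    half line and [cone_measure]. *)
Lemma polar_measurable : measurable_fun setT
  (fun x : borel_rV R n => ((enorm x ^+ n)%R, direction x) : measurableTypeR R * borel_rV R n).
Proof.
apply/measurable_fun_pairP; split; last exact: direction_measurable.
by apply: measurable_funX; exact: enorm_measurable.
Qed.

Definition polar_inv (p : measurableTypeR R * borel_rV R n) : borel_rV R n :=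
  ((p.1 `^ n%:R^-1) *: (p.2 : 'rV[R]_n))%R.

Lemma polar_inv_measurable : measurable_fun setT polar_inv.
Proof.
apply: measurable_rVZ; last exact: measurable_snd.
by apply: (measurableT_comp (measurable_powR _)); exact: measurable_fst.
Qed.

Lemma polarK (x : 'rV[R]_n) : polar_inv ((enorm x ^+ n)%R, direction x) = x.
Proof.
rewrite /polar_inv /= -powR_mulrn ?enorm_ge0// -powRrM divff ?pnatr_eq0// powRr1 ?enorm_ge0//.
have [->|x0] := eqVneq x 0%R; first by rewrite /direction !scaler0.
by rewrite scalerA divff ?scale1r// enorm_eq0.
Qed.

Definition posm := mrestr leb (measurable_itv `]0%R, +oo[%R).
HB.instance Definition _ := Measure.copy posm (mrestr leb (measurable_itv `]0%R, +oo[%R)).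

Let posm_sigma_finite : sigma_finite setT posm.
Proof.
have [F F1 F2] := sigma_finiteT leb; exists F => // i; have [mF Foo] := F2 i; split=> //.
by apply: le_lt_trans Foo; exact: measureIl.
Qed.
HB.instance Definition _ := Measure_isSigmaFinite.Build _ _ _ posm posm_sigma_finite.

Lemma ge0_integral_posm (f : R -> \bar R) : measurable_fun [set: R] f -> (forall x, 0 <= f x) ->
  \int[posm]_x f x = \int[leb]_(x in pos) f x.
Proof.
move=> mf f0.
have m1 : measurable_fun [set: R] (cst (1%R : R)) by exact: measurable_cst.
have i1 (x : R) : (0 <= cst (1%R : R) x)%R by [].
have := ge0_integral_density (measurable_itv `]0%R, +oo[%R) m1 i1 mf f0.
under [in RHS]eq_integral do rewrite mule1.
move=> <-; apply: eq_measure_integral => C mC _.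
rewrite /density_measure; apply/esym.
have mCI : measurable ((C : set R) `&` pos) by exact: measurableI.
by apply: etrans (integral_cst leb mCI 1%E) _; rewrite mul1e.
Qed.

Lemma lebesgue_rVD0 (X : set (borel_rV R n)) : measurable X -> mu (X `\ (0%R : 'rV[R]_n)) = mu X.
Proof.
move=> mX; have m0 : measurable ([set (0%R : 'rV[R]_n)] : set (borel_rV R n)).
  rewrite (_ : [set 0%R : 'rV[R]_n] = eball 0 0); first exact: eball_measurable.
  apply/seteqP; split=> y; rewrite /eball /= subr0; first by move=> ->; rewrite enorm0.
  move=> h; apply/eqP; rewrite -enorm_eq0 eq_le h /=; exact: enorm_ge0.
have mXD : measurable (X `\ (0%R : 'rV[R]_n)) by exact: measurableD.
apply/eqP; rewrite eq_le; apply/andP; split.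
  by apply: le_measure; rewrite ?inE// => x [].
have mU : measurable (X `\ (0%R : 'rV[R]_n) `|` [set (0%R : 'rV[R]_n)]) by exact: measurableU.
apply: (@le_trans _ _ (mu (X `\ (0%R : 'rV[R]_n) `|` [set (0%R : 'rV[R]_n)]))).
  apply: le_measure; rewrite ?inE// => x Xx.
  by have [->|/eqP x0] := eqVneq (x : 'rV[R]_n) 0%R; [right|left].
apply: le_trans (measureU2 _ _ _) _ => //.
by rewrite [X in _ + X]lebesgue_rV_set1 adde0.
Qed.

(** For fixed B both sides are measures in A. On a half-open interval the set on the left is, up to
    the origin, a difference of two scaled cones. *)
Lemma polar_pushforward (A : set (measurableTypeR R)) (B : set (borel_rV R n)) :
  measurable A -> measurable B ->
  mu [set x : 'rV[R]_n | A (enorm x ^+ n)%R /\ B (direction x)] = posm A * cone_measure B.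
Proof.
move=> mA mB.
have cB : cone_measure B \is a fin_num by exact: cone_fin.
have c0 : (0 <= fine (cone_measure B))%R by exact: fine_ge0.
have mdB : measurable (direction @^-1` B).
  by rewrite -[X in measurable X]setTI; exact: direction_measurable.
have men : measurable_fun setT (fun x : borel_rV R n => (enorm x ^+ n)%R : measurableTypeR R).
  by apply: measurable_funX; exact: enorm_measurable.
have mpre (C : set (measurableTypeR R)) : measurable C ->
    measurable ((fun x : borel_rV R n => (enorm x ^+ n)%R : measurableTypeR R) @^-1` C).
  by move=> mC; rewrite -[X in measurable X]setTI; exact: men.
pose m1 := pushforward_measure (mrestr mu mdB) men.
pose m2 := mscale (NngNum c0) posm.
have m1E (C : set (measurableTypeR R)) : m1 C = mu [set x : 'rV[R]_n | C (enorm x ^+ n)%R /\ B (direction x)] by [].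
have m2E C : m2 C = posm C * cone_measure B by rewrite /m2 /mscale /= muleC fineK.
rewrite -m1E -m2E; apply: measure_R_unique => // a b ab; last first.
  rewrite m1E; have [d d0 db] := nth_root m (normr_ge0 b).
  apply: (@le_lt_trans _ _ (mu (eball 0 d))); last exact: lebesgue_eball_fin.
  apply: le_measure; rewrite ?inE; last 2 first.
  - exact: eball_measurable.
  - move=> x /= [+ _]; rewrite in_itv/= /eball/= subr0 => /andP[_ h].
    rewrite -(@ler_pXn2r _ n)// ?nnegrE ?enorm_ge0// db; exact: le_trans (ler_norm b).
  by apply: measurableI => //; exact: mpre.
rewrite m1E -[RHS]/(m2 _) m2E.
pose S (r : R) := [set x : 'rV[R]_n | (0 < enorm x ^+ n <= r)%R /\ B (direction x)] : set (borel_rV R n).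
have mS r : measurable (S r).
  rewrite (_ : S r = (fun x : borel_rV R n => (enorm x ^+ n)%R : measurableTypeR R) @^-1` [set` `]0%R, r]%R] `&` direction @^-1` B); last first.
    by apply/seteqP; split=> x /=; rewrite /S /= in_itv.
  by apply: measurableI => //; exact: mpre.
have SE r : (0 <= r)%R -> mu (S r) = r%:E * cone_measure B.
  move=> r0; have [d d0 dr] := nth_root m r0.
  have [d1|d1] := ltP 0%R d.
    rewrite -dr -cone_measure_scale//; congr lebesgue_rV.
    apply/seteqP; split=> x; rewrite /S /= ?dr -?dr; move=> [/andP[h1 h2] Bx]; split=> //; apply/andP; split.
    - by rewrite lt_neqAle enorm_ge0 andbT; apply: contraTneq h1 => <-; rewrite expr0n /= ltxx.
    - by rewrite -(@ler_pXn2r _ n)// ?nnegrE ?enorm_ge0.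
    - by rewrite exprn_gt0.
    - by rewrite ler_pXn2r// ?nnegrE ?enorm_ge0.
  have -> : r = 0%R by rewrite -dr (_ : d = 0%R) ?expr0n//; apply/eqP; rewrite eq_le d0 d1.
  rewrite mul0e (_ : S 0%R = set0) ?measure0//; rewrite -subset0 => x [/andP[h1 h2] _].
  by have := lt_le_trans h1 h2; rewrite ltxx.
have mC : measurable ([set x : 'rV[R]_n | [set` `]a, b]%R] (enorm x ^+ n)%R /\ B (direction x)] : set (borel_rV R n)).
  by apply: measurableI => //; exact: mpre.
(* The origin is removed because its direction 0 may belong to B, whereas the cones [S r] leave it
   out. *)
rewrite -lebesgue_rVD0//.
have [b0|b0] := leP b 0%R.
  rewrite (_ : _ `\` _ = set0); last first.
    rewrite -subset0 => x /= [[+ _]]; rewrite in_itv/= => /andP[_ h1] h2; apply: h2.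
    apply/eqP/negPn/negP; rewrite -enorm_gt0 => /(exprn_gt0 n) h3.
    by have := lt_le_trans h3 (le_trans h1 b0); rewrite ltxx.
  rewrite measure0 /posm /mrestr (_ : _ `&` _ = set0) ?measure0 ?mul0e//.
  rewrite -subset0 => x []; rewrite /= !in_itv/= andbT => /andP[_ h1] h2.
  by have := le_lt_trans (le_trans h1 b0) h2; rewrite ltxx.
pose a' := Num.max a 0%R.
have a'0 : (0 <= a')%R by rewrite le_max lexx orbT.
have a'b : (a' < b)%R by rewrite gt_max ab.
have -> : posm [set` `]a, b]%R] = (b - a')%:E.
  by rewrite /posm /mrestr itv_oc_setI_pos -/a' lebesgue_measure_itv/= lte_fin a'b EFinB.
rewrite (_ : _ `\` _ = S b `\` S a'); last first.
  have en0 (x : 'rV[R]_n) : (0 < enorm x ^+ n)%R <-> x <> 0%R.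
    split=> [h x0|/eqP]; first by rewrite x0 enorm0 expr0n ltxx in h.
    by rewrite -enorm_gt0 => h; exact: exprn_gt0.
  apply/seteqP; split=> x; rewrite /S /= in_itv/=.
    move=> [[/andP[h1 h2] Bx] x0]; rewrite h2 andbT; split; first by split=> //; apply/en0.
    move=> [/andP[h3 h4] _]; move: h4; rewrite le_max !leNgt h1 /=.
    by move/en0 : x0 => ->.
  move=> [[/andP[h1 h2] Bx] h3]; rewrite h2 andbT; split; last exact/en0.
  split=> //; rewrite ltNge; apply/negP => h4; apply: h3; split=> //.
  by rewrite h1 le_max h4.
rewrite measureD//; last first.
  by rewrite [X in X < _](SE b (ltW b0)) -(fineK cB) -EFinM ltry.
rewrite (_ : S b `&` S a' = S a'); last first.
  apply/seteqP; split=> x; rewrite /S /=; first by case.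
  move=> [/andP[h1 h2] Bx]; split; last by rewrite h1 h2.
  by rewrite h1 (le_trans h2)// ltW.
by rewrite [X in X - _](SE b (ltW b0)) [X in _ - X](SE a' a'0) -(fineK cB) -!EFinM -EFinB -mulrBl.
Qed.

Lemma ge0_integral_polar (f : borel_rV R n -> \bar R) :
  measurable_fun setT f -> (forall x, 0 <= f x) ->
  \int[mu]_x f x = \int[cone_measure]_u \int[leb]_(s in pos)
    (f (s *: (u : 'rV[R]_n)) * (n%:R * s ^+ m)%:E).
Proof.
move=> mf f0.
pose K := pushforward_measure mu polar_measurable.
have mg : measurable_fun setT (f \o polar_inv) by exact: measurableT_comp mf polar_inv_measurable.
have e1 := ge0_integral_pushforward polar_measurable mu measurableT mg (fun x _ => f0 _).
rewrite preimage_setT in e1.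
have -> : \int[mu]_x f x = \int[mu]_x ((f \o polar_inv) \o
    (fun x0 : borel_rV R n => ((enorm x0 ^+ n)%R, direction x0))) x.
  by apply: eq_integral => x _ /=; rewrite polarK.
rewrite -e1.
transitivity (\int[posm \x cone_measure]_y (f \o polar_inv) y).
  apply: eq_measure_integral => [|P' C mC _]; first exact: polar_measurable.
  apply/esym; apply: (product_measure_unique (m' := K)) => // A B mA mB.
  exact: polar_pushforward.
have g0 p : 0 <= (f \o polar_inv) p by exact: f0.
apply: (etrans (@fubini_tonelli1 _ _ _ _ R posm cone_measure _ mg g0)).
apply: (etrans (@fubini_tonelli _ _ _ _ R posm cone_measure _ mg g0)).
apply: eq_integral => u _ /=.
have mh : measurable_fun [set: R] (fun t => f (t `^ n%:R^-1 *: (u : 'rV[R]_n))%R).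
  apply: (measurableT_comp mf); apply: measurable_rVZ; last exact: measurable_cst.
  exact: measurable_powR.
apply: etrans (ge0_integral_posm mh (fun=> f0 _)) _.
apply: etrans (esym (substitution_expn m mh (fun=> f0 _))) _.
apply: eq_integral => s /[!inE] /=; rewrite in_itv/= andbT => s0.
rewrite -powR_mulrn ?(ltW s0)// -powRrM divff ?pnatr_eq0// powRr1 ?(ltW s0)//.
Qed.

Lemma sphere_areaE : @sphere_area R n = n%:R%:E * cone_measure setT.
Proof.
rewrite /sphere_area /sphere_measure; congr (_ * _).
rewrite /cone_measure /pushforward /mrestr preimage_setT setTI; congr lebesgue_rV.
apply/seteqP; split=> x; rewrite /punctured_ball /=.
  move=> [t /andP[t0 t1] [u u1 <-]]; rewrite enormZ u1 mulr1 gtr0_norm// t0 //.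
move=> /andP[x0 x1]; exists (enorm x); first by rewrite x0.
exists (direction x).
  by rewrite /direction enormZ ger0_norm ?invr_ge0 ?enorm_ge0// mulVf// gt_eqF.
by rewrite /direction scalerA divff ?scale1r// gt_eqF.
Qed.

End polar_coordinates.

(** * Convexity inequalities for powers *)

Section power_inequalities.
Context {R : realType}.

(** A power lies above its tangent at b. Holder's and Jensen's inequalities are replaced by this
    linear bound, with the extremal b inserted at each use; b = 1 gives Bernoulli's inequality. *)
Lemma tangent_line_power (m : nat) (b x : R) : 0 <= b -> 0 <= x ->
  m.+1%:R * b ^+ m * x <= x ^+ m.+1 + m%:R * b ^+ m.+1.
Proof.
move=> b0 x0; elim: m => [|m IH]; first by rewrite mul0r addr0 expr0 !expr1 !mul1r.
have h1 : 0 <= x * (x ^+ m.+1 + m%:R * b ^+ m.+1 - m.+1%:R * b ^+ m * x).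
  by rewrite mulr_ge0// subr_ge0.
have h2 : 0 <= m.+1%:R * b ^+ m * (x - b) ^+ 2 by apply: mulr_ge0; [rewrite mulr_ge0 ?exprn_ge0|exact: sqr_ge0].
rewrite -subr_ge0.
have -> : x ^+ m.+2 + m.+1%:R * b ^+ m.+2 - m.+2%:R * b ^+ m.+1 * x =
  x * (x ^+ m.+1 + m%:R * b ^+ m.+1 - m.+1%:R * b ^+ m * x) + m.+1%:R * b ^+ m * (x - b) ^+ 2.
  by rewrite !exprS -!natr1; ring.
exact: addr_ge0.
Qed.

(** A crude form of Young's inequality: a value above k is at most k (x/k)^(m+1). The free scale k
    serves to balance the two terms. *)
Lemma le_power_split (m : nat) (k x : R) : 0 < k -> 0 <= x -> x <= k + k ^- m * x ^+ m.+1.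
Proof.
move=> k0 x0; have [xk|kx] := leP x k.
  by rewrite (le_trans xk)// lerDl mulr_ge0 ?exprn_ge0// invr_ge0 exprn_ge0// ltW.
apply: (@le_trans _ _ (k ^- m * x ^+ m.+1)); last by rewrite lerDr ltW.
rewrite exprSr mulrA ler_peMl// mulrC ler_pdivlMr ?exprn_gt0// mul1r.
by rewrite lerXn2r// ?nnegrE// ltW.
Qed.

Local Open Scope ereal_scope.

Lemma expe_pinfty (m : nat) : (+oo : \bar R) ^+ m.+1 = +oo.
Proof. by elim: m => [//|m IH]; rewrite expeS IH mulyy. Qed.

Lemma tangent_line_powere (m : nat) (b : R) (x : \bar R) : (0 <= b)%R -> 0 <= x ->
  (m.+1%:R * b ^+ m)%:E * x <= x ^+ m.+1 + (m%:R * b ^+ m.+1)%:E.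
Proof.
case: x => [x| |]// b0 x0; last by rewrite expe_pinfty addye// leey.
by rewrite -EFin_expe -EFinM -EFinD lee_fin tangent_line_power.
Qed.

Lemma le_power_splite (m : nat) (k : R) (x : \bar R) : (0 < k)%R -> 0 <= x ->
  x <= k%:E + (k ^- m)%:E * x ^+ m.+1.
Proof.
case: x => [x| |]// k0 x0; last by rewrite expe_pinfty gt0_muley ?lte_fin ?invr_gt0 ?exprn_gt0// addey.
by rewrite -EFin_expe -EFinM -EFinD lee_fin le_power_split.
Qed.

Lemma measurable_fun_expe d (T : measurableType d) (f : T -> \bar R) (m : nat) :
  measurable_fun setT f -> measurable_fun setT (fun x => f x ^+ m).
Proof.
move=> mf; elim: m => [|m IH]; first by apply: (eq_measurable_fun (cst 1)) => // x _; rewrite expe0.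
apply: (eq_measurable_fun (fun x => f x * f x ^+ m)); first by move=> x _; rewrite expeS.
exact: emeasurable_funM.
Qed.
End power_inequalities.

(** * Integrals over rays, inversions and radial energy *)

Section spherical_coordinates.
Context {R : realType} {m : nat}.
Local Notation n := m.+1.
Local Notation Rn := 'rV[R]_n.
Local Open Scope ereal_scope.
Local Notation leb := (@lebesgue_measure R).
Local Notation mu := (@lebesgue_rV R n).
Local Notation cone := (@cone_measure R m).
Local Notation pos := [set` `]0%R, +oo[%R].

Definition usphere : set (borel_rV R n) := [set u : Rn | enorm u = 1]%R.

Lemma usphere_measurable : measurable usphere.
Proof.
rewrite (_ : usphere = [set x : Rn | enorm x \in `[1, 1]%R]); first exact: norm_itv_measurable.
apply/seteqP; split=> x; rewrite /usphere /= in_itv/=; first by move=> ->; rewrite lexx.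
by move=> h; apply/eqP; rewrite eq_le andbC.
Qed.

Lemma cone_measure_sphereC : cone (~` usphere) = 0.
Proof.
rewrite /cone_measure /pushforward /mrestr (_ : _ `&` _ = set0) ?measure0//.
rewrite -subset0 => x [] /= h /andP[x0 _]; apply: h.
by rewrite /usphere /= /direction enormZ ger0_norm ?invr_ge0 ?enorm_ge0// mulVf// gt_eqF.
Qed.

Lemma ge0_integral_cone (f : borel_rV R n -> \bar R) : measurable_fun setT f -> (forall x, 0 <= f x) ->
  \int[cone]_u f u = \int[cone]_(u in usphere) f u.
Proof.
move=> mf f0; have mS := usphere_measurable.
by rewrite (ge0_negligible_integral (measurableC mS))// ?setTD ?setCK//; exact: cone_measure_sphereC.
Qed.

Lemma cone_sphere : cone usphere = cone setT.
Proof.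
have mS := usphere_measurable; have mSC : measurable (~` usphere) by exact: measurableC.
by rewrite -(setvU usphere) measureU ?setICl// [X in _ = X + _]cone_measure_sphereC add0e.
Qed.

Lemma ge0_measurable_section (D : set R) (h : R -> borel_rV R n -> \bar R) : measurable D ->
  measurable_fun setT (fun p : measurableTypeR R * borel_rV R n => h p.1 p.2) ->
  (forall s u, 0 <= h s u) -> measurable_fun setT (fun u => \int[leb]_(s in D) h s u).
Proof.
move=> mD mh h0.
pose k (p : borel_rV R n * measurableTypeR R) := ((fun s => h s p.1) \_ D) p.2.
have mk : measurable_fun setT k.
  have mh' : measurable_fun setT (fun p : borel_rV R n * measurableTypeR R => h p.2 p.1).
    exact: (measurableT_comp mh (measurable_swap (T1 := borel_rV R n) (T2 := measurableTypeR R))).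
  have ms : measurable_fun setT (@snd (borel_rV R n) (measurableTypeR R)) by exact: measurable_snd.
  have mD' : measurable ((@snd (borel_rV R n) (measurableTypeR R)) @^-1` D).
    by rewrite -[X in measurable X]setTI; exact: ms.
  have := (measurable_restrictT (fun p : borel_rV R n * measurableTypeR R => h p.2 p.1) mD').1 (measurable_funTS mh').
  apply: eq_measurable_fun => p _; rewrite /k /patch.
  by congr (if _ then _ else _); apply/idP/idP; rewrite !inE.
have k0 p : 0 <= k p by rewrite /k /patch; case: ifP.
have := @measurable_fun_fubini_tonelli_F _ _ _ _ R leb k mk k0.
apply: eq_measurable_fun => u _; rewrite /fubini_F /= [RHS]integral_mkcond.
by [].
Qed.

Lemma spherical_measurable (f : borel_rV R n -> \bar R) :
  measurable_fun setT f -> (forall x, 0 <= f x) ->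
  measurable_fun setT (fun u : borel_rV R n => \int[leb]_(s in pos)
    (f (s *: (u : Rn))%R * (n%:R * s ^+ m)%:E)).
Proof.
move=> mf f0; pose w (s : R) := (n%:R * (Num.max s 0) ^+ m)%R.
have mw : measurable_fun [set: measurableTypeR R] w.
  apply: measurable_funM; first exact: measurable_cst.
  by apply: measurable_funX; apply: measurable_maxr => //; exact: measurable_cst.
have w0 s : (0 <= w s)%R by rewrite mulr_ge0// exprn_ge0// le_max lexx orbT.
have mh : measurable_fun setT (fun p : measurableTypeR R * borel_rV R n => f (p.1 *: (p.2 : Rn))%R * (w p.1)%:E).
  apply: emeasurable_funM.
    apply: (measurableT_comp mf); apply: measurable_rVZ; [exact: measurable_fst|exact: measurable_snd].
  by apply/measurable_EFinP; exact: (measurableT_comp mw measurable_fst).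
have := @ge0_measurable_section pos (fun s u => f (s *: (u : Rn))%R * (w s)%:E) (measurable_itv _) mh.
move=> /(_ (fun s u => ltac:(by rewrite mule_ge0// lee_fin))).
apply: eq_measurable_fun => u _; apply: eq_integral => s /[!inE] /=.
by rewrite in_itv/= andbT => s0; rewrite /w max_l// ltW.
Qed.

Lemma ge0_integral_spherical (f : borel_rV R n -> \bar R) :
  measurable_fun setT f -> (forall x, 0 <= f x) ->
  \int[mu]_x f x = \int[cone]_(u in usphere) \int[leb]_(s in pos)
    (f (s *: (u : Rn)) * (n%:R * s ^+ m)%:E).
Proof.
move=> mf f0; rewrite ge0_integral_polar// ge0_integral_cone//; last first.
  move=> u; apply: integral_ge0 => s; rewrite /= in_itv/= andbT => s0.
  by rewrite mule_ge0// lee_fin mulr_ge0// exprn_ge0// ltW.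
exact: spherical_measurable.
Qed.

Let scal (f : R -> \bar R) : measurable_fun [set: R] f -> (forall s, 0 <= f s) ->
  \int[leb]_(s in pos) (f s * (n%:R * s ^+ m)%:E) = n%:R%:E * \int[leb]_(s in pos) (f s * (s ^+ m)%:E).
Proof.
move=> mf f0; rewrite -ge0_integralZl//; first by apply: eq_integral => s _; rewrite EFinM muleCA.
  apply: emeasurable_funM; first exact: measurable_funTS.
  by apply: measurable_funTS; apply/measurable_EFinP; exact: measurable_funX.
by move=> s; rewrite /= in_itv/= andbT => s0; rewrite mule_ge0// lee_fin exprn_ge0// ltW.
Qed.

Let radial_measurable (f : borel_rV R n -> \bar R) (u : Rn) : measurable_fun setT f ->
  measurable_fun [set: R] (fun s => f (s *: u)%R).
Proof.
by move=> mf; apply: (measurableT_comp mf); apply: measurable_rVZ; [exact: measurable_id|exact: measurable_cst].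
Qed.

Lemma ge0_integral_spherical_ge (f : borel_rV R n -> \bar R) (c : \bar R) :
  measurable_fun setT f -> (forall x, 0 <= f x) -> 0 <= c ->
  (forall u : Rn, enorm u = 1%R -> c <= \int[leb]_(s in pos) (f (s *: u)%R * (s ^+ m)%:E)) ->
  c * @sphere_area R n <= \int[mu]_x f x.
Proof.
move=> mf f0 c0 H; rewrite ge0_integral_spherical// sphere_areaE -cone_sphere.
apply: (@le_trans _ _ (\int[cone]_(u in usphere) (n%:R%:E * c))).
  rewrite integral_cst//; last exact: usphere_measurable.
  by rewrite muleA (muleC c).
apply: ge0_le_integral => //; first exact: usphere_measurable.
- by move=> u _; rewrite mule_ge0.
- by apply: measurable_funTS; exact: spherical_measurable.
- move=> u u1; rewrite scal//; last exact: radial_measurable.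
  by rewrite lee_pmul2l//; exact: H.
Qed.

Lemma ge0_integral_spherical_le (f : borel_rV R n -> \bar R) (c : \bar R) :
  measurable_fun setT f -> (forall x, 0 <= f x) -> 0 <= c ->
  (forall u : Rn, enorm u = 1%R -> \int[leb]_(s in pos) (f (s *: u)%R * (s ^+ m)%:E) <= c) ->
  \int[mu]_x f x <= c * @sphere_area R n.
Proof.
move=> mf f0 c0 H; rewrite ge0_integral_spherical// sphere_areaE -cone_sphere.
apply: (@le_trans _ _ (\int[cone]_(u in usphere) (n%:R%:E * c))); last first.
  rewrite integral_cst//; last exact: usphere_measurable.
  by rewrite muleA (muleC c).
apply: ge0_le_integral => //; first exact: usphere_measurable.
- move=> u _; apply: integral_ge0 => s; rewrite /= in_itv/= andbT => s0.
  by rewrite mule_ge0// lee_fin mulr_ge0// exprn_ge0// ltW.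
- by apply: measurable_funTS; exact: spherical_measurable.
- move=> u u1; rewrite scal//; last exact: radial_measurable.
  by rewrite lee_pmul2l//; exact: H.
Qed.

(** In polar coordinates an inversion keeps directions and sends the radius s to k/s. The Jacobian
    thus comes from the one-dimensional substitutions s -> 1/s and s -> k s. *)
Lemma ge0_integral_inversion (p q : Rn) (k : R) (f : borel_rV R n -> \bar R) : (0 < k)%R ->
  measurable_fun setT f -> (forall x, 0 <= f x) ->
  \int[mu]_x (f (q + (k / enorm ((x : Rn) - p) ^+ 2) *: ((x : Rn) - p))%R *
     ((k / enorm ((x : Rn) - p) ^+ 2) ^+ n)%:E) = \int[mu]_x f x.
Proof.
move=> k0 mf f0.
pose T (y : Rn) : Rn := (q + (k / enorm y ^+ 2) *: y)%R.
pose J (y : Rn) : R := ((k / enorm y ^+ 2) ^+ n)%R.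
have mc : measurable_fun setT (fun y : borel_rV R n => (k / enorm (y : Rn) ^+ 2)%R).
  apply: measurable_funM; first exact: measurable_cst.
  apply: (measurableT_comp measurable_invr).
  by apply: measurable_funX; exact: enorm_measurable.
have mT : measurable_fun setT (T : borel_rV R n -> borel_rV R n).
  by apply: measurable_rVD; [exact: measurable_cst|exact: measurable_rVZ].
have mJ : measurable_fun setT (fun y : borel_rV R n => (J y)%:E).
  by apply/measurable_EFinP; exact: measurable_funX.
have mh : measurable_fun setT (fun y : borel_rV R n => f (T y) * (J y)%:E).
  by apply: emeasurable_funM => //; exact: (measurableT_comp mf mT).
have J0 y : 0 <= (J y)%:E by rewrite lee_fin exprn_ge0// divr_ge0 ?exprn_ge0 ?enorm_ge0// ltW.
have h0 y : 0 <= f (T y) * (J y)%:E by rewrite mule_ge0.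
transitivity (\int[mu]_x (f (T x) * (J x)%:E)).
  exact: (ge0_integral_rVD (- p)%R mh h0).
have mfq : measurable_fun setT (fun y : borel_rV R n => f (q + (y : Rn))%R).
  by apply: (measurableT_comp mf); apply: measurable_rVD; [exact: measurable_cst|exact: measurable_id].
transitivity (\int[mu]_x f (q + (x : Rn))%R); last first.
  have := ge0_integral_rVD q mf f0.
  by under eq_integral do rewrite addrC.
rewrite !ge0_integral_spherical//; apply: eq_integral => u /[!inE] u1.
(* The absolute value makes [F] nonnegative on the whole line, as the substitution lemmas
   require. *)
pose F (r : R) := f (q + r *: (u : Rn))%R * (n%:R * `|r| ^+ m)%:E.
have mF : measurable_fun [set: R] F.
  apply: emeasurable_funM.
    apply: (measurableT_comp mf); apply: measurable_rVD; first exact: measurable_cst.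
    by apply: measurable_rVZ; [exact: measurable_id|exact: measurable_cst].
  apply/measurable_EFinP; apply: measurable_funM; first exact: measurable_cst.
  by apply: measurable_funX; exact: normr_measurable.
have F0 r : 0 <= F r by rewrite mule_ge0// lee_fin mulr_ge0// exprn_ge0.
transitivity (\int[leb]_(s in pos) F s); last first.
  apply: eq_integral => s /[!inE] /=; rewrite in_itv/= andbT => s0.
  by rewrite /F gtr0_norm.
have mFp : measurable_fun [set: R] (F \_ pos).
  by apply/(measurable_restrictT _ _).1 => //; exact: measurable_funTS.
have Fp0 r : 0 <= (F \_ pos) r by rewrite /patch; case: ifP.
rewrite [RHS]integral_mkcond.
have -> : \int[leb]_s (F \_ pos) s = \int[leb]_s (k%:E * (F \_ pos) (k * s)%R).
  rewrite ge0_integralZl//; last by rewrite lee_fin ltW.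
    by rewrite ge0_integral_lebesgueZ// muleA -EFinM divff ?gt_eqF// mul1e.
  by apply: (measurableT_comp mFp); exact: measurable_funM.
have mG : measurable_fun [set: R] (fun s => k%:E * (F \_ pos) (k * s)%R).
  apply: measurable_funeM.
  by apply: (measurableT_comp mFp); exact: measurable_funM.
have G0 s : 0 <= k%:E * (F \_ pos) (k * s)%R by rewrite mule_ge0// lee_fin ltW.
transitivity (\int[leb]_(s in pos) (k%:E * (F \_ pos) (k * s)%R)); last first.
  rewrite integral_mkcond; apply: eq_integral => s _; rewrite {1}/patch; case: ifPn => // /negP.
  rewrite /patch inE/= in_itv/= andbT => h.
  case: ifPn; last by rewrite mule0.
  by rewrite inE/= in_itv/= andbT pmulr_rgt0// => /h.
apply: etrans _ (substitution_inv mG G0); apply: eq_integral => s /[!inE] /=; rewrite in_itv/= andbT => s0.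
rewrite /patch ifT; last by rewrite inE/= in_itv/= andbT divr_gt0.
have u1' : enorm (u : Rn) = 1%R := u1.
have sn : s != 0%R by rewrite gt_eqF.
rewrite /F /T /J enormZ u1' mulr1 (gtr0_norm s0) (gtr0_norm (divr_gt0 k0 s0)) scalerA.
have -> : (k / s ^+ 2 * s = k / s)%R by field.
rewrite -!muleA -!EFinM muleCA -!EFinM; congr (_ * _%:E).
have -> : (k / s ^+ 2 = (k / s) * s^-1)%R by field.
rewrite exprMn exprS (exprS _ m) exprVn.
by field; rewrite sn expf_neq0.
Qed.

Lemma integral_log (r0 r1 : R) : (0 < r0)%R -> (r0 <= r1)%R ->
  \int[leb]_(s in [set` `[r0, r1]%R]) (s^-1)%:E = (ln r1 - ln r0)%:E.
Proof.
move=> h0; rewrite le_eqVlt => /predU1P[<-|h1].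
  by rewrite set_itv1 integral_set1 subrr.
apply: FTC2_is_derive => // x /andP[hx _].
  by apply: inv_continuous; rewrite gt_eqF// (lt_le_trans h0).
by apply: is_derive1_ln; exact: lt_le_trans hx.
Qed.

Lemma sphere_area_fin : @sphere_area R n \is a fin_num.
Proof.
by rewrite sphere_areaE fin_numM// ge0_fin_numE//; exact: cone_measure_fin.
Qed.

Lemma sphere_area_gt0 : 0 < @sphere_area R n.
Proof.
rewrite sphere_areaE mule_gt0// /cone_measure /pushforward /mrestr preimage_setT setTI.
apply: (@lt_le_trans _ _ (mu (punctured_ball))); last by [].
have -> : punctured_ball = (eball 0 1 : set (borel_rV R n)) `\ (0%R : Rn).
  apply/seteqP; split=> x; rewrite /punctured_ball /eball /= subr0.
    by move=> /andP[x0 x1]; split=> // e; rewrite e enorm0 ltxx in x0.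
  by move=> [x1 /eqP x0]; rewrite x1 enorm_gt0 x0.
have mE : measurable (eball 0 1 : set (borel_rV R n)) by exact: eball_measurable.
by rewrite [X in _ < X](lebesgue_rVD0 mE); exact: lebesgue_eball_gt0.
Qed.

(* Holder's inequality for radial segments, linearized at the extremal
   density [k / s]. *)
Lemma radial_tangent (f : R -> \bar R) (r0 r1 k : R) : (0 < r0)%R -> (r0 <= r1)%R -> (0 <= k)%R ->
  measurable_fun [set: R] f -> (forall s, 0 <= f s) ->
  (n%:R * k ^+ m)%:E * \int[leb]_(s in [set` `[r0, r1]%R]) f s <=
  \int[leb]_(s in [set` `[r0, r1]%R]) (f s ^+ n * (s ^+ m)%:E) + (m%:R * k ^+ n * (ln r1 - ln r0))%:E.
Proof.
move=> h0 h1 k0 mf f0.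
have mfn : measurable_fun [set: R] (fun s => f s ^+ n) by exact: measurable_fun_expe.
have mi : measurable_fun [set: R] (fun s : R => (s^-1)%:E) by apply/measurable_EFinP; exact: measurable_invr.
have ms : measurable_fun [set: R] (fun s : R => (s ^+ m)%:E) by apply/measurable_EFinP; exact: measurable_funX.
have pos_ s : s \in `[r0, r1]%R -> (0 < s)%R by rewrite in_itv/= => /andP[+ _]; exact: lt_le_trans.
have c0 : (0 <= n%:R * k ^+ m)%R by rewrite mulr_ge0// exprn_ge0.
have d0 : (0 <= m%:R * k ^+ n)%R by rewrite mulr_ge0// exprn_ge0.
have i0 s : s \in `[r0, r1]%R -> 0 <= (s^-1)%:E by move=> /pos_ s0; rewrite lee_fin invr_ge0 ltW.
have fs0 s : s \in `[r0, r1]%R -> 0 <= f s ^+ n * (s ^+ m)%:E.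
  by move=> /pos_ s0; rewrite mule_ge0 ?expe_ge0// lee_fin exprn_ge0// ltW.
rewrite (EFinM (m%:R * _)) -integral_log//.
rewrite -(@ge0_integralZl _ _ _ leb _ _ f)//; last exact: measurable_funTS.
rewrite -(@ge0_integralZl _ _ _ leb _ _ (fun s : R => (s^-1)%:E))//; last exact: measurable_funTS.
have mA : measurable_fun [set` `[r0, r1]%R] (fun s => f s ^+ n * (s ^+ m)%:E).
  by apply: measurable_funTS; exact: emeasurable_funM.
have mB : measurable_fun [set` `[r0, r1]%R] (fun s : R => (m%:R * k ^+ n)%:E * (s^-1)%:E).
  by apply: measurable_funTS; exact: measurable_funeM.
rewrite -ge0_integralD//; last by move=> s hs; rewrite mule_ge0// i0.
apply: ge0_le_integral => //.
- by move=> s _; rewrite mule_ge0.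
- by apply: measurable_funTS; exact: measurable_funeM.
- exact: emeasurable_funD.
- move=> s /pos_ s0.
  have sm0 : (0 < s ^+ m)%R by rewrite exprn_gt0.
  have h := @tangent_line_powere R m (k / s)%R (f s) (divr_ge0 k0 (ltW s0)) (f0 s).
  have := lee_wpmul2l (ltW sm0 : 0 <= (s ^+ m)%:E) h.
  rewrite muleA -EFinM ge0_muleDr ?lee_fin ?expe_ge0// ?mulr_ge0 ?exprn_ge0 ?divr_ge0 ?(ltW s0)//.
  rewrite (muleC (s ^+ m)%:E (f s ^+ n)) -!EFinM.
  rewrite (_ : s ^+ m * (n%:R * (k / s) ^+ m) = n%:R * k ^+ m)%R; last first.
    by rewrite expr_div_n mulrCA (mulrC (s ^+ m)%R) divfK ?gt_eqF.
  rewrite (_ : s ^+ m * (m%:R * (k / s) ^+ n) = m%:R * k ^+ n * s^-1)%R//.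
  rewrite expr_div_n exprSr (exprSr s) invfM; field.
  by rewrite expf_neq0 gt_eqF.
Qed.

(* Equality holds for [f = 1 / (|x| ln (r1 / r0))]. *)
Lemma radial_energy_ge (f : borel_rV R n -> \bar R) (r0 r1 : R) : (0 < r0)%R -> (r0 < r1)%R ->
  measurable_fun setT f -> (forall x, 0 <= f x) ->
  (forall u : Rn, enorm u = 1%R -> 1 <= \int[leb]_(s in [set` `[r0, r1]%R]) f (s *: u)%R) ->
  ((ln (r1 / r0)) ^- m)%:E * @sphere_area R n <= \int[mu]_x (f x ^+ n).
Proof.
move=> h0 h1 mf f0 H; pose L := ln (r1 / r0).
have r10 : (0 < r1)%R by exact: lt_trans h1.
have L0 : (0 < L)%R by rewrite ln_gt0// ltr_pdivlMr// mul1r.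
have LE : L = (ln r1 - ln r0)%R by rewrite /L lnM ?posrE ?invr_gt0// lnV ?posrE.
have mfn : measurable_fun setT (fun x => f x ^+ n) by exact: measurable_fun_expe.
apply: ge0_integral_spherical_ge => //.
- by move=> x; exact: expe_ge0.
- by rewrite lee_fin invr_ge0 exprn_ge0// ltW.
move=> u u1; have mr := radial_measurable u mf.
have mr2 : measurable_fun [set: R] (fun s => f (s *: u)%R ^+ n * (s ^+ m)%:E).
  apply: emeasurable_funM; first exact: measurable_fun_expe.
  by apply/measurable_EFinP; exact: measurable_funX.
have h := radial_tangent h0 (ltW h1) (ltW (_ : 0 < L^-1)%R) mr (fun=> f0 _).
rewrite invr_gt0 in h; have {h} := h L0; rewrite -LE => h.
apply: (@le_trans _ _ (\int[leb]_(s in [set` `[r0, r1]%R]) (f (s *: u)%R ^+ n * (s ^+ m)%:E))); last first.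
  apply: ge0_subset_integral => //; first exact: measurable_funTS.
    move=> s hs; have s0 : (0 < s)%R by move: hs; rewrite /= in_itv/= andbT.
    by apply: mule_ge0; [exact: expe_ge0|rewrite lee_fin exprn_ge0// ltW].
  by move=> s /=; rewrite !in_itv/= andbT => /andP[+ _]; exact: lt_le_trans.
have L1 : (0 <= L^-1 ^+ m)%R by rewrite exprn_ge0// invr_ge0 ltW.
have h2 : (n%:R * L^-1 ^+ m)%:E <= (n%:R * L^-1 ^+ m)%:E * \int[leb]_(s in [set` `[r0, r1]%R]) f (s *: u)%R.
  by rewrite -{1}(mule1 (_ * _)%:E) lee_wpmul2l//; [rewrite lee_fin mulr_ge0|exact: H].
have := le_trans h2 h; rewrite -leeBlDr//; apply: le_trans.
rewrite -EFinB lee_fin exprS mulrA (mulrAC _ _ L) -(mulrA m%:R) mulVf ?gt_eqF// mulr1.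
by rewrite -exprVn -natr1 mulrDl mul1r addrAC subrr add0r.
Qed.
End spherical_coordinates.

(** * Arc length and line integrals *)

Section arc_length.
Context {R : realType} {n : nat}.
Local Notation Rn := 'rV[R]_n.
Implicit Types (f g : R -> Rn) (c d e t : R) (s : seq R).

Fixpoint partition_sum f c s : R :=
  if s is x :: s' then enorm (f x - f c) + partition_sum f x s' else 0.

Lemma partition_sumE f c d s :
  \sum_(0 <= k < size s) enorm (f (nth d (c :: s) k.+1) - f (nth d (c :: s) k))
  = partition_sum f c s.
Proof.
elim: s c => [|x s IH] c /=; first by rewrite big_nil.
by rewrite big_nat_recl//= -IH.
Qed.

Lemma partition_sum_cat f c s1 s2 :
  partition_sum f c (s1 ++ s2) = partition_sum f c s1 + partition_sum f (last c s1) s2.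
Proof. by elim: s1 c => [|x s IH] c /=; rewrite ?add0r// IH addrA. Qed.

Lemma eq_partition_sum f g c d s : (forall t, c <= t <= d -> f t = g t) ->
  itv_partition c d s -> partition_sum f c s = partition_sum g c s.
Proof.
elim: s c => [//|x s IH] c fg /= [/= /andP[cx px] /eqP lx].
have xd : x <= d by apply: (@itv_partition_le _ _ _ _ s); split=> //; rewrite lx.
rewrite !fg ?lexx ?xd ?(le_trans (ltW cx) xd) ?(ltW cx)//; congr (_ + _); apply: IH.
  by move=> t /andP[h1 h2]; rewrite fg// h2 (le_trans (ltW cx) h1).
by split=> //; rewrite lx.
Qed.

(** Inserting the point d does not decrease the sum, by the triangle inequality; this bounds the
    length of the whole by the sum of the lengths of its parts. *)
Lemma partition_insert f c d e s : c <= d -> d <= e -> itv_partition c e s ->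
  exists s1 s2, [/\ itv_partition c d s1, itv_partition d e s2 &
    partition_sum f c s <= partition_sum f c s1 + partition_sum f d s2].
Proof.
move=> + de; elim: s c => [|x s IH] c cd.
  move=> /itv_partition_nil ce; exists [::], [::].
  have dc : d = c by apply/eqP; rewrite eq_le cd ce de.
  by rewrite dc ce /= addr0; split=> //; split.
move=> /= [/= /andP[cx px] /eqP lx].
have [<-|cd'] := eqVneq c d.
  exists [::], (x :: s); rewrite /= add0r lexx; split=> //; split=> //=; first by rewrite cx.
  by rewrite lx.
have {cd cd'} cd : c < d by rewrite lt_neqAle cd' cd.
have [dx|xd|dx] := ltgtP d x.
- exists [:: d], (x :: s); split.
  + by split=> //=; rewrite cd.
  + by split=> //=; [rewrite dx|rewrite lx].
  + rewrite /= addr0 addrA lerD2r addrC; exact: enorm_triangle.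
- have [s1 [s2 [p1 p2 h]]] := IH x (ltW xd) ltac:(by split=> //; rewrite lx).
  exists (x :: s1), s2; split=> //=; last by rewrite -addrA lerD2l.
  by case: p1 => h1 h2; split=> //=; rewrite cx.
- exists [:: x], s; split=> /=.
  + by split=> /=; rewrite ?cx// dx.
  + by split; rewrite ?dx// lx.
  + by rewrite addr0 dx.
Qed.

Local Open Scope ereal_scope.

Lemma curve_lengthE c d f :
  curve_length c d f = ereal_sup [set (partition_sum f c s)%:E | s in itv_partition c d].
Proof.
by congr ereal_sup; apply/seteqP; split=> x [s hs <-]; exists s => //; rewrite partition_sumE.
Qed.

Lemma partition_sum_le c d f s : itv_partition c d s -> (partition_sum f c s)%:E <= curve_length c d f.
Proof. by move=> hs; rewrite curve_lengthE; apply: ereal_sup_ubound; exists s. Qed.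

Lemma curve_length_le c d f (z : \bar R) :
  (forall s, itv_partition c d s -> (partition_sum f c s)%:E <= z) -> curve_length c d f <= z.
Proof. by move=> h; rewrite curve_lengthE; apply: ge_ereal_sup => _ [s hs <-]; exact: h. Qed.

Lemma dist_le_length c d f : (c <= d)%R -> (enorm (f d - f c))%:E <= curve_length c d f.
Proof.
rewrite le_eqVlt => /predU1P[->|cd].
  by rewrite subrr enorm0; apply: le_trans (@partition_sum_le d d f [::] _) => //; split=> /=.
by have := @partition_sum_le c d f [:: d] (itv_partition1 cd); rewrite /= addr0.
Qed.

Lemma curve_length_ge0 c d f : (c <= d)%R -> 0 <= curve_length c d f.
Proof. by move=> cd; apply: le_trans (dist_le_length f cd); rewrite lee_fin enorm_ge0. Qed.

Lemma eq_curve_length f g c d : (forall t, c <= t <= d -> f t = g t)%R ->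
  curve_length c d f = curve_length c d g.
Proof.
move=> fg; rewrite !curve_lengthE; congr ereal_sup.
by apply/seteqP; split=> x [s hs <-]; exists s; rewrite // (eq_partition_sum fg hs).
Qed.

Lemma curve_lengthD c d e f : (c <= d)%R -> (d <= e)%R ->
  curve_length c e f = curve_length c d f + curve_length d e f.
Proof.
move=> cd de; apply/eqP; rewrite eq_le; apply/andP; split.
  apply: curve_length_le => s hs.
  have [s1 [s2 [p1 p2 h]]] := partition_insert f cd de hs.
  apply: (@le_trans _ _ (partition_sum f c s1 + partition_sum f d s2)%:E); first by rewrite lee_fin.
  by rewrite EFinD; apply: leeD; exact: partition_sum_le.
have h s1 s2 : itv_partition c d s1 -> itv_partition d e s2 ->
    (partition_sum f c s1)%:E + (partition_sum f d s2)%:E <= curve_length c e f.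
  move=> p1 p2; have p3 := itv_partition_cat p1 p2.
  apply: le_trans (partition_sum_le f p3).
  by rewrite partition_sum_cat -EFinD lee_fin; case: p1 => _ /eqP ->.
have [->|V] := eqVneq (curve_length c e f) +oo; first exact: leey.
have Vf : curve_length c e f \is a fin_num.
  by rewrite ge0_fin_numE ?curve_length_ge0 ?(le_trans cd)// ltey.
have h2 s1 : itv_partition c d s1 -> (partition_sum f c s1)%:E + curve_length d e f <= curve_length c e f.
  move=> p1; rewrite addeC -leeBrDr//; apply: curve_length_le => s2 p2.
  by rewrite leeBrDr// addeC; exact: h.
have cdf : curve_length d e f \is a fin_num.
  rewrite ge0_fin_numE ?curve_length_ge0//.
  have [s1 p1] : exists s1, itv_partition c d s1.
    move: cd; rewrite le_eqVlt => /predU1P[->|cd]; first by exists [::]; split=> /=.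
    by exists [:: d]; exact: itv_partition1.
  have := h2 _ p1; rewrite -leeBrDl// => /le_lt_trans; apply.
  by rewrite -(fineK Vf) -EFinB ltry.
rewrite -leeBrDr//; apply: curve_length_le => s1 p1.
by rewrite leeBrDr//; exact: h2.
Qed.

Lemma curve_length_lipschitz c d f : (c <= d)%R ->
  (forall x y, (enorm (f x - f y) <= `|x - y|)%R) -> curve_length c d f <= (d - c)%:E.
Proof.
move=> cd lf; apply: curve_length_le => s; rewrite lee_fin.
elim: s c cd => [|x s IH] c cd.
  by move=> /itv_partition_nil ->; rewrite /= subrr.
move=> /= [/= /andP[cx px] /eqP lx].
have hs : itv_partition x d s by split=> //; rewrite lx.
have := IH x (itv_partition_le hs) hs; have := lf x c; rewrite gtr0_norm ?subr_gt0//.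
by move=> h1 h2; lra.
Qed.

Lemma partition_sum_shift f c s (a : R) :
  partition_sum f (c + a)%R (map (fun x => x + a)%R s) = partition_sum (fun x => f (x + a)%R) c s.
Proof. by elim: s c => //= x s IH c; rewrite IH. Qed.

Lemma itv_partition_shift c d s (a : R) : itv_partition c d s ->
  itv_partition (c + a)%R (d + a)%R (map (fun x => x + a)%R s).
Proof.
elim: s c => [|x s IH] c; first by move=> /itv_partition_nil ->; split=> /=.
move=> /= [/= /andP[cx px] /eqP lx].
have [] := IH x (conj px (introT eqP lx)).
by move=> h1 h2; split=> //=; rewrite ltrD2r cx.
Qed.

End arc_length.

Lemma clamp_lipschitz (R : realType) (V s t : R) :
  `|Num.min (Num.max s 0) V - Num.min (Num.max t 0) V| <= `|s - t|.
Proof.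
wlog st : s t / s <= t => [H|].
  by have [/H//|/ltW/H] := leP s t; rewrite distrC (distrC t).
have mono (x y : R) : x <= y -> Num.max x 0 <= Num.max y 0 /\ Num.max y 0 - Num.max x 0 <= y - x.
  by move=> xy; case: (lerP x 0) => h1; case: (lerP y 0) => h2; split; lra.
have mono2 (x y : R) : x <= y -> Num.min x V <= Num.min y V /\ Num.min y V - Num.min x V <= y - x.
  by move=> xy; case: (lerP x V) => h1; case: (lerP y V) => h2; split; lra.
have [h1 h2] := mono _ _ st; have [h3 h4] := mono2 _ _ h1.
by rewrite distrC (distrC s) !ger0_norm ?subr_ge0//; apply: le_trans h4 h2.
Qed.

(** * Parametrization by arc length *)

Section arc_length_parametrization.
Context {R : realType} {n : nat}.
Local Notation Rn := 'rV[R]_n.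
Variables (f : R -> Rn) (c d : R).
Hypotheses (cd : c <= d).
Hypothesis cf : forall t e, c <= t <= d -> 0 < e ->
  exists2 r, 0 < r & forall t', c <= t' <= d -> `|t' - t| < r -> enorm (f t' - f t) < e.
Hypothesis Vfin : (curve_length c d f < +oo)%E.

Let V a b := fine (curve_length a b f).

Let Vfn a b : c <= a -> a <= b -> b <= d -> curve_length a b f \is a fin_num.
Proof.
move=> ca ab bd; rewrite ge0_fin_numE ?curve_length_ge0//.
apply: le_lt_trans Vfin; rewrite (curve_lengthD f ca (le_trans ab bd)).
rewrite (curve_lengthD f ab bd).
have h1 := @curve_length_ge0 _ _ c a f ca; have h2 := @curve_length_ge0 _ _ b d f bd.
apply: (@le_trans _ _ (curve_length a b f + curve_length b d f)%E).
  by rewrite leeDl.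
by rewrite leeDr.
Qed.

Let VD a b e : c <= a -> a <= b -> b <= e -> e <= d -> V a e = V a b + V b e.
Proof.
move=> ca ab be ed; rewrite /V (curve_lengthD f ab be) fineD//.
  by apply: Vfn => //; exact: le_trans ed.
by apply: Vfn => //; exact: le_trans ab.
Qed.

Let V_ge0 a b : a <= b -> 0 <= V a b.
Proof. by move=> ab; rewrite fine_ge0// curve_length_ge0. Qed.

Let dist_le_V a b : c <= a -> a <= b -> b <= d -> enorm (f b - f a) <= V a b.
Proof.
move=> ca ab bd; rewrite -lee_fin fineK ?Vfn//; exact: dist_le_length.
Qed.

(** In a nearly optimal partition of [t, d] the starting point t is replaced by a close t'. The sum
    loses less than e/2 and still bounds the length on [t', d] from below, so little length is left
    for [t, t']. *)
Let V_right t e : c <= t -> t < d -> 0 < e ->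
  exists2 r, 0 < r & forall t', t <= t' -> t' <= d -> t' - t < r -> V t t' < e.
Proof.
move=> ct td e0; have e2 : 0 < e / 2 by rewrite divr_gt0.
have fV := Vfn ct (ltW td) (lexx d).
have := @ub_ereal_sup_adherent R [set (partition_sum f t s)%:E | s in itv_partition t d] (e / 2) e2.
rewrite -curve_lengthE => /(_ fV) [_ [s hs <-]].
rewrite -(fineK fV) -EFinB lte_fin -/(V t d) => hV.
case: s hs hV => [/itv_partition_nil h|x s hs]; first by rewrite h ltxx in td.
case: (hs) => /= /andP[tx px] /eqP lx hV.
have [r r0 hr] := @cf t (e / 2) ltac:(by rewrite ct ltW) e2.
exists (Num.min r (x - t)); first by rewrite lt_min r0 subr_gt0.
move=> t' tt' t'd; rewrite lt_min => /andP[h1 h2].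
have t'x : t' < x by lra.
have hd : enorm (f t' - f t) < e / 2.
  by apply: hr; [rewrite (le_trans ct)|rewrite ger0_norm ?subr_ge0].
have h3 : partition_sum f t' (x :: s) <= V t' d.
  rewrite -lee_fin fineK; last by apply: Vfn => //; exact: le_trans tt'.
  by apply: partition_sum_le; split=> /=; [rewrite t'x|rewrite lx].
have := VD ct tt' t'd (lexx d); move: h3 => /=.
by have := enorm_triangle (f t') (f x) (f t); lra.
Qed.

Let V_left t e : c < t -> t <= d -> 0 < e ->
  exists2 r, 0 < r & forall t', c <= t' -> t' <= t -> t - t' < r -> V t' t < e.
Proof.
move=> ct td e0; have e2 : 0 < e / 2 by rewrite divr_gt0.
have fV := Vfn (lexx c) (ltW ct) td.
have := @ub_ereal_sup_adherent R [set (partition_sum f c s)%:E | s in itv_partition c t] (e / 2) e2.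
rewrite -curve_lengthE => /(_ fV) [_ [s hs <-]].
rewrite -(fineK fV) -EFinB lte_fin -/(V c t).
case/lastP: s hs => [/itv_partition_nil h|s x hs]; first by rewrite h ltxx in ct.
case: hs; rewrite rcons_path last_rcons => /andP[ps lx] /eqP ex; rewrite {x}ex in lx *.
rewrite -cats1 partition_sum_cat /= addr0 => hV.
have [r r0 hr] := @cf t (e / 2) ltac:(by rewrite td ltW) e2.
exists (Num.min r (t - last c s)); first by rewrite lt_min r0 subr_gt0.
move=> t' ct' t't; rewrite lt_min => /andP[h1 h2].
have h4 : last c s < t' by lra.
have hd : enorm (f t' - f t) < e / 2.
  apply: hr; first by rewrite ct' (le_trans t't).
  by rewrite distrC ger0_norm ?subr_ge0.
have h3 : partition_sum f c (rcons s t') <= V c t'.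
  rewrite -lee_fin fineK; last by apply: Vfn => //; exact: le_trans td.
  by apply: partition_sum_le; split=> /=; rewrite ?rcons_path ?last_rcons// ps.
move: h3; rewrite -cats1 partition_sum_cat /= addr0.
have := VD (lexx c) ct' t't td.
have := enorm_triangle (f t') (f t) (f (last c s)); rewrite (enormC (f t) (f t')); lra.
Qed.

(** The supremum of the times of length at most s has length exactly s, by the continuity of length
    from both sides. *)
Lemma length_surjective (s : R) : 0 <= s <= V c d -> exists2 t, c <= t <= d & V c t = s.
Proof.
move=> /andP[s0 sV].
pose S := [set t | c <= t <= d /\ V c t <= s].
have Vcc : V c c = 0.
  have := VD (lexx c) (lexx c) (lexx c) cd => h; by apply: (@addrI _ (V c c)); rewrite addr0 -h.
have hS : has_sup S.
  split; first by exists c; split; rewrite ?lexx// Vcc.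
  by exists d => t [/andP[]].
have cS : S c by split; rewrite ?lexx// Vcc.
have ct0 : c <= sup S by apply: ub_le_sup => //; case: hS.
have t0d : sup S <= d by apply: ge_sup; [exists c|move=> t [/andP[]]].
exists (sup S); first by rewrite ct0.
apply/eqP; rewrite eq_le; apply/andP; split.
  have /predU1P[e|{}ct0] : (c == sup S) || (c < sup S) by rewrite -le_eqVlt.
    by rewrite -e Vcc.
  rewrite leNgt; apply/negP => h.
  have e0 : 0 < V c (sup S) - s by rewrite subr_gt0.
  have [r r0 hr] := V_left ct0 t0d e0.
  have [t [/andP[ct td] Vt] tr] := sup_adherent r0 hS.
  have tS : t <= sup S by apply: ub_le_sup; [case: hS|split=> //; rewrite ct].
  have := hr t ct tS ltac:(lra).
  have := VD (lexx c) ct tS t0d; lra.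
have /predU1P[->//|{}t0d] : (sup S == d) || (sup S < d) by rewrite -le_eqVlt.
rewrite leNgt; apply/negP => h.
have e0 : 0 < s - V c (sup S) by rewrite subr_gt0.
have [r r0 hr] := V_right ct0 t0d e0.
pose t := Num.min d (sup S + r / 2).
have t1 : sup S < t by rewrite lt_min t0d ltrDl divr_gt0.
have t2 : t <= d by rewrite ge_min lexx.
have t3 : t - sup S < r.
  have : t <= sup S + r / 2 by rewrite ge_min lexx orbT.
  by lra.
have h1 := hr t (ltW t1) t2 t3.
have h2 := VD (lexx c) ct0 (ltW t1) t2.
have : t <= sup S.
  by apply: ub_le_sup; [case: hS|split; [rewrite t2 (le_trans ct0)// ltW|lra]].
by rewrite leNgt t1.
Qed.

(** Clamping extends the parametrization to a 1-Lipschitz map of the whole line. *)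
Let gam (s : R) := arclength_param c d f (Num.min (Num.max s 0) (V c d)).

Let gamP (s : R) : 0 <= s <= V c d -> exists2 t, c <= t <= d & V c t = s /\ arclength_param c d f s = f t.
Proof.
move=> hs; have [t t1 t2] := length_surjective hs.
have h : [set t | t \in `[c, d] /\ curve_length c t f = s%:E] !=set0.
  by exists t; split; rewrite ?in_itv//= -t2 fineK// Vfn//; case/andP: t1.
exists (get [set t | t \in `[c, d] /\ curve_length c t f = s%:E]).
  by case: (getPex h); rewrite in_itv.
split=> //; rewrite /V; by case: (getPex h) => _ ->.
Qed.

(** Two points of the curve are no farther apart than their length coordinates. Hence points with
    equal coordinates coincide, and the choice made by [get] in [arclength_param] is harmless. *)
Lemma arc_parametrization : exists gamma : R -> Rn,
  [/\ forall s t, enorm (gamma s - gamma t) <= `|s - t|,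
      gamma 0 = f c, gamma (fine (curve_length c d f)) = f d,
      forall s, 0 < s < fine (curve_length c d f) -> exists2 t, c < t < d & gamma s = f t &
      forall rho, arc_integral rho c d f =
        (\int[lebesgue_measure]_(s in `[0%R, fine (curve_length c d f)]) rho (gamma s))%E].
Proof.
have V0 : 0 <= V c d by exact: V_ge0.
have clamp s : 0 <= Num.min (Num.max s 0) (V c d) <= V c d.
  by rewrite le_min le_max lexx orbT V0 ge_min lexx orbT.
have dis t t' : c <= t <= d -> c <= t' <= d -> enorm (f t - f t') <= `|V c t - V c t'|.
  move=> /andP[a1 a2] /andP[b1 b2]; have [tt|tt] := leP t t'.
    rewrite enormC; have := dist_le_V a1 tt b2; have := VD (lexx c) a1 tt b2.
    by move=> -> h; rewrite opprD addrA subrr sub0r normrN ger0_norm// V_ge0.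
  have := dist_le_V b1 (ltW tt) a2; have := VD (lexx c) b1 (ltW tt) a2.
  by move=> -> h; rewrite addrAC subrr add0r ger0_norm// V_ge0// ltW.
have Vcc : V c c = 0.
  have := VD (lexx c) (lexx c) (lexx c) cd => h; by apply: (@addrI _ (V c c)); rewrite addr0 -h.
have ends t : c <= t <= d -> arclength_param c d f (V c t) = f t.
  move=> ht; have /andP[ct td] := ht.
  have [|t' ht' [e ->]] := @gamP (V c t).
    by rewrite V_ge0//= (VD (lexx c) ct td (lexx d)) lerDl V_ge0.
  by apply/eqP; rewrite -subr_eq0 -enorm_eq0 eq_le enorm_ge0 andbT (le_trans (dis _ _ ht' ht))// e subrr normr0.
exists gam; split.
- rewrite /gam => s t; have [s' hs' [es ->]] := gamP (clamp s); have [t' ht' [et ->]] := gamP (clamp t).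
  apply: le_trans (dis _ _ hs' ht') _; rewrite es et.
  exact: clamp_lipschitz.
- by rewrite /gam max_l// min_l// -Vcc ends// lexx.
- by rewrite /gam max_l// min_l// ends// cd lexx.
- move=> s /andP[s0 sL]; have hs : 0 <= s <= V c d by rewrite !ltW.
  have [t /andP[ct td] [e1 e2]] := gamP hs; exists t.
    rewrite !lt_neqAle ct td !andbT; apply/andP; split; apply/eqP => e.
      by move: s0; rewrite -e1 -e Vcc ltxx.
    by move: sL; rewrite -e1 e ltxx.
  by rewrite /gam max_l ?(ltW s0)// min_l ?(ltW sL)// e2.
- move=> rho; apply: eq_integral => s /[!inE] /=; rewrite in_itv/= => /andP[s0 sV].
  by rewrite /gam max_l// min_l.
Qed.

End arc_length_parametrization.

(** * Paths of unit speed *)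

Section unit_speed.
Context {R : realType} {n : nat}.
Local Notation Rn := 'rV[R]_n.
Local Open Scope ereal_scope.

(** For segments and their concatenations the parameter is arc length itself, so that [arc_integral]
    becomes an ordinary integral in the parameter. *)
Definition unit_speed (f : R -> Rn) (a b : R) :=
  forall c d, (a <= c)%R -> (c <= d)%R -> (d <= b)%R -> curve_length c d f = (d - c)%:E.

Lemma arc_integral_unit_speed (f : R -> Rn) (c d : R) (rho : Rn -> \bar R) : (c <= d)%R ->
  unit_speed f c d -> measurable_fun setT (fun s : R => rho (f s)) -> (forall x, 0 <= rho x) ->
  arc_integral rho c d f = \int[lebesgue_measure]_(t in [set` `[c, d]%R]) rho (f t).
Proof.
move=> cd us mrho rho0; rewrite /arc_integral us//=.
have e s : s \in `[0%R, (d - c)%R] -> arclength_param c d f s = f (c + s)%R.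
  rewrite in_itv/= => /andP[s0 sd]; rewrite /arclength_param.
  have h : [set t | t \in `[c, d] /\ curve_length c t f = s%:E] !=set0.
    exists (c + s)%R; split; first by rewrite in_itv/= lerDl s0 -lerBrDl.
    by rewrite us ?lexx ?lerDl -?lerBrDl// addrC addKr.
  case: (getPex h) => /=; rewrite in_itv/= => /andP[]; move: (get _) => g h1 h2.
  rewrite us// => e; congr f.
  by have := EFin_inj e => <-; rewrite addrCA subrr addr0.
transitivity (\int[lebesgue_measure]_(s in [set` `[0%R, (d - c)%R]]) rho (f (c + s)%R)).
  by apply: eq_integral => s /[!inE] /= hs; rewrite e.
have mI : measurable_fun [set: R] ((fun t => rho (f t)) \_ [set` `[c, d]%R]).
  by apply/(measurable_restrictT _ _).1 => //; exact: measurable_funTS.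
rewrite [LHS]integral_mkcond [RHS]integral_mkcond.
apply: etrans _ (@ge0_integral_lebesgueD R _ c mI _); last first.
  by move=> x; rewrite /patch; case: ifP.
apply: eq_integral => s _; rewrite /patch (addrC s c).
have -> : (s \in [set` `[0%R, (d - c)%R]]) = ((c + s)%R \in [set` `[c, d]%R]).
  by apply/idP/idP; rewrite !inE/= !in_itv/=; lra.
by [].
Qed.

(* A path of length [L] from [x] to [y], parametrized by arc length. *)
Definition upath (f : R -> Rn) (L : R) (x y : Rn) :=
  [/\ (0 <= L)%R, f 0%R = x, f L = y,
      forall s t, (enorm (f s - f t) <= `|s - t|)%R & unit_speed f 0 L].

Lemma upath_segment (x y : Rn) : x != y ->
  upath (fun s => x + (s / enorm (y - x)) *: (y - x))%R (enorm (y - x)) x y.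
Proof.
move=> xy; have L0 : (0 < enorm (y - x))%R by rewrite enorm_gt0 subr_eq0 eq_sym.
have lf s t : (enorm (x + (s / enorm (y - x)) *: (y - x) - (x + (t / enorm (y - x)) *: (y - x))) = `|s - t|)%R.
  rewrite opprD addrACA subrr add0r -scalerBl -mulrBl enormZ normrM.
  by rewrite (gtr0_norm (_ : 0 < _^-1)%R) ?invr_gt0// divfK// gt_eqF.
split=> //.
- exact: ltW.
- by rewrite mul0r scale0r addr0.
- by rewrite divff ?gt_eqF// scale1r addrC subrK.
- by move=> s t; rewrite lf.
- move=> c d c0 cd dL; apply/eqP; rewrite eq_le; apply/andP; split.
    by apply: curve_length_lipschitz => // s t; rewrite lf.
  by apply: le_trans (dist_le_length _ cd); rewrite lf lee_fin ger0_norm ?subr_ge0.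
Qed.

Lemma upath_refl (x : Rn) : upath (fun=> x) 0 x x.
Proof.
split=> //; first by move=> s t; rewrite subrr enorm0.
move=> c d c0 cd d0; have {cd d0 c0} [-> ->] : c = 0%R /\ d = 0%R by split; lra.
rewrite subrr; apply/eqP; rewrite eq_le curve_length_ge0// andbT.
apply: curve_length_le => s /itv_partitionxx -> //.
Qed.

Lemma upath_cat f g L M x y z : upath f L x y -> upath g M y z ->
  upath (fun t => if t <= L then f t else g (t - L))%R (L + M)%R x z.
Proof.
move=> [L0 f0 fL lf uf] [M0 g0 gM lg ug].
set h := fun t => _.
have hl t : (t <= L)%R -> h t = f t by move=> tL; rewrite /h tL.
have hr t : (L <= t)%R -> h t = g (t - L)%R.
  rewrite /h le_eqVlt => /predU1P[<-|tL]; first by rewrite lexx subrr g0.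
  by rewrite leNgt tL.
have lh s t : (enorm (h s - h t) <= `|s - t|)%R.
  wlog st : s t / (s <= t)%R => [H|].
    by have [/H//|/ltW/H] := leP s t; rewrite enormC distrC.
  have [tL|tL] := leP t L; first by rewrite !hl// (le_trans st).
  have [sL|sL] := leP L s.
    by rewrite !hr ?(ltW tL)//; apply: le_trans (lg _ _) _; rewrite opprB addrA subrK.
  rewrite (hl _ (ltW sL)) (hr _ (ltW tL)).
  have h1 := enorm_triangle y (f s) (g (t - L)%R).
  have h2 := lf s L; have h3 := lg 0%R (t - L)%R.
  rewrite fL in h2; rewrite g0 in h3.
  move: h2 h3; rewrite ltr0_norm ?subr_lt0// sub0r normrN (gtr0_norm (_ : 0 < t - L)%R) ?subr_gt0// => h2 h3.
  by rewrite distrC ger0_norm ?subr_ge0//; lra.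
split=> //.
- exact: addr_ge0.
- by rewrite hl.
- by rewrite hr ?lerDl// addrC addKr.
- have ul c d : (0 <= c)%R -> (c <= d)%R -> (d <= L)%R -> curve_length c d h = (d - c)%:E.
    move=> c0 cd dL; rewrite -(uf c d)//; apply: eq_curve_length => t /andP[_ td].
    by rewrite hl// (le_trans td).
  have ur c d : (L <= c)%R -> (c <= d)%R -> (d <= L + M)%R -> curve_length c d h = (d - c)%:E.
    move=> c0 cd dL; apply/eqP; rewrite eq_le; apply/andP; split.
      exact: curve_length_lipschitz.
    have us := ug (c - L)%R (d - L)%R ltac:(lra) ltac:(lra) ltac:(lra).
    rewrite (_ : (d - c = d - L - (c - L))%R); last by ring.
    rewrite -us; apply: curve_length_le => s hs.
    have p := itv_partition_shift L hs; rewrite !subrK in p.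
    apply: le_trans (partition_sum_le h p); rewrite lee_fin.
    rewrite -[c in partition_sum h c](subrK L) partition_sum_shift.
    rewrite (@eq_partition_sum _ _ g (fun x => h (x + L)%R) _ _ _ _ hs)// => t /andP[ct _].
    by rewrite hr ?addrK//; lra.
  move=> c d c0 cd dLM; have [dL|Ld] := leP d L; first exact: ul.
  have [cL|Lc] := leP c L; last by apply: ur => //; exact: ltW.
  rewrite (curve_lengthD h cL (ltW Ld)) ul// ur// ?(ltW Ld)//.
  by rewrite -EFinD; congr (_%:E); ring.
Qed.
End unit_speed.

Section interval_integrals.
Context {R : realType}.
Local Notation leb := (@lebesgue_measure R).
Local Open Scope ereal_scope.
Variable f : R -> \bar R.
Hypotheses (mf : measurable_fun [set: R] f) (f0 : forall x, 0 <= f x).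

Lemma ge0_integral_itv_cat (a b c : R) : (a <= b)%R -> (b <= c)%R ->
  \int[leb]_(x in [set` `[a, c]%R]) f x =
  \int[leb]_(x in [set` `[a, b]%R]) f x + \int[leb]_(x in [set` `[b, c]%R]) f x.
Proof.
move=> ab bc.
have e : \int[leb]_(x in [set` `[b, c]%R]) f x = \int[leb]_(x in [set` `]b, c]%R]) f x.
  by rewrite integral_itv_obnd_cbnd//; exact: measurable_funTS.
rewrite e -ge0_integral_setU//=.
- congr integral; rewrite (@itv_bndbnd_setU _ _ (BLeft a) (BRight b) (BRight c))//=.
- by exact: measurable_funTS.
- apply/disj_setPLR => x /=; rewrite !in_itv/= => /andP[_ xb]; rewrite ltNge xb//.
Qed.

Lemma ge0_integral_itv_shift (a b s : R) :
  \int[leb]_(x in [set` `[a, b]%R]) f (x + s)%R = \int[leb]_(x in [set` `[a + s, b + s]%R]) f x.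
Proof.
have mI : measurable_fun [set: R] (f \_ [set` `[a + s, b + s]%R]).
  by apply/(measurable_restrictT _ _).1 => //; exact: measurable_funTS.
rewrite [LHS]integral_mkcond [RHS]integral_mkcond.
apply: etrans _ (@ge0_integral_lebesgueD R _ s mI _); last first.
  by move=> x; rewrite /patch; case: ifP.
apply: eq_integral => x _; rewrite /patch.
have -> : (x \in [set` `[a, b]%R]) = ((x + s)%R \in [set` `[a + s, b + s]%R]).
  by apply/idP/idP; rewrite !inE/= !in_itv/= !lerD2r.
by [].
Qed.

Lemma ge0_integral_itv_flip (a : R) :
  \int[leb]_(x in [set` `[0, a]%R]) f (a - x)%R = \int[leb]_(x in [set` `[0, a]%R]) f x.
Proof.
have mI : measurable_fun [set: R] (f \_ [set` `[0, a]%R]).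
  by apply/(measurable_restrictT _ _).1 => //; exact: measurable_funTS.
have mI0 x : 0 <= (f \_ [set` `[0, a]%R]) x by rewrite /patch; case: ifP.
rewrite [LHS]integral_mkcond [RHS]integral_mkcond.
transitivity (\int[leb]_x (f \_ [set` `[0, a]%R]) (- x + a)%R).
  apply: eq_integral => x _; rewrite /patch (addrC (- x)%R).
  have -> : (x \in [set` `[0, a]%R]) = ((a - x)%R \in [set` `[0, a]%R]).
    by apply/idP/idP; rewrite !inE/= !in_itv/=; lra.
  by [].
have m2 : measurable_fun [set: R] (fun x : R => (f \_ [set` `[0, a]%R]) (x + a)%R).
  by apply: (measurableT_comp mI); exact: measurable_funD.
by rewrite (ge0_integral_lebesgueN m2)// ge0_integral_lebesgueD.
Qed.

Lemma ge0_integral_itv_scale (a : R) : (0 < a)%R ->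
  a%:E * \int[leb]_(x in [set` `[0%R, 1%R]%R]) f (a * x)%R = \int[leb]_(x in [set` `[0, a]%R]) f x.
Proof.
move=> a0; have mI : measurable_fun [set: R] (f \_ [set` `[0, a]%R]).
  by apply/(measurable_restrictT _ _).1 => //; exact: measurable_funTS.
have mI0 x : 0 <= (f \_ [set` `[0, a]%R]) x by rewrite /patch; case: ifP.
rewrite [in LHS]integral_mkcond [RHS]integral_mkcond.
rewrite (_ : \int[leb]_x _ = \int[leb]_x (f \_ [set` `[0, a]%R]) (a * x)%R).
  by rewrite ge0_integral_lebesgueZ// muleA -EFinM divff ?gt_eqF// mul1e.
apply: eq_integral => x _; rewrite /patch.
have -> : (x \in [set` `[0%R, 1%R]%R]) = ((a * x)%R \in [set` `[0, a]%R]).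
  by apply/idP/idP; rewrite !inE/= !in_itv/= pmulr_rge0// -{2}(mulr1 a) ler_pM2l.
by [].
Qed.
End interval_integrals.

(** * Costs of paths and segments *)

Section path_cost.
Context {R : realType} {n : nat}.
Local Notation Rn := 'rV[R]_n.
Local Open Scope ereal_scope.

Lemma lipschitz_measurable (f : R -> Rn) :
  (forall s t, (enorm (f s - f t) <= `|s - t|)%R) -> measurable_fun [set: R] (f : R -> borel_rV R n).
Proof.
move=> lf; apply: measurable_fun_rV => i; apply: continuous_measurable_fun => s.
apply/cvgrPdist_le => e e0; near=> t.
have := coord_le_enorm (f s - f t)%R i; rewrite !mxE => h.
apply: le_trans h (le_trans (lf s t) _).
near: t; apply: cvgr_dist_le => //; exact: cvg_id.
Unshelve. all: by end_near. Qed.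

Lemma measurable_along (rho : borel_rV R n -> \bar R) (f : R -> Rn) :
  measurable_fun setT rho -> (forall s t, (enorm (f s - f t) <= `|s - t|)%R) ->
  measurable_fun setT (fun s : R => rho (f s)).
Proof. by move=> mrho lf; apply: (measurableT_comp mrho); exact: lipschitz_measurable. Qed.

Definition path_cost (rho : Rn -> \bar R) (f : R -> Rn) (L : R) : \bar R :=
  \int[lebesgue_measure]_(s in [set` `[0%R, L]%R]) rho (f s).

(** The parameter interval is [0, 1] for all endpoints: this makes the cost measurable in y by
    Tonelli's theorem and covers x = y. *)
Definition segment_cost (rho : Rn -> \bar R) (x y : Rn) : \bar R :=
  (enorm (y - x))%:E * \int[lebesgue_measure]_(t in [set` `[0%R, 1%R]%R]) rho (x + t *: (y - x))%R.

Lemma path_cost_ge0 rho f L : (forall x, 0 <= rho x) -> 0 <= path_cost rho f L.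
Proof. by move=> r0; exact: integral_ge0. Qed.

Lemma upath_join f g L M x y z : upath f L x y -> upath g M y z ->
  exists2 h, upath h (L + M)%R x z & forall rho : borel_rV R n -> \bar R, measurable_fun setT rho ->
    (forall x, 0 <= rho x) -> path_cost rho h (L + M) = path_cost rho f L + path_cost rho g M.
Proof.
move=> uf ug; have uh := upath_cat uf ug; eexists; first exact: uh.
case: uf => L0 f0 fL lf uf; case: ug => M0 g0 gM lg ug; case: uh => _ _ _ lh _.
move=> rho mrho rho0; have mh := measurable_along mrho lh.
have LM : (L <= L + M)%R by rewrite lerDl.
rewrite /path_cost (ge0_integral_itv_cat mh _ L0 LM)//; congr (_ + _).
  by apply: eq_integral => s /[!inE] /=; rewrite in_itv/= => /andP[_ sL]; rewrite sL.
rewrite (_ : [set` `[L, L + M]%R] = [set` `[0 + L, M + L]%R]); last by rewrite add0r addrC.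
rewrite -[LHS](ge0_integral_itv_shift mh _ 0 M L)//.
apply: eq_integral => s /[!inE] /=; rewrite in_itv/= => /andP[s0 _].
move: s0; rewrite le_eqVlt => /predU1P[<-|s0]; first by rewrite add0r lexx fL g0.
by rewrite leNgt ltrDr s0 /= addrK.
Qed.

Lemma upath_straight (x y : Rn) : exists f L, upath f L x y /\
  forall rho : borel_rV R n -> \bar R, measurable_fun setT rho -> (forall x, 0 <= rho x) ->
    path_cost rho f L = segment_cost rho x y.
Proof.
have [<-|xy] := eqVneq x y.
  exists (fun=> x), 0%R; split; first exact: upath_refl.
  by move=> rho _ _; rewrite /path_cost /segment_cost subrr enorm0 mul0e set_itv1 integral_set1.
have ux := upath_segment xy; exists (fun s => x + (s / enorm (y - x)) *: (y - x))%R, (enorm (y - x)).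
split=> // rho mrho rho0; case: ux => _ _ _ lf _.
have L0 : (0 < enorm (y - x))%R by rewrite enorm_gt0 subr_eq0 eq_sym.
rewrite /path_cost -(ge0_integral_itv_scale (measurable_along mrho lf))//; congr (_ * _).
by apply: eq_integral => s _; rewrite (mulrC _ s) mulfK ?gt_eqF.
Qed.

Lemma upath_translate (f : R -> Rn) L x y z : upath f L x y ->
  upath (fun s => f s + z)%R L (x + z)%R (y + z)%R.
Proof.
have e s t : (f s + z - (f t + z) = f s - f t)%R by rewrite opprD addrACA subrr addr0.
move=> [L0 f0 fL lf uf]; split=> //; rewrite ?f0 ?fL//.
  by move=> s t; rewrite e.
move=> c d c0 cd dL; rewrite -uf// !curve_lengthE; congr ereal_sup.
apply/seteqP; split=> _ [s hs <-]; exists s => //; congr (_%:E);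
  by elim: s c {hs cd c0} => //= a s IH c; rewrite IH e.
Qed.

End path_cost.

Lemma integral_cst_itv (R : realType) (a b c : R) : a <= b ->
  (\int[lebesgue_measure]_(x in [set` `[a, b]%R]) c%:E = (c * (b - a))%:E)%E.
Proof.
rewrite integral_cst//= lebesgue_measure_itv/= lte_fin le_eqVlt => /predU1P[->|ab].
  by rewrite ltxx subrr mulr0 mule0.
by rewrite ab EFinM.
Qed.

(** * Increments along Lipschitz paths *)

Section sobolev_path.
Context {R : realType}.
Local Open Scope ereal_scope.
Local Notation leb := (@lebesgue_measure R).

(* The difference quotient with step [h] integrates to the difference of the
   averages of [F] over [L, L + h] and [0, h]. *)
Lemma difference_quotient_bound (F : R -> R) (G : R -> \bar R) (K h L : R) :
  (0 < h)%R -> (0 <= L)%R -> (0 <= K)%R -> (forall s t, `|F s - F t| <= K * `|s - t|)%R ->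
  measurable_fun [set: R] G -> (forall s, 0 <= G s) ->
  (forall s, (0 <= s <= L)%R -> (F (s + h) - F s)%:E <= h%:E * G s) ->
  (F L - F 0 - 2 * K * h)%:E <= \int[leb]_(s in [set` `[0%R, L]%R]) G s.
Proof.
move=> h0 L0 K0 lF mG G0 FG.
(* Adding [B] makes F nonnegative on [0, L + h], so that it can be integrated as a nonnegative
   function; [B] cancels at the end. *)
pose B : R := (`|F 0| + K * (L + h))%R.
pose H s := Num.max (F s + B)%R 0%R.
have cF : continuous F.
  move=> s; apply/cvgrPdist_le => e e0; near=> t.
  apply: le_trans (lF s t) _.
  have : (`|s - t| <= e / (K + 1))%R.
    near: t; apply: cvgr_dist_le; first exact: cvg_id.
    by rewrite divr_gt0// ltr_wpDl.
  rewrite ler_pdivlMr ?ltr_wpDl// => e1.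
  by apply: le_trans e1; rewrite mulrC ler_wpM2l// lerDl.
have mH : measurable_fun [set: R] (fun s => (H s)%:E).
  apply/measurable_EFinP; apply: measurable_maxr; last exact: measurable_cst.
  by apply: measurable_funD; [exact: continuous_measurable_fun|exact: measurable_cst].
have H0 s : 0 <= (H s)%:E by rewrite lee_fin le_max lexx orbT.
have HF s : (0 <= s <= L + h)%R -> H s = (F s + B)%R.
  move=> /andP[s0 sL]; rewrite /H max_l// /B.
  have := lF s 0%R; rewrite subr0 (ger0_norm s0) => e1.
  have e2 : (K * s <= K * (L + h))%R by rewrite ler_wpM2l.
  have := ler_norm (- F 0%R); have := ler_norm (F 0 - F s)%R; rewrite distrC normrN; lra.
have e1 : \int[leb]_(s in [set` `[0%R, L + h]%R]) (H s)%:E =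
    \int[leb]_(s in [set` `[0%R, h]%R]) (H s)%:E + \int[leb]_(s in [set` `[0%R, L]%R]) (H (s + h)%R)%:E.
  by rewrite (ge0_integral_itv_cat mH H0 (ltW h0)) ?lerDr// (ge0_integral_itv_shift mH H0) add0r.
have e2 : \int[leb]_(s in [set` `[0%R, L + h]%R]) (H s)%:E =
    \int[leb]_(s in [set` `[0%R, L]%R]) (H s)%:E + \int[leb]_(s in [set` `[L, L + h]%R]) (H s)%:E.
  by rewrite (ge0_integral_itv_cat mH H0 L0) ?lerDl// ltW.
have e3 : \int[leb]_(s in [set` `[0%R, L]%R]) (H (s + h)%R)%:E <=
    \int[leb]_(s in [set` `[0%R, L]%R]) (H s)%:E + h%:E * \int[leb]_(s in [set` `[0%R, L]%R]) G s.
  rewrite -ge0_integralZl//; [|exact: measurable_funTS|by rewrite lee_fin ltW].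
  rewrite -ge0_integralD//; [|exact: measurable_funTS| |]; last first.
  - by apply: measurable_funeM; exact: measurable_funTS.
  - by move=> s _; rewrite mule_ge0// lee_fin ltW.
  apply: ge0_le_integral => //.
  - by apply: measurable_funTS; apply: (measurableT_comp mH); exact: measurable_funD.
  - apply: emeasurable_funD; first exact: measurable_funTS.
    by apply: measurable_funeM; exact: measurable_funTS.
  - move=> s; rewrite /= in_itv/= => /andP[s0 sL].
    rewrite !HF; [|lra|lra].
    have := FG s ltac:(by rewrite s0); case: (h%:E * G s) => //= [r|_]; last by rewrite addey// leey.
    by rewrite -EFinD !lee_fin; lra.
have bnd (a b c : R) : (a <= b)%R -> (0 <= c)%R -> (forall x, (a <= x <= b)%R -> (H x <= c)%R) ->
    \int[leb]_(x in [set` `[a, b]%R]) (H x)%:E <= (c * (b - a))%:E.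
  move=> ab c0 Hc; have -> : (c * (b - a))%:E = \int[leb]_(x in [set` `[a, b]%R]) c%:E.
    by rewrite integral_cst_itv.
  apply: ge0_le_integral => //; first exact: measurable_funTS.
have bnd2 (a b c : R) : (a <= b)%R -> (forall x, (a <= x <= b)%R -> (c <= H x)%R) -> (0 <= c)%R ->
    (c * (b - a))%:E <= \int[leb]_(x in [set` `[a, b]%R]) (H x)%:E.
  move=> ab Hc c0; have -> : (c * (b - a))%:E = \int[leb]_(x in [set` `[a, b]%R]) c%:E.
    by rewrite integral_cst_itv.
  apply: ge0_le_integral => //.
  exact: measurable_funTS.
have Kh : (0 <= K * h)%R by rewrite mulr_ge0// ltW.
have KL : (0 <= K * L)%R by rewrite mulr_ge0.
have lF2 s t d : (t <= s)%R -> (s - t <= d)%R -> (F s - F t <= K * d /\ F t - F s <= K * d)%R.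
  move=> ts std; have h1 := lF s t; rewrite (ger0_norm (_ : 0 <= s - t)%R) ?subr_ge0// in h1.
  have h2 : (K * (s - t) <= K * d)%R by rewrite ler_wpM2l.
  have h3 := ler_norm (F s - F t)%R; have h4 := ler_norm (F t - F s)%R; rewrite distrC in h4.
  by split; lra.
have F0B := ler_norm (F 0%R); have F0B' := ler_norm (- F 0%R); rewrite normrN in F0B'.
have KLh : (K * (L + h) = K * L + K * h)%R by rewrite mulrDr.
have HB s : (0 <= s <= L + h)%R -> (H s <= 2 * B)%R.
  move=> hs; rewrite (HF _ hs); case/andP: hs => s0 sL.
  by have [] := lF2 s 0%R (L + h)%R s0 ltac:(by rewrite subr0); rewrite /B; lra.
have B0 : (0 <= B)%R by rewrite /B addr_ge0// mulrDr addr_ge0.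
have If : \int[leb]_(s in [set` `[0%R, L]%R]) (H s)%:E \is a fin_num.
  rewrite ge0_fin_numE; last exact: integral_ge0.
  apply: le_lt_trans (bnd 0%R L (2 * B)%R L0 _ _) (ltry _); first by rewrite mulr_ge0.
  by move=> x hx; apply: HB; lra.
have e4 : \int[leb]_(s in [set` `[0%R, h]%R]) (H s)%:E <= ((F 0%R + B + K * h) * h)%:E.
  rewrite (_ : ((_ * h)%:E = ((F 0%R + B + K * h) * (h - 0))%:E)); last by rewrite subr0.
  apply: bnd; first exact: ltW.
    by rewrite /B; lra.
  move=> x hx; rewrite HF; last lra.
  by have [] := lF2 x 0%R h ltac:(lra) ltac:(lra); lra.
have e5 : ((F L + B - K * h) * h)%:E <= \int[leb]_(s in [set` `[L, L + h]%R]) (H s)%:E.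
  rewrite (_ : ((_ * h)%:E = ((F L + B - K * h) * (L + h - L))%:E)); last by rewrite (addrC L h) addrK.
  apply: bnd2; first by rewrite lerDl ltW.
    move=> x hx; rewrite HF; last lra.
    by have [] := lF2 x L h ltac:(lra) ltac:(lra); lra.
  by have [] := lF2 L 0%R L L0 ltac:(by rewrite subr0); rewrite /B; lra.
have [->|Gf] := eqVneq (\int[leb]_(s in [set` `[0%R, L]%R]) G s) +oo; first exact: leey.
have {}Gf : \int[leb]_(s in [set` `[0%R, L]%R]) G s \is a fin_num.
  by rewrite ge0_fin_numE ?ltey//; exact: integral_ge0.
have : \int[leb]_(s in [set` `[0%R, L]%R]) (H s)%:E + ((F L + B - K * h) * h)%:E <=
    ((F 0%R + B + K * h) * h)%:E + (\int[leb]_(s in [set` `[0%R, L]%R]) (H s)%:E +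
    h%:E * \int[leb]_(s in [set` `[0%R, L]%R]) G s).
  by apply: le_trans (leeD e4 e3); rewrite -e1 e2 leeD2l.
move: If Gf => /fineK <- /fineK <-; rewrite -!EFinM -!EFinD !lee_fin.
move: (fine _) (fine _) => I J hI.
rewrite -(ler_pM2l h0); lra.
Unshelve. all: by end_near. Qed.
End sobolev_path.

(** * Rings and upper gradients *)

Section extended_space.
Context {R : realType} {n : nat}.
Local Notation Rn := 'rV[R]_n.
Local Notation Rb := (Rbar R n).

Lemma open_enorm_lt (a : Rn) (r : R) : open [set x : Rn | enorm (x - a) < r].
Proof.
rewrite (_ : mkset _ = (fun x => enorm (x - a)) @^-1` [set y | y < r])//.
by apply: open_comp; [move=> x _; exact: enorm_sub_continuous|exact: open_lt].
Qed.

Lemma open_enorm_gt (a : Rn) (r : R) : open [set x : Rn | r < enorm (x - a)].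
Proof.
rewrite (_ : mkset _ = (fun x => enorm (x - a)) @^-1` [set y | r < y])//.
by apply: open_comp; [move=> x _; exact: enorm_sub_continuous|exact: open_gt].
Qed.

Lemma measurable_enorm_lt (r : R) : measurable ([set x | enorm x < r] : set (borel_rV R n)).
Proof.
apply: open_rV_measurable; rewrite (_ : mkset _ = [set x : Rn | enorm (x - 0) < r]); first exact: open_enorm_lt.
by apply/seteqP; split=> x; rewrite /= subr0.
Qed.

Lemma measurable_enorm_gt (r : R) : measurable ([set x | r < enorm x] : set (borel_rV R n)).
Proof.
apply: open_rV_measurable; rewrite (_ : mkset _ = [set x : Rn | r < enorm (x - 0)]); first exact: open_enorm_gt.
by apply/seteqP; split=> x; rewrite /= subr0.
Qed.

Lemma closed_enorm_le (a : Rn) (r : R) : closed [set x : Rn | enorm (x - a) <= r].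
Proof.
rewrite (_ : mkset _ = ~` [set x : Rn | r < enorm (x - a)]); first exact/open_closedC/open_enorm_gt.
by apply/seteqP; split=> x /=; rewrite leNgt => /negP.
Qed.

Lemma compact_enorm (K : set Rn) (r : R) : closed K -> (forall x, K x -> enorm x <= r) -> compact K.
Proof.
move=> cK Kr; apply: (subclosed_compact cK (B := [set x : Rn | forall i, `[- r, r]%classic (x ord0 i)])).
  by apply: (@rV_compact _ _ (fun=> `[- r, r]%classic)) => i; exact: segment_compact.
move=> x /Kr xr i /=; rewrite in_itv/= -ler_norml.
by apply: le_trans xr; exact: coord_le_enorm.
Qed.

Lemma Rbar_hausdorff : hausdorff_space Rb.
Proof.
apply: one_point_compactification_hausdorff; last exact: norm_hausdorff.
move=> x _; exists [set y | enorm (y - x) <= 1].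
  have h : nbhs x [set y : Rn | enorm (y - x) < 1].
    by apply: open_nbhs_nbhs; split; [exact: open_enorm_lt|rewrite /= subrr enorm0 ltr01].
  have h2 : nbhs x [set y : Rn | enorm (y - x) <= 1] by apply: filterS h => y /= /ltW.
  exact: cvg_within h2.
split; last exact: closed_enorm_le.
apply: (@compact_enorm _ (1 + enorm x)); first exact: closed_enorm_le.
by move=> y /= h; have := enormD (y - x) x; rewrite subrK; lra.
Qed.

Lemma compact_Rbar (C : set Rb) : compact C <-> closed C.
Proof.
split; first exact: (compact_closed Rbar_hausdorff).
by move=> cC; apply: subclosed_compact cC (one_point_compactification_compact) _.
Qed.

Lemma compact_some (K : set Rn) : compact K -> compact (Some @` K : set Rb).
Proof.
move=> cK; apply: continuous_compact => //.
by apply: continuous_subspaceT; exact: one_point_compactification_some_continuous.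
Qed.

Lemma closed_some_none (F : set Rn) : closed F -> closed (Some @` F `|` [set None] : set Rb).
Proof.
move=> cF; rewrite (_ : _ `|` _ = ~` (Some @` (~` F))).
  by apply/open_closedC/one_point_compactification_open_some; rewrite openC.
apply/seteqP; split=> [_ [[x Fx <-]|->] [y] //= + [e]|[x|] h]; last by right.
  by rewrite e.
by left; exists x => //; apply: contrapT => Fx; apply: h; exists x.
Qed.

Lemma closed_preimage_some (C : set Rb) : closed C -> closed [set x | C (Some x)].
Proof.
move=> cC; apply: (closed_comp (f := Some : Rn -> Rb)) => // x _.
exact: one_point_compactification_some_continuous.
Qed.

Lemma compact_enorm_bounded (K : set Rn) : compact K -> exists r, forall x, K x -> enorm x <= r.
Proof.
move=> cK; have [M [_ hM]] := compact_bounded cK.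
exists (n%:R * (M + 1)) => x Kx.
by apply: le_trans (enorm_le_norm x) _; rewrite ler_wpM2l//; apply: hM => //; rewrite ltrDl.
Qed.

Lemma closed_bounded (C : set Rb) : closed C -> ~ C None ->
  exists r, forall x, C (Some x) -> enorm x <= r.
Proof.
move=> cC CN; have : nbhs (None : Rb) (~` C) by apply: open_nbhs_nbhs; split=> //; rewrite openC.
move=> [K [cK _] KC].
have [r hr] := compact_enorm_bounded cK.
exists r => x Cx; apply: hr.
by apply: contrapT => nK; apply: (KC (Some x)) => //; left; exists x.
Qed.

(** The sublevel set is compact, hence closed in the compactified space, and the strict sublevel set
    is open. If C missed the level s, they would have the same trace on C, a proper nonempty part
    that is open and closed. The point q outside may be infinity. *)
Lemma connected_level (C : set Rb) (phi : Rn -> R) (p : Rn) (s : R) :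
  continuous phi -> compact [set x | phi x <= s] -> connected C ->
  C (Some p) -> phi p < s -> (exists2 q, C q & ~ (Some @` [set x | phi x <= s]) q) ->
  exists2 x, C (Some x) & phi x = s.
Proof.
move=> cphi cs cC Cp ps [q Cq qs]; apply: contrapT => H.
have h : C `&` (Some @` [set x | phi x <= s]) = C.
  apply: cC.
  - by exists (Some p); split=> //; exists p => //=; exact: ltW.
  - exists (Some @` [set x | phi x < s]).
      apply: one_point_compactification_open_some.
      rewrite (_ : mkset _ = phi @^-1` [set y | y < s])//.
      by apply: open_comp; [move=> x _; exact: cphi|exact: open_lt].
    apply/seteqP; split=> y [Cy [x /= xs xe]]; split=> //; exists x => //=; last exact: ltW.
    rewrite lt_neqAle xs andbT; apply/eqP => e; apply: H; exists x => //; by rewrite xe.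
  - by exists (Some @` [set x | phi x <= s]) => //; apply/compact_Rbar/compact_some.
by apply: qs; have : C q by []; rewrite -h => -[].
Qed.

Lemma connected_between (A B : set Rb) : connected A -> A `<=` B -> B `<=` closure A -> connected B.
Proof.
move=> cA AB BA W [w Ww] [D oD WD] [F cF WF].
have [[a Aa Wa]|AW] := pselect (exists2 a, A a & W a).
  have e : A `&` F = A.
    apply: cA.
    - by exists a; split=> //; move: Wa; rewrite WF => -[].
    - exists D => //; apply/seteqP; split=> x [Ax h]; split=> //.
        by have [] : (B `&` D) x by rewrite -WD WF; split=> //; exact: AB.
      by have [] : (B `&` F) x by rewrite -WF WD; split=> //; exact: AB.
    - by exists F.
  rewrite WF; apply/seteqP; split=> [x [//]|x Bx]; split=> //.
  have /closure_id -> := cF; have : closure A x by exact: BA.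
  by apply: closure_subset => y; rewrite -e => -[].
exfalso; have [Bw Dw] : (B `&` D) w by rewrite -WD.
have [x [Ax Dx]] := BA _ Bw D (open_nbhs_nbhs (conj oD Dw)).
by apply: AW; exists x => //; rewrite WD; split=> //; exact: AB.
Qed.

Lemma connected_star (A : set Rb) (o : Rb) :
  (forall x, A x -> exists B, [/\ connected B, B x, B o & B `<=` A]) -> connected A.
Proof.
move=> H; have [[x0 Ax0]|A0] := pselect (A !=set0); last first.
  rewrite (_ : A = set0); first exact: connected0.
  by apply/seteqP; split=> x // Ax; apply: A0; exists x.
pose B x := if pselect (A x) is left h then sval (cid (H x h)) else [set o].
have HB x : A x -> [/\ connected (B x), B x x, B x o & B x `<=` A].
  by move=> Ax; rewrite /B; case: pselect => // h; case: cid.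
rewrite (_ : A = \bigcup_(x in A) B x).
  apply: bigcup_connected; last by move=> x Ax; case: (HB x Ax).
  by exists o => x Ax; case: (HB x Ax).
apply/seteqP; split=> [x Ax|y [x Ax Bxy]]; first by exists x => //; case: (HB x Ax).
by case: (HB x Ax) => _ _ _; exact.
Qed.

Lemma affine_continuous (x v : Rn) : continuous (fun t : R => Some (x + t *: v) : Rb).
Proof.
move=> t; apply: continuous_comp; last exact: one_point_compactification_some_continuous.
by apply: cvgD; [exact: cvg_cst|apply: cvgZl; exact: cvg_id].
Qed.

Lemma connected_affine (x v : Rn) (i : interval R) :
  connected (Some @` [set x + t *: v | t in [set` i]] : set Rb).
Proof.
rewrite (_ : _ @` _ = (fun t : R => Some (x + t *: v)) @` [set` i]).
  apply: connected_continuous_connected.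
    by apply/connected_intervalP; exact: interval_is_interval.
  by apply: continuous_subspaceT; exact: affine_continuous.
apply/seteqP; split=> [_ [_ [t it <-] <-]|_ [t it <-]]; first by exists t.
by exists (x + t *: v) => //; exists t.
Qed.

Lemma connected_affine_ray (x v : Rn) (a : R) : v != 0 ->
  connected (Some @` [set x + t *: v | t in [set t | a <= t]] `|` [set None] : set Rb).
Proof.
move=> v0; have cA := @connected_affine x v `[a, +oo[%R.
refine (@connected_between _ _ cA _ _).
  move=> _ [_ [t ht <-] <-]; left; exists (x + t *: v) => //; exists t => //.
  by move: ht; rewrite /= in_itv/= andbT.
move=> _ [[_ [t ht <-] <-]|->].
  apply: subset_closure; exists (x + t *: v) => //; exists t => //.
  by rewrite /= in_itv/= andbT.
move=> U [K [cK _] KU]; have [r hr] := compact_enorm_bounded cK.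
have v1 : 0 < enorm v by rewrite enorm_gt0.
pose t := Num.max a ((`|r| + enorm x + 1) / enorm v).
have h : r < enorm (x + t *: v).
  have h1 := enormD (x + t *: v) (- x); rewrite addrAC subrr add0r enormN enormZ in h1.
  have h2 : `|r| + enorm x + 1 <= t * enorm v by rewrite -ler_pdivrMr// le_max lexx orbT.
  have h3 : t * enorm v <= `|t| * enorm v by rewrite ler_wpM2r ?enorm_ge0// ler_norm.
  by have := ler_norm r; lra.
exists (Some (x + t *: v)); split.
  by exists (x + t *: v) => //; exists t; rewrite //= in_itv/= andbT le_max lexx.
apply: KU; left; exists (x + t *: v) => // /hr; rewrite leNgt h //.
Qed.

Lemma continuum_closed_bounded (F : set Rn) (r : R) : F !=set0 -> closed F ->
  (forall x, F x -> enorm x <= r) -> connected (Some @` F : set Rb) -> continuum (Some @` F : set Rb).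
Proof.
move=> [x Fx] cF Fr cn; split=> //; first by exists (Some x), x.
by apply: compact_some; exact: compact_enorm Fr.
Qed.

Lemma continuum_some_none (F : set Rn) : closed F -> connected (Some @` F `|` [set None] : set Rb) ->
  continuum (Some @` F `|` [set None] : set Rb).
Proof.
move=> cF cn; split=> //; first by exists None; right.
by apply/compact_Rbar; exact: closed_some_none.
Qed.

Lemma setC_some (F : set Rn) : ~` (Some @` F : set Rb) = Some @` (~` F) `|` [set None].
Proof.
apply/seteqP; split=> [[x|] h|_ [[x Fx <-]|->] [y]//]; last 2 first.
- by right.
- by move=> Fy [e]; apply: Fx; rewrite -e.
- by left; exists x => // Fx; apply: h; exists x.
Qed.

Lemma setC_some_none (F : set Rn) : ~` (Some @` F `|` [set None] : set Rb) = Some @` (~` F).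
Proof. by rewrite -[in RHS](setCK (Some @` (~` F))) setC_some setCK. Qed.

Definition closed_eball (a : Rn) (r : R) : set Rb := Some @` [set x | enorm (x - a) <= r].
Definition exterior (a : Rn) (r : R) : set Rb := Some @` [set x | r <= enorm (x - a)] `|` [set None].

Lemma connected_star_some (F : set Rn) (a : Rn) :
  (forall x t, F x -> 0 <= t <= 1 -> F (a + t *: (x - a))) -> connected (Some @` F : set Rb).
Proof.
move=> H; apply: (@connected_star _ (Some a)) => _ [x Fx <-].
exists (Some @` [set a + t *: (x - a) | t in [set` `[0, 1]%R]]); split.
- exact: connected_affine.
- exists x => //; exists 1; rewrite /= ?in_itv/= ?ler01 ?lexx//.
  by rewrite scale1r addrC subrK.
- exists a => //; exists 0; rewrite /= ?in_itv/= ?ler01 ?lexx//.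
  by rewrite scale0r addr0.
- by move=> _ [_ [t ht <-] <-]; exists (a + t *: (x - a)) => //; apply: H; rewrite // in_itv in ht.
Qed.

Lemma connected_star_none (F : set Rn) :
  (forall x, F x -> exists2 v, v != 0 & forall t, 0 <= t -> F (x + t *: v)) ->
  connected (Some @` F `|` [set None] : set Rb).
Proof.
move=> H; apply: (@connected_star _ None) => _ [[x Fx <-]|->]; last first.
  by exists [set None]; split=> //; exact: connected1.
have [v v0 hv] := H x Fx.
exists (Some @` [set x + t *: v | t in [set t | 0 <= t]] `|` [set None]); split.
- exact: connected_affine_ray.
- by left; exists x => //; exists 0; rewrite //= scale0r addr0.
- by right.
- move=> _ [[_ [t ht <-] <-]|->]; last by right.
  by left; exists (x + t *: v) => //; exact: hv.
Qed.

Lemma ball_exterior_ring (a : Rn) (r0 r1 : R) : (0 < n)%N -> 0 < r0 < r1 ->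
  ring_pair (closed_eball a r0) (exterior a r1) /\
  ring_dom (closed_eball a r0) (exterior a r1) = annulus a r0 r1.
Proof.
move=> n0 /andP[r00 r01].
have out r x : r <= enorm (x - a) -> 0 < r -> exists2 v, v != 0 &
    forall t, 0 <= t -> enorm (x - a) <= enorm (x + t *: v - a).
  move=> h r0'; exists (x - a); first by rewrite -enorm_gt0 (lt_le_trans r0').
  move=> t t0; rewrite addrAC -{2}[x - a]scale1r -scalerDl enormZ ger0_norm ?addr_ge0//.
  by rewrite ler_peMl ?enorm_ge0// lerDl.
have inn x t : 0 <= t <= 1 -> enorm (a + t *: (x - a) - a) <= enorm (x - a).
  move=> /andP[t0 t1]; rewrite addrAC subrr add0r enormZ ger0_norm//.
  by rewrite ler_piMl ?enorm_ge0.
have hB : filled_continuum (closed_eball a r0).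
  split.
  - apply: (@continuum_closed_bounded _ (r0 + enorm a)).
    + by exists a; rewrite /= subrr enorm0 ltW.
    + exact: closed_enorm_le.
    + by move=> x /=; have := enormD (x - a) a; rewrite subrK; lra.
    + by apply: connected_star_some => x t /= h /inn /le_trans; exact.
  - move=> h; have : [set: Rb] None by [].
    by rewrite -h => -[].
  - rewrite setC_some; apply: connected_star_none => x /negP; rewrite -ltNge => h.
    have [v v0 hv] := out _ x (ltW h) r00; exists v => // t t0.
    by apply/negP; rewrite -ltNge (lt_le_trans h)// hv.
have hE : filled_continuum (exterior a r1).
  split.
  - apply: continuum_some_none; first by
      rewrite (_ : mkset _ = ~` [set x | enorm (x - a) < r1]);
      [exact/open_closedC/open_enorm_lt|apply/seteqP; split=> x /=; rewrite leNgt => /negP].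
    apply: connected_star_none => x /= h.
    have [v v0 hv] := out _ x h (lt_trans r00 r01); exists v => // t t0.
    exact: le_trans h (hv _ t0).
  - move=> h; have : [set: Rb] (Some a) by [].
    rewrite -h => -[[x /= h1 [e]]|//]; move: h1; rewrite e subrr enorm0.
    by have := lt_trans r00 r01; lra.
  - rewrite setC_some_none; apply: (@connected_star_some _ a) => x t /= /negP; rewrite -ltNge => h /(inn x) h2.
    by apply/negP; rewrite -ltNge (le_lt_trans h2).
split; first split=> //.
  by apply/seteqP; split=> // _ [[x /= h <-] [[y /= h2 [e]]|//]]; move: h2; rewrite e; lra.
rewrite /ring_dom setCU setC_some setC_some_none.
apply/seteqP; split=> [_ [[[x /= /negP h1 <-]|->] [y /= /negP h2 //]] [e]|_ [x /= /andP[h1 h2] <-]].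
  by exists x => //=; move: h1 h2; rewrite -!ltNge e => -> ->.
by split; [left|]; exists x => //=; apply/negP; rewrite -ltNge.
Qed.
End extended_space.

Section closed_extrema.
Context {R : realType}.

Lemma closed_sup (A : set R) : closed A -> has_sup A -> A (sup A).
Proof.
move=> cA hA; apply: cA => U /nbhs_ballP[e /= e0 eU].
have [x Ax xe] := sup_adherent e0 hA; exists x; split=> //; apply: eU.
by rewrite /ball/= ger0_norm ?subr_ge0; [lra|apply: ub_le_sup => //; case: hA].
Qed.

Lemma closed_inf (A : set R) : closed A -> has_inf A -> A (inf A).
Proof.
move=> cA hA; apply: cA => U /nbhs_ballP[e /= e0 eU].
have [x Ax xe] := inf_adherent e0 hA; exists x; split=> //; apply: eU.
by rewrite /ball/= distrC ger0_norm ?subr_ge0; [lra|apply: ge_inf => //; case: hA].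
Qed.

Lemma lipschitz_continuous_curve n (f : R -> 'rV[R]_n) :
  (forall s t, enorm (f s - f t) <= `|s - t|) -> continuous f.
Proof.
move=> lf t; apply/cvgrPdist_le => e e0; near=> s.
apply: le_trans (norm_le_enorm _) (le_trans (lf _ _) _).
by near: s; apply: cvgr_dist_le => //; exact: cvg_id.
Unshelve. all: by end_near. Qed.
End closed_extrema.

(** * Curve families of rings *)

Section ring_curves.
Context {R : realType} {n : nat}.
Local Notation Rn := 'rV[R]_n.
Local Notation Rb := (Rbar R n).
Local Open Scope ereal_scope.
Variables (C0 C1 : set Rb).

Lemma finite_part_continuous (g : @curve R n) (a b : R) : curve_dom g = `[a, b]%R ->
  (forall t, t \in `[a, b]%R -> g t <> None) ->
  forall t e, (a <= t <= b)%R -> (0 < e)%R -> exists2 r, (0 < r)%R &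
    forall t', (a <= t' <= b)%R -> (`|t' - t| < r)%R -> (enorm (finite_part g t' - finite_part g t) < e)%R.
Proof.
move=> dg gN t e abt e0.
have gS s : (a <= s <= b)%R -> g s = Some (finite_part g s).
  by move=> hs; have := gN s; rewrite in_itv/= /finite_part => /(_ hs); case: (g s).
have cg := @curve_continuous _ _ g; rewrite dg in cg.
have hn : nbhs (g t) (Some @` [set y : Rn | enorm (y - finite_part g t) < e]%R : set Rb).
  rewrite gS//; apply: one_point_compactification_some_nbhs.
  by apply: open_nbhs_nbhs; split; [exact: open_enorm_lt|rewrite /= subrr enorm0].
have [r r0 hr] : exists2 r, (0 < r)%R & forall t', (`|t' - t| < r)%R -> (a <= t' <= b)%R ->
    (Some @` [set y : Rn | enorm (y - finite_part g t) < e]%R : set Rb) (g t').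
  have h : @nbhs_subspace _ [set` `[a, b]%R] t (g @^-1` (Some @` [set y : Rn | enorm (y - finite_part g t) < e]%R)) := cg t _ hn.
  rewrite -nbhs_subspace_in in h; last by rewrite /= in_itv.
  move: h => /nbhs_ballP[r /= r0 hr]; exists r => // t' t't hab.
  by apply: (hr t'); rewrite ?in_itv//= /ball/= distrC.
by exists r => // t' hab /hr /(_ hab) [y /= hy]; rewrite gS// => -[<-].
Qed.

(** Parametrization by arc length, and reversal of the curves that run from C1 to C0, reduce
    admissibility to 1-Lipschitz arcs from C0 to C1. *)
Lemma admissible_arcs (rho : borel_rV R n -> \bar R) : measurable_fun setT rho ->
  (forall x, 0 <= rho x) ->
  (forall (gamma : R -> Rn) L, (0 <= L)%R -> (forall s t, (enorm (gamma s - gamma t) <= `|s - t|)%R) ->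
     C0 (Some (gamma 0%R)) -> C1 (Some (gamma L)) ->
     (forall s, (0 < s < L)%R -> ring_dom C0 C1 (Some (gamma s))) ->
     1 <= path_cost rho gamma L) ->
  admissible (ring_curves C0 C1) rho.
Proof.
move=> mrho rho0 H; split=> // g [a [b [ab dg ends inn]]] lr.
have [gN Vf] := lr a b (ltW ab) ltac:(by rewrite dg).
have gS s : (a <= s <= b)%R -> g s = Some (finite_part g s).
  by move=> hs; have := gN s; rewrite in_itv/= /finite_part => /(_ hs); case: (g s).
have [gam [lg g0 gL gin gint]] := arc_parametrization (ltW ab) (finite_part_continuous dg gN) Vf.
set L := fine _ in gL gin gint.
have L0 : (0 <= L)%R by rewrite fine_ge0// curve_length_ge0// ltW.
have aa : (a <= a <= b)%R by rewrite lexx ltW.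
have bb : (a <= b <= b)%R by rewrite lexx ltW.
have rd s : (0 < s < L)%R -> ring_dom C0 C1 (Some (gam s)).
  by move=> /gin [t /[dup] ht /andP[/ltW h1 /ltW h2] ->]; rewrite -gS ?h1//; exact: inn.
apply: (@le_trans _ _ (arc_integral rho a b (finite_part g))); last first.
  by apply: ereal_sup_ubound; exists (a, b) => //; split=> /=; [exact: ltW|rewrite dg].
rewrite gint; case: ends => -[h0 h1].
  by apply: H => //; rewrite ?g0 ?gL -gS.
have lg' s t : (enorm (gam (L - s) - gam (L - t)) <= `|s - t|)%R.
  apply: le_trans (lg _ _) _.
    by rewrite (_ : L - s - (L - t) = t - s)%R; [rewrite distrC|ring].
have := H (fun s => gam (L - s))%R L L0 lg'.
rewrite subr0 subrr g0 gL -!gS// => /(_ h1 h0) h.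
rewrite -(ge0_integral_itv_flip (measurable_along mrho lg))//; apply: h => s hs.
by apply: rd; lra.
Qed.

(** The path may meet the two continua many times. The piece between its last time in C0 and the
    next time in C1 belongs to [ring_curves] and costs no more than the whole. *)
Lemma admissible_upath (rho : borel_rV R n -> \bar R) f L x y : closed C0 -> closed C1 ->
  C0 `&` C1 = set0 -> admissible (ring_curves C0 C1) rho -> upath f L x y -> C0 (Some x) -> C1 (Some y) ->
  1 <= path_cost rho f L.
Proof.
move=> cl0 cl1 dis [mrho rho0 adm] [L0 f0 fL lf uf] C0x C1y.
have cf : continuous (fun t => Some (f t) : Rb).
  move=> t; apply: continuous_comp; last exact: one_point_compactification_some_continuous.
  exact: lipschitz_continuous_curve.
pose A := [set t | (0 <= t <= L)%R /\ C0 (Some (f t))].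
have ccc (u v : R) : closed [set t : R | (u <= t <= v)%R].
  rewrite (_ : mkset _ = [set` `[u, v]%R]); first exact: interval_closed.
  by apply/seteqP; split=> t; rewrite /= in_itv.
have cA : closed A.
  apply: closedI; first exact: ccc.
  exact: (closed_comp (fun x _ => cf x) cl0).
have A0 : A 0%R by split; rewrite ?lexx// f0.
have AL t : A t -> (0 <= t <= L)%R by case.
have supA : has_sup A by split; [exists 0%R|exists L => t /AL /andP[]].
have Aa : A (sup A) by exact: closed_sup.
pose B := [set t | (sup A <= t <= L)%R /\ C1 (Some (f t))].
have cB : closed B.
  apply: closedI; first exact: ccc.
  exact: (closed_comp (fun x _ => cf x) cl1).
have BL : B L by split; rewrite ?fL// lexx andbT; case/AL/andP: Aa.
have infB : has_inf B by split; [exists L|exists (sup A) => t [/andP[]]].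
have Bb : B (inf B) by exact: closed_inf.
set a := sup A in Aa BL infB *; set b := inf B in Bb.
have [/andP[a0 aL] C0a] := Aa; have [/andP[ab bL] C1b] := Bb.
have {}ab : (a < b)%R.
  rewrite lt_neqAle ab andbT; apply/eqP => e.
  have : (C0 `&` C1) (Some (f a)) by split; rewrite // e.
  by rewrite dis.
have inn t : (a < t < b)%R -> ring_dom C0 C1 (Some (f t)).
  move=> /andP[at_ tb] [Ct|Ct].
    have : (t <= a)%R.
      by apply: ub_le_sup; [case: supA|split=> //; lra].
    by rewrite leNgt at_.
  have : (b <= t)%R.
    by apply: ge_inf; [case: infB|split=> //; rewrite (ltW at_) (le_trans (ltW tb))].
  by rewrite leNgt tb.
have cg : {within [set` `[a, b]%R], continuous (fun t => Some (f t) : Rb)}.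
  exact: continuous_subspaceT.
pose g := @Curve R n `[a, b]%R _ cg.
have lr : locally_rectifiable g.
  move=> c d cd _; split=> //.
  apply: le_lt_trans (curve_length_lipschitz cd _) (ltry _).
  by move=> s t; exact: lf.
have gG : ring_curves C0 C1 g by exists a, b; split=> //; left.
apply: le_trans (adm g gG lr) _; apply: ge_ereal_sup => _ [[c d] /= [cd hcd] <-].
have c_a : (a <= c)%R by have := hcd c; rewrite /= !in_itv/= lexx cd => /(_ isT) /andP[].
have d_b : (d <= b)%R by have := hcd d; rewrite /= !in_itv/= lexx cd => /(_ isT) /andP[].
have fg : finite_part g = f by [].
rewrite fg arc_integral_unit_speed//; [|by move=> u v cu uv vd; apply: uf => //; lra|exact: measurable_along].
apply: ge0_subset_integral => //.
  by apply: measurable_funTS; exact: measurable_along.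
by move=> t /=; rewrite !in_itv/= => /andP[h1 h2]; lra.
Qed.

End ring_curves.

(** * Estimates of the modulus of a ring *)

Section ring_modulus.
Context {R : realType} {m : nat}.
Hypothesis m0 : (0 < m)%N.
Local Notation n := m.+1.
Local Notation Rb := (Rbar R n).
Local Notation mu := (@lebesgue_rV R n).
Local Open Scope ereal_scope.

Definition sphere_areaR : R := fine (@sphere_area R n).
Local Notation w := sphere_areaR.

Lemma sphere_areaRE : @sphere_area R n = w%:E.
Proof. by rewrite fineK//; exact: sphere_area_fin. Qed.

Lemma sphere_areaR_gt0 : (0 < w)%R.
Proof. by rewrite -lte_fin -sphere_areaRE; exact: sphere_area_gt0. Qed.

Let mi0 : (m%:R^-1 != 0 :> R)%R.
Proof. by rewrite invr_eq0 pnatr_eq0 -lt0n. Qed.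

Let powK (X : R) : (0 <= X)%R -> ((X ^+ m) `^ m%:R^-1)%R = X.
Proof. by move=> X0; rewrite -powR_mulrn// -powRrM divff ?powRr1// pnatr_eq0 -lt0n. Qed.

Lemma modulus_ge0 (G : set (@curve R n)) : 0 <= modulus G.
Proof.
apply: le_ereal_inf_tmp => _ [rho [_ rho0 _] <-]; apply: integral_ge0 => x _; exact: expe_ge0.
Qed.

(** Besides the monotonicity of powers, the conventions of extended arithmetic intervene: 1/oo = 0
    here, and 1/0 = oo in [mod_ge], where a vanishing modulus makes the ring infinitely thick. *)
Let mod_le (X : R) (M : \bar R) : (0 < X)%R -> 0 <= M -> (w / X ^+ m)%:E <= M ->
  ((w%:E / M) `^ m%:R^-1)%E <= X%:E.
Proof.
move=> X0; case: M => [r| |]// r0; last by move=> _; rewrite invey mule0 poweR0r// lee_fin ltW.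
rewrite lee_fin => h; have r1 : (0 < r)%R.
  by apply: lt_le_trans h; rewrite divr_gt0 ?exprn_gt0// sphere_areaR_gt0.
rewrite inver gt_eqF// -EFinM poweR_EFin lee_fin -[leRHS]powK ?(ltW X0)//.
apply: ge0_ler_powR; rewrite ?invr_ge0 ?nnegrE ?ler0n ?exprn_ge0 ?divr_ge0 ?(ltW X0) ?(ltW r1)//.
  by rewrite ltW// sphere_areaR_gt0.
by rewrite ler_pdivrMr// mulrC -ler_pdivrMr// exprn_gt0.
Qed.

Let mod_ge (X : R) (M : \bar R) : (0 < X)%R -> 0 <= M -> M <= (w / X ^+ m)%:E ->
  X%:E <= ((w%:E / M) `^ m%:R^-1)%E.
Proof.
move=> X0; case: M => [r| |]// r0; rewrite lee_fin => h.
have [r1|r1] := eqVneq r 0%R.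
  by rewrite r1 inve0 gt0_muley ?lte_fin ?sphere_areaR_gt0// poweRyr// leey.
have {r1 r0} r1 : (0 < r)%R by rewrite lt_neqAle eq_sym r1.
rewrite inver gt_eqF// -EFinM poweR_EFin lee_fin -[leLHS]powK ?(ltW X0)//.
apply: ge0_ler_powR; rewrite ?invr_ge0 ?nnegrE ?ler0n ?exprn_ge0 ?divr_ge0 ?(ltW X0) ?(ltW r1)//.
  by rewrite ltW// sphere_areaR_gt0.
by rewrite ler_pdivlMr// mulrC -ler_pdivlMr// exprn_gt0.
Qed.

Lemma ring_mod_ge (C0 C1 : set Rb) (X : R) : (0 < X)%R ->
  modulus (ring_curves C0 C1) <= (w / X ^+ m)%:E -> X%:E <= ring_mod C0 C1.
Proof.
by move=> X0 h; rewrite /ring_mod sphere_areaRE; apply: mod_ge => //; exact: modulus_ge0.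
Qed.

Lemma ring_mod_le (C0 C1 : set Rb) (X : R) : (0 < X)%R ->
  (w / X ^+ m)%:E <= modulus (ring_curves C0 C1) -> ring_mod C0 C1 <= X%:E.
Proof.
by move=> X0 h; rewrite /ring_mod sphere_areaRE; apply: mod_le => //; exact: modulus_ge0.
Qed.

Lemma ring_mod_gt (C0 C1 : set Rb) (X : R) : (0 < X)%R -> X%:E < ring_mod C0 C1 ->
  exists2 rho, admissible (ring_curves C0 C1) rho & \int[mu]_x (rho x ^+ n) < (w / X ^+ m)%:E.
Proof.
move=> X0 h.
have : modulus (ring_curves C0 C1) < (w / X ^+ m)%:E.
  by rewrite ltNge; apply/negP => /(ring_mod_le X0); rewrite leNgt h.
by move=> /ereal_inf_lt [_ [rho arho <-] ?]; exists rho.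
Qed.

Lemma ring_mod_adm (C0 C1 : set Rb) (X : R) rho : (0 < X)%R ->
  admissible (ring_curves C0 C1) rho -> \int[mu]_x (rho x ^+ n) <= (w / X ^+ m)%:E ->
  X%:E <= ring_mod C0 C1.
Proof.
move=> X0 arho h; apply: ring_mod_ge => //; apply: le_trans h.
by apply: ereal_inf_lbound; exists rho.
Qed.

Lemma ring_curvesC (C0 C1 : set Rb) : ring_curves C0 C1 = ring_curves C1 C0.
Proof.
rewrite /ring_curves /ring_dom; apply/seteqP; split=> g [a [b [ab dg h inn]]]; exists a, b;
  split=> //; first [by case: h; [right|left] | by rewrite setUC].
Qed.

Lemma ring_modC (C0 C1 : set Rb) : ring_mod C0 C1 = ring_mod C1 C0.
Proof. by rewrite /ring_mod ring_curvesC. Qed.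
End ring_modulus.

(** * Lipschitz potentials and their upper gradients *)

Section upper_gradients.
Context {R : realType} {n : nat}.
Local Notation Rn := 'rV[R]_n.
Local Notation Rb := (Rbar R n).
Local Notation mu := (@lebesgue_rV R n).
Local Open Scope ereal_scope.

(** Stronger than the usual notion: [g x] bounds the difference quotients of u for all pairs of
    points close to x, at a scale h independent of x. Difference quotients of u along a 1-Lipschitz
    curve are then bounded by g on the curve, and u is never differentiated. *)
Record upper_gradient (u g : Rn -> R) : Prop := UpperGradient {
  ug_lipschitz : exists2 K, (0 <= K)%R & forall x y, (`|u x - u y| <= K * enorm (x - y))%R;
  ug_measurable : measurable_fun setT (g : borel_rV R n -> R);
  ug_ge0 : forall x, (0 <= g x)%R;
  ug_local : exists2 h, (0 < h)%R & forall x y z, (enorm (y - x) < h)%R -> (enorm (z - x) < h)%R ->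
    (`|u y - u z| <= g x * enorm (y - z))%R }.

Definition energy (g : Rn -> R) : \bar R := \int[mu]_x (g x ^+ n)%:E.

(** [difference_quotient_bound] is applied with a step k below the scale of [ug_local]; its error 2
    K k is made smaller than any e. *)
Lemma upper_gradient_path u g (gamma : R -> Rn) (L : R) : upper_gradient u g -> (0 <= L)%R ->
  (forall s t, (enorm (gamma s - gamma t) <= `|s - t|)%R) ->
  (u (gamma L) - u (gamma 0%R))%:E <= path_cost (EFin \o g) gamma L.
Proof.
move=> [[K K0 lu] mg g0 [h h0 loc]] L0 lg.
have lF s t : (`|u (gamma s) - u (gamma t)| <= K * `|s - t|)%R.
  by apply: le_trans (lu _ _) _; rewrite ler_wpM2l.
apply/lee_addgt0Pr => e e0.
pose k := (Num.min (h / 2) (e / (2 * K + 1)))%R.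
have K1 : (0 < 2 * K + 1)%R by rewrite ltr_wpDl// mulr_ge0.
have k0 : (0 < k)%R by rewrite lt_min !divr_gt0.
have kh : (k < h)%R by rewrite gt_min ltr_pdivrMr// ltr_pMr// (_ : (1 < 2 :> R)%R) ?orbT//; rewrite ltr1n.
have ke : (2 * K * k <= e)%R.
  have : (k <= e / (2 * K + 1))%R by rewrite ge_min lexx orbT.
  rewrite ler_pdivlMr//; lra.
have mG : measurable_fun [set: R] (fun s => (g (gamma s))%:E).
  apply: (@measurable_along _ _ (EFin \o g)) => //; exact/measurable_EFinP.
have FG s : (0 <= s <= L)%R -> (u (gamma (s + k)%R) - u (gamma s))%:E <= k%:E * (g (gamma s))%:E.
  move=> _; rewrite -EFinM lee_fin.
  have d : (enorm (gamma (s + k) - gamma s) <= k)%R.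
    by apply: le_trans (lg _ _) _; rewrite addrAC subrr add0r gtr0_norm.
  apply: le_trans (ler_norm _) _; apply: le_trans (loc (gamma s) _ _ _ _) _.
  - exact: le_lt_trans d kh.
  - by rewrite subrr enorm0.
  - by rewrite mulrC ler_wpM2r.
have := difference_quotient_bound k0 L0 K0 lF mG (fun s => ltac:(by rewrite lee_fin)) FG.
rewrite /path_cost /= => h1; rewrite -leeBlDr//; apply: le_trans h1.
by rewrite -EFinB lee_fin; lra.
Qed.

Lemma path_cost_itvoo (rho : borel_rV R n -> \bar R) (gamma : R -> Rn) (L : R) :
  measurable_fun setT rho -> (forall x, 0 <= rho x) ->
  (forall s t, (enorm (gamma s - gamma t) <= `|s - t|)%R) ->
  path_cost rho gamma L = \int[lebesgue_measure]_(s in [set` `]0%R, L[%R]) rho (gamma s).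
Proof.
move=> mrho rho0 lg; have mG := measurable_along mrho lg.
rewrite /path_cost -integral_itv_obnd_cbnd; last exact: measurable_funTS.
by rewrite -integral_itv_bndo_bndc//; exact: measurable_funTS.
Qed.

(** The two endpoints of an arc lie on the continua, possibly outside A. The open parameter interval
    carries the same integral, and there the indicator of A equals 1. *)
Lemma upper_gradient_admissible u g (A : set Rn) (C0 C1 : set Rb) : upper_gradient u g ->
  measurable (A : set (borel_rV R n)) ->
  (forall x, ring_dom C0 C1 (Some x) -> A x) ->
  (forall x, C0 (Some x) -> u x <= 0)%R -> (forall x, C1 (Some x) -> 1 <= u x)%R ->
  admissible (ring_curves C0 C1) (fun x => (g x * \1_A x)%:E).
Proof.
move=> ug mA dA u0 u1; have mg := ug_measurable ug; have g0 := ug_ge0 ug.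
have mgE : measurable_fun setT (EFin \o (g : borel_rV R n -> R)) by exact/measurable_EFinP.
have mr : measurable_fun setT (fun x : borel_rV R n => (g x * \1_A x)%:E).
  by apply/measurable_EFinP; exact: measurable_funM.
have r0 x : 0 <= (g x * \1_A x)%:E by rewrite lee_fin mulr_ge0.
apply: admissible_arcs => // gamma L L0 lg h0 h1 inn.
have := upper_gradient_path ug L0 lg; rewrite !path_cost_itvoo//.
rewrite (_ : \int[_]_(s in _) _ = \int[lebesgue_measure]_(s in [set` `]0%R, L[%R]) (g (gamma s) * \1_A (gamma s))%:E).
  apply: le_trans; rewrite lee_fin; have := u0 _ h0; have := u1 _ h1; lra.
apply: eq_integral => s /[!inE] /=; rewrite in_itv/= => hs.
by rewrite indicE mem_set ?mulr1//; apply: dA; exact: inn.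
Qed.

Lemma upper_gradient_modulus u g (C0 C1 : set Rb) : upper_gradient u g ->
  (forall x, C0 (Some x) -> u x <= 0)%R -> (forall x, C1 (Some x) -> 1 <= u x)%R ->
  modulus (ring_curves C0 C1) <= energy g.
Proof.
move=> ug u0 u1; have := upper_gradient_admissible ug measurableT (fun=> fun=> I) u0 u1.
move=> adm; apply: le_trans (ereal_inf_lbound _) _; first by exists (fun x => (g x * \1_setT x)%:E); [exact: adm|reflexivity].
by rewrite /energy; under eq_integral do rewrite indicT mulr1 -EFin_expe.
Qed.

Lemma upper_gradient_affine u g (a : Rn) (r : R) : (0 < r)%R -> upper_gradient u g ->
  upper_gradient (fun x => u (r^-1 *: (x - a))%R) (fun x => r^-1 * g (r^-1 *: (x - a)))%R.
Proof.
move=> r0 [[K K0 lu] mg g0 [h h0 loc]].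
have ri : (0 < r^-1)%R by rewrite invr_gt0.
have e x y : (enorm (r^-1 *: (x - a) - r^-1 *: (y - a)) = r^-1 * enorm (x - y))%R.
  by rewrite -scalerBr opprB addrA subrK enormZ gtr0_norm.
split.
- exists (K * r^-1)%R; first by rewrite mulr_ge0// ltW.
  by move=> x y; rewrite -mulrA -e.
- apply: measurable_funM; first exact: measurable_cst.
  apply: (measurableT_comp mg); apply: measurable_rVZ; first exact: measurable_cst.
  exact: measurable_rV_sub.
- by move=> x; rewrite mulr_ge0// ltW.
- exists (r * h)%R; first by rewrite mulr_gt0.
  move=> x y z yx zx; rewrite (mulrC r^-1%R) -mulrA -e; apply: loc; rewrite e mulrC ltr_pdivrMr// mulrC//.
Qed.

(** The exponent equals the dimension: this is the conformal invariance of the energy for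
    similarities. *)
Lemma energy_affine g (a : Rn) (r : R) : (0 < r)%R -> (forall x, 0 <= g x)%R ->
  measurable_fun setT (g : borel_rV R n -> R) ->
  energy (fun x => r^-1 * g (r^-1 *: (x - a)))%R = energy g.
Proof.
move=> r0 g0 mg; rewrite /energy.
have mgn : measurable_fun setT (fun x : borel_rV R n => (g x ^+ n)%:E).
  by apply/measurable_EFinP; exact: measurable_funX.
have gn0 x : 0 <= (g x ^+ n)%:E by rewrite lee_fin exprn_ge0.
have mgz : measurable_fun setT (fun x : borel_rV R n => (g (r^-1 *: (x : Rn))%R ^+ n)%:E).
  by apply: (measurableT_comp mgn); apply: measurable_rVZ; [exact: measurable_cst|exact: measurable_id].
have mgd : measurable_fun setT (fun x : borel_rV R n => (g (r^-1 *: ((x : Rn) - a))%R ^+ n)%:E).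
  by apply: (measurableT_comp mgz); apply: measurable_rVD; [exact: measurable_id|exact: measurable_cst].
transitivity ((r^-1 ^+ n)%:E * \int[mu]_x (g (r^-1 *: ((x : Rn) - a))%R ^+ n)%:E).
  rewrite -ge0_integralZl//; last by rewrite lee_fin exprn_ge0// invr_ge0 ltW.
  by apply: eq_integral => x _; rewrite exprMn EFinM.
have gz0 x : 0 <= (g (r^-1 *: (x : Rn))%R ^+ n)%:E by rewrite lee_fin exprn_ge0.
have -> : \int[mu]_x (g (r^-1 *: ((x : Rn) - a))%R ^+ n)%:E = \int[mu]_x (g (r^-1 *: (x : Rn))%R ^+ n)%:E.
  exact: (ge0_integral_rVD (- a)%R mgz gz0).
rewrite (ge0_integral_rVZ _ mgn gn0) ?invr_gt0// muleA -EFinM exprVn invrK mulVf ?mul1e//.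
by rewrite expf_neq0 ?gt_eqF.
Qed.

Lemma upper_gradient_linear u1 g1 u2 g2 (a b c : R) : upper_gradient u1 g1 -> upper_gradient u2 g2 ->
  upper_gradient (fun x => a * u1 x + b * u2 x + c)%R (fun x => `|a| * g1 x + `|b| * g2 x)%R.
Proof.
move=> [[K K0 lu] mg g0 [h h0 loc]] [[K' K'0 lu'] mg' g'0 [h' h'0 loc']].
have e x y : (`|a * u1 x + b * u2 x + c - (a * u1 y + b * u2 y + c)| <=
    `|a| * `|u1 x - u1 y| + `|b| * `|u2 x - u2 y|)%R.
  rewrite (_ : _ - _ = a * (u1 x - u1 y) + b * (u2 x - u2 y))%R; last by ring.
  by rewrite -!normrM ler_normD.
split.
- exists (`|a| * K + `|b| * K')%R; first by rewrite addr_ge0// mulr_ge0.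
  move=> x y; apply: le_trans (e _ _) _; rewrite mulrDl -!mulrA.
  by apply: lerD; rewrite ler_wpM2l.
- by apply: measurable_funD; apply: measurable_funM => //; exact: measurable_cst.
- by move=> x; rewrite addr_ge0// mulr_ge0.
- exists (Num.min h h'); first by rewrite lt_min h0.
  move=> x y z; rewrite !lt_min => /andP[y1 y2] /andP[z1 z2].
  apply: le_trans (e _ _) _; rewrite mulrDl -!mulrA.
  by apply: lerD; rewrite ler_wpM2l//; [exact: loc|exact: loc'].
Qed.

Lemma upper_gradient_comp u g (phi : R -> R) : (forall s t, `|phi s - phi t| <= `|s - t|)%R ->
  upper_gradient u g -> upper_gradient (phi \o u) g.
Proof.
move=> lp [[K K0 lu] mg g0 [h h0 loc]]; split=> //.
  by exists K => // x y; exact: le_trans (lp _ _) (lu _ _).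
by exists h => // x y z yx zx; exact: le_trans (lp _ _) (loc _ _ _ yx zx).
Qed.

(** Around a point outside A the potential is constant at the scale e, so 0 is a valid gradient
    there. This is how [inner_chain] makes the supports of two gradients disjoint. *)
Lemma upper_gradient_restrict u g (A : set Rn) (e : R) : upper_gradient u g -> (0 < e)%R ->
  measurable (A : set (borel_rV R n)) ->
  (forall x y z, ~ A x -> enorm (y - x) < e -> enorm (z - x) < e -> u y = u z)%R ->
  upper_gradient u (fun x => g x * \1_A x)%R.
Proof.
move=> [lu mg g0 [h h0 loc]] e0 mA uA; split=> //.
- by apply: measurable_funM.
- by move=> x; rewrite mulr_ge0.
exists (Num.min h e); first by rewrite lt_min h0.
move=> x y z; rewrite !lt_min => /andP[y1 y2] /andP[z1 z2]; rewrite indicE.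
have [/set_mem Ax|/negP nAx] := boolP (x \in A); first by rewrite mulr1; exact: loc.
by rewrite (uA x y z) ?subrr ?normr0 ?mulr0 ?mul0r// => Ax; apply: nAx; exact: mem_set.
Qed.
End upper_gradients.

(** * Tonelli on subsets and absolute continuity of the integral *)

Section integration_complements.
Context {R : realType}.
Local Open Scope ereal_scope.

Lemma integral_indicM d (T : measurableType d) (mu : {measure set T -> \bar R}) (D : set T) (f : T -> \bar R) :
  \int[mu]_(x in D) f x = \int[mu]_x (f x * (\1_D x)%:E).
Proof.
rewrite integral_mkcond; apply: eq_integral => x _; rewrite /patch indicE.
by case: (x \in D); rewrite ?mule1 ?mule0.
Qed.

Lemma ge0_integral_cstDZ d (T : measurableType d) (mu : {measure set T -> \bar R}) (D : set T)
    (a b : R) (f : T -> \bar R) : measurable D -> measurable_fun D f -> (forall x, 0 <= f x) ->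
  (0 <= a)%R -> (0 <= b)%R ->
  \int[mu]_(x in D) (a%:E + b%:E * f x) = a%:E * mu D + b%:E * \int[mu]_(x in D) f x.
Proof.
move=> mD mf f0 a0 b0; rewrite ge0_integralD//; last 2 first.
- by move=> x _; rewrite mule_ge0// lee_fin.
- exact: measurable_funeM.
by rewrite integral_cst// ge0_integralZl.
Qed.

Section tonelli.
Context d1 d2 (T1 : measurableType d1) (T2 : measurableType d2).
Variables (m1 : {sigma_finite_measure set T1 -> \bar R}) (m2 : {sigma_finite_measure set T2 -> \bar R}).
Variables (A : set T1) (B : set T2) (h : T1 * T2 -> \bar R).
Hypotheses (mA : measurable A) (mB : measurable B) (mh : measurable_fun setT h) (h0 : forall p, 0 <= h p).

Let mia : measurable_fun setT (\1_A : T1 -> R). Proof. exact: measurable_indic. Qed.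
Let mib : measurable_fun setT (\1_B : T2 -> R). Proof. exact: measurable_indic. Qed.

Let k (p : T1 * T2) := h p * (\1_A p.1)%:E * (\1_B p.2)%:E.

Let mk : measurable_fun setT k.
Proof.
apply: emeasurable_funM; first apply: emeasurable_funM => //.
  apply/measurable_EFinP; exact: (measurableT_comp mia measurable_fst).
by apply/measurable_EFinP; exact: (measurableT_comp mib measurable_snd).
Qed.

Let k0 p : 0 <= k p.
Proof. by rewrite /k !mule_ge0// lee_fin. Qed.

Lemma ge0_measurable_inner : measurable_fun setT (fun x => \int[m2]_(y in B) h (x, y)).
Proof.
have mh' : measurable_fun setT (fun p : T1 * T2 => h p * (\1_B p.2)%:E).
  apply: emeasurable_funM => //; apply/measurable_EFinP.
  exact: (measurableT_comp mib measurable_snd).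
have h'0 p : 0 <= h p * (\1_B p.2)%:E by rewrite mule_ge0// lee_fin.
apply: (eq_measurable_fun (fubini_F m2 (fun p : T1 * T2 => h p * (\1_B p.2)%:E))).
  by move=> x _; rewrite /fubini_F [in RHS]integral_indicM.
exact: measurable_fun_fubini_tonelli_F.
Qed.

Lemma ge0_tonelli : \int[m1]_(x in A) \int[m2]_(y in B) h (x, y) =
  \int[m2]_(y in B) \int[m1]_(x in A) h (x, y).
Proof.
have e1 : \int[m1]_(x in A) \int[m2]_(y in B) h (x, y) = \int[m1]_x \int[m2]_y k (x, y).
  rewrite integral_indicM; apply: eq_integral => x _.
  rewrite integral_indicM muleC -ge0_integralZl//; last first.
  - by move=> y _; rewrite mule_ge0// lee_fin.
  - apply: emeasurable_funM; first exact: (measurableT_comp mh (pair1_measurable x)).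
    by apply/measurable_EFinP; exact: measurable_indic.
  by apply: eq_integral => y _; rewrite /k /= muleA (muleC (\1_A x)%:E).
have e2 : \int[m2]_(y in B) \int[m1]_(x in A) h (x, y) = \int[m2]_y \int[m1]_x k (x, y).
  rewrite integral_indicM; apply: eq_integral => y _.
  rewrite integral_indicM muleC -ge0_integralZl//; last first.
  - by move=> x _; rewrite mule_ge0// lee_fin.
  - apply: emeasurable_funM; first exact: (measurableT_comp mh (pair2_measurable y)).
    by apply/measurable_EFinP; exact: measurable_indic.
  by apply: eq_integral => x _; rewrite /k /= muleC.
by rewrite e1 e2; exact: (@fubini_tonelli _ _ _ _ R m1 m2 _ mk k0).
Qed.
End tonelli.

(** f may be infinite on a null set; the absolute continuity of the integral is applied to its
    finite part, which is equal to f almost everywhere. *)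
Lemma integral_small_sets d (T : measurableType d) (mu : {measure set T -> \bar R}) (f : T -> \bar R) (e : R) :
  measurable_fun setT f -> (forall x, 0 <= f x) -> \int[mu]_x f x < +oo -> (0 < e)%R ->
  exists2 r : R, (0 < r)%R & forall A, measurable A -> mu A < r%:E -> \int[mu]_(x in A) f x < e%:E.
Proof.
move=> mf f0 foo e0.
have intf : mu.-integrable setT f.
  by apply/integrableP; split=> //; under eq_integral do rewrite gee0_abs//.
pose g x := fine (f x).
have mg : measurable_fun setT g by exact: measurableT_comp.
have fg : ae_eq mu setT f (EFin \o g).
  have := integrable_ae measurableT intf; apply: filterS => x /(_ I) fx _ /=.
  by rewrite /g fineK.
have g0 x : (0 <= g x)%R by rewrite fine_ge0.
have intg : mu.-integrable setT (EFin \o g).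
  apply/integrableP; split; first exact/measurable_EFinP.
  have ef : \int[mu]_x f x = \int[mu]_x (g x)%:E.
    apply: ge0_ae_eq_integral => //; first exact/measurable_EFinP.
    by move=> x _; rewrite lee_fin.
  by under eq_integral do rewrite /= ger0_norm//; rewrite -ef.
have [r [r0 hr]] := integral_normr_continuous intg e0.
exists r => // A mA Ar; have {hr} := hr A mA Ar.
have -> : \int[mu]_(x in A) f x = \int[mu]_(x in A) (g x)%:E.
  apply: ge0_ae_eq_integral => //; [exact: measurable_funTS| | |].
  - by apply: measurable_funTS; exact/measurable_EFinP.
  - by move=> x _; rewrite lee_fin.
  - exact: ae_eq_subset fg.
rewrite /Rintegral.
have -> : \int[mu]_(x in A) (`|g x|)%:E = \int[mu]_(x in A) (g x)%:E.
  by apply: eq_integral => x _; rewrite ger0_norm.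
have fi : \int[mu]_(x in A) (g x)%:E \is a fin_num.
  by apply: integrable_fin_num => //; exact: integrableS intg.
by move=> h; rewrite -(fineK fi) lte_fin.
Qed.
End integration_complements.

(** * Cubes and segments *)

Section segment_costs.
Context {R : realType} {n : nat}.
Local Notation Rn := 'rV[R]_n.
Local Open Scope ereal_scope.
Local Notation mu := (@lebesgue_rV R n).

Definition cube (p : Rn) (r : R) : set (borel_rV R n) := [set x : Rn | forall i, (`|x ord0 i - p ord0 i| < r)%R].

Lemma cube_ball (p : Rn) (r : R) : (0 < r)%R -> cube p r = ball p r.
Proof.
move=> r0; apply/seteqP; split=> x /=; last by move/ball_rVE => h i; rewrite distrC; exact: h.
by move=> h; apply/ball_rVE => // i; rewrite distrC; exact: h.
Qed.

Lemma cube_measurable p r : (0 < r)%R -> measurable (cube p r).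
Proof. by move=> r0; rewrite cube_ball//; apply: open_rV_measurable; exact: ball_open. Qed.

Lemma lebesgue_cubeE p r : (0 < r)%R -> mu (cube p r) = ((2 * r) ^+ n)%:E.
Proof. exact: lebesgue_cube. Qed.

Lemma cube_convex p r (x y : Rn) (t : R) : (0 <= t <= 1)%R -> cube p r x -> cube p r y ->
  cube p r (x + t *: (y - x))%R.
Proof.
move=> /andP[t0 t1] hx hy i; rewrite !mxE.
rewrite (_ : _ - _ = (1 - t) * (x ord0 i - p ord0 i) + t * (y ord0 i - p ord0 i))%R; last by ring.
apply: le_lt_trans (ler_normD _ _) _; rewrite !normrM (ger0_norm t0) ger0_norm ?subr_ge0//.
have := hx i; have := hy i; move: (`|_|)%R (`|_|)%R => a b ha hb.
have [->|t2] := eqVneq t 1%R; first by rewrite subrr mul0r add0r mul1r.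
have t3 : (0 < 1 - t)%R by rewrite subr_gt0 lt_neqAle t2.
have h1 : ((1 - t) * a < (1 - t) * r)%R by rewrite ltr_pM2l.
have h2 : (t * b <= t * r)%R by rewrite ler_wpM2l// ltW.
lra.
Qed.

Lemma cube_dist p r (x y : Rn) : cube p r x -> cube p r y -> (enorm (x - y) <= n%:R * (2 * r))%R.
Proof.
move=> hx hy; apply: le_trans (enorm_le_norm _) _.
have [n0|n0] := posnP n; first by rewrite (_ : n%:R = 0 :> R)%R ?mul0r// n0.
have r0 : (0 <= r)%R by exact: le_trans (ltW (hx (Ordinal n0))).
rewrite ler_wpM2l//; apply: norm_le_coord; first by rewrite mulr_ge0.
move=> i; rewrite !mxE.
have h1 := hx i; have h2 := hy i; rewrite ltr_norml in h1; rewrite ltr_norml in h2.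
rewrite ler_norml; lra.
Qed.

Lemma segment_point_measurable (x y : Rn) :
  measurable_fun [set: R] (fun t : R => (x + t *: (y - x))%R : borel_rV R n).
Proof.
apply: measurable_rVD; first exact: measurable_cst.
by apply: measurable_rVZ; [exact: measurable_id|exact: measurable_cst].
Qed.

Lemma segment_cost_ge0 (rho : Rn -> \bar R) x y : (forall x, 0 <= rho x) -> 0 <= segment_cost rho x y.
Proof. by move=> r0; rewrite mule_ge0 ?lee_fin ?enorm_ge0//; exact: integral_ge0. Qed.

Lemma segment_cost_measurable (rho : borel_rV R n -> \bar R) (c : Rn) : measurable_fun setT rho ->
  (forall x, 0 <= rho x) -> measurable_fun setT (segment_cost rho c : borel_rV R n -> \bar R).
Proof.
move=> mrho rho0; apply: emeasurable_funM.
  apply/measurable_EFinP; apply: (measurableT_comp (continuous_rV_measurable (@enorm_continuous R n))).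
  exact: measurable_rV_sub.
pose h (q : borel_rV R n * measurableTypeR R) := rho (c + q.2 *: ((q.1 : Rn) - c))%R.
have mh : measurable_fun setT h.
  apply: (measurableT_comp mrho); apply: measurable_rVD; first exact: measurable_cst.
  apply: measurable_rVZ; first exact: measurable_snd.
  by apply: measurable_rVD; [exact: measurable_fst|exact: measurable_cst].
exact: (@ge0_measurable_inner R _ _ _ _ (@lebesgue_measure R) _ h (measurable_itv _) mh (fun=> rho0 _)).
Qed.

Lemma segment_costC (rho : borel_rV R n -> \bar R) (x y : Rn) : measurable_fun setT rho ->
  (forall x, 0 <= rho x) -> segment_cost rho x y = segment_cost rho y x.
Proof.
move=> mrho r0; rewrite /segment_cost enormC; congr (_ * _).
have mf : measurable_fun [set: R] (fun t : R => rho (y + t *: (x - y))%R).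
  exact: (measurableT_comp mrho (segment_point_measurable y x)).
rewrite -(ge0_integral_itv_flip mf)//; apply: eq_integral => t _; congr rho.
by apply/rowP => i; rewrite !mxE; ring.
Qed.

Lemma segment_cost_le (rho : borel_rV R n -> \bar R) (x y : Rn) (K : R) : measurable_fun setT rho ->
  (forall x, 0 <= rho x) -> (0 <= K)%R ->
  (forall t : R, (0 <= t <= 1)%R -> rho (x + t *: (y - x))%R <= K%:E) ->
  segment_cost rho x y <= (K * enorm (y - x))%:E.
Proof.
move=> mrho r0 K0 hK; rewrite mulrC EFinM; apply: lee_wpmul2l; first by rewrite lee_fin enorm_ge0.
have <- : \int[lebesgue_measure]_(t in [set` `[0%R, 1%R]%R]) K%:E = K%:E.
  by rewrite integral_cst_itv// subr0 mulr1.
apply: ge0_le_integral => //.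
- by apply: measurable_funTS; exact: (measurableT_comp mrho (segment_point_measurable x y)).
Qed.
End segment_costs.

(** * A Morrey-type estimate *)

Section cube_average.
Context {R : realType} {m : nat}.
Hypothesis m0 : (0 < m)%N.
Local Notation Rm := 'rV[R]_m.
Local Open Scope ereal_scope.
Local Notation leb := (@lebesgue_measure R).
Local Notation mu := (@lebesgue_rV R m).
Variables (g : borel_rV R m -> \bar R) (p c : Rm) (r k : R).
Hypotheses (mg : measurable_fun setT g) (g0 : forall x, 0 <= g x).
Hypotheses (r0 : (0 < r)%R) (k0 : (0 < k)%R) (Qc : cube p r c).
Local Notation Q := (cube p r).
Local Notation N := (2 * m).-1.

Let NE : N.+1 = (2 * m)%N. Proof. by rewrite prednK// muln_gt0. Qed.

(** The homothety of ratio t centered at c has Jacobian t^m, and the convexity of the cube keeps its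
    image inside. *)
Let contraction (t : R) : (0 < t)%R -> (t <= 1)%R ->
  \int[mu]_(y in Q) (g (c + t *: ((y : Rm) - c))%R ^+ m.+1) <= (t ^- m)%:E * \int[mu]_(y in Q) (g y ^+ m.+1).
Proof.
move=> t0 t1.
pose G (y : borel_rV R m) := g y ^+ m.+1 * (\1_Q y)%:E.
have mG : measurable_fun setT G.
  apply: emeasurable_funM; first exact: measurable_fun_expe.
  by apply/measurable_EFinP; apply: measurable_indic; exact: cube_measurable.
have G0 y : 0 <= G y by rewrite mule_ge0 ?expe_ge0// lee_fin.
have mGc : measurable_fun setT (fun y : borel_rV R m => G (c - t *: c + (y : Rm))%R).
  by apply: (measurableT_comp mG); apply: measurable_rVD; [exact: measurable_cst|exact: measurable_id].
have -> : \int[mu]_(y in Q) (g y ^+ m.+1) = \int[mu]_y G y by rewrite integral_indicM.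
have -> : \int[mu]_y G y = \int[mu]_y G (c - t *: c + (y : Rm))%R.
  have := ge0_integral_rVD (c - t *: c)%R mG G0.
  by under eq_integral do rewrite addrC.
rewrite -(ge0_integral_rVZ t0 mGc)// integral_indicM; apply: ge0_le_integral => //.
- by move=> y _; rewrite mule_ge0 ?expe_ge0// lee_fin.
- apply: emeasurable_funM; last by apply/measurable_EFinP; apply: measurable_indic; exact: cube_measurable.
  apply: measurable_fun_expe; apply: (measurableT_comp mg).
  exact: measurable_rV_homothety.
- by apply: (measurableT_comp mGc); apply: measurable_rVZ; [exact: measurable_cst|exact: measurable_id].
move=> y _; rewrite /G (_ : c - t *: c + t *: (y : Rm) = c + t *: ((y : Rm) - c))%R; last first.
  by rewrite scalerBr addrAC addrA.
rewrite !indicE; have [/set_mem Qy|] := boolP (y \in Q); last first.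
  by rewrite mule0 => _; rewrite mule_ge0 ?expe_ge0// lee_fin.
by rewrite mem_set//; apply: cube_convex => //; rewrite t1 ltW.
Qed.

(** The exponent m + 1 exceeds the dimension m of the cube, which makes the mean cost of the
    segments issued from c controllable although they all pass near c. The singular factor t^-m of
    [contraction] is absorbed by the substitution t = s^(2m). *)
Lemma cube_segment_cost :
  \int[mu]_(y in Q) segment_cost g c y <=
  (m%:R * (2 * r) * (2 * m)%:R)%:E * ((k * (2 * r) ^+ m)%:E + (k ^- m)%:E * \int[mu]_(y in Q) (g y ^+ m.+1)).
Proof.
have two_m : (0 < (2 * m)%:R :> R)%R by rewrite ltr0n muln_gt0.
pose I : set R := [set` `]0%R, 1%R]%R].
have mIl : measurable I by exact: measurable_itv.
have mQ := cube_measurable p r0.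
pose T (s : R) (y : Rm) : Rm := (c + s ^+ (2 * m) *: (y - c))%R.
have mT : measurable_fun setT (fun q : borel_rV R m * measurableTypeR R => T q.2 q.1 : borel_rV R m).
  apply: measurable_rVD; first exact: measurable_cst.
  apply: measurable_rVZ; first by apply: measurable_funX; exact: measurable_snd.
  by apply: measurable_rVD; [exact: measurable_fst|exact: measurable_cst].
pose h (q : borel_rV R m * measurableTypeR R) := g (T q.2 q.1) * ((2 * m)%:R * (`|q.2| ^+ N))%:E.
have mh : measurable_fun setT h.
  apply: emeasurable_funM; first exact: (measurableT_comp mg mT).
  apply/measurable_EFinP; apply: measurable_funM; first exact: measurable_cst.
  apply: measurable_funX; apply: (measurableT_comp (@normr_measurable R setT)); exact: measurable_snd.
have h0 q : 0 <= h q by rewrite mule_ge0// lee_fin mulr_ge0// exprn_ge0.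
have segE y : \int[leb]_(t in [set` `[0%R, 1%R]%R]) g (c + t *: (y - c))%R = \int[leb]_(s in I) h (y, s).
  pose f (t : R) := g (c + t *: (y - c))%R * (\1_I t)%:E.
  have mf : measurable_fun [set: R] f.
    apply: emeasurable_funM; first exact: (measurableT_comp mg (segment_point_measurable c y)).
    by apply/measurable_EFinP; apply: measurable_indic.
  have f0 t : 0 <= f t by rewrite mule_ge0// lee_fin.
  transitivity (\int[leb]_(t in [set` `]0%R, +oo[%R]) f t).
    rewrite -integral_itv_obnd_cbnd; last first.
      by apply: measurable_funTS; exact: (measurableT_comp mg (segment_point_measurable c y)).
    rewrite integral_indicM [RHS]integral_indicM; apply: eq_integral => t _.
    rewrite /f -muleA -EFinM; congr (_ * _%:E); rewrite !indicE !mem_setE !in_itv/= andbT.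
    by case: ltP; rewrite ?mulr1 ?mulr0.
  rewrite -(substitution_expn N mf f0) integral_indicM [RHS]integral_indicM.
  apply: eq_integral => s _; rewrite !indicE !mem_setE !in_itv/= andbT.
  have [s0|s0] := ltP 0%R s; last by rewrite !mule0.
  rewrite mule1 /f /h /= /T NE (gtr0_norm s0) indicE mem_setE in_itv/= exprn_gt0//=.
  by rewrite expr_le1 ?muln_gt0 ?(ltW s0)// muleAC.
pose D := (m%:R * (2 * r))%R.
have D0 : (0 <= D)%R by rewrite !mulr_ge0// ltW.
pose W := \int[mu]_(y in Q) (g y ^+ m.+1).
have W0 : 0 <= W by apply: integral_ge0 => y _; exact: expe_ge0.
have mhI := @ge0_measurable_inner R _ _ _ _ leb I h mIl mh h0.
apply: (@le_trans _ _ (D%:E * \int[mu]_(y in Q) \int[leb]_(s in I) h (y, s))).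
  rewrite -ge0_integralZl//; last 2 first.
  - exact: measurable_funTS.
  - by move=> y _; exact: integral_ge0.
  apply: ge0_le_integral => //.
  - by move=> y _; exact: segment_cost_ge0.
  - apply: measurable_funTS; rewrite /segment_cost; under eq_fun do rewrite segE.
    apply: emeasurable_funM => //; apply/measurable_EFinP.
    apply: (measurableT_comp (continuous_rV_measurable (@enorm_continuous R m))).
    exact: measurable_rV_sub.
  - by apply: measurable_funTS; exact: measurable_funeM.
  - move=> y Qy; rewrite /segment_cost segE; apply: lee_wpmul2r; first exact: integral_ge0.
    by rewrite lee_fin; exact: cube_dist Qy Qc.
rewrite (@ge0_tonelli R _ _ _ _ mu leb Q I h mQ mIl mh h0) -/D (EFinM D) -muleA.
apply: lee_wpmul2l; first by rewrite lee_fin.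
pose c1 := ((2 * m)%:R%:E * ((k * (2 * r) ^+ m)%:E + (k ^- m)%:E * W)).
apply: (@le_trans _ _ (\int[leb]_(s in I) c1)); last first.
  have leb1 : lebesgue_measure [set` `]0%R, 1%R]%R] = 1 :> \bar R.
    by rewrite lebesgue_measure_itv/= lte_fin ltr01 sube0.
  by rewrite integral_cst// [X in _ * X]leb1 mule1.
apply: ge0_le_integral => //.
- by move=> s _; exact: integral_ge0.
- apply: measurable_funTS; apply: (@ge0_measurable_inner R _ _ (measurableTypeR R) _ mu Q (fun q => h (q.2, q.1)) mQ) => //.
  exact: (measurableT_comp mh (measurable_swap (T1 := measurableTypeR R) (T2 := borel_rV R m))).
move=> s; rewrite /I /= in_itv/= => /andP[s0 s1].
have sN : (0 < s ^+ N)%R by rewrite exprn_gt0.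
have mTs : measurable_fun setT (T s : borel_rV R m -> borel_rV R m).
  exact: measurable_rV_homothety.
have mgT : measurable_fun setT (fun y : borel_rV R m => g (T s y) ^+ m.+1).
  by apply: measurable_fun_expe; exact: (measurableT_comp mg mTs).
pose a := ((2 * m)%:R * k)%R.
pose b := ((2 * m)%:R * k ^- m * s ^+ (N * m.+1))%R.
have a0 : (0 <= a)%R by rewrite mulr_ge0 ?(ltW k0).
have b0 : (0 <= b)%R by rewrite !mulr_ge0 ?invr_ge0 ?exprn_ge0 ?(ltW k0) ?(ltW s0).
apply: (@le_trans _ _ (\int[mu]_(y in Q) (a%:E + b%:E * g (T s y) ^+ m.+1))).
  apply: ge0_le_integral => //.
  - by apply: measurable_funTS; apply: (measurableT_comp mh); exact: (pair2_measurable s).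
  - apply: emeasurable_funD; first exact: measurable_cst.
    by apply: measurable_funTS; exact: measurable_funeM.
  move=> y _; rewrite /h /= (gtr0_norm s0).
  (* The splitting scale depends on s: with k / s^N, the weight s^N of the substitution turns the
     first term into a constant and gives the second the power s^(N (m + 1)). *)
  have kN : (0 < k / s ^+ N)%R by rewrite divr_gt0.
  have := le_power_splite m kN (g0 (T s y)).
  move/(lee_wpmul2r (_ : 0 <= ((2 * m)%:R * s ^+ N)%:E)).
  rewrite lee_fin mulr_ge0 ?(ltW sN)// => /(_ isT) /le_trans; apply.
  rewrite ge0_muleDl ?lee_fin ?(ltW kN)//; last first.
    by rewrite mule_ge0 ?expe_ge0// lee_fin invr_ge0 exprn_ge0// ltW.
  rewrite (muleC (_ ^- m)%:E) -muleA -!EFinM (muleC (g _ ^+ _)).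
  rewrite (_ : (k / s ^+ N * ((2 * m)%:R * s ^+ N) = a)%R); last first.
    by rewrite /a; field; rewrite expf_neq0// gt_eqF.
  rewrite (_ : ((k / s ^+ N) ^- m * ((2 * m)%:R * s ^+ N) = b)%R)//.
  rewrite /b expr_div_n invfM invrK mulnSr exprD exprM.
  by ring.
rewrite ge0_integral_cstDZ//; do ?[exact: measurable_funTS]; do ?[by move=> y; exact: expe_ge0].
rewrite [X in _ * X + _]lebesgue_cubeE//.
have -> : c1 = (a * (2 * r) ^+ m)%:E + (2 * m)%:R%:E * ((k ^- m)%:E * W).
  rewrite /c1 ge0_muleDr; last 2 first.
  - by rewrite lee_fin mulr_ge0 ?(ltW k0)// exprn_ge0// mulr_ge0// ltW.
  - by rewrite mule_ge0// lee_fin invr_ge0 exprn_ge0// ltW.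
  by rewrite -EFinM mulrA.
rewrite -EFinM (muleA (2 * m)%:R%:E) -EFinM; apply: leeD2l.
have t0 : (0 < s ^+ (2 * m))%R by rewrite exprn_gt0.
have t1 : (s ^+ (2 * m) <= 1)%R by rewrite expr_le1 ?muln_gt0 ?(ltW s0).
apply: (@le_trans _ _ (b%:E * (((s ^+ (2 * m)) ^- m)%:E * W))).
  by apply: lee_wpmul2l; [rewrite lee_fin|exact: contraction].
rewrite muleA -EFinM; apply: lee_wpmul2r => //.
rewrite lee_fin /b -(mulrA _ (s ^+ _)%R).
have c20 : (0 <= (2 * m)%:R / k ^+ m)%R by rewrite divr_ge0 ?exprn_ge0 ?(ltW k0).
rewrite -[leRHS]mulr1; apply: (ler_wpM2l c20).
(* The gained power exceeds the singular one, 2 m m, by m - 1 >= 0, and s <= 1. *)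
have -> : (N * m.+1 = 2 * m * m + m.-1)%N by move: m0; clear; case: (m) => // q _; lia.
rewrite exprD -exprM mulrAC divff ?mul1r ?expf_neq0 ?(gt_eqF s0)//.
by rewrite exprn_ile1 ?(ltW s0).
Qed.
End cube_average.

Section extremal_rings.
Context {R : realType} {m : nat}.
Hypothesis m0 : (0 < m)%N.
Local Notation n := m.+1.
Local Notation Rn := 'rV[R]_n.
Local Notation Bn := (borel_rV R n).
Local Notation Rb := (Rbar R n).
Local Notation mu := (@lebesgue_rV R n).

(** * Logarithmic potentials of annuli *)

Section log_potential.
Local Notation w := (@sphere_areaR R m).

Lemma ln_diff_le (a s t : R) : 0 < a -> a <= s -> a <= t -> `|ln s - ln t| <= `|s - t| / a.
Proof.
wlog st : s t / t <= s => [H|] a0 as_ at_.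
  by have [/H|/ltW/H] := leP t s; last rewrite distrC (distrC s); apply.
have t0 : 0 < t by exact: lt_le_trans at_.
have s0 : 0 < s by exact: lt_le_trans as_.
rewrite ger0_norm ?subr_ge0 ?ler_ln ?posrE// ger0_norm ?subr_ge0// -ln_div ?posrE//.
have h : ln (1 + (s - t) / t) <= (s - t) / t.
  by apply: le_ln1Dx; rewrite (lt_le_trans (_ : -1 < 0))// ?oppr_lt0// divr_ge0 ?subr_ge0// ltW.
rewrite (_ : s / t = 1 + (s - t) / t); last by rewrite mulrBl divff ?gt_eqF// addrCA subrr addr0.
by apply: le_trans h _; rewrite ler_wpM2l ?subr_ge0// lef_pV2.
Qed.

(** Room for the two losses of [log_potential0]: a factor exp d in the gradient, and a length d at
    each end of the annulus measured logarithmically. *)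
Lemma log_slack (L X : R) : 0 < X < L ->
  exists2 d, 0 < d & 0 < L - 2 * d /\ expR d ^+ n * (L * X ^+ m) <= (L - 2 * d) ^+ n.
Proof.
move=> /andP[X0 XL]; have L0 : 0 < L by exact: lt_trans XL.
have [c c0 cE] := nth_root m (ltW (mulr_gt0 L0 (exprn_gt0 m X0))).
have cL : c < L.
  rewrite -(@ltr_pXn2r _ n)// ?nnegrE ?(ltW L0)// cE exprS ltr_pM2l//.
  by rewrite ltr_pXn2r// ?nnegrE ltW.
(* For d <= 1/2 one has exp d <= 1 + 2 d; the other bound on d is the linear inequality (1 + 2 d) c
   <= L - 2 d. *)
pose d := Num.min (2^-1) ((L - c) / (2 * (c + 1))).
have c1 : 0 < 2 * (c + 1) by rewrite mulr_gt0// ltr_wpDl.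
have d0 : 0 < d by rewrite lt_min invr_gt0 ltr0n divr_gt0// subr_gt0.
have d1 : d <= 2^-1 by rewrite ge_min lexx.
have d2 : d * (2 * (c + 1)) <= L - c by rewrite -ler_pdivlMr// ge_min lexx orbT.
have e1 : expR d <= 1 + 2 * d.
  have h := expR_ge1Dx (- d).
  rewrite -[expR d]invrK -expRN invf_ple ?posrE ?expR_gt0//; last lra.
  apply: le_trans h; rewrite -[leLHS]div1r ler_pdivrMr; last lra.
  have : 0 <= d * (1 - 2 * d) by rewrite mulr_ge0//; lra.
  nra.
have e2 : expR d * c <= L - 2 * d.
  have : expR d * c <= (1 + 2 * d) * c by rewrite ler_wpM2r.
  lra.
exists d => //; split.
  apply: lt_le_trans e2; rewrite mulr_gt0 ?expR_gt0// lt_neqAle c0 andbT.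
  apply/eqP => c2; move: cE; rewrite -c2 expr0n /= => /esym/eqP.
  by rewrite mulf_eq0 expf_eq0 (gt_eqF L0) (gt_eqF X0) andbF.
have p : 0 <= expR d * c by rewrite mulr_ge0// expR_ge0.
by rewrite -cE -exprMn; apply: lerXn2r; rewrite ?nnegrE// (le_trans p).
Qed.

(** The logarithm is truncated to the smaller annulus between [r0] and [r1], while the gradient is
    spread over the annulus between [R0] and [R1] and multiplied by q = exp d. This margin is what
    lets it dominate the potential at a uniform scale. *)
Let log_potential0 (R0 R1 X : R) : 0 < R0 -> R0 < R1 -> 0 < X < ln (R1 / R0) ->
  exists u (g : Rn -> R), [/\ upper_gradient u g,
    forall x, 0 <= u x <= 1,
    forall x, (enorm x <= R0 -> u x = 0) /\ (R1 <= enorm x -> u x = 1),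
    forall x, ~ (R0 <= enorm x <= R1) -> g x = 0 &
    (energy g <= (w / X ^+ m)%:E)%E].
Proof.
move=> h0 h01 hX; set L := ln _ in hX.
have L0 : 0 < L by case/andP: hX; exact: lt_trans.
have h1 : 0 < R1 by exact: lt_trans h01.
have [d d0 [Ld sl]] := log_slack hX.
pose q := expR d; have q0 : 0 < q by exact: expR_gt0.
have q1 : 1 < q by rewrite /q expR_gt1.
pose r0 := R0 * q; pose r1 := R1 / q; pose l := L - 2 * d.
have Ll : 0 < l by [].
have r00 : 0 < r0 by rewrite mulr_gt0.
have r10 : 0 < r1 by rewrite divr_gt0.
have lnq : ln q = d by rewrite /q expRK.
have lE : ln r1 - ln r0 = l.
  rewrite /r1 /r0 ln_div ?posrE// lnM ?posrE// lnq /l /L ln_div ?posrE//; ring.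
have r01 : r0 < r1 by rewrite -ltr_ln ?posrE// -subr_gt0 lE.
have R0r0 : R0 <= r0 by rewrite ler_pMr// ltW.
have r1R1 : r1 <= R1 by rewrite ler_pdivrMr// ler_peMr// ltW.
pose cl (s : R) := Num.max r0 (Num.min s r1).
have cl0 s : r0 <= cl s by rewrite le_max lexx.
have cl_lip s t : `|cl s - cl t| <= `|s - t|.
  have e v : cl v = Num.min (Num.max (v - r0) 0) (r1 - r0) + r0.
    by rewrite /cl; case: (lerP v r1) => h; case: (lerP (v - r0) 0) => h'; case: lerP => h''; case: lerP => h3; lra.
  by rewrite !e opprD addrACA subrr addr0; apply: le_trans (clamp_lipschitz _ _ _) _; rewrite opprB addrA subrK.
have cl_small s : s <= r0 -> cl s = r0.
  by move=> hs; rewrite /cl min_l ?max_l// (le_trans hs)// ltW.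
have cl_big s : r1 <= s -> cl s = r1.
  by move=> hs; rewrite /cl min_r// max_r// ltW.
pose U (x : Rn) := (ln (cl (enorm x)) - ln r0) / l.
pose G (x : Rn) := (q / l * (enorm x)^-1) * \1_[set x : Rn | enorm x \in `[R0, R1]] x.
have UD x y : `|U x - U y| = `|ln (cl (enorm x)) - ln (cl (enorm y))| / l.
  rewrite /U -mulrBl opprB addrA subrK normrM (gtr0_norm (_ : 0 < l^-1)) ?invr_gt0//.
have mA : measurable ([set x : Rn | enorm x \in `[R0, R1]] : set Bn) by exact: norm_itv_measurable.
have ugU : upper_gradient U G.
  split.
  - exists (r0^-1 / l); first by rewrite divr_ge0 ?invr_ge0 ?(ltW r00) ?(ltW Ll).
    move=> x y; rewrite UD mulrAC (mulrC r0^-1) ler_wpM2r ?invr_ge0 ?(ltW Ll)//.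
    apply: le_trans (ln_diff_le r00 (cl0 _) (cl0 _)) _.
    rewrite ler_wpM2r ?invr_ge0 ?(ltW r00)//; exact: le_trans (cl_lip _ _) (enorm_dist _ _).
  - apply: measurable_funM => //; apply: measurable_funM; first exact: measurable_cst.
    exact: (measurableT_comp measurable_invr (@enorm_measurable R m)).
  - by move=> x; rewrite mulr_ge0// mulr_ge0 ?invr_ge0 ?enorm_ge0// divr_ge0 ?(ltW q0) ?(ltW Ll).
  - exists (R0 * (q - 1) / q); first by rewrite divr_gt0// mulr_gt0// subr_gt0.
    set h := R0 * (q - 1) / q => x y z yx zx.
    have hE : h = R0 - R0 / q by rewrite /h mulrBr mulr1 mulrBl mulfK ?gt_eqF.
    have hq : R0 / q <= R0 by rewrite ler_pdivrMr// ler_peMr// ltW.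
    have dy := le_lt_trans (enorm_dist y x) yx; have dz := le_lt_trans (enorm_dist z x) zx.
    rewrite ltr_norml in dy; rewrite ltr_norml in dz.
    rewrite UD /G indicE; have [/set_mem /=|/negP nA] := boolP (x \in _).
      rewrite in_itv/= mulr1 => /andP[a1 a2].
      have x0 : 0 < enorm x by exact: lt_le_trans a1.
      have low (v : Rn) : enorm x - h < enorm v -> enorm x / q <= cl (enorm v).
        move=> hv; rewrite le_max; apply/orP.
        have [h3|h3] := leP (enorm x / q) r0; [by left|right].
        rewrite le_min; apply/andP; split; last by rewrite ler_wpM2r// invr_ge0 ltW.
        apply: ltW; apply: le_lt_trans hv.
        have : R0 * (1 - q^-1) <= enorm x * (1 - q^-1).
          by rewrite ler_wpM2r// subr_ge0 invf_le1// ltW.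
        by rewrite hE; lra.
      have xq : 0 < enorm x / q by rewrite divr_gt0.
      have := ln_diff_le xq (low y ltac:(lra)) (low z ltac:(lra)).
      move=> /le_trans h4.
      rewrite (mulrC (q / l)) (mulrA _ q) (mulrC _ q) -(mulrA _ l^-1) (mulrC l^-1) mulrA ler_wpM2r ?invr_ge0 ?(ltW Ll)//.
      have qx : 0 <= q / enorm x by rewrite divr_ge0 ?(ltW q0) ?enorm_ge0.
      apply: h4; rewrite invf_div [leRHS]mulrC; apply: (ler_wpM2r qx).
      exact: le_trans (cl_lip _ _) (enorm_dist _ _).
    have nx : ~ (R0 <= enorm x <= R1) by move=> hx; apply: nA; apply: mem_set; rewrite /= in_itv.
    rewrite mulr0 mul0r.
    have hr0 : R0 + h <= r0.
      rewrite hE /r0; have : 0 <= R0 * ((q - 1) * (q - 1) / q).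
        by rewrite mulr_ge0 ?(ltW h0)// divr_ge0 ?(ltW q0)// mulr_ge0// subr_ge0 ltW.
      rewrite (_ : R0 * _ = R0 * q - (R0 + (R0 - R0 / q))); first by rewrite subr_ge0.
      by field; rewrite gt_eqF.
    have hr1 : r1 <= R1 - h.
      have : h <= R1 - r1.
        have -> : R1 - r1 = R1 * (1 - q^-1) by rewrite mulrBr mulr1.
        have -> : h = R0 * (1 - q^-1) by rewrite hE mulrBr mulr1.
        by rewrite ler_wpM2r ?(ltW h01)// subr_ge0 invf_le1// ltW.
      lra.
    have [h3|h3] := ltP (enorm x) R0.
      by rewrite !cl_small ?subrr ?normr0 ?mul0r//; lra.
    have {}h3 : R1 < enorm x by rewrite ltNge; apply/negP => h4; apply: nx; rewrite h3.
    by rewrite !cl_big ?subrr ?normr0 ?mul0r//; lra.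
exists U, G; split=> //.
- move=> x; rewrite /U; have c0 := cl0 (enorm x).
  have c1 : cl (enorm x) <= r1 by rewrite ge_max (ltW r01) ge_min lexx orbT.
  have cp : 0 < cl (enorm x) by exact: lt_le_trans c0.
  have h2 : ln r0 <= ln (cl (enorm x)) by rewrite ler_ln ?posrE.
  have h3 : ln (cl (enorm x)) <= ln r1 by rewrite ler_ln ?posrE.
  apply/andP; split; first by apply: divr_ge0; [rewrite subr_ge0|exact: ltW].
  by rewrite ler_pdivrMr// mul1r -/l -lE lerD2r.
- move=> x; split=> hx; rewrite /U.
    by rewrite cl_small ?subrr ?mul0r// (le_trans hx).
  by rewrite cl_big ?(le_trans r1R1)// lE divff// gt_eqF.
- by move=> x nx; rewrite /G indicE memNset ?mulr0//= in_itv.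
rewrite /energy.
have mG : measurable_fun setT (fun x : Bn => (G x ^+ n)%:E).
  by apply/measurable_EFinP; apply: measurable_funX; exact: ug_measurable ugU.
have G0 x : (0 <= (G x ^+ n)%:E)%E by rewrite lee_fin exprn_ge0//; exact: ug_ge0 ugU x.
have h := @ge0_integral_spherical_le R m (fun x => (G x ^+ n)%:E) ((X ^- m)%:E) mG G0.
rewrite mulrC EFinM -sphere_areaRE; apply: h; first by rewrite lee_fin invr_ge0 exprn_ge0//; case/andP: hX => /ltW.
move=> u u1; have ql0 : 0 <= q / l by rewrite divr_ge0 ?(ltW q0) ?(ltW Ll).
apply: (@le_trans _ _ (\int[lebesgue_measure]_(s in [set` `[R0, R1]%R]) (((q / l) ^+ n)%:E * (s^-1)%:E))%E).
  rewrite [leLHS]integral_mkcond [leRHS]integral_mkcond; apply: ge0_le_integral => //.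
  - move=> s _; rewrite /patch; case: ifPn => //; rewrite inE/= in_itv/= andbT => s0.
    by rewrite mule_ge0// lee_fin exprn_ge0// ltW.
  - apply/(measurable_restrictT _ _).1 => //; apply: measurable_funTS; apply: emeasurable_funM.
      apply: (measurableT_comp mG); apply: measurable_rVZ; [exact: measurable_id|exact: measurable_cst].
    by apply/measurable_EFinP; exact: measurable_funX.
  - apply/(measurable_restrictT _ _).1 => //; apply: measurable_funTS.
    apply: measurable_funeM; apply/measurable_EFinP; exact: measurable_invr.
  - move=> s _; rewrite /patch !mem_setE !in_itv/= andbT.
    have [s0|s0] := ltP 0 s; last first.
      by rewrite ifF//; apply/negbTE; rewrite negb_and -ltNge (le_lt_trans s0 h0).
    rewrite /G enormZ u1 mulr1 gtr0_norm// indicE; case: ifPn => hs; last first.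
      by rewrite memNset ?mulr0 ?expr0n ?mul0e//= enormZ u1 mulr1 gtr0_norm// in_itv/=; exact/negP.
    rewrite mem_set ?mulr1; last by rewrite /= enormZ u1 mulr1 gtr0_norm// in_itv.
    rewrite -!EFinM lee_fin exprMn -mulrA ler_wpM2l ?exprn_ge0//.
    by rewrite exprSr exprVn mulrAC mulVf ?mul1r// expf_neq0// gt_eqF.
rewrite ge0_integralZl//; last 3 first.
- by apply: measurable_funTS; apply/measurable_EFinP; exact: measurable_invr.
- by move=> s /=; rewrite in_itv/= => /andP[h2 _]; rewrite lee_fin invr_ge0 ltW// (lt_le_trans h0).
- by rewrite lee_fin exprn_ge0.
rewrite integral_log ?(ltW h01)// -ln_div ?posrE// -/L -EFinM lee_fin.
rewrite expr_div_n mulrAC ler_pdivrMr ?exprn_gt0//.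
have Xm : 0 < X ^+ m by rewrite exprn_gt0//; case/andP: hX.
by rewrite ler_pdivlMl// mulrCA (mulrC (X ^+ m)).
Qed.

Lemma log_potential (a : Rn) (R0 R1 X : R) : 0 < R0 -> R0 < R1 -> 0 < X < ln (R1 / R0) ->
  exists u (g : Rn -> R), [/\ upper_gradient u g,
    forall x, 0 <= u x <= 1,
    forall x, (enorm (x - a) <= R0 -> u x = 0) /\ (R1 <= enorm (x - a) -> u x = 1),
    forall x, ~ (R0 <= enorm (x - a) <= R1) -> g x = 0 &
    (energy g <= (w / X ^+ m)%:E)%E].
Proof.
move=> h0 h1 hX; have [u [g [ug u01 uE gE eg]]] := log_potential0 h0 h1 hX.
exists (fun x => u (1^-1 *: (x - a))), (fun x => 1^-1 * g (1^-1 *: (x - a))); split.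
- exact: upper_gradient_affine.
- by [].
- by move=> x; rewrite invr1 scale1r.
- by move=> x hx; rewrite gE ?mulr0// invr1 scale1r.
- by rewrite energy_affine//; [exact: ug_ge0 ug|exact: ug_measurable ug].
Qed.
End log_potential.

(** * Composition with inversions *)

Section inversion.

Definition inversion (p q : Rn) (k : R) (x : Rn) : Rn := q + (k / enorm (x - p) ^+ 2) *: (x - p).

Lemma inversion_sub (p q : Rn) (k : R) (x : Rn) : 0 < k -> x != p ->
  enorm (inversion p q k x - q) = k / enorm (x - p).
Proof.
move=> k0 xp; have x0 : 0 < enorm (x - p) by rewrite enorm_gt0 subr_eq0.
rewrite /inversion addrAC subrr add0r enormZ ger0_norm ?divr_ge0 ?(ltW k0) ?exprn_ge0 ?(ltW x0)//.
by field; rewrite gt_eqF.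
Qed.

Lemma inversion_dist (p q : Rn) (k : R) (x y : Rn) : 0 < k -> x != p -> y != p ->
  enorm (inversion p q k x - inversion p q k y) = k * enorm (x - y) / (enorm (x - p) * enorm (y - p)).
Proof.
move=> k0 xp yp; rewrite /inversion opprD addrACA subrr add0r.
have x0 : 0 < enorm (x - p) by rewrite enorm_gt0 subr_eq0.
have y0 : 0 < enorm (y - p) by rewrite enorm_gt0 subr_eq0.
have -> : x - y = (x - p) - (y - p) by rewrite opprB addrA subrK.
move: (x - p) (y - p) x0 y0 => a b a0 b0.
have nn : 0 <= k * enorm (a - b) / (enorm a * enorm b).
  by rewrite divr_ge0 ?mulr_ge0 ?enorm_ge0// ltW.
apply/eqP; rewrite -(@eqrXn2 _ 2)// ?enorm_ge0//; apply/eqP.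
rewrite expr_div_n !exprMn !enorm_sqr.
rewrite !(dotDl, dotDr, dotNl, dotNr, dotZl, dotZr) (dotC b a).
have da : dot a a != 0 by rewrite -enorm_sqr expf_neq0// gt_eqF.
have db : dot b b != 0 by rewrite -enorm_sqr expf_neq0// gt_eqF.
by field; rewrite da db.
Qed.

(** Since u is constant far from q, the composition is constant on the ball of radius s0 = k/r
    around p, and extends to p. Elsewhere the conformal factor varies little at a small uniform
    scale, which costs the factor 1 + e. *)
Lemma upper_gradient_inversion (u g : Rn -> R) (p q : Rn) (k r c e : R) :
  0 < k -> 0 < r -> 0 < e -> upper_gradient u g -> (forall y, r <= enorm (y - q) -> u y = c) ->
  exists v g', [/\ upper_gradient v g', v p = c, forall x, x != p -> v x = u (inversion p q k x) &
    forall x, g' x <= (1 + e) * (g (inversion p q k x) * (k / enorm (x - p) ^+ 2))].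
Proof.
move=> k0 r0 e0 [[K K0 lu] mg g0 [h h0 loc]] uc.
set T := inversion p q k.
pose v x := if x == p then c else u (T x).
have [s0 s00 s0E] : exists2 s0 : R, 0 < s0 & s0 = k / r by exists (k / r) => //; rewrite divr_gt0.
have neqp x : 0 < enorm (x - p) -> x != p by rewrite enorm_gt0 subr_eq0.
have v_in x : enorm (x - p) <= s0 -> v x = c.
  move=> xs; rewrite /v; case: eqVneq => // xp; apply: uc.
  have x0 : 0 < enorm (x - p) by rewrite enorm_gt0 subr_eq0.
  by rewrite /T inversion_sub// ler_pdivlMr// mulrC -ler_pdivlMr// -s0E.
have v_out x : 0 < enorm (x - p) -> v x = u (T x) by move=> /neqp /negbTE; rewrite /v => ->.
pose A := [set x : Rn | s0 / 2 <= enorm (x - p)].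
have mA : measurable (A : set Bn).
  rewrite (_ : A = ~` [set x : Rn | enorm (x - p) < s0 / 2]).
    by apply: measurableC; apply: open_rV_measurable; exact: open_enorm_lt.
  by apply/seteqP; split=> x /=; rewrite /A /= leNgt => /negP.
pose g' (x : Rn) := ((1 + e) * (g (T x) * (k / enorm (x - p) ^+ 2))) * \1_A x.
have e1 : 0 < 1 + e by rewrite addr_gt0.
have j0 x : 0 <= k / enorm (x - p) ^+ 2 by rewrite divr_ge0 ?exprn_ge0 ?enorm_ge0// ltW.
have G0 x : 0 <= (1 + e) * (g (T x) * (k / enorm (x - p) ^+ 2)) by rewrite mulr_ge0 ?(ltW e1)// mulr_ge0.
have mb := measurable_rV_sub p.
have mk : measurable_fun setT (fun x : Bn => k / enorm ((x : Rn) - p) ^+ 2).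
  apply: measurable_funM; first exact: measurable_cst.
  apply: (measurableT_comp measurable_invr); apply: measurable_funX.
  exact: (measurableT_comp (@enorm_measurable R m) mb).
have mT : measurable_fun setT (T : Bn -> Bn).
  by apply: measurable_rVD; [exact: measurable_cst|exact: measurable_rVZ].
have far y z : s0 <= enorm (y - p) -> s0 <= enorm (z - p) ->
    `|v y - v z| <= K * k / s0 ^+ 2 * enorm (y - z).
  move=> ys zs; have y0 := lt_le_trans s00 ys; have z0 := lt_le_trans s00 zs.
  rewrite !v_out//; apply: le_trans (lu _ _) _; rewrite -!mulrA ler_wpM2l//.
  rewrite /T inversion_dist ?neqp// -mulrA ler_wpM2l ?(ltW k0)// mulrC ler_wpM2r ?enorm_ge0//.
  have : s0 ^+ 2 <= enorm (y - p) * enorm (z - p) by rewrite expr2; apply: ler_pM => //; exact: ltW.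
  have p1 : 0 < s0 ^+ 2 by rewrite exprn_gt0.
  have p2 : 0 < enorm (y - p) * enorm (z - p) by rewrite mulr_gt0.
  by move=> h1; rewrite lef_pV2 ?posrE.
have C0 : 0 <= K * k / s0 ^+ 2 by rewrite divr_ge0 ?exprn_ge0 ?(ltW s00)// mulr_ge0// ltW.
have mixed y z : s0 <= enorm (y - p) -> enorm (z - p) <= s0 ->
    `|v y - v z| <= K * k / s0 ^+ 2 * enorm (y - z).
  move=> ys zs; have y0 := lt_le_trans s00 ys.
  (* The point of the sphere of radius [s0] on the ray from p to y: v has there the same value as at
     z, and it is no farther from y than z is. *)
  pose z' := p + (s0 / enorm (y - p)) *: (y - p).
  have z's : enorm (z' - p) = s0.
    by rewrite /z' addrAC subrr add0r enormZ ger0_norm ?divr_ge0 ?(ltW s00) ?(ltW y0)// divfK ?gt_eqF.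
  rewrite (v_in z)// -(v_in z') ?z's//; apply: le_trans (far y z' ys _) _; first by rewrite z's.
  rewrite ler_wpM2l//.
  have -> : y - z' = (1 - s0 / enorm (y - p)) *: (y - p).
    by rewrite /z' scalerBl scale1r opprD addrA.
  rewrite enormZ ger0_norm ?subr_ge0 ?ler_pdivrMr ?mul1r// mulrBl mul1r divfK ?gt_eqF//.
  have := enorm_dist (y - p) (z - p); rewrite opprB addrA subrK => /(le_trans (ler_norm _)); lra.
exists v, g'; split=> //.
- split.
  + exists (K * k / s0 ^+ 2) => // y z.
    have [ys|/ltW ys] := leP s0 (enorm (y - p)); have [zs|/ltW zs] := leP s0 (enorm (z - p)).
    * exact: far.
    * exact: mixed.
    * by rewrite distrC (enormC y); exact: mixed.
    * by rewrite !v_in// subrr normr0 mulr_ge0 ?enorm_ge0.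
  + apply: measurable_funM => //; apply: measurable_funM; first exact: measurable_cst.
    by apply: measurable_funM => //; exact: (measurableT_comp mg mT).
  + by move=> x; rewrite mulr_ge0.
  (* The three bounds keep y and z away from p, their images within the scale h of u, and the
     variation of the conformal factor within 1 + e. *)
  + pose h' := Num.min (s0 / 4) (Num.min (h * s0 ^+ 2 / (8 * k)) (s0 * e / (4 * (1 + e)))).
    have h'0 : 0 < h'.
      by rewrite !lt_min !divr_gt0 ?mulr_gt0 ?exprn_gt0.
    have h'1 : h' <= s0 / 4 by rewrite ge_min lexx.
    have h'2 : h' <= h * s0 ^+ 2 / (8 * k) by rewrite !ge_min lexx orbT.
    have h'3 : h' <= s0 * e / (4 * (1 + e)) by rewrite !ge_min lexx !orbT.
    exists h' => // x y z yx zx.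
    have dy : `|enorm (y - p) - enorm (x - p)| < h'.
      by apply: le_lt_trans yx; have := enorm_dist (y - p) (x - p); rewrite opprB addrA subrK.
    have dz : `|enorm (z - p) - enorm (x - p)| < h'.
      by apply: le_lt_trans zx; have := enorm_dist (z - p) (x - p); rewrite opprB addrA subrK.
    move: dy dz; rewrite !ltr_norml => dy dz.
    rewrite /g' indicE; have [/set_mem Ax|/negP nAx] := boolP (x \in A); last first.
      have nx : enorm (x - p) < s0 / 2 by rewrite ltNge; apply/negP => Ax; apply: nAx; exact: mem_set.
      by rewrite mulr0 mul0r !v_in ?subrr ?normr0//; lra.
    have {}Ax : s0 / 2 <= enorm (x - p) := Ax.
    have x0 : 0 < enorm (x - p) by lra.
    have y0 : s0 / 4 <= enorm (y - p) by lra.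
    have z0 : s0 / 4 <= enorm (z - p) by lra.
    have s4 : 0 < s0 / 4 by rewrite divr_gt0.
    have yp : 0 < enorm (y - p) by exact: lt_le_trans y0.
    have zp : 0 < enorm (z - p) by exact: lt_le_trans z0.
    rewrite mulr1 !v_out//.
    have near_ w : enorm (w - x) < h' -> s0 / 4 <= enorm (w - p) -> enorm (T w - T x) < h.
      move=> wx ws; have wp : 0 < enorm (w - p) by exact: lt_le_trans ws.
      rewrite /T inversion_dist ?neqp// ltr_pdivrMr ?mulr_gt0//.
      have : k * enorm (w - x) < k * h' by rewrite ltr_pM2l.
      move/lt_le_trans; apply; have : s0 / 4 * (s0 / 2) <= enorm (w - p) * enorm (x - p).
        by apply: ler_pM => //; rewrite ?(ltW s4)// divr_ge0 ?(ltW s00).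
      rewrite -(ler_pM2l h0) => /(le_trans _); apply.
      move: h'2; rewrite ler_pdivlMr ?mulr_gt0// expr2; lra.
    apply: le_trans (loc (T x) _ _ (near_ _ yx y0) (near_ _ zx z0)) _.
    rewrite /T inversion_dist ?neqp// mulrAC !mulrA.
    pose th := 1 - 2 * h' / s0.
    have thy w : - h' < enorm (w - p) - enorm (x - p) -> th * enorm (x - p) <= enorm (w - p).
      move=> hw; have : h' <= 2 * h' / s0 * enorm (x - p).
        rewrite (_ : 2 * h' / s0 * enorm (x - p) = h' * (enorm (x - p) / (s0 / 2))); last by field; rewrite gt_eqF.
        by rewrite ler_peMr ?(ltW h'0)// ler_pdivlMr ?mul1r// divr_gt0.
      rewrite /th; lra.
    have th1 : 0 <= th.
      rewrite /th subr_ge0 ler_pdivrMr// mul1r; lra.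
    have th2 : 1 <= (1 + e) * th ^+ 2.
      have hh : 4 * (h' / s0) * (1 + e) <= e.
        move: h'3; rewrite ler_pdivlMr ?mulr_gt0// => h3.
        rewrite (_ : 4 * (h' / s0) * (1 + e) = h' * (4 * (1 + e)) / s0); last by ring.
        by rewrite ler_pdivrMr// (mulrC e).
      have : 0 <= (1 + e) * (h' / s0) ^+ 2 by rewrite mulr_ge0 ?sqr_ge0 ?(ltW e1).
      rewrite /th; lra.
    have prod : enorm (x - p) ^+ 2 <= (1 + e) * (enorm (y - p) * enorm (z - p)).
      apply: (@le_trans _ _ ((1 + e) * ((th * enorm (x - p)) * (th * enorm (x - p))))).
        rewrite (_ : (1 + e) * _ = (1 + e) * th ^+ 2 * enorm (x - p) ^+ 2); last by ring.
        by rewrite ler_peMl ?exprn_ge0 ?enorm_ge0.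
      rewrite ler_wpM2l ?(ltW e1)//; apply: ler_pM; rewrite ?mulr_ge0 ?enorm_ge0// thy//; lra.
    rewrite ler_wpM2r ?enorm_ge0//.
    rewrite (_ : (1 + e) * g _ * k / _ = g (inversion p q k x) * k * ((1 + e) / enorm (x - p) ^+ 2)); last by ring.
    rewrite ler_wpM2l ?mulr_ge0 ?(ltW k0)// -[leLHS]div1r ler_pdivrMr ?mulr_gt0//.
    by rewrite mulrAC ler_pdivlMr ?exprn_gt0// mul1r.
- by rewrite /v eqxx.
- by move=> x /negbTE xp; rewrite /v xp.
- by move=> x; rewrite /g' ler_piMr// indicE; case: (_ \in _).
Qed.
End inversion.

(** * Regularization of admissible densities *)

Section coordinate_slices.
Local Notation Rm := 'rV[R]_m.
Local Open Scope ereal_scope.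
Local Notation leb := (@lebesgue_measure R).

Definition rVtail (x : Rn) : Rm := \row_j x ord0 (lift ord0 j).

Lemma rVcons_tail (x : Rn) : rVcons (x ord0 ord0) (rVtail x) = x.
Proof.
by apply/rowP => i; rewrite mxE; case: unliftP => [j ->|->] //=; rewrite mxE.
Qed.

Lemma rVtail_cons s (y : Rm) : rVtail (rVcons s y) = y.
Proof. by apply/rowP => i; rewrite mxE rVconsS. Qed.

Lemma rVtail_measurable : measurable_fun setT (rVtail : Bn -> borel_rV R m).
Proof.
apply: measurable_fun_rV => i; under eq_fun do rewrite mxE.
exact: coord_rV_measurable.
Qed.

Lemma enorm_rVcons s (y : Rm) : (enorm (rVcons s y) ^+ 2 = s ^+ 2 + enorm y ^+ 2)%R.
Proof.
rewrite !enorm_sqr /dot big_ord_recl rVcons0 -expr2; congr (_ + _)%R.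
by apply: eq_bigr => i _; rewrite rVconsS.
Qed.

Lemma enorm_rVcons0 (y : Rm) : enorm (rVcons 0%R y) = enorm y.
Proof.
by apply/eqP; rewrite -(@eqrXn2 _ 2)// ?enorm_ge0// enorm_rVcons expr0n add0r.
Qed.

Lemma enorm_rVcons_0 (s : R) : enorm (rVcons s (0 : Rm)) = `|s|%R.
Proof.
by apply/eqP; rewrite -(@eqrXn2 _ 2)// ?enorm_ge0// enorm_rVcons enorm0 expr0n addr0 real_normK ?num_real.
Qed.

Lemma cube_rVcons (p0 : R) (p' : Rm) (r s : R) (y : Rm) :
  cube (rVcons p0 p') r (rVcons s y) <-> (`|s - p0| < r)%R /\ cube p' r y.
Proof.
split=> [h|[h1 h2] i].
  by split=> [|i]; [have := h ord0; rewrite !rVcons0|have := h (lift ord0 i); rewrite !rVconsS].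
by rewrite !mxE; case: unliftP => [j _|_] /=; [exact: h2|].
Qed.

Lemma ge0_integral_cube (p : Rn) (r : R) (f : Bn -> \bar R) : (0 < r)%R ->
  measurable_fun setT f -> (forall x, 0 <= f x) ->
  \int[mu]_(x in cube p r) f x =
  \int[leb]_(s in [set` `](p ord0 ord0 - r)%R, (p ord0 ord0 + r)%R[%R])
    \int[@lebesgue_rV R m]_(y in cube (rVtail p) r) f (rVcons s y).
Proof.
move=> r0 mf f0; have mQ := cube_measurable p r0.
rewrite integral_indicM ge0_integral_lebesgue_rVS; last 2 first.
- by apply: emeasurable_funM => //; apply/measurable_EFinP; exact: measurable_indic.
- by move=> x; rewrite mule_ge0// lee_fin.
rewrite [RHS]integral_indicM; apply: eq_integral => s _.
rewrite [X in _ = X * _]integral_indicM [RHS]muleC -ge0_integralZl//; last 2 first.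
- apply: emeasurable_funM; first exact: measurable_slice.
  by apply/measurable_EFinP; apply: measurable_indic; exact: cube_measurable.
- by move=> y _; rewrite mule_ge0// lee_fin.
apply: eq_integral => y _; rewrite muleCA -!EFinM; congr (_ * _%:E).
have h := cube_rVcons (p ord0 ord0) (rVtail p) r s y; rewrite rVcons_tail in h.
rewrite !indicE mem_setE in_itv/= -ltr_distl.
have [/set_mem/h[-> Qy]|/negP nQ] := boolP (rVcons s y \in cube p r); first by rewrite mem_set// mulr1.
case: ltP => h1; rewrite ?mul0r// mul1r memNset// => Qy.
by apply: nQ; apply: mem_set; apply/h.
Qed.

Lemma ge0_measurable_slice_cube (p' : Rm) (r : R) (f : Bn -> \bar R) : (0 < r)%R ->
  measurable_fun setT f -> (forall x, 0 <= f x) ->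
  measurable_fun [set: R] (fun s : R => \int[@lebesgue_rV R m]_(y in cube p' r) f (rVcons s y)).
Proof.
move=> r0 mf f0.
have mh : measurable_fun setT (fun q : measurableTypeR R * borel_rV R m => f (rVcons q.1 q.2)).
  exact: (measurableT_comp mf rVcons_measurable).
exact: (@ge0_measurable_inner R _ _ _ _ (@lebesgue_rV R m) _ _ (cube_measurable p' r0) mh (fun=> f0 _)).
Qed.

Lemma ge0_integral_affine_le (f : R -> \bar R) (a d u v : R) : measurable_fun [set: R] f ->
  (forall x, 0 <= f x) -> (u < a < v)%R -> (u < a + d < v)%R ->
  `|d|%:E * \int[leb]_(t in [set` `[0%R, 1%R]%R]) f (a + t * d)%R <= \int[leb]_(t in [set` `]u, v[%R]) f t.
Proof.
move=> mf f0 /andP[ua av] /andP[uv1 uv2].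
have [->|d0] := eqVneq d 0%R; first by rewrite normr0 mul0e; exact: integral_ge0.
pose F t := f t * (\1_[set` `]u, v[%R] t)%:E.
have mF : measurable_fun [set: R] F.
  by apply: emeasurable_funM => //; apply/measurable_EFinP; exact: measurable_indic.
have F0 t : 0 <= F t by rewrite mule_ge0// lee_fin.
have chv : `|d|%:E * \int[leb]_t F (t * d + a)%R = \int[leb]_t F t.
  have mFa : measurable_fun [set: R] (fun t : R => F (t + a)%R).
    by apply: (measurableT_comp mF); exact: measurable_funD.
  rewrite -(ge0_integral_lebesgueD a mF F0).
  have ap : (0 < `|d|)%R by rewrite normr_gt0.
  have [dp|dn] := ltP 0%R d.
    under eq_integral do rewrite mulrC.
    rewrite (ge0_integral_lebesgueZ dp mFa)// muleA -EFinM gtr0_norm// divff ?gt_eqF// mul1e//.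
  have mFn : measurable_fun [set: R] (fun t : R => F (- t + a)%R).
    by apply: (measurableT_comp mFa); exact: measurable_funN.
  rewrite -(ge0_integral_lebesgueN mFa)//.
  have e t : F (t * d + a)%R = F (- (`|d| * t) + a)%R by rewrite ler0_norm// mulNr opprK mulrC.
  under eq_integral do rewrite e.
  by rewrite (ge0_integral_lebesgueZ ap mFn)// muleA -EFinM divff ?gt_eqF// mul1e.
rewrite [leRHS]integral_indicM -[leRHS]chv; apply: lee_wpmul2l; first by rewrite lee_fin.
rewrite integral_indicM; apply: ge0_le_integral => //.
- by move=> t _; rewrite mule_ge0// lee_fin.
- apply: emeasurable_funM; last by apply/measurable_EFinP; exact: measurable_indic.
  apply: (measurableT_comp mf); apply: measurable_funD; first exact: measurable_cst.
  by apply: measurable_funM => //; exact: measurable_cst.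
- apply: (measurableT_comp mF); apply: measurable_funD; last exact: measurable_cst.
  by apply: measurable_funM => //; exact: measurable_cst.
move=> t _; have [/andP[t0 t1]|nt] := boolP (0 <= t <= 1)%R; last first.
  by rewrite indicE memNset ?mule0 ?F0//= in_itv/=; exact/negP.
rewrite [X in _ * X%:E <= _]indicE mem_set ?mule1/= ?in_itv/= ?t0//.
rewrite /F addrC indicE mem_set ?mule1//= in_itv/=.
have e : (t * d + a = (1 - t) * a + t * (a + d))%R by ring.
have [->|t2] := eqVneq t 1%R; first by rewrite mul1r addrC uv1.
have t3 : (0 < 1 - t)%R by rewrite subr_gt0 lt_neqAle t2.
have h1 : ((1 - t) * u < (1 - t) * a)%R by rewrite ltr_pM2l.
have h2 : ((1 - t) * a < (1 - t) * v)%R by rewrite ltr_pM2l.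
have h3 : (t * u <= t * (a + d))%R by rewrite ler_wpM2l// ltW.
have h4 : (t * (a + d) <= t * v)%R by rewrite ler_wpM2l// ltW.
rewrite e; lra.
Qed.

(** Brings the i-th coordinate to the first place, where [rVcons] slices. *)
Definition rVswap (i : 'I_n) (x : Rn) : Rn := \row_j x ord0 (tperm ord0 i j).

Lemma rVswapK i : involutive (rVswap i).
Proof. by move=> x; apply/rowP => j; rewrite !mxE tpermK. Qed.

Lemma rVswapD i x y : (rVswap i (x + y) = rVswap i x + rVswap i y)%R.
Proof. by apply/rowP => j; rewrite !mxE. Qed.

Lemma rVswapB i x y : (rVswap i (x - y) = rVswap i x - rVswap i y)%R.
Proof. by apply/rowP => j; rewrite !mxE. Qed.

Lemma rVswapZ i a x : (rVswap i (a *: x) = a *: rVswap i x)%R.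
Proof. by apply/rowP => j; rewrite !mxE. Qed.

Lemma enorm_rVswap i x : enorm (rVswap i x) = enorm x.
Proof.
rewrite /enorm (reindex_inj (@perm_inj _ (tperm ord0 i))) /=; congr Num.sqrt.
by apply: eq_bigr => j _; rewrite mxE tpermK.
Qed.

Lemma rVswap_continuous i : continuous (rVswap i).
Proof.
move=> x; apply/(@cvgrPdist_lt _ _ _ (nbhs x) _ (rVswap i) (rVswap i x)) => e e0.
have h : nbhs x [set y : Rn | enorm (y - x) < e]%R.
  by apply: open_nbhs_nbhs; split; [exact: open_enorm_lt|rewrite /= subrr enorm0].
apply: filterS h => y /= h; apply: le_lt_trans (norm_le_enorm _) _.
by rewrite -rVswapB enorm_rVswap enormC.
Qed.

Lemma rVswap_measurable i : measurable_fun setT (rVswap i : Bn -> Bn).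
Proof.
apply: measurable_fun_rV => j; under eq_fun do rewrite mxE.
exact: coord_rV_measurable.
Qed.

Lemma ge0_integral_rVswap i (f : Bn -> \bar R) : measurable_fun setT f -> (forall x, 0 <= f x) ->
  \int[mu]_x f (rVswap i x) = \int[mu]_x f x.
Proof.
move=> mf f0.
exact: (lebesgue_rV_isometry (rVswapD i) (@rVswap_continuous i) (@rVswap_continuous i) (rVswapK i) (rVswapK i) (enorm_rVswap i) mf f0).
Qed.

Lemma cube_rVswap i p r x : cube (rVswap i p) r (rVswap i x) <-> cube p r x.
Proof.
by split=> h j; [have := h (tperm ord0 i j); rewrite !mxE tpermK|rewrite !mxE; exact: h].
Qed.

Lemma ge0_integral_cube_swap i p r (f : Bn -> \bar R) : (0 < r)%R ->
  measurable_fun setT f -> (forall x, 0 <= f x) ->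
  \int[mu]_(x in cube (rVswap i p) r) f (rVswap i x) = \int[mu]_(x in cube p r) f x.
Proof.
move=> r0 mf f0; rewrite [LHS]integral_indicM [RHS]integral_indicM.
have mF : measurable_fun setT (fun x : Bn => f x * (\1_(cube p r) x)%:E).
  by apply: emeasurable_funM => //; apply/measurable_EFinP; apply: measurable_indic; exact: cube_measurable.
rewrite -(ge0_integral_rVswap i mF); last by move=> x; rewrite mule_ge0// lee_fin.
apply: eq_integral => x _; congr (_ * _%:E); rewrite !indicE; congr (nat_of_bool _)%:R.
have h := cube_rVswap i p r (rVswap i x); rewrite rVswapK in h.
by apply/idP/idP; rewrite !inE => /h.
Qed.

Lemma segment_cost_swap i (rho : Rn -> \bar R) x y :
  segment_cost (rho \o rVswap i) (rVswap i x) (rVswap i y) = segment_cost rho x y.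
Proof.
rewrite /segment_cost -rVswapB enorm_rVswap; congr (_ * _); apply: eq_integral => t _ /=.
by rewrite -rVswapZ -rVswapD rVswapK.
Qed.
End coordinate_slices.

(** * Attaching cubes to a continuum *)

Section attachment.
Local Notation Rm := 'rV[R]_m.
Local Open Scope ereal_scope.
Local Notation leb := (@lebesgue_measure R).

(** The computation in [attach0] yields 2 + 4 m^2 in front of k and 2 + 16 m^2 n in front of the
    energy; the larger constant serves for both. *)
Definition attach_const : R := (2 + 16 * m%:R ^+ 2 * n%:R)%R.

Definition cube_face (p : Rn) (s : R) (x : Rn) :=
  exists2 i, (`|x ord0 i - p ord0 i| = s)%R & forall j, (`|x ord0 j - p ord0 j| <= s)%R.

(** A single x may be expensive to reach from c: only the integral over the cube of a measurable
    bound F of the cost is controlled. *)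
Definition two_segment_cost (rho : Bn -> \bar R) (c p : Rn) (r : R) (F : Bn -> \bar R) (B : R) :=
  [/\ measurable_fun setT F, (forall x, 0 <= F x),
    (forall x, cube p r x -> exists b, segment_cost rho c b + segment_cost rho b x <= F x) &
    \int[mu]_(x in cube p r) F x <= B%:E].

(** The slice through c orthogonal to the first axis has small energy. From c one moves inside this
    slice to the line through x parallel to that axis, at the Morrey cost [S], and then along the
    line, at most at the cost [L] of its whole trace in the cube. *)
Let attach0 (rho : Bn -> \bar R) (p c : Rn) (r k B : R) :
  measurable_fun setT rho -> (forall x, 0 <= rho x) -> (0 < r)%R -> (0 < k)%R -> (0 <= B)%R ->
  cube p r c -> \int[mu]_(x in cube p r) (rho x ^+ n) <= B%:E ->
  \int[@lebesgue_rV R m]_(y in cube (rVtail p) r) (rho (rVcons (c ord0 ord0) y) ^+ n) <= ((2 * n)%:R * B / r)%:E ->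
  exists F : Bn -> \bar R, two_segment_cost rho c p r F ((2 * r) ^+ n * (attach_const * (k + k ^- m * B))).
Proof.
move=> mrho rho0 r0 k0 B0 Qc hB hM.
pose p0 := p ord0 ord0; pose p' := rVtail p; pose a := c ord0 ord0; pose c' := rVtail c.
have pE : p = rVcons p0 p' by rewrite rVcons_tail.
have cE : c = rVcons a c' by rewrite rVcons_tail.
have [ap Qc'] : (`|a - p0| < r)%R /\ cube p' r c' by apply/cube_rVcons; rewrite -pE -cE.
pose J : set R := [set` `](p0 - r)%R, (p0 + r)%R[%R].
have mJ : measurable J by exact: measurable_itv.
have inJ s : (`|s - p0| < r)%R -> (p0 - r < s < p0 + r)%R by rewrite ltr_distl.
pose L (y : Rm) := \int[leb]_(t in J) rho (rVcons t y).
have mra : measurable_fun setT (fun y : borel_rV R m => rho (rVcons a y)) by exact: measurable_slice.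
pose S (y : Rm) := segment_cost (fun y => rho (rVcons a y)) c' y.
have mh : measurable_fun setT (fun q : borel_rV R m * measurableTypeR R => rho (rVcons q.2 q.1)).
  exact: (measurableT_comp (measurableT_comp mrho rVcons_measurable) (measurable_swap (T1 := borel_rV R m) (T2 := measurableTypeR R))).
have mL : measurable_fun setT (L : borel_rV R m -> \bar R).
  exact: (@ge0_measurable_inner R _ _ _ _ leb J _ mJ mh (fun=> rho0 _)).
have mS : measurable_fun setT (S : borel_rV R m -> \bar R) by exact: segment_cost_measurable.
have L0 y : 0 <= L y by exact: integral_ge0.
have S0 y : 0 <= S y by exact: segment_cost_ge0.
pose F (x : Bn) := L (rVtail x) + S (rVtail x).
have mF : measurable_fun setT F.
  by apply: emeasurable_funD; [exact: (measurableT_comp mL rVtail_measurable)|exact: (measurableT_comp mS rVtail_measurable)].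
exists F; split=> //.
- by move=> x; rewrite adde_ge0.
- move=> x Qx; have xE := rVcons_tail x.
  set x0 := x ord0 ord0 in xE; set y := rVtail x in xE.
  have [xp Qy] : (`|x0 - p0| < r)%R /\ cube p' r y by apply/cube_rVcons; rewrite -pE xE.
  exists (rVcons a y); rewrite addeC /F -/y; apply: leeD.
    rewrite /segment_cost -xE rVcons_opp rVcons_add subrr enorm_rVcons_0 /L.
    have mg : measurable_fun [set: R] (fun t : R => rho (rVcons t y)).
      apply: (measurableT_comp mrho); apply: measurable_fun_rV => j.
      under eq_fun do rewrite mxE; case: unliftP => [j' _|_] /=; [exact: measurable_cst|exact: measurable_id].
    apply: le_trans (ge0_integral_affine_le (d := x0 - a) mg _ (inJ _ ap) _) => //; last first.
      by rewrite (addrC a) subrK; exact: inJ.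
    rewrite le_eqVlt; apply/orP; left; apply/eqP; congr (_ * _); apply: eq_integral => t _.
    by rewrite rVcons_scale rVcons_add scaler0 addr0.
  rewrite {1}cE /S /segment_cost rVcons_opp rVcons_add subrr enorm_rVcons0.
  rewrite le_eqVlt; apply/orP; left; apply/eqP; congr (_ * _); apply: eq_integral => t _.
  by rewrite rVcons_scale rVcons_add mulr0 addr0.
- pose W := \int[mu]_(x in cube p r) rho x.
  have kr : (0 < k / r)%R by rewrite divr_gt0.
  have mQ := cube_measurable p r0; have mQ' := cube_measurable p' r0.
  have hW : W <= ((2 * r) ^+ n * (k / r) + (k / r) ^- m * B)%:E.
    apply: (@le_trans _ _ (\int[mu]_(x in cube p r) ((k / r)%:E + ((k / r) ^- m)%:E * rho x ^+ n))).
      apply: ge0_le_integral => //; first exact: measurable_funTS.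
        apply: emeasurable_funD; first exact: measurable_cst.
        by apply: measurable_funTS; apply: measurable_funeM; exact: measurable_fun_expe.
      by move=> x _; exact: le_power_splite.
    have kr0 : (0 <= (k / r) ^- m)%R by rewrite invr_ge0 exprn_ge0// ltW.
    have mrn : measurable_fun setT (fun x => rho x ^+ n) by exact: measurable_fun_expe.
    rewrite ge0_integral_cstDZ//; do ?[exact: measurable_funTS]; do ?[exact: ltW]; do ?[by move=> x; exact: expe_ge0].
    rewrite [X in _ * X + _]lebesgue_cubeE//.
    by rewrite EFinD -EFinM mulrC; apply: leeD2l; rewrite EFinM; apply: lee_wpmul2l.
  pose V := \int[@lebesgue_rV R m]_(y in cube p' r) S y.
  have hV : V <= (m%:R * (2 * r) * (2 * m)%:R * (k / r * (2 * r) ^+ m + (k / r) ^- m * ((2 * n)%:R * B / r)))%:E.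
    apply: le_trans (cube_segment_cost m0 mra (fun=> rho0 _) r0 kr Qc') _.
    rewrite [leRHS]EFinM; apply: lee_wpmul2l; first by rewrite lee_fin !mulr_ge0// ltW.
    rewrite EFinD; apply: leeD2l; rewrite EFinM; apply: lee_wpmul2l => //.
    by rewrite lee_fin invr_ge0 exprn_ge0// ltW.
  have lJ : lebesgue_measure J = (2 * r)%:E.
    rewrite /J lebesgue_measure_itv/= lte_fin ifT; last lra.
    by rewrite -EFinB; congr (_%:E); ring.
  have e1 : \int[mu]_(x in cube p r) F x = (2 * r)%:E * (\int[@lebesgue_rV R m]_(y in cube p' r) L y + V).
    rewrite (ge0_integral_cube _ r0 mF); last by move=> x; rewrite adde_ge0.
    transitivity (\int[leb]_(s in J) (\int[@lebesgue_rV R m]_(y in cube p' r) L y + V)).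
      have ed : \int[@lebesgue_rV R m]_(y in cube p' r) (L y + S y) = \int[@lebesgue_rV R m]_(y in cube p' r) L y + V.
        apply: ge0_integralD => //; exact: measurable_funTS.
      apply: eq_integral => s _; rewrite -ed.
      by apply: eq_integral => y _; rewrite /F rVtail_cons.
    by rewrite integral_cst// [X in _ * X]lJ muleC.
  have e2 : \int[@lebesgue_rV R m]_(y in cube p' r) L y = W.
    rewrite /W (ge0_integral_cube _ r0 mrho)//.
    exact: (@ge0_tonelli R _ _ _ _ (@lebesgue_rV R m) leb _ J _ mQ' mJ mh (fun=> rho0 _)).
  rewrite e1 e2; apply: (@le_trans _ _ ((2 * r) * (((2 * r) ^+ n * (k / r) + (k / r) ^- m * B) +
    m%:R * (2 * r) * (2 * m)%:R * (k / r * (2 * r) ^+ m + (k / r) ^- m * ((2 * n)%:R * B / r))))%:E).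
    rewrite [leRHS]EFinM; apply: lee_wpmul2l; first by rewrite lee_fin mulr_ge0// ltW.
    by rewrite EFinD; exact: leeD.
  rewrite lee_fin; set t := (2 * r)%R; set x := (k ^- m * B)%R.
  have x0 : (0 <= x)%R by rewrite mulr_ge0// invr_ge0 exprn_ge0// ltW.
  have rE : (k / r) ^- m = (r ^+ m * k ^- m)%R by rewrite expr_div_n invfM invrK mulrC.
  have rm : (r ^+ n <= t ^+ n)%R by apply: lerXn2r; rewrite ?nnegrE /t; lra.
  have -> : (t * (t ^+ n * (k / r) + (k / r) ^- m * B + m%:R * t * (2 * m)%:R * (k / r * t ^+ m + (k / r) ^- m * ((2 * n)%:R * B / r))) =
     (2 + 4 * m%:R ^+ 2) * (t ^+ n * k) + (2 + 16 * m%:R ^+ 2 * n%:R) * (r ^+ n * x))%R.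
    by rewrite rE /x /t !natrM !exprS; field; rewrite ?expf_neq0 ?(gt_eqF k0) ?(gt_eqF r0).
  have tn : (0 <= t ^+ n)%R by rewrite exprn_ge0// mulr_ge0// ltW.
  have n1 : (1 <= n%:R :> R)%R by rewrite ler1n.
  rewrite [leRHS]mulrCA mulrDr mulrDr; apply: lerD; rewrite /attach_const.
    apply: ler_wpM2r; first by rewrite mulr_ge0// ltW.
    rewrite lerD2l; have m2 : (0 <= m%:R ^+ 2 :> R)%R by rewrite exprn_ge0.
    have : (m%:R ^+ 2 * 1 <= m%:R ^+ 2 * n%:R :> R)%R by rewrite ler_wpM2l.
    lra.
  apply: ler_wpM2l; first by rewrite addr_ge0// !mulr_ge0// exprn_ge0.
  exact: ler_wpM2r.
Qed.

(** For every s < r a point of P lies on one of the 2n faces of the cube of radius s. If the slices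
    through all these points had integrals above 2nB/r, then integrating over s and summing over the
    faces would give at least 2nB, whereas each of the 2n families contributes less than B. *)
Lemma good_slice (phi : Bn -> \bar R) (p : Rn) (r B : R) (P : Rn -> Prop) :
  measurable_fun setT phi -> (forall x, 0 <= phi x) -> (0 < r)%R ->
  \int[mu]_(x in cube p r) phi x < B%:E ->
  (forall s, (0 < s < r)%R -> exists x, P x /\ cube_face p s x) ->
  exists i x, [/\ P x, cube p r x &
    \int[@lebesgue_rV R m]_(y in cube (rVtail (rVswap i p)) r) phi (rVswap i (rVcons (x ord0 i) y))
      <= ((2 * n)%:R * B / r)%:E].
Proof.
move=> mphi phi0 r0 hB sp.
(* The integrated inequalities are weak; the strictness needed for the contradiction is stored in B'
   < B. *)
have [B' hB' B'B] : exists2 B', \int[mu]_(x in cube p r) phi x <= B'%:E & (B' < B)%R.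
  have fi : \int[mu]_(x in cube p r) phi x \is a fin_num.
    by rewrite ge0_fin_numE; [exact: lt_trans hB (ltry _)|exact: integral_ge0].
  by exists (fine (\int[mu]_(x in cube p r) phi x)); rewrite -?lte_fin fineK.
pose sl i (t : R) := \int[@lebesgue_rV R m]_(y in cube (rVtail (rVswap i p)) r) phi (rVswap i (rVcons t y)).
have mphii i : measurable_fun setT (phi \o (rVswap i : Bn -> Bn)).
  by apply: measurableT_comp => //; exact: rVswap_measurable.
have msl i : measurable_fun [set: R] (sl i) by apply: (ge0_measurable_slice_cube _ r0 (mphii i)) => x; exact: phi0.
have sl0 i t : 0 <= sl i t by exact: integral_ge0.
have slI i : \int[leb]_(t in [set` `](p ord0 i - r)%R, (p ord0 i + r)%R[%R]) sl i t <= B'%:E.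
  have -> : p ord0 i = rVswap i p ord0 ord0 by rewrite mxE tpermL.
  by rewrite -(ge0_integral_cube _ r0 (mphii i))//= ge0_integral_cube_swap.
apply: contrapT => H.
have M0 i s x : (0 < s < r)%R -> P x -> (`|x ord0 i - p ord0 i| = s)%R -> (forall j, `|x ord0 j - p ord0 j| <= s)%R ->
    ((2 * n)%:R * B / r)%:E < sl i (x ord0 i).
  move=> /andP[s0 sr] Px e hx; rewrite ltNge; apply/negP => h; apply: H; exists i, x; split=> //.
  by move=> j; exact: le_lt_trans sr.
pose up i (s : R) := sl i (p ord0 i + s)%R; pose dn i (s : R) := sl i (p ord0 i - s)%R.
pose I : set R := [set` `]0%R, r[%R]; have mI : measurable I by exact: measurable_itv.
have mup i : measurable_fun [set: R] (up i).
  by apply: (measurableT_comp (msl i)); apply: measurable_funD => //; exact: measurable_cst.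
have mdn i : measurable_fun [set: R] (dn i).
  by apply: (measurableT_comp (msl i)); apply: measurable_funB => //; exact: measurable_cst.
have side i (tau : R -> R) : measurable_fun [set: R] tau -> (forall s, I s -> `|tau s - p ord0 i| < r)%R ->
    (forall f : R -> \bar R, measurable_fun [set: R] f -> (forall t, 0 <= f t) ->
      \int[leb]_t f t = \int[leb]_s f (tau s)) -> \int[leb]_(s in I) sl i (tau s) <= B'%:E.
  move=> mt It ti; apply: le_trans (slI i); rewrite integral_indicM [leRHS]integral_indicM.
  pose f t := sl i t * (\1_[set` `](p ord0 i - r)%R, (p ord0 i + r)%R[%R] t)%:E.
  have mf : measurable_fun [set: R] f.
    by apply: emeasurable_funM => //; apply/measurable_EFinP; exact: measurable_indic.
  rewrite [leRHS](ti f mf); last by move=> t; rewrite mule_ge0// lee_fin.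
  apply: ge0_le_integral => //.
  - by move=> s _; apply: mule_ge0; [exact: sl0|rewrite lee_fin].
  - by apply: emeasurable_funM; [exact: (measurableT_comp (msl i))|apply/measurable_EFinP; exact: measurable_indic].
  - exact: (measurableT_comp mf).
  move=> s _; apply: lee_wpmul2l; first exact: sl0.
  rewrite lee_fin !indicE; have [/set_mem /It hs|] := boolP (s \in I); last by rewrite ler0n.
  by rewrite mem_set//= in_itv/= -ltr_distl.
have upI i : \int[leb]_(s in I) up i s <= B'%:E.
  apply: side => [|s|f mf f0]; first by apply: measurable_funD => //; exact: measurable_cst.
    by rewrite /I /= in_itv/= (addrC (p ord0 i)) addrK => /andP[s0 sr]; rewrite gtr0_norm.
  by rewrite -(ge0_integral_lebesgueD (p ord0 i) mf f0); apply: eq_integral => s _; rewrite addrC.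
have dnI i : \int[leb]_(s in I) dn i s <= B'%:E.
  apply: side => [|s|f mf f0]; first by apply: measurable_funB => //; exact: measurable_cst.
    by rewrite /I /= in_itv/= addrAC subrr add0r normrN => /andP[s0 sr]; rewrite gtr0_norm.
  have mfd : measurable_fun [set: R] (fun t => f (t + p ord0 i)%R).
    by apply: (measurableT_comp mf); exact: measurable_funD.
  rewrite -(ge0_integral_lebesgueD (p ord0 i) mf f0) -(ge0_integral_lebesgueN mfd)//.
  by apply: eq_integral => s _; rewrite addrC.
have tot : \int[leb]_(s in I) (\sum_(i < n) (up i s + dn i s)) <= ((2 * n)%:R * B')%:E.
  rewrite ge0_integral_sum//; last 2 first.
  - by move=> i; apply: emeasurable_funD; apply: measurable_funTS; [exact: mup|exact: mdn].
  - by move=> i s _; rewrite adde_ge0//; exact: sl0.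
  apply: (@le_trans _ _ (\sum_(i < n) (B'%:E + B'%:E))).
    apply: lee_sum => i _; rewrite ge0_integralD//; first exact: leeD.
    - by move=> s _; exact: sl0.
    - by apply: measurable_funTS; exact: mup.
    - by move=> s _; exact: sl0.
    - by apply: measurable_funTS; exact: mdn.
  rewrite -EFinD sumEFin sumr_const card_ord lee_fin -mulr_natl natrM; lra.
have B0 : (0 < B)%R by rewrite -lte_fin; apply: le_lt_trans hB; exact: integral_ge0.
pose c := ((2 * n)%:R * B / r)%R.
have n0 : (0 < (2 * n)%:R :> R)%R by rewrite ltr0n.
have c0 : (0 < c)%R by rewrite /c divr_gt0// mulr_gt0.
have lI : lebesgue_measure I = r%:E by rewrite /I lebesgue_measure_itv/= lte_fin r0 sube0.
have low s : I s -> c%:E < \sum_(i < n) (up i s + dn i s).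
  rewrite /I /= in_itv/= => hs; have [x [Px [i xi hx]]] := sp s hs.
  apply: lt_le_trans (M0 i s x hs Px xi hx) _.
  rewrite (bigD1 i)//= -[leLHS]adde0; apply: leeD; last first.
    by apply: sume_ge0 => j _; rewrite adde_ge0//; exact: sl0.
  have s0 : (0 < s)%R by case/andP: hs.
  move: xi; case: (ler0P (x ord0 i - p ord0 i)) => hxi e.
    have -> : x ord0 i = (p ord0 i - s)%R by rewrite -e opprK addrCA subrr addr0.
    by rewrite leeDr//; exact: sl0.
  have -> : x ord0 i = (p ord0 i + s)%R by rewrite -e addrCA subrr addr0.
  by rewrite leeDl//; exact: sl0.
have : (c * r)%:E <= \int[leb]_(s in I) (\sum_(i < n) (up i s + dn i s)).
  have -> : (c * r)%:E = \int[leb]_(s in I) c%:E by rewrite integral_cst// [X in _ * X]lI.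
  apply: ge0_le_integral => //.
  - by move=> s _; rewrite lee_fin ltW.
  - apply: measurable_funTS; apply: emeasurable_sum => i.
    by apply: emeasurable_funD; [exact: mup|exact: mdn].
  - by move=> s /low /ltW.
move=> /le_trans /(_ tot); rewrite lee_fin /c divfK ?gt_eqF// ler_pM2l// leNgt B'B //.
Qed.

Lemma attach (rho : Bn -> \bar R) (p : Rn) (r k B : R) (P : Rn -> Prop) :
  measurable_fun setT rho -> (forall x, 0 <= rho x) -> (0 < r)%R -> (0 < k)%R ->
  \int[mu]_(x in cube p r) (rho x ^+ n) < B%:E ->
  (forall s, (0 < s < r)%R -> exists x, P x /\ cube_face p s x) ->
  exists c (F : Bn -> \bar R), P c /\
    two_segment_cost rho c p r F ((2 * r) ^+ n * (attach_const * (k + k ^- m * B))).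
Proof.
move=> mrho rho0 r0 k0 hB sp.
have B0 : (0 < B)%R.
  by rewrite -lte_fin; apply: le_lt_trans hB; apply: integral_ge0 => x _; exact: expe_ge0.
have mrn : measurable_fun setT (fun x => rho x ^+ n) by exact: measurable_fun_expe.
have [i [c [Pc Qc hM]]] := good_slice mrn (fun x => expe_ge0 _ (rho0 x)) r0 hB sp.
pose rho' : Bn -> \bar R := rho \o rVswap i.
have mrho' : measurable_fun setT rho' by apply: measurableT_comp => //; exact: rVswap_measurable.
have rho'0 x : 0 <= rho' x by exact: rho0.
have Qc' : cube (rVswap i p) r (rVswap i c) by apply/cube_rVswap.
have hB' : \int[mu]_(x in cube (rVswap i p) r) (rho' x ^+ n) <= B%:E.
  by rewrite /rho' /= (ge0_integral_cube_swap i p r0 mrn) ?ltW// => x; exact: expe_ge0.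
have ci : rVswap i c ord0 ord0 = c ord0 i by rewrite mxE tpermL.
have [] := @attach0 rho' (rVswap i p) (rVswap i c) r k B mrho' rho'0 r0 k0 (ltW B0) Qc' hB'.
  by rewrite ci.
move=> F [mF F0 hF IF].
exists c, (F \o rVswap i); split=> //; split=> //.
- by apply: measurableT_comp => //; exact: rVswap_measurable.
- by move=> x; exact: F0.
- move=> x Qx; have [|b hb] := hF (rVswap i x); first exact/cube_rVswap.
  exists (rVswap i b); apply: le_trans hb.
  by rewrite -(segment_cost_swap i rho c) -(segment_cost_swap i rho _ x) rVswapK.
- apply: le_trans IF.
  have mFs : measurable_fun setT (F \o rVswap i : Bn -> \bar R).
    by apply: measurableT_comp => //; exact: rVswap_measurable.
  rewrite -(ge0_integral_cube_swap i p r0 mFs) ?le_eqVlt; last by move=> x; exact: F0.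
  by apply/orP; left; apply/eqP; apply: eq_integral => x _ /=; rewrite rVswapK.
Qed.
End attachment.

Section max_gradient.
Local Open Scope ereal_scope.

Lemma max_dist (a b c d : R) : (`|Num.max a b - Num.max c d| <= Num.max `|a - c| `|b - d|)%R.
Proof.
have h1 := ler_norm (a - c)%R; have h2 := ler_norm (b - d)%R.
have h3 := ler_norm (c - a)%R; have h4 := ler_norm (d - b)%R.
rewrite distrC in h3; rewrite distrC in h4.
rewrite le_max; move: (`|a - c|)%R (`|b - d|)%R h1 h2 h3 h4 => X Y h1 h2 h3 h4.
by case: (lerP a b) => hab; case: (lerP c d) => hcd; rewrite !ler_norml;
  have [XY|XY] := leP X Y; apply/orP; try (by right; lra); try (by left; lra).
Qed.

Lemma upper_gradient_max (u1 g1 u2 g2 : Rn -> R) : upper_gradient u1 g1 -> upper_gradient u2 g2 ->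
  upper_gradient (fun x => Num.max (u1 x) (u2 x)) (fun x => Num.max (g1 x) (g2 x)).
Proof.
move=> [[K K0 lu] mg g0 [h h0 loc]] [[K' K'0 lu'] mg' g'0 [h' h'0 loc']]; split.
- exists (Num.max K K'); first by rewrite le_max K0.
  move=> x y; apply: le_trans (max_dist _ _ _ _) _; rewrite ge_max; apply/andP; split.
    by apply: le_trans (lu _ _) _; rewrite ler_wpM2r ?enorm_ge0// le_max lexx.
  by apply: le_trans (lu' _ _) _; rewrite ler_wpM2r ?enorm_ge0// le_max lexx orbT.
- exact: measurable_maxr.
- by move=> x; rewrite le_max g0.
- exists (Num.min h h'); first by rewrite lt_min h0.
  move=> x y z; rewrite !lt_min => /andP[y1 y2] /andP[z1 z2].
  apply: le_trans (max_dist _ _ _ _) _; rewrite ge_max; apply/andP; split.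
    by apply: le_trans (loc _ _ _ y1 z1) _; rewrite ler_wpM2r ?enorm_ge0// le_max lexx.
  by apply: le_trans (loc' _ _ _ y2 z2) _; rewrite ler_wpM2r ?enorm_ge0// le_max lexx orbT.
Qed.

Lemma energy_max_le (g1 g2 : Rn -> R) : (forall x, 0 <= g1 x)%R -> (forall x, 0 <= g2 x)%R ->
  measurable_fun setT (g1 : Bn -> R) -> measurable_fun setT (g2 : Bn -> R) ->
  energy (fun x => Num.max (g1 x) (g2 x)) <= energy g1 + energy g2.
Proof.
move=> g10 g20 mg1 mg2.
have m1 : measurable_fun setT (fun x : Bn => (g1 x ^+ n)%:E).
  by apply/measurable_EFinP; exact: measurable_funX.
have m2 : measurable_fun setT (fun x : Bn => (g2 x ^+ n)%:E).
  by apply/measurable_EFinP; exact: measurable_funX.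
rewrite /energy -ge0_integralD//; last 2 first.
- by move=> x _; rewrite lee_fin exprn_ge0.
- by move=> x _; rewrite lee_fin exprn_ge0.
apply: ge0_le_integral => //.
- by move=> x _; rewrite lee_fin exprn_ge0// le_max g10.
- by apply/measurable_EFinP; apply: measurable_funX; exact: measurable_maxr.
- exact: emeasurable_funD.
move=> x _; rewrite -EFinD lee_fin.
by case: (leP (g1 x) (g2 x)) => _; rewrite ?lerDr ?lerDl exprn_ge0.
Qed.
End max_gradient.

(** * Averages over cubes *)

Section cube_means.
Local Open Scope ereal_scope.
Variable rho : Bn -> \bar R.
Hypotheses (mrho : measurable_fun setT rho) (rho0 : forall x, 0 <= rho x).

Let mrn : measurable_fun setT (fun x => rho x ^+ n).
Proof. exact: measurable_fun_expe. Qed.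

Let rn0 x : 0 <= rho x ^+ n.
Proof. exact: expe_ge0. Qed.

Lemma ge0_integral_cube_translate (f : Bn -> \bar R) (x : Rn) (s : R) : (0 < s)%R ->
  measurable_fun setT f -> (forall x, 0 <= f x) ->
  \int[mu]_(y in cube x s) f y = \int[mu]_(z in cube (0 : Rn)%R s) f (x + (z : Rn))%R.
Proof.
move=> s0 mf f0; rewrite [LHS]integral_indicM [RHS]integral_indicM.
have mF : measurable_fun setT (fun y : Bn => f y * (\1_(cube x s) y)%:E).
  by apply: emeasurable_funM => //; apply/measurable_EFinP; apply: measurable_indic; exact: cube_measurable.
have F0 y : 0 <= f y * (\1_(cube x s) y)%:E by rewrite mule_ge0// lee_fin.
have := ge0_integral_rVD x mF F0.
move=> <-; apply: eq_integral => z _; rewrite addrC; congr (_ * _%:E).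
rewrite !indicE; congr (nat_of_bool _)%:R; apply/idP/idP; rewrite !inE => h i; have := h i;
  by rewrite !mxE subr0 [X in (X - _)%R]addrC addrK.
Qed.

Definition cube_integral (s : R) (x : Rn) : \bar R := \int[mu]_(y in cube x s) rho y.

Lemma cube_integral_measurable s : (0 < s)%R -> measurable_fun setT (cube_integral s : Bn -> \bar R).
Proof.
move=> s0.
have mh : measurable_fun setT (fun q : Bn * Bn => rho ((q.1 : Rn) + (q.2 : Rn))%R).
  by apply: (measurableT_comp mrho); apply: measurable_rVD; [exact: measurable_fst|exact: measurable_snd].
have := @ge0_measurable_inner R _ _ _ _ mu _ _ (cube_measurable (0 : Rn)%R s0) mh (fun=> rho0 _).
by apply: eq_measurable_fun => x _; rewrite /cube_integral ge0_integral_cube_translate.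
Qed.

Lemma cube_integral_ge0 s x : 0 <= cube_integral s x.
Proof. exact: integral_ge0. Qed.

Lemma cube_integral_le s x : (0 < s)%R -> cube_integral s x <= ((2 * s) ^+ n)%:E + \int[mu]_y (rho y ^+ n).
Proof.
move=> s0; have mQ := cube_measurable x s0.
apply: (@le_trans _ _ (\int[mu]_(y in cube x s) (1%:E + rho y ^+ n))).
  apply: ge0_le_integral => //; first exact: measurable_funTS.
    by apply: emeasurable_funD; [exact: measurable_cst|exact: measurable_funTS].
  move=> y _; have := @le_power_splite R m 1%R (rho y) ltr01 (rho0 y).
  by rewrite expr1n invr1 mul1e.
rewrite ge0_integralD//; last exact: measurable_funTS.
rewrite integral_cst// mul1e [X in X + _]lebesgue_cubeE//; apply: leeD2l.
by apply: ge0_subset_integral.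
Qed.

(** Jensen's inequality, from the tangent line at the mean value b. *)
Lemma cube_integral_power (s : R) (x : Rn) : (0 < s)%R -> cube_integral s x < +oo ->
  cube_integral s x ^+ n <= (((2 * s) ^+ n) ^+ m)%:E * \int[mu]_(y in cube x s) (rho y ^+ n).
Proof.
move=> s0 foo; have mQ := cube_measurable x s0.
pose q := ((2 * s) ^+ n)%R; have q0 : (0 < q)%R by rewrite exprn_gt0// mulr_gt0.
have fA : cube_integral s x \is a fin_num by rewrite ge0_fin_numE// cube_integral_ge0.
pose b := (fine (cube_integral s x) / q)%R.
have a0 : (0 <= fine (cube_integral s x))%R by rewrite fine_ge0// cube_integral_ge0.
have b0 : (0 <= b)%R by rewrite divr_ge0// ltW.
have h : (n%:R * b ^+ m)%:E * cube_integral s x <=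
    \int[mu]_(y in cube x s) (rho y ^+ n) + (m%:R * b ^+ n * q)%:E.
  have e0 : (m%:R * b ^+ n * q)%:E = \int[mu]_(y in cube x s) (m%:R * b ^+ n)%:E.
    by rewrite integral_cst// [X in _ * X]lebesgue_cubeE// -EFinM.
  rewrite e0 -ge0_integralZl//; last 2 first.
  - exact: measurable_funTS.
  - by rewrite lee_fin mulr_ge0// exprn_ge0.
  rewrite -ge0_integralD//; last 2 first.
  - exact: measurable_funTS.
  - by move=> y _; rewrite lee_fin mulr_ge0// exprn_ge0.
  apply: ge0_le_integral => //.
  - by move=> y _; rewrite mule_ge0// lee_fin mulr_ge0// exprn_ge0.
  - by apply: measurable_funTS; exact: measurable_funeM.
  - by apply: emeasurable_funD; [exact: measurable_funTS|exact: measurable_cst].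
  - by move=> y _; exact: tangent_line_powere.
have e1 : cube_integral s x = (b * q)%:E by rewrite /b divfK ?gt_eqF// fineK.
rewrite e1 -EFinM -leeBlDr// -EFinB in h.
have e2 : (n%:R * b ^+ m * (b * q) - m%:R * b ^+ n * q = b ^+ n * q)%R by rewrite exprS -natr1; ring.
rewrite e2 in h; rewrite e1 -EFin_expe exprMn (exprSr q) mulrA mulrAC mulrC EFinM -/q.
by apply: lee_wpmul2l => //; rewrite lee_fin exprn_ge0// ltW.
Qed.

(** By Jensen and Tonelli, averaging over cubes does not increase the L^n norm; the constant is
    there because [cube_integral] is not normalized. *)
Lemma integral_cube_integral_power (s : R) : (0 < s)%R -> \int[mu]_y (rho y ^+ n) < +oo ->
  \int[mu]_x (cube_integral s x ^+ n) <= (((2 * s) ^+ n) ^+ n)%:E * \int[mu]_y (rho y ^+ n).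
Proof.
move=> s0 foo.
have mQ := cube_measurable (0 : Rn)%R s0.
have mh : measurable_fun setT (fun q : Bn * Bn => rho ((q.1 : Rn) + (q.2 : Rn))%R ^+ n).
  by apply: (measurableT_comp mrn); apply: measurable_rVD; [exact: measurable_fst|exact: measurable_snd].
have q0 : (0 <= ((2 * s) ^+ n) ^+ m)%R by rewrite !exprn_ge0// mulr_ge0// ltW.
apply: (@le_trans _ _ (\int[mu]_x ((((2 * s) ^+ n) ^+ m)%:E * \int[mu]_(z in cube (0 : Rn)%R s) (rho ((x : Rn) + (z : Rn))%R ^+ n)))).
  apply: ge0_le_integral => //.
  - by move=> x _; rewrite expe_ge0// cube_integral_ge0.
  - by apply: measurable_fun_expe; exact: cube_integral_measurable.
  - apply: measurable_funeM; exact: (@ge0_measurable_inner R _ _ _ _ mu _ _ mQ mh (fun=> rn0 _)).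
  move=> x _; rewrite -(ge0_integral_cube_translate x s0 mrn rn0); apply: cube_integral_power => //.
  by apply: le_lt_trans (cube_integral_le x s0) _; rewrite lte_add_pinfty// ltry.
rewrite ge0_integralZl//; last 2 first.
- exact: (@ge0_measurable_inner R _ _ _ _ mu _ _ mQ mh (fun=> rn0 _)).
- by move=> x _; exact: integral_ge0.
rewrite (@ge0_tonelli R _ _ _ _ mu mu setT _ _ measurableT mQ mh (fun=> rn0 _)) (exprSr ((2 * s) ^+ n)) EFinM -muleA.
apply: lee_wpmul2l; first by rewrite lee_fin.
have e z : \int[mu]_x (rho ((x : Rn) + (z : Rn))%R ^+ n) = \int[mu]_y (rho y ^+ n) by exact: (ge0_integral_rVD z mrn rn0).
under eq_integral do rewrite e.
have fi : \int[mu]_y (rho y ^+ n) \is a fin_num by rewrite ge0_fin_numE//; exact: integral_ge0.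
by rewrite -(fineK fi) integral_cst// [X in _ * X]lebesgue_cubeE// muleC.
Qed.
End cube_means.

(** * From an admissible density to a Lipschitz potential *)

Section regularization.
Local Open Scope ereal_scope.
Local Notation leb := (@lebesgue_measure R).

(* [E] meets every sphere of the supremum norm of radius less than [r0]
   centered at a point of [E]. *)
Definition meets_cubes (E : set Rn) (r0 : R) := forall p, E p -> forall s, (0 < s < r0)%R ->
  exists x, E x /\ cube_face p s x.

Variables (C0 C1 : set Rb) (rho : Bn -> \bar R) (r0 : R).
Local Notation E0 := [set x : Rn | C0 (Some x)].
Local Notation E1 := [set x : Rn | C1 (Some x)].
Hypotheses (cl0 : closed C0) (cl1 : closed C1) (dis : C0 `&` C1 = set0).
Hypotheses (r00 : (0 < r0)%R) (mE0 : meets_cubes E0 r0) (mE1 : meets_cubes E1 r0).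
Hypotheses (adm : admissible (ring_curves C0 C1) rho) (rho_fin : \int[mu]_x (rho x ^+ n) < +oo).

Let mrho : measurable_fun setT rho. Proof. by case: adm. Qed.
Let rho0 x : 0 <= rho x. Proof. by case: adm. Qed.
Let mrn : measurable_fun setT (fun x => rho x ^+ n). Proof. exact: measurable_fun_expe. Qed.
Let C : R := attach_const.
Let C_gt0 : (0 < C)%R.
Proof. by rewrite /C /attach_const ltr_wpDr// !mulr_ge0// exprn_ge0. Qed.

Let attach_cost (d : R) : (0 < d)%R -> exists2 e, (0 < e < r0)%R & forall E, meets_cubes E r0 ->
  forall p, E p -> exists c F,
    E c /\ two_segment_cost rho c p e F ((2 * e) ^+ n * d).
Proof.
(* With this k and the B below, k and k^-m B each contribute d/2 to C (k + k^-m B). The radius e is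
   then taken so small that every cube of radius e carries energy less than B. *)
move=> d0; pose k := (d / (2 * C))%R.
have C2 : (0 < 2 * C)%R by rewrite mulr_gt0.
have k0 : (0 < k)%R by rewrite divr_gt0.
pose B := (d * k ^+ m / (2 * C))%R.
have B0 : (0 < B)%R by rewrite divr_gt0// mulr_gt0// exprn_gt0.
have CB : (C * (k + k ^- m * B) = d)%R.
  by rewrite /B /k; field; rewrite !gt_eqF//= ?exprn_gt0// ?divr_gt0.
have [r rp hr] := integral_small_sets mrn (fun x => expe_ge0 _ (rho0 x)) rho_fin B0.
pose e := (Num.min (r0 / 2) (Num.min (2^-1) (r / 4)))%R.
have e0 : (0 < e)%R by rewrite !lt_min !divr_gt0// invr_gt0 ltr0n.
have e1 : (e <= r0 / 2)%R by rewrite ge_min lexx.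
have e2 : (e <= 2^-1)%R by rewrite !ge_min lexx orbT.
have e3 : (e <= r / 4)%R by rewrite !ge_min lexx !orbT.
have er : (e < r0)%R by lra.
exists e; first by rewrite e0.
move=> E mE p Ep.
have hB : \int[mu]_(x in cube p e) (rho x ^+ n) < B%:E.
  apply: hr; first exact: cube_measurable.
  rewrite [X in X < _]lebesgue_cubeE// lte_fin; apply: (@le_lt_trans _ _ (2 * e)%R); last lra.
  by rewrite exprS ler_piMr ?exprn_ile1//; lra.
have sp s : (0 < s < e)%R -> exists x, E x /\ cube_face p s x.
  by move=> /andP[s0 se]; apply: mE => //; rewrite s0 (lt_trans se).
have [c [F [Ec [mF F0 hF IF]]]] := attach mrho rho0 e0 k0 hB sp.
by exists c, F; split=> //; split=> //; rewrite -CB.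
Qed.

Section scale.
Variables (d e : R).
Hypotheses (d0 : (0 < d < 1)%R) (e0 : (0 < e < r0)%R).
Hypothesis attached : forall E, meets_cubes E r0 ->
  forall p, E p -> exists c F,
    E c /\ two_segment_cost rho c p e F ((2 * e) ^+ n * (d / 2)).

Let ep : (0 < e)%R. Proof. by case/andP: e0. Qed.
Let q : R := ((2 * e) ^+ n)%R.
Let q0 : (0 < q)%R. Proof. by rewrite exprn_gt0// mulr_gt0. Qed.
Let A (s : R) (x : Rn) : \bar R := cube_integral rho s x.
Let Afin s x : (0 < s)%R -> A s x \is a fin_num.
Proof.
move=> s0; rewrite ge0_fin_numE ?cube_integral_ge0//.
by apply: le_lt_trans (cube_integral_le mrho rho0 x s0) _; rewrite lte_add_pinfty// ltry.
Qed.

Let rt (x : Rn) : \bar R := (q^-1)%:E * A e x.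
Let mrt : measurable_fun setT (rt : Bn -> \bar R).
Proof. by apply: measurable_funeM; exact: cube_integral_measurable. Qed.
Let rt0 x : 0 <= rt x.
Proof. by rewrite mule_ge0 ?cube_integral_ge0// lee_fin invr_ge0 ltW. Qed.

(** The path is translated by every z of the cube and its two ends are attached to the continua.
    Each path so obtained costs at least 1 for [rho]; averaging over z turns the cost of the
    translates into the cost for the mean [rt], and each attachment costs d/2 on average. *)
Let cost_lower f L (x y : Rn) : upath f L x y -> E0 x -> E1 y -> (1 - d)%:E <= path_cost rt f L.
Proof.
move=> uf Ex Ey.
have [c [F [Ec [mF F0 hF IF]]]] := attached mE0 Ex.
have [c' [F' [Ec' [mF' F'0 hF' IF']]]] := attached mE1 Ey.
have mQ := cube_measurable (0 : Rn)%R ep.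
pose Z (z : Rn) := path_cost rho (fun s => f s + z)%R L.
have key (z : Rn) : cube (0 : Rn)%R e z -> 1 <= F (x + z)%R + Z z + F' (y + z)%R.
  move=> Qz.
  have Qp p : cube p e (p + z)%R.
    by move=> i; have := Qz i; rewrite !mxE subr0 addrAC subrr add0r.
  have [b hb] := hF _ (Qp x); have [b' hb'] := hF' _ (Qp y).
  have [f1 [L1 [u1 c1]]] := upath_straight c b.
  have [f2 [L2 [u2 c2]]] := upath_straight b (x + z)%R.
  have [f3 [L3 [u3 c3]]] := upath_straight (y + z)%R b'.
  have [f4 [L4 [u4 c4]]] := upath_straight b' c'.
  have [g1 v1 k1] := upath_join u1 u2.
  have [g2 v2 k2] := upath_join v1 (upath_translate z uf).
  have [g3 v3 k3] := upath_join v2 u3.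
  have [g4 v4 k4] := upath_join v3 u4.
  have := admissible_upath cl0 cl1 dis adm v4 Ec Ec'.
  rewrite k4// k3// k2// k1// c1// c2// c3// c4//.
  move/le_trans; apply; rewrite -[leLHS]addeA; apply: leeD; first by apply: leeD.
  by rewrite segment_costC// addeC (segment_costC b')//.
have mtr (p : Rn) : measurable_fun setT (fun z : Bn => (p + (z : Rn))%R : Bn).
  by apply: measurable_rVD; [exact: measurable_cst|exact: measurable_id].
have mh : measurable_fun setT (fun p : Bn * measurableTypeR R => rho (f p.2 + (p.1 : Rn))%R).
  apply: (measurableT_comp mrho); apply: measurable_rVD; last exact: measurable_fst.
  case: uf => _ _ _ lf _.
  exact: (measurableT_comp (lipschitz_measurable lf) measurable_snd).
have mI := measurable_itv `[0%R, L].
have mZ : measurable_fun setT (Z : Bn -> \bar R).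
  exact: (@ge0_measurable_inner R _ _ _ _ leb _ _ mI mh (fun=> rho0 _)).
have Z0 z : 0 <= Z z by exact: path_cost_ge0.
have IZ : \int[mu]_(z in cube (0 : Rn)%R e) Z z = q%:E * path_cost rt f L.
  have mA : measurable_fun setT (fun s : R => A e (f s)).
    by case: uf => _ _ _ lf _; apply: (measurable_along _ lf); exact: cube_integral_measurable.
  have mrtf : measurable_fun setT (fun s : R => rt (f s)) by exact: measurable_funeM.
  rewrite (@ge0_tonelli R _ _ _ _ mu leb _ _ _ mQ mI mh (fun=> rho0 _)) /path_cost.
  rewrite -ge0_integralZl//; last 2 first.
  - exact: measurable_funTS.
  - by rewrite lee_fin ltW.
  apply: eq_integral => s _; rewrite /rt muleA -EFinM divff ?gt_eqF// mul1e /A /cube_integral.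
  by rewrite (ge0_integral_cube_translate _ ep mrho rho0).
have IF1 : \int[mu]_(z in cube (0 : Rn)%R e) F (x + (z : Rn))%R <= (q * (d / 2))%:E.
  by rewrite -(ge0_integral_cube_translate _ ep mF F0).
have IF2 : \int[mu]_(z in cube (0 : Rn)%R e) F' (y + (z : Rn))%R <= (q * (d / 2))%:E.
  by rewrite -(ge0_integral_cube_translate _ ep mF' F'0).
have mFx : measurable_fun setT (fun z : Bn => F (x + (z : Rn))%R) by exact: (measurableT_comp mF (mtr x)).
have mFy : measurable_fun setT (fun z : Bn => F' (y + (z : Rn))%R) by exact: (measurableT_comp mF' (mtr y)).
have : q%:E <= (q * (d / 2))%:E + q%:E * path_cost rt f L + (q * (d / 2))%:E.
  apply: (@le_trans _ _ (\int[mu]_(z in cube (0 : Rn)%R e) (F (x + (z : Rn))%R + Z z + F' (y + (z : Rn))%R))).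
    have -> : q%:E = \int[mu]_(z in cube (0 : Rn)%R e) 1%:E.
      by rewrite integral_cst// mul1e [RHS]lebesgue_cubeE.
    apply: ge0_le_integral => //.
    apply: measurable_funTS; apply: emeasurable_funD => //; exact: emeasurable_funD.
  have e1 : \int[mu]_(z in cube (0 : Rn)%R e) (F (x + (z : Rn))%R + Z z + F' (y + (z : Rn))%R) =
      \int[mu]_(z in cube (0 : Rn)%R e) (F (x + (z : Rn))%R + Z z) + \int[mu]_(z in cube (0 : Rn)%R e) F' (y + (z : Rn))%R.
    apply: ge0_integralD => //; try exact: measurable_funTS; first by move=> z _; rewrite adde_ge0.
    by apply: measurable_funTS; exact: emeasurable_funD.
  have e2 : \int[mu]_(z in cube (0 : Rn)%R e) (F (x + (z : Rn))%R + Z z) =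
      \int[mu]_(z in cube (0 : Rn)%R e) F (x + (z : Rn))%R + \int[mu]_(z in cube (0 : Rn)%R e) Z z.
    by apply: ge0_integralD => //; exact: measurable_funTS.
  by rewrite e1 e2 IZ; apply: leeD => //; apply: leeD.
have := path_cost_ge0 f L rt0; case: (path_cost rt f L) => [P| |]//; last by move=> *; exact: leey.
move=> P0; rewrite -EFinM -!EFinD !lee_fin => h.
by rewrite -(ler_pM2l q0); lra.
Qed.

(** The least [rt]-cost of a path from C0. Truncated at a = 1 - d it becomes the potential [v],
    which is Lipschitz because [rt] is bounded. *)
Let U (x : Rn) : \bar R := ereal_inf [set c | exists f L p, [/\ E0 p, upath f L p x & c = path_cost rt f L]].
Let a : R := (1 - d)%R.
Let a0 : (0 < a)%R. Proof. by rewrite subr_gt0; case/andP: d0. Qed.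
Let U0 x : 0 <= U x.
Proof. by apply: le_ereal_inf_tmp => _ [f [L [p [_ _ ->]]]]; exact: path_cost_ge0. Qed.
Let UE0 x : E0 x -> U x = 0.
Proof.
move=> Ex; apply/eqP; rewrite eq_le U0 andbT; apply: ereal_inf_lbound.
exists (fun=> x), 0%R, x; split=> //; first exact: upath_refl.
by rewrite /path_cost set_itv1 integral_set1.
Qed.
Let UE1 x : E1 x -> a%:E <= U x.
Proof.
by move=> Ex; apply: le_ereal_inf_tmp => _ [f [L [p [Ep uf ->]]]]; exact: cost_lower uf Ep Ex.
Qed.
Let U_step x y : U y <= U x + segment_cost rt x y.
Proof.
have s0 := segment_cost_ge0 x y rt0.
have [->|sf] := eqVneq (segment_cost rt x y) +oo; first by rewrite addey ?leey// gt_eqF// (lt_le_trans _ (U0 x)).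
have {}sf : segment_cost rt x y \is a fin_num by rewrite ge0_fin_numE// ltey.
rewrite -leeBlDr//; apply: le_ereal_inf_tmp => _ [f [L [p [Ep uf ->]]]].
rewrite leeBlDr//.
have [g [M [ug hg]]] := upath_straight x y.
have [h uh hh] := upath_join uf ug.
by rewrite -hg// -hh//; apply: ereal_inf_lbound; exists h, (L + M)%R, p.
Qed.

Let v (x : Rn) : R := fine (mine a%:E (U x)).
Let vE x : (v x)%:E = mine a%:E (U x).
Proof.
rewrite fineK// ge0_fin_numE; last by rewrite le_min U0 lee_fin ltW.
by rewrite gt_min ltry.
Qed.
Let v_step x y c : segment_cost rt x y <= c%:E -> (v y <= v x + c)%R.
Proof.
move=> h; rewrite -lee_fin EFinD !vE.
have c0 : (0 <= c)%R by rewrite -lee_fin; exact: le_trans (segment_cost_ge0 x y rt0) h.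
have h2 : U y <= U x + c%:E by apply: le_trans (U_step x y) _; exact: leeD2l.
case: (leP a%:E (U x)) => h3; rewrite ge_min; apply/orP; [left|right] => //.
by rewrite -EFinD lee_fin lerDl.
Qed.

(** The gradient averages [rho] over the larger cube of radius s = e (1 + h). It contains the cubes
    of radius e around all points within e h of x, so [g x] dominates [rt] at a uniform scale; the
    enlargement costs (1 + h)^(n n) in energy. *)
Lemma regularized_potential (h : R) : (0 < h)%R ->
  exists u g, [/\ upper_gradient u g, (forall x, 0 <= u x <= 1)%R, (forall x, E0 x -> u x = 0%R),
    (forall x, E1 x -> u x = 1%R) &
    energy g <= ((1 - d)^-1 ^+ n * (1 + h) ^+ (n * n))%:E * \int[mu]_x (rho x ^+ n)].
Proof.
move=> h0; pose s := (e * (1 + h))%R.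
have s0 : (0 < s)%R by rewrite mulr_gt0// addr_gt0.
have eh : (0 < e * h)%R by rewrite mulr_gt0.
pose u (x : Rn) := (v x / a)%R.
pose g (x : Rn) := (fine (A s x) / (q * a))%R.
have qa : (0 < q * a)%R by rewrite mulr_gt0.
have symcost x y c : segment_cost rt x y <= c%:E -> (`|u x - u y| <= c / a)%R.
  move=> hc; rewrite /u -mulrBl normrM (gtr0_norm (_ : 0 < a^-1)%R) ?invr_gt0//.
  rewrite ler_wpM2r ?invr_ge0 ?(ltW a0)// ler_norml; apply/andP; split.
    by have := v_step hc; lra.
  by rewrite segment_costC// in hc; have := v_step hc; lra.
have rtK x (K : R) : A e x <= K%:E -> rt x <= (K / q)%:E.
  by move=> hK; rewrite mulrC EFinM; apply: lee_wpmul2l => //; rewrite lee_fin invr_ge0 ltW.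
exists u, g; split.
- split.
  + pose K := (q + fine (\int[mu]_x (rho x ^+ n)))%R.
    have If : \int[mu]_x (rho x ^+ n) \is a fin_num.
      by rewrite ge0_fin_numE//; apply: integral_ge0 => x _; exact: expe_ge0.
    have K0 : (0 <= K)%R.
      by rewrite addr_ge0 ?(ltW q0)// fine_ge0//; apply: integral_ge0 => x _; exact: expe_ge0.
    have AK x : A e x <= K%:E.
      by rewrite /K EFinD fineK//; exact: cube_integral_le.
    exists (K / q / a)%R; first by rewrite !divr_ge0// ltW.
    move=> x y; rewrite enormC mulrAC; apply: symcost; apply: segment_cost_le => //.
      by rewrite divr_ge0// ltW.
    by move=> t _; exact: rtK.
  + apply: measurable_funM; last exact: measurable_cst.
    by apply: measurableT_comp => //; exact: cube_integral_measurable.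
  + by move=> x; rewrite divr_ge0 ?fine_ge0 ?cube_integral_ge0// ltW.
  + exists (e * h)%R => // x y z yx zx.
    have -> : (g x * enorm (y - z) = fine (A s x) / q * enorm (z - y) / a)%R.
      by rewrite /g enormC invfM; ring.
    apply: symcost; apply: segment_cost_le => //.
      by rewrite divr_ge0 ?fine_ge0 ?cube_integral_ge0// ltW.
    move=> t /andP[t0 t1]; apply: rtK; rewrite fineK ?Afin//.
    apply: ge0_subset_integral => //; [exact: cube_measurable|exact: cube_measurable|exact: measurable_funTS|].
    move=> w hw i; have := hw i.
    have hc : (enorm (y + t *: (z - y) - x) < e * h)%R.
      have -> : (y + t *: (z - y) - x = (1 - t) *: (y - x) + t *: (z - x))%R.
        by apply/rowP => j; rewrite !mxE; ring.
      apply: le_lt_trans (enormD _ _) _; rewrite !enormZ (ger0_norm t0) ger0_norm ?subr_ge0//.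
      have [->|t2] := eqVneq t 1%R; first by rewrite subrr mul0r add0r mul1r.
      have t3 : (0 < 1 - t)%R by rewrite subr_gt0 lt_neqAle t2.
      have h1 : ((1 - t) * enorm (y - x) < (1 - t) * (e * h))%R by rewrite ltr_pM2l.
      have h2 : (t * enorm (z - x) <= t * (e * h))%R by rewrite ler_wpM2l// ltW.
      lra.
    have := coord_le_enorm (y + t *: (z - y) - x)%R i; rewrite !mxE => hi hwi.
    have := ler_distD (y ord0 i + t * (z ord0 i - y ord0 i))%R (w ord0 i) (x ord0 i).
    have -> : s = (e + e * h)%R by rewrite /s mulrDr mulr1.
    by move: hi hwi hc; lra.
- move=> x; have : 0 <= (v x)%:E by rewrite vE le_min U0 lee_fin ltW.
  have : (v x)%:E <= a%:E by rewrite vE ge_min lexx.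
  rewrite !lee_fin => h1 h2; rewrite /u divr_ge0 ?(ltW a0)//=.
  by rewrite ler_pdivrMr// mul1r.
- move=> x Ex; have : (v x)%:E = 0 by rewrite vE UE0// min_r// lee_fin ltW.
  by move=> [e1]; rewrite /u e1 mul0r.
- move=> x Ex; have : (v x)%:E = a%:E by rewrite vE min_l// UE1.
  by move=> [e1]; rewrite /u e1 divff// gt_eqF.
- rewrite /energy.
  have c0 : (0 <= ((q * a)^-1) ^+ n)%R by rewrite exprn_ge0// invr_ge0 ltW.
  have mAs : measurable_fun setT (fun x : Bn => A s x ^+ n).
    by apply: measurable_fun_expe; exact: cube_integral_measurable.
  have -> : \int[mu]_x (g x ^+ n)%:E = (((q * a)^-1) ^+ n)%:E * \int[mu]_x (A s x ^+ n).
    rewrite -ge0_integralZl//; last by move=> x _; rewrite expe_ge0// cube_integral_ge0.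
    apply: eq_integral => x _; rewrite -(fineK (Afin x s0)) -EFin_expe -EFinM /g mulrC.
    by rewrite exprMn.
  apply: (@le_trans _ _ ((((q * a)^-1) ^+ n)%:E * ((((2 * s) ^+ n) ^+ n)%:E * \int[mu]_x (rho x ^+ n)))).
    by apply: lee_wpmul2l; [rewrite lee_fin|exact: integral_cube_integral_power].
  rewrite muleA -EFinM le_eqVlt; apply/orP; left; apply/eqP; congr (_%:E * _).
  have -> : ((2 * s) ^+ n = q * (1 + h) ^+ n)%R by rewrite /q -exprMn /s mulrA.
  by rewrite invfM !exprMn mulrACA -exprMn mulVf ?gt_eqF// expr1n mul1r -exprM.
Qed.
End scale.

(** The maximum with a logarithmic potential on a huge annulus around C0 makes u equal to 1 near
    infinity at an arbitrarily small cost. Symmetrization and inversions rely on this. *)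
Lemma regularization (b B : R) : (forall x, E0 x -> (enorm x <= b)%R) ->
  \int[mu]_x (rho x ^+ n) < B%:E ->
  exists u g, [/\ upper_gradient u g, (forall x, 0 <= u x <= 1)%R, (forall x, E0 x -> u x = 0%R),
    (forall x, E1 x -> u x = 1%R) &
    (exists Rb, forall x, (Rb <= enorm x)%R -> u x = 1%R) /\ energy g <= B%:E].
Proof.
move=> hb IB.
have I0 : 0 <= \int[mu]_x (rho x ^+ n) by apply: integral_ge0 => x _; exact: expe_ge0.
have If : \int[mu]_x (rho x ^+ n) \is a fin_num by rewrite ge0_fin_numE.
move: If IB I0; set I' := integral _ _ _ => If; rewrite -(fineK If).
pose I := fine I'; rewrite -/I lte_fin lee_fin => IB I0.
pose del := ((B - I) / 2)%R; have del0 : (0 < del)%R by rewrite divr_gt0// subr_gt0.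
(* Multiplying the loss (1 - h)^-n (1 + h)^(n n) by (1 - h)^N leaves a power of 1 - h^2, which is at
   most 1; Bernoulli's inequality bounds (1 - h)^N from below. *)
pose N := (n + n * n)%N; have N1 : (1 <= N%:R :> R)%R by rewrite ler1n.
have Id : (0 < I + del)%R by rewrite ltr_wpDl.
pose h := (del / (2 * N%:R * (I + del)))%R.
have D0 : (0 < 2 * N%:R * (I + del))%R by rewrite !mulr_gt0.
have h0 : (0 < h)%R by rewrite divr_gt0.
have Nh : (N%:R * h * (I + del) = del / 2)%R.
  by rewrite /h; field; rewrite !gt_eqF.
have Nh1 : (N%:R * h <= 2^-1)%R.
  by rewrite -(ler_pM2r Id) Nh mulrC ler_pM2l ?invr_gt0//; lra.
have h1 : (h < 1)%R.
  by apply: (@le_lt_trans _ _ (N%:R * h)%R); [rewrite ler_peMl// ltW|lra].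
have a0 : (0 < 1 - h)%R by rewrite subr_gt0.
have bern : (1 - N%:R * h <= (1 - h) ^+ N)%R.
  have := @tangent_line_power R N.-1 1%R (1 - h)%R ler01 (ltW a0).
  rewrite (_ : N.-1.+1 = N)// !expr1n !mulr1.
  have -> : (N.-1%:R = N%:R - 1 :> R)%R by rewrite -[in RHS](prednK (_ : 0 < N)%N)// -natr1 addrK.
  by lra.
have key : ((1 - h)^-1 ^+ n * (1 + h) ^+ (n * n) * I <= I + del)%R.
  have p1 : (0 < (1 - h) ^+ N)%R by rewrite exprn_gt0.
  rewrite -(ler_pM2l p1).
  have -> : ((1 - h) ^+ N * ((1 - h)^-1 ^+ n * (1 + h) ^+ (n * n) * I) = ((1 - h) * (1 + h)) ^+ (n * n) * I)%R.
    rewrite /N exprD exprMn !mulrA; congr (_ * _ * _)%R.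
    by rewrite mulrAC -exprMn divff ?gt_eqF// expr1n mul1r.
  apply: (@le_trans _ _ I).
    by rewrite ler_piMl// exprn_ile1//; nra.
  apply: (@le_trans _ _ ((1 - N%:R * h) * (I + del))%R); last by rewrite ler_wpM2r// ltW.
  by rewrite mulrBl mul1r Nh; lra.
have [e e0 att] := attach_cost (divr_gt0 h0 (ltr0n R 2)).
have hh : (0 < h < 1)%R by rewrite h0.
have [u1 [g1 [ug1 u1b u10 u11 eg1]]] := regularized_potential hh e0 att h0.
pose w := @sphere_areaR R m; have w0 : (0 < w)%R by exact: sphere_areaR_gt0.
(* With this X the energy w / X^m of the logarithmic potential is at most [del]. *)
pose X := (1 + w / del)%R; have X1 : (1 <= X)%R by rewrite lerDl divr_ge0// ltW.
have X0 : (0 < X)%R by exact: lt_le_trans X1.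
pose R0 := Num.max b 1%R; have R00 : (0 < R0)%R by rewrite lt_max ltr01 orbT.
pose R1 := (R0 * expR (X + 1))%R.
have R01 : (R0 < R1)%R by rewrite ltr_pMr// expR_gt1; lra.
have [|u2 [g2 [ug2 u2b u2E _ eg2]]] := @log_potential 0%R R0 R1 X R00 R01.
  by rewrite X0 /R1 mulrAC divff ?gt_eqF// mul1r expRK; lra.
exists (fun x => Num.max (u1 x) (u2 x)), (fun x => Num.max (g1 x) (g2 x)); split.
- exact: upper_gradient_max.
- by move=> x; rewrite le_max ge_max; case/andP: (u1b x) => -> ->; case/andP: (u2b x) => _ ->.
- move=> x Ex; have [u20 _] := u2E x; rewrite u10// u20 ?maxxx// subr0.
  by rewrite le_max hb.
- by move=> x Ex; rewrite u11// max_l//; case/andP: (u2b x).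
split.
  exists R1 => x hx; have [_ u21] := u2E x; rewrite u21 ?subr0// max_r//; by case/andP: (u1b x).
case: (ug1) (ug2) => [_ mg1 g10 _] [_ mg2 g20 _].
apply: (le_trans (energy_max_le g10 g20 mg1 mg2)).
have -> : B = (I + del + del)%R by rewrite /del; lra.
rewrite EFinD; apply: leeD.
  apply: (le_trans eg1); rewrite -/I' -(fineK If) -EFinM lee_fin; exact: key.
apply: (le_trans eg2); rewrite lee_fin ler_pdivrMr ?exprn_gt0//.
have Xm : (X <= X ^+ m)%R by rewrite -[leLHS]expr1 ler_weXn2l.
apply: (@le_trans _ _ (del * X)%R); last by rewrite ler_pM2l.
have -> : (del * X = del + w)%R by rewrite /X; field; rewrite gt_eqF.
by rewrite lerDr ltW.
Qed.
End regularization.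

(** * Symmetrization by polarization *)

Section dilation.

(** (dilation h v - v) / h plays the role of the gradient at scale h. It depends on the values of v
    alone, so that polarization acts on it pointwise. *)
Definition dilation (h : R) (v : Rn -> R) (x : Rn) : R := sup [set v y | y in [set y | enorm (y - x) <= h]].

Lemma dilation_ge h v x y : (forall z, v z <= 1) -> enorm (y - x) <= h -> v y <= dilation h v x.
Proof.
move=> v1 hy; apply: ub_le_sup; last by exists y.
by exists 1 => _ [z _ <-].
Qed.

Lemma dilation_le h v x c : 0 <= h -> (forall y, enorm (y - x) <= h -> v y <= c) -> dilation h v x <= c.
Proof.
move=> h0 hc; apply: ge_sup; last by move=> _ [y hy <-]; exact: hc.
by exists (v x), x => //=; rewrite subrr enorm0.
Qed.

Lemma dilation_lipschitz h v K : 0 <= h -> (forall z, v z <= 1) ->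
  (forall x y, `|v x - v y| <= K * enorm (x - y)) ->
  forall x y, `|dilation h v x - dilation h v y| <= K * enorm (x - y).
Proof.
move=> h0 v1 lv.
have H x y : dilation h v x <= dilation h v y + K * enorm (x - y).
  apply: dilation_le => // z hz.
  have h1 : enorm (z + (y - x) - y) <= h by rewrite (_ : z + (y - x) - y = z - x)// addrAC addrA subrK.
  have := dilation_ge v1 h1; have := lv z (z + (y - x)); rewrite ler_norml.
  rewrite (_ : z - (z + (y - x)) = x - y); last by rewrite opprD addrA subrr add0r opprB.
  lra.
move=> x y; have := H x y; have := H y x; rewrite (enormC y x) ler_norml; lra.
Qed.

Lemma expr_convex (p d e : R) k : 0 <= p -> 0 <= d -> 0 <= e ->
  (p + d) ^+ k + (p + e) ^+ k <= p ^+ k + (p + d + e) ^+ k.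
Proof.
move=> p0 d0 e0.
suff : 0 <= (p + d) ^+ k - p ^+ k <= (p + e + d) ^+ k - (p + e) ^+ k.
  by rewrite (addrAC p d e); lra.
elim: k => [|k /andP[h1 h2]]; first by rewrite !expr0 !subrr lexx.
have E q : (q + d) ^+ k.+1 - q ^+ k.+1 = (q + d) * ((q + d) ^+ k - q ^+ k) + d * q ^+ k.
  by rewrite !exprS; ring.
rewrite !E; apply/andP; split.
  by apply: addr_ge0; apply: mulr_ge0 => //; [exact: addr_ge0|exact: exprn_ge0].
apply: lerD; last by rewrite ler_wpM2l// lerXn2r ?nnegrE ?addr_ge0// lerDl.
by apply: ler_pM => //; rewrite ?addr_ge0//; lra.
Qed.

(** Convexity of powers: of the two ways to pair A, B with a, b, the one that respects the order has
    the smaller sum of powers of differences. *)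
Lemma expr_minmax (a b A B : R) k : a <= A -> b <= B ->
  (Num.max A B - Num.max a b) ^+ k + (Num.min A B - Num.min a b) ^+ k <= (A - a) ^+ k + (B - b) ^+ k.
Proof.
move=> aA bB; case: (leP A B) => AB; case: (leP a b) => ab; rewrite ?lexx//.
- by rewrite addrC.
- have := @expr_convex (A - a) (B - A) (a - b) k.
  rewrite !subr_ge0 aA AB (ltW ab) => /(_ isT isT isT).
  rewrite (_ : A - a + (B - A) = B - a); last by ring.
  rewrite (_ : A - a + (a - b) = A - b); last by ring.
  rewrite (_ : B - a + (a - b) = B - b); last by ring.
  by rewrite [X in X <= _]addrC.
- have := @expr_convex (B - b) (A - B) (b - a) k.
  rewrite !subr_ge0 bB ab (ltW AB) => /(_ isT isT isT).
  rewrite (_ : B - b + (A - B) = A - b); last by ring.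
  rewrite (_ : B - b + (b - a) = B - a); last by ring.
  rewrite (_ : A - b + (b - a) = A - a); last by ring.
  by rewrite [X in _ <= X]addrC.
Qed.

Definition oscillation (h : R) (v : Rn -> R) (x : Rn) : R := (dilation h v x - v x) ^+ n.

Lemma le_dilation h v x : 0 <= h -> (forall z, v z <= 1) -> v x <= dilation h v x.
Proof. by move=> h0 v1; apply: dilation_ge => //; rewrite subrr enorm0. Qed.
End dilation.

(** * Polarization with respect to a hyperplane *)

Section polarization.
Variable e : Rn.
Hypothesis e0 : 0 < dot e e.

Definition reflect (x : Rn) : Rn := x - (2 * dot x e / dot e e) *: e.

Lemma dot_reflect x : dot (reflect x) e = - dot x e.
Proof. by rewrite dotDl dotNl dotZl; field; rewrite gt_eqF. Qed.

Lemma reflectB x y : reflect (x - y) = reflect x - reflect y.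
Proof. by apply/rowP => i; rewrite /reflect dotDl dotNl !mxE; field; rewrite gt_eqF. Qed.

Lemma reflectD x y : reflect (x + y) = reflect x + reflect y.
Proof. by apply/rowP => i; rewrite /reflect dotDl !mxE; field; rewrite gt_eqF. Qed.

Lemma reflectK : involutive reflect.
Proof. by move=> x; apply/rowP => i; rewrite /reflect dotDl dotNl dotZl !mxE; field; rewrite gt_eqF. Qed.

Lemma enorm_reflect x : enorm (reflect x) = enorm x.
Proof.
apply: enorm_eq; rewrite /reflect dotDl dotNl dotZl !dotDr !dotNr !dotZr (dotC e x).
by field; rewrite gt_eqF.
Qed.

Lemma reflect_id x : dot x e = 0 -> reflect x = x.
Proof. by move=> h; rewrite /reflect h mulr0 mul0r scale0r subr0. Qed.

Lemma enorm_reflect_le x y : 0 <= dot x e -> 0 <= dot y e -> enorm (x - y) <= enorm (x - reflect y).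
Proof.
move=> hx hy; rewrite -(ler_pXn2r (ltn0Sn 1)) ?nnegrE ?enorm_ge0// !enorm_sqr.
have -> : dot (x - reflect y) (x - reflect y) = dot (x - y) (x - y) + 4 * dot x e * dot y e / dot e e.
  have hz : dot (x - y) e = dot x e - dot y e by rewrite dotDl dotNl.
  rewrite /reflect opprD opprK addrA; move: (x - y) hz => z hz.
  rewrite dotDl dotZl !dotDr !dotZr (dotC e z) hz.
  by field; rewrite gt_eqF.
by rewrite lerDl !mulr_ge0// invr_ge0 ltW.
Qed.

Lemma reflect_continuous : continuous (reflect : Rn -> Rn).
Proof.
move=> x; apply/(@cvgrPdist_le _ _ _ (nbhs x) _ reflect (reflect x)) => r r0; near=> y.
apply: (le_trans (norm_le_enorm _)); rewrite -reflectB enorm_reflect.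
near: y; have : nbhs x [set y : Rn | enorm (y - x) < r].
  apply: open_nbhs_nbhs; split; first exact: open_enorm_lt.
  by rewrite /= subrr enorm0.
by apply: filterS => y /= /ltW; rewrite enormC.
Unshelve. all: by end_near. Qed.

Definition polarize (v : Rn -> R) (x : Rn) : R :=
  if 0 <= dot x e then Num.max (v x) (v (reflect x)) else Num.min (v x) (v (reflect x)).

Lemma polarize_pos v x : 0 <= dot x e -> polarize v x = Num.max (v x) (v (reflect x)).
Proof. by rewrite /polarize => ->. Qed.

Lemma polarize_neg v x : dot x e <= 0 -> polarize v x = Num.min (v x) (v (reflect x)).
Proof.
move=> h; rewrite /polarize; case: ifPn => // h2.
have h0 : dot x e = 0 by apply/eqP; rewrite eq_le h.
by rewrite reflect_id// maxxx minxx.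
Qed.

Lemma polarize_reflect v x : 0 <= dot x e -> polarize v (reflect x) = Num.min (v x) (v (reflect x)).
Proof. by move=> h; rewrite polarize_neg ?dot_reflect ?oppr_le0// reflectK minC. Qed.

Lemma polarize_cases v x : polarize v x = v x \/ polarize v x = v (reflect x).
Proof.
by rewrite /polarize; case: ifP => _; case: (leP (v x) (v (reflect x))) => _; [right|left|left|right].
Qed.

Lemma polarize_lipschitz v K : 0 <= K -> (forall x y, `|v x - v y| <= K * enorm (x - y)) ->
  forall x y, `|polarize v x - polarize v y| <= K * enorm (x - y).
Proof.
move=> K0 lv.
have same x y : `|v (reflect x) - v (reflect y)| <= K * enorm (x - y).
  by apply: le_trans (lv _ _) _; rewrite -reflectB enorm_reflect.
(* On opposite sides, x and the mirror image of y are no farther apart than x and y, and likewise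
   for the mirror image of x and y. All four differences of values are therefore controlled. *)
have opposite x y : 0 <= dot x e -> dot y e < 0 -> `|polarize v x - polarize v y| <= K * enorm (x - y).
  move=> hx hy; rewrite polarize_pos// polarize_neg ?(ltW hy)//.
  have d : enorm (x - reflect y) <= enorm (x - y).
    by rewrite -{2}(reflectK y) enorm_reflect_le// dot_reflect; lra.
  have d' : enorm (reflect x - y) = enorm (x - reflect y) by rewrite -{1}(reflectK y) -reflectB enorm_reflect.
  have := same x y; have := lv x y.
  have : `|v x - v (reflect y)| <= K * enorm (x - y) by apply: le_trans (lv _ _) _; rewrite ler_wpM2l.
  have : `|v (reflect x) - v y| <= K * enorm (x - y).
    by apply: le_trans (lv _ _) _; rewrite ler_wpM2l// d'.
  rewrite !ler_norml.
  by case: (leP (v x) (v (reflect x))) => _; case: (leP (v y) (v (reflect y))) => _; lra.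
move=> x y; case: (leP 0 (dot x e)) => hx; case: (leP 0 (dot y e)) => hy.
- rewrite !polarize_pos//; have := same x y; have := lv x y; rewrite !ler_norml.
  by case: (leP (v x) (v (reflect x))) => ?; case: (leP (v y) (v (reflect y))) => ?; lra.
- exact: opposite.
- by rewrite distrC enormC; exact: opposite.
- rewrite !polarize_neg ?(ltW hx) ?(ltW hy)//; have := same x y; have := lv x y; rewrite !ler_norml.
  by case: (leP (v x) (v (reflect x))) => ?; case: (leP (v y) (v (reflect y))) => ?; lra.
Qed.

(** Together with [dilation_polarize_min]: the dilation of the polarized function is at most the
    polarization of the dilation. *)
Lemma dilation_polarize_max h v x : 0 <= h -> (forall z, v z <= 1) ->
  dilation h (polarize v) x <= Num.max (dilation h v x) (dilation h v (reflect x)).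
Proof.
move=> h0 v1; apply: dilation_le => // y hy; rewrite le_max.
have hy' : enorm (reflect y - reflect x) <= h by rewrite -reflectB enorm_reflect.
have [->|->] := polarize_cases v y; first by rewrite dilation_ge.
by rewrite orbC dilation_ge.
Qed.

Lemma dilation_polarize_min h v x : 0 <= h -> (forall z, v z <= 1) -> 0 <= dot x e ->
  dilation h (polarize v) (reflect x) <= Num.min (dilation h v x) (dilation h v (reflect x)).
Proof.
move=> h0 v1 hx; apply: dilation_le => // y hy; rewrite le_min.
have hy1 : enorm (reflect y - x) <= h by rewrite -[X in _ - X]reflectK -reflectB enorm_reflect.
(* If y lies on the side of x, it is close to both x and its mirror image, so both values v y and v
   (reflect y) count in both dilations. On the other side polarization keeps the smaller value,
   which each dilation dominates. *)
case: (leP 0 (dot y e)) => dy.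
  have hy2 : enorm (y - x) <= h.
    by rewrite enormC; apply: le_trans (enorm_reflect_le hx dy) _; rewrite enormC.
  have hy3 : enorm (reflect y - reflect x) <= h by rewrite -reflectB enorm_reflect.
  have := dilation_ge v1 hy; have := dilation_ge v1 hy1; have := dilation_ge v1 hy2; have := dilation_ge v1 hy3.
  by have [->|->] := polarize_cases v y => *; apply/andP.
rewrite polarize_neg ?(ltW dy)//; apply/andP; split.
  by apply: (@le_trans _ _ (v (reflect y))); [rewrite ge_min lexx orbT|exact: dilation_ge].
by apply: (@le_trans _ _ (v y)); [rewrite ge_min lexx|exact: dilation_ge].
Qed.

(** At x and its mirror image polarization sorts the values and, up to an inequality in the right
    direction, the dilations; [expr_minmax] compares the powers of the differences. *)
Lemma polarize_two_point h v x : 0 <= h -> (forall z, v z <= 1) ->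
  oscillation h (polarize v) x + oscillation h (polarize v) (reflect x) <=
  oscillation h v x + oscillation h v (reflect x).
Proof.
move=> h0 v1; pose f := @oscillation h; rewrite -!/(f _ _).
have vD w y := @le_dilation h w y h0.
have w1 z : polarize v z <= 1 by have [->|->] := polarize_cases v z.
have H y : 0 <= dot y e -> f (polarize v) y + f (polarize v) (reflect y) <= f v y + f v (reflect y).
  move=> hy; rewrite /f /oscillation; have := expr_minmax n (vD v y v1) (vD v (reflect y) v1); apply: le_trans.
  rewrite -(polarize_pos v hy) -(polarize_reflect v hy); apply: lerD.
    rewrite lerXn2r ?nnegrE ?subr_ge0 ?vD// ?lerB ?dilation_polarize_max//.
    by apply: le_trans (vD _ y w1) _; exact: dilation_polarize_max.
  rewrite lerXn2r ?nnegrE ?subr_ge0 ?vD// ?lerB ?dilation_polarize_min//.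
  by apply: le_trans (vD _ (reflect y) w1) _; exact: dilation_polarize_min.
case: (leP 0 (dot x e)) => hx; first exact: H.
by have := H (reflect x); rewrite dot_reflect reflectK oppr_ge0 (ltW hx) => /(_ isT); rewrite addrC [X in _ <= X]addrC.
Qed.

Local Open Scope ereal_scope.

(** Reflections preserve the integral, so a two-point inequality integrates to twice the comparison.
    The term k records a gain: zero for the energy, positive on a ball for the moment. *)
Lemma integral_reflect_le (f g k : Bn -> R) :
  measurable_fun setT f -> measurable_fun setT g -> measurable_fun setT k ->
  (forall x, 0 <= f x)%R -> (forall x, 0 <= g x)%R -> (forall x, 0 <= k x)%R ->
  (forall x, f x + f (reflect x) + k x <= g x + g (reflect x))%R ->
  \int[mu]_x (f x)%:E + \int[mu]_x (f x)%:E + \int[mu]_x (k x)%:E <= \int[mu]_x (g x)%:E + \int[mu]_x (g x)%:E.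
Proof.
move=> mf mg mk f0 g0 k0 hfg.
have mr (w : Bn -> R) : measurable_fun setT w -> measurable_fun setT (fun x : Bn => w (reflect x)).
  by move=> mw; apply: (measurableT_comp mw); exact: (continuous_rV_rV_measurable reflect_continuous).
have I (w : Bn -> R) : measurable_fun setT w -> (forall x, 0 <= w x)%R -> \int[mu]_x (w (reflect x))%:E = \int[mu]_x (w x)%:E.
  move=> mw w0.
  apply: (lebesgue_rV_isometry reflectD reflect_continuous reflect_continuous reflectK reflectK enorm_reflect (h := fun x => (w x)%:E)).
    exact/measurable_EFinP.
  by move=> x; rewrite lee_fin.
rewrite -{2}(I f)// -{2}(I g)// -!ge0_integralD//; do ?[by move=> x _; rewrite lee_fin ?addr_ge0];
  do ?[by apply/measurable_EFinP; first [exact: mf|exact: mg|exact: mk|exact: mr]];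
  do ?[by apply: emeasurable_funD; apply/measurable_EFinP => //; exact: mr].
apply: ge0_le_integral => //.
- by move=> x _; rewrite -!EFinD lee_fin !addr_ge0.
- apply/measurable_EFinP; apply: measurable_funD => //; apply: measurable_funD => //; exact: mr.
- apply/measurable_EFinP; apply: measurable_funD => //; exact: mr.
- by move=> x _; rewrite -!EFinD lee_fin.
Qed.
End polarization.

Lemma expr_le_add (a b e : R) k : 0 <= a <= 1 -> 0 <= b <= 1 -> 0 <= e -> a <= b + e ->
  a ^+ k - b ^+ k <= k%:R * e.
Proof.
move=> /andP[a0 a1] /andP[b0 b1] e0 ab; elim: k => [|k IH]; first by rewrite !expr0 subrr mul0r.
have -> : a ^+ k.+1 - b ^+ k.+1 = a * (a ^+ k - b ^+ k) + (a - b) * b ^+ k by rewrite !exprS; ring.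
have h1 : (a - b) * b ^+ k <= e.
  apply: (@le_trans _ _ (e * b ^+ k)); first by rewrite ler_wpM2r ?exprn_ge0//; lra.
  by rewrite ler_piMr// exprn_ile1.
have h2 : a * (a ^+ k - b ^+ k) <= k%:R * e.
  apply: (@le_trans _ _ (a * (k%:R * e))); first by rewrite ler_wpM2l.
  by rewrite ler_piMl// mulr_ge0.
by rewrite -natr1 (mulrDl k%:R) mul1r; apply: lerD.
Qed.

(** * Minimizers in a class stable under polarization *)

Section symmetrization.
Variables (K B t h : R) (D : \bar R).
Hypotheses (K0 : 0 <= K) (B1 : 1 <= B) (h0 : 0 < h).

(** Stable under polarization and under uniform limits. The geometry of the ring is retained only
    through the values 1 on spheres of radius at most 1 and 0 on spheres of radius at least t, at
    unspecified points of these spheres. *)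
Record profile (v : Rn -> R) : Prop := Profile {
  profile_lipschitz : forall x y, `|v x - v y| <= K * enorm (x - y);
  profile_itv : forall x, 0 <= v x <= 1;
  profile_out : forall x, B <= enorm x -> v x = 0;
  profile_one : forall r, 0 <= r <= 1 -> exists2 x, enorm x = r & v x = 1;
  profile_zero : forall r, t <= r -> exists2 x, enorm x = r & v x = 0;
  profile_energy : (\int[mu]_x (oscillation h v x)%:E <= D)%E }.

Lemma profile_le1 v : profile v -> forall x, v x <= 1.
Proof. by move=> pv x; case/andP: (profile_itv pv x). Qed.

Lemma profile_measurable v : profile v -> measurable_fun setT (v : Bn -> R).
Proof.
by move=> pv; apply: continuous_rV_measurable; exact: lipschitz_rV_continuous (profile_lipschitz pv).
Qed.

Lemma oscillation_measurable (v : Rn -> R) : (forall x y, `|v x - v y| <= K * enorm (x - y)) ->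
  (forall x, v x <= 1) -> measurable_fun setT (oscillation h v : Bn -> R).
Proof.
move=> lv v1; apply: measurable_funX; apply: measurable_funB; apply: continuous_rV_measurable;
  apply: (@lipschitz_rV_continuous R n _ K) => //.
exact: dilation_lipschitz (ltW h0) v1 lv.
Qed.

Lemma oscillation_ge0 (v : Rn -> R) : (forall x, v x <= 1) -> forall x, 0 <= oscillation h v x.
Proof. by move=> v1 x; rewrite exprn_ge0// subr_ge0 le_dilation ?(ltW h0). Qed.

Lemma profile_polarize e v : 0 < dot e e -> profile v -> profile (polarize e v).
Proof.
move=> e0 pv; have v01 := profile_itv pv; have v1 := profile_le1 pv.
have P x (Q : R -> Prop) : Q (v x) -> Q (v (reflect e x)) -> Q (polarize e v x).
  by have [->|->] := polarize_cases e v x.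
have w1 z : polarize e v z <= 1 by exact: (P z (fun c => c <= 1)).
have lW := polarize_lipschitz e0 K0 (profile_lipschitz pv).
have mo := oscillation_measurable lW w1.
split.
- exact: polarize_lipschitz (profile_lipschitz pv).
- by move=> x; apply: (P x (fun c => 0 <= c <= 1)).
- move=> x hx; apply: (P x (fun c => c = 0)); first exact: profile_out.
  by apply: (profile_out pv); rewrite enorm_reflect.
- move=> r /(profile_one pv)[x xr vx]; case: (leP 0 (dot x e)) => hx.
    by exists x => //; rewrite polarize_pos// vx max_l.
  exists (reflect e x); first by rewrite enorm_reflect.
  by rewrite polarize_pos ?dot_reflect ?oppr_ge0 ?(ltW hx)// reflectK// vx max_r.
- move=> r /(profile_zero pv)[x xr vx]; case: (leP 0 (dot x e)) => hx.
    exists (reflect e x); first by rewrite enorm_reflect.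
    by rewrite polarize_reflect// vx min_l//; case/andP: (v01 (reflect e x)).
  by exists x => //; rewrite polarize_neg ?(ltW hx)// vx min_l//; case/andP: (v01 (reflect e x)).
- apply: le_trans (profile_energy pv).
  have o0 := oscillation_ge0 w1.
  have mv := oscillation_measurable (profile_lipschitz pv) v1.
  have := @integral_reflect_le e e0 _ _ (cst 0) mo mv (measurable_cst _) o0 (oscillation_ge0 v1) (fun=> lexx _).
  have -> : (\int[mu]_x (cst 0 x : R)%:E = 0)%E by apply: integral0_eq.
  rewrite adde0.
  have I0 : (0 <= \int[mu]_x (oscillation h (polarize e v) x)%:E)%E by apply: integral_ge0 => x _; rewrite lee_fin.
  have I1 : (0 <= \int[mu]_x (oscillation h v x)%:E)%E by apply: integral_ge0 => x _; rewrite lee_fin oscillation_ge0.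
  have H x : oscillation h (polarize e v) x + oscillation h (polarize e v) (reflect e x) + cst 0 x <=
    oscillation h v x + oscillation h v (reflect e x).
    by rewrite /= addr0; exact: polarize_two_point (ltW h0) v1.
  move=> /(_ H); move: I0 I1.
  case: integral => [a| |] //; case: integral => [b| |] // _ _; rewrite ?leey//.
  by rewrite -!EFinD !lee_fin; lra.
Qed.

(** It increases with the first coordinate, so minimizing the moment pushes the large values of v
    towards -e_1; the shift makes it positive on the open ball of radius B, outside of which
    profiles vanish. *)
Definition weight (x : Rn) : R := Num.max 0 (B + x ord0 ord0).

Lemma weight_ge0 x : 0 <= weight x. Proof. by rewrite le_max lexx. Qed.

Lemma weight_le x : enorm x <= B -> weight x <= 2 * B.
Proof.
move=> hx; have h1 := le_trans (ler_norm _) (le_trans (coord_le_enorm x ord0) hx).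
by have B1' := B1; rewrite /weight ge_max; apply/andP; split; lra.
Qed.

Lemma weight_continuous : continuous (weight : Rn -> R).
Proof.
apply: (@lipschitz_rV_continuous R n _ 1) => x y; rewrite mul1r.
have := coord_le_enorm (x - y) ord0; rewrite !mxE /weight !ler_norml.
by case: (leP 0 (B + x ord0 ord0)) => ?; case: (leP 0 (B + y ord0 ord0)) => ?; lra.
Qed.

Lemma weight_reflect e x : 0 < dot e e -> e ord0 ord0 < 0 -> 0 <= dot x e ->
  weight x <= weight (reflect e x) /\ (0 < dot x e -> enorm x < B -> weight x < weight (reflect e x)).
Proof.
move=> e0 en xe.
have E : (reflect e x) ord0 ord0 = x ord0 ord0 + 2 * dot x e / dot e e * - e ord0 ord0.
  by rewrite !mxE mulrN.
have c0 : 0 <= 2 * dot x e / dot e e * - e ord0 ord0.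
  by apply: mulr_ge0; rewrite ?oppr_ge0 ?(ltW en)//; apply: divr_ge0; rewrite ?mulr_ge0// ltW.
split; first by rewrite /weight E; case: (leP 0 (B + x ord0 ord0)) => ?; rewrite le_max; apply/orP; [right; lra|left].
move=> xe0 xB; have c1 : 0 < 2 * dot x e / dot e e * - e ord0 ord0.
  by rewrite mulr_gt0 ?divr_gt0 ?mulr_gt0 ?oppr_gt0.
have xb : 0 < B + x ord0 ord0.
  by have := coord_le_enorm x ord0; rewrite ler_norml; lra.
by rewrite /weight E max_r ?(ltW xb)// lt_max; apply/orP; right; lra.
Qed.

Definition moment (v : Rn -> R) : \bar R := (\int[mu]_x (v x * weight x)%:E)%E.

Lemma moment_ge0 v : profile v -> (0 <= moment v)%E.
Proof.
move=> pv; apply: integral_ge0 => x _; rewrite lee_fin mulr_ge0 ?weight_ge0//.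
by case/andP: (profile_itv pv x).
Qed.

Lemma moment_measurable v : profile v -> measurable_fun setT (fun x : Bn => v x * weight x).
Proof.
move=> pv; apply: measurable_funM; first exact: profile_measurable.
exact: continuous_rV_measurable weight_continuous.
Qed.

(** Gives the continuity of the discrete energy and of the moment under uniform convergence of
    profiles, which all vanish outside one ball. *)
Lemma integral_close (f g : Bn -> R) (c r : R) :
  measurable_fun setT f -> measurable_fun setT g -> (forall x, 0 <= f x) -> (forall x, 0 <= g x) -> 0 <= c ->
  (forall x, enorm x <= r -> f x <= g x + c) -> (forall x, r < enorm x -> f x = 0) ->
  (\int[mu]_x (f x)%:E <= \int[mu]_x (g x)%:E + c%:E * mu (eball 0 r))%E.
Proof.
move=> mf mg f0 g0 c0 hin hout.
have mE : measurable (eball 0 r : set Bn) by exact: eball_measurable.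
have -> : (c%:E * mu (eball 0 r) = \int[mu]_x (c * \1_(eball 0 r) x)%:E)%E.
  transitivity (\int[mu]_(x in eball 0 r) c%:E)%E; first by rewrite integral_cst.
  by rewrite integral_indicM; apply: eq_integral => x _; rewrite -EFinM.
have mc : measurable_fun setT (fun x : Bn => (c * \1_(eball 0 r) x)%:E).
  by apply/measurable_EFinP; apply: measurable_funM => //; exact: measurable_indic.
rewrite -ge0_integralD//; do ?[by move=> x _; rewrite lee_fin ?mulr_ge0]; do ?[exact/measurable_EFinP].
apply: ge0_le_integral => //.
- by move=> x _; rewrite lee_fin.
- exact/measurable_EFinP.
- by apply: emeasurable_funD => //; exact/measurable_EFinP.
move=> x _; rewrite -EFinD lee_fin; case: (leP (enorm x) r) => hx.
  by rewrite indicE mem_set ?mulr1 ?hin//= /eball/= subr0.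
by rewrite hout// addr_ge0// mulr_ge0.
Qed.

Lemma oscillation_near v w eps : (forall x y, `|v x - v y| <= K * enorm (x - y)) ->
  (forall x, 0 <= v x <= 1) -> (forall x, B <= enorm x -> v x = 0) ->
  profile w -> 0 <= eps -> (forall x, `|v x - w x| <= eps) ->
  (\int[mu]_x (oscillation h v x)%:E <= \int[mu]_x (oscillation h w x)%:E + (n%:R * (2 * eps))%:E * mu (eball 0%R (B + h)))%E.
Proof.
move=> lv v01 vout pw eps0 vw; have v1 x : v x <= 1 by case/andP: (v01 x).
have w1 := profile_le1 pw; have lw := profile_lipschitz pw.
apply: integral_close; [exact: oscillation_measurable|exact: oscillation_measurable|exact: oscillation_ge0|
  exact: oscillation_ge0|by rewrite !mulr_ge0| |].
- move=> x _; rewrite -lerBlDl /oscillation.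
  have dv : dilation h v x <= dilation h w x + eps.
    apply: dilation_le => [|y hy]; first exact: ltW.
    by have := dilation_ge w1 hy; have := vw y; rewrite ler_norml; lra.
  have a0 : 0 <= dilation h v x - v x by rewrite subr_ge0 le_dilation ?(ltW h0).
  have b0 : 0 <= dilation h w x - w x by rewrite subr_ge0 le_dilation ?(ltW h0).
  have a1 : dilation h v x - v x <= 1.
    have : dilation h v x <= 1 by apply: dilation_le => [|y _]; [exact: ltW|].
    by have := v01 x; lra.
  have b1 : dilation h w x - w x <= 1.
    have : dilation h w x <= 1 by apply: dilation_le => [|y _]; [exact: ltW|].
    by have := profile_itv pw x; lra.
  have ab : dilation h v x - v x <= dilation h w x - w x + 2 * eps.
    by have := vw x; rewrite ler_norml; lra.
  by apply: expr_le_add; rewrite ?a0 ?b0 ?mulr_ge0.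
- move=> x hx; rewrite /oscillation; have h0' := h0; have xB : B <= enorm x by lra.
  rewrite (vout x xB) subr0 (_ : dilation h v x = 0) ?expr0n//.
  apply/eqP; rewrite eq_le; apply/andP; split.
    apply: dilation_le => [|y hy]; first exact: ltW.
    rewrite vout//; have := enorm_dist x y; rewrite (enormC x y) ler_norml; lra.
  by rewrite -(vout x xB) le_dilation ?(ltW h0).
Qed.

Lemma moment_near v w eps : profile v -> profile w -> (forall x, `|v x - w x| <= eps) -> 0 <= eps ->
  (moment v <= moment w + (eps * (2 * B))%:E * mu (eball 0%R B))%E.
Proof.
move=> pv pw vw eps0; have B0 := le_trans ler01 B1.
apply: integral_close; [exact: moment_measurable|exact: moment_measurable| | |by rewrite !mulr_ge0| |].
- by move=> x; rewrite mulr_ge0 ?weight_ge0//; case/andP: (profile_itv pv x).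
- by move=> x; rewrite mulr_ge0 ?weight_ge0//; case/andP: (profile_itv pw x).
- move=> x hx; rewrite -lerBlDl -mulrBl.
  apply: (@le_trans _ _ (eps * weight x)); last by rewrite ler_wpM2l// weight_le.
  by rewrite ler_wpM2r ?weight_ge0//; have := vw x; rewrite ler_norml; lra.
- by move=> x hx; rewrite (profile_out pv) ?mul0r// ltW.
Qed.

Lemma moment_fin v : profile v -> moment v \is a fin_num.
Proof.
move=> pv; have B0 := le_trans ler01 B1; rewrite ge0_fin_numE ?moment_ge0//.
apply: (@le_lt_trans _ _ (\int[mu]_x (0 : R)%:E + (2 * B)%:E * mu (eball 0 B))%E).
  apply: integral_close => //; first exact: moment_measurable.
  - by move=> x; rewrite mulr_ge0 ?weight_ge0//; case/andP: (profile_itv pv x).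
  - by rewrite mulr_ge0.
  - move=> x hx; rewrite add0r; apply: le_trans (weight_le hx).
    by rewrite ler_piMl ?weight_ge0//; exact: profile_le1.
  - by move=> x hx; rewrite (profile_out pv) ?mul0r// ltW.
rewrite integral0_eq// add0e ltey_eq fin_numM// ge0_fin_numE//; exact: lebesgue_eball_fin.
Qed.

(** An ultrafilter finer than the minimizing families has pointwise limits because [0, 1] is
    compact. The common Lipschitz constant and the common bound on the supports make the convergence
    uniform, so the limit is again a profile. *)
Lemma profile_minimizer v0 : profile v0 ->
  exists2 w, profile w & forall v, profile v -> (moment w <= moment v)%E.
Proof.
move=> p0; have B0 := le_trans ler01 B1.
pose i := ereal_inf [set moment v | v in profile].
have i0 : (0 <= i)%E by apply: le_ereal_inf_tmp => _ [v pv <-]; exact: moment_ge0.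
have ifin : i \is a fin_num.
  rewrite ge0_fin_numE//; apply: (@le_lt_trans _ _ (moment v0)); first by apply: ereal_inf_lbound; exists v0.
  by rewrite -ge0_fin_numE ?moment_ge0// moment_fin.
pose G eps : set (Rn -> R) := [set v | profile v /\ (moment v <= i + eps%:E)%E].
have GF : ProperFilter (filter_from [set eps : R | 0 < eps] G).
  apply: filter_from_proper; first apply: filter_from_filter.
  - by exists 1 => /=.
  - move=> a b a0 b0; exists (Num.min a b); first by rewrite /= lt_min a0.
    by move=> v [pv hv]; split; split=> //; apply: (le_trans hv); rewrite leeD2l// lee_fin ge_min lexx ?orbT.
  - move=> eps eps0; have [_ [v pv <-] hv] := lb_ereal_inf_adherent eps0 ifin.
    by exists v; split=> //; exact: ltW.
have [U [UU sU]] := ultraFilterLemma GF.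
have UG eps : 0 < eps -> U (G eps) by move=> eps0; apply: sU; exists eps.
have Up : U profile by apply: filterS (UG 1 ltr01) => v [].
have lim x : exists l : R, (fun v : Rn -> R => v x) @ U --> l.
  have [|l [_ hl]] := @segment_compact R 0 1 ((fun v : Rn -> R => v x) @ U) _.
    suff : U [set v : Rn -> R | `[0, 1]%classic (v x)] by [].
    apply: (@filterS _ U _ profile) => // v pv; have := profile_itv pv x.
    by rewrite /= in_itv.
  exists l => N hN; have [//|UN] := in_ultra_setVsetC ((fun v : Rn -> R => v x) @^-1` N) UU.
  by have [y [/= hy1 hy2]] := hl (~` N) N UN hN.
have [w wE] := choice lim.
have Uw x d : 0 < d -> U [set v : Rn -> R | `|w x - v x| < d].
  by move=> d0; have /cvgrPdist_lt := wE x; apply.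
have wlip x y : `|w x - w y| <= K * enorm (x - y).
  apply/ler_addgt0Pr => d d0; have d2 : 0 < d / 2 by rewrite divr_gt0.
  have [v [[hx hy] pv]] := @filter_ex _ U _ _ (filterI (filterI (Uw x _ d2) (Uw y _ d2)) Up).
  have := profile_lipschitz pv x y; move: hx hy => /=; rewrite !ler_norml !ltr_norml; lra.
have w01 x : 0 <= w x <= 1.
  have H d : 0 < d -> - d <= w x <= 1 + d.
    move=> d0; have [v [hx pv]] := @filter_ex _ U _ _ (filterI (Uw x _ d0) Up).
    by have := profile_itv pv x; move: hx => /=; rewrite ltr_norml; lra.
  apply/andP; split; apply/ler_addgt0Pr => d d0; have := H d d0; lra.
have wout x : B <= enorm x -> w x = 0.
  move=> hx; apply/eqP; rewrite eq_le; have /andP[-> _] := w01 x; rewrite andbT.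
  apply/ler_addgt0Pr => d d0; rewrite add0r.
  have [v [hv pv]] := @filter_ex _ U _ _ (filterI (Uw x _ d0) Up).
  by move: hv => /=; rewrite (profile_out pv hx) subr0 ltr_norml; lra.
(* Equicontinuity makes the convergence locally uniform; [compact_near_coveringP] then passes to
   balls and spheres. *)
have local x d : 0 < d -> \forall x' \near x & v \near U, `|v x' - w x| < d /\ `|w x' - w x| < d.
  move=> d0; pose r := d / (2 * (K + 1)).
  have K1 : 0 < 2 * (K + 1) by rewrite mulr_gt0// ltr_wpDl.
  have r0 : 0 < r by rewrite divr_gt0.
  have Kr : K * r <= d / 2.
    rewrite /r mulrA ler_pdivrMr// (_ : d / 2 * (2 * (K + 1)) = d * (K + 1)); last by field.
    by rewrite mulrC ler_pM2l//; lra.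
  have nx : nbhs x [set y : Rn | enorm (y - x) < r].
    by apply: open_nbhs_nbhs; split; [exact: open_enorm_lt|rewrite /= subrr enorm0].
  have d2 : 0 < d / 2 by rewrite divr_gt0.
  exists ([set y : Rn | enorm (y - x) < r], profile `&` [set v : Rn -> R | `|w x - v x| < d / 2]) => /=.
    by split=> //; apply: filterI => //; exact: Uw.
  move=> [y v] /= [yr [pv hv]].
  have h1 : K * enorm (y - x) <= d / 2 by apply: le_trans Kr; rewrite ler_wpM2l// ltW.
  have := profile_lipschitz pv y x; have := wlip y x; move: hv; rewrite !ler_norml !ltr_norml => *.
  by split; apply/andP; split; lra.
have cB r : compact [set x : Rn | enorm x <= r].
  apply: (@compact_enorm R n _ r) => //.
  rewrite (_ : [set x : Rn | enorm x <= r] = [set x : Rn | enorm (x - 0) <= r]); first exact: closed_enorm_le.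
  by apply/seteqP; split=> x /=; rewrite subr0.
have cS r : compact [set x : Rn | enorm x = r].
  apply: (subclosed_compact _ (cB r)); last by move=> x /= ->.
  by apply: (@closed_comp _ _ (@enorm R n) [set r]) => [x _|]; [exact: enorm_continuous|exact: closed_eq].
have unif d : 0 < d -> U [set v : Rn -> R | forall x, `|v x - w x| <= d].
  move=> d0; have d2 : 0 < d / 2 by rewrite divr_gt0.
  have /compact_near_coveringP/(_ _ U (fun v x => `|v x - w x| <= d) _) near := cB B.
  have {}near : U [set v : Rn -> R | [set x : Rn | enorm x <= B] `<=` [set x | `|v x - w x| <= d]].
    by apply: near => x _; apply: filterS (local x _ d2) => -[y v] /=; rewrite ler_norml !ltr_norml; lra.
  apply: filterS (filterI near Up) => v [hv pv] x; case: (leP (enorm x) B) => hx; first exact: hv.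
  by rewrite (profile_out pv) ?wout ?(ltW hx)// subrr normr0 ltW.
have wone r : 0 <= r <= 1 -> exists2 x, enorm x = r & w x = 1.
  move=> hr; apply: contrapT => none.
  have wlt x : enorm x = r -> w x < 1.
    move=> xr; have /andP[_ w1] := w01 x; rewrite lt_neqAle w1 andbT.
    by apply/eqP => wx; apply: none; exists x.
  have /compact_near_coveringP/(_ _ U (fun v x => v x < 1) _) near := cS r.
  have {}near : U [set v : Rn -> R | [set x : Rn | enorm x = r] `<=` [set x | v x < 1]].
    apply: near => x /wlt xr; have d0 : 0 < 1 - w x by rewrite subr_gt0.
    by apply: filterS (local x _ d0) => -[y v] /=; rewrite !ltr_norml; lra.
  have [v [hv pv]] := @filter_ex _ U _ _ (filterI near Up).
  by have [x xr vx] := profile_one pv hr; have := hv x xr; rewrite /= vx ltxx.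
have wzero r : t <= r -> exists2 x, enorm x = r & w x = 0.
  move=> hr; apply: contrapT => none.
  have wgt x : enorm x = r -> 0 < w x.
    move=> xr; have /andP[w0 _] := w01 x; rewrite lt_neqAle w0 andbT.
    by apply/eqP => wx; apply: none; exists x.
  have /compact_near_coveringP/(_ _ U (fun v x => 0 < v x) _) near := cS r.
  have {}near : U [set v : Rn -> R | [set x : Rn | enorm x = r] `<=` [set x | 0 < v x]].
    apply: near => x /wgt xr.
    by apply: filterS (local x _ xr) => -[y v] /=; rewrite !ltr_norml; lra.
  have [v [hv pv]] := @filter_ex _ U _ _ (filterI near Up).
  by have [x xr vx] := profile_zero pv hr; have := hv x xr; rewrite /= vx ltxx.
have ballE r : exists2 V, 0 <= V & mu (eball 0 r) = V%:E.
  have fb : mu (eball 0 r) \is a fin_num by rewrite ge0_fin_numE//; exact: lebesgue_eball_fin.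
  by exists (fine (mu (eball 0 r))); rewrite ?fine_ge0// fineK.
have pw : profile w.
  split=> //; apply/lee_addgt0Pr => d d0.
  have [V V0 VE] := ballE (B + h).
  pose eps := d / (2 * n%:R * V + 1).
  have P0 : 0 < 2 * n%:R * V + 1 by rewrite ltr_wpDl// !mulr_ge0.
  have eps0 : 0 < eps by rewrite divr_gt0.
  have [v [hv pv]] := @filter_ex _ U _ _ (filterI (unif _ eps0) Up).
  have oE : (\int[mu]_x (oscillation h w x)%:E <= \int[mu]_x (oscillation h v x)%:E + (n%:R * (2 * eps))%:E * mu (eball 0%R (B + h)))%E.
    apply: oscillation_near => //; [exact: ltW|by move=> x; rewrite distrC; exact: hv].
  apply: (le_trans oE); apply: leeD; first exact: profile_energy.
  rewrite VE -EFinM lee_fin (_ : n%:R * (2 * eps) * V = eps * (2 * n%:R * V)); last by ring.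
  by rewrite /eps mulrAC ler_pdivrMr// ler_pM2l// lerDl.
exists w => // u pu; apply: (@le_trans _ _ i); last by apply: ereal_inf_lbound; exists u.
apply/lee_addgt0Pr => d d0.
have [V V0 VE] := ballE B.
pose eps := d / (1 + 2 * B * V).
have P0 : 0 < 1 + 2 * B * V by rewrite ltr_pwDl// !mulr_ge0.
have eps0 : 0 < eps by rewrite divr_gt0.
have [v [hv [pv iv]]] := @filter_ex _ U _ _ (filterI (unif _ eps0) (UG _ eps0)).
have oE : (moment w <= moment v + (eps * (2 * B))%:E * mu (eball 0%R B))%E.
  by apply: moment_near => //; [move=> x; rewrite distrC; exact: hv|exact: ltW].
apply: (le_trans oE); rewrite VE -EFinM; apply: (le_trans (leeD2r _ iv)).
rewrite -addeA -EFinD leeD2l// lee_fin le_eqVlt; apply/orP; left; apply/eqP.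
by rewrite /eps; field; rewrite gt_eqF.
Qed.

(** Where w is larger on the heavier side, polarization moves the larger value to the side of
    nonnegative product with e, on which the weight is smaller. The moment never increases and would
    decrease strictly near x. *)
Lemma minimizer_reflect w : profile w -> (forall v, profile v -> (moment w <= moment v)%E) ->
  forall e x, 0 < dot e e -> e ord0 ord0 < 0 -> 0 <= dot x e -> w (reflect e x) <= w x.
Proof.
move=> pw wmin e x e0 en xe; rewrite leNgt; apply/negP => wx.
have pW := profile_polarize e0 pw; have lw := lipschitz_rV_continuous (profile_lipschitz pw).
have lW := lipschitz_rV_continuous (profile_lipschitz pW).
pose W := polarize e w.
pose F (v : Rn -> R) y := v y * weight y.
pose gap y := F w y + F w (reflect e y) - (F W y + F W (reflect e y)).
have gap_pos y : 0 <= dot y e -> gap y = Num.max 0 (w (reflect e y) - w y) * (weight (reflect e y) - weight y).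
  move=> ye; rewrite /gap /F /W polarize_pos// polarize_reflect//.
  case: (leP (w y) (w (reflect e y))) => h1.
    by rewrite max_r ?subr_ge0//; ring.
  by rewrite max_l ?subr_le0 ?ltW//; ring.
have gap0 y : 0 <= gap y.
  have H z : 0 <= dot z e -> 0 <= gap z.
    move=> ze; rewrite gap_pos// mulr_ge0 ?le_max ?lexx// subr_ge0.
    by have [] := weight_reflect e0 en ze.
  case: (leP 0 (dot y e)) => ye; first exact: H.
  have := H (reflect e y); rewrite dot_reflect// oppr_ge0 ltW// => /(_ isT).
  by rewrite /gap reflectK// (addrC (F w (reflect e y))) (addrC (F W (reflect e y))).
have gapx : 0 < gap x.
  rewrite gap_pos// mulr_gt0 ?lt_max ?subr_gt0 ?wx ?orbT//.
  have [_] := weight_reflect e0 en xe; apply.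
    rewrite lt_neqAle xe andbT; apply/eqP => xe0.
    by move: wx; rewrite reflect_id// ltxx.
  rewrite ltNge; apply/negP => Bx; move: wx.
  by rewrite (profile_out pw Bx) (profile_out pw) ?ltxx// enorm_reflect.
have cr : continuous (reflect e : Rn -> Rn) by exact: reflect_continuous.
have cF v : continuous (v : Rn -> R) -> continuous (F v : Rn -> R).
  by move=> cv z; exact: (cvgM (cv z) (@weight_continuous z)).
have cgap : continuous (gap : Rn -> R).
  have cFr v : continuous (v : Rn -> R) -> continuous (fun z : Rn => F v (reflect e z)).
    by move=> cv z; apply: (@continuous_comp _ _ _ (reflect e) (F v)); [exact: cr|exact: cF].
  by move=> z; exact: (cvgB (cvgD (cF w lw z) (cFr w lw z)) (cvgD (cF W lW z) (cFr W lW z))).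
have : nbhs x [set y : Rn | gap x / 2 < gap y].
  apply: (cgap x [set y | gap x / 2 < y]); apply: open_nbhs_nbhs; split; [exact: open_gt|rewrite /=; lra].
move=> /nbhs_ballP[d /= d0 hd].
pose k (y : Bn) := gap x / 2 * \1_(ball x d) y.
have mb : measurable (ball x d : set Bn) by apply: open_rV_measurable; exact: ball_open.
have mk : measurable_fun setT k by apply: measurable_funM => //; exact: measurable_indic.
have k0 y : 0 <= k y by rewrite mulr_ge0// ltW// divr_gt0.
have FW0 y : 0 <= F W y by rewrite mulr_ge0 ?weight_ge0//; case/andP: (profile_itv pW y).
have Fw0 y : 0 <= F w y by rewrite mulr_ge0 ?weight_ge0//; case/andP: (profile_itv pw y).
have H y : F W y + F W (reflect e y) + k y <= F w y + F w (reflect e y).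
  rewrite -lerBrDl -/(gap y) /k indicE; case: (boolP (y \in _)) => [|_]; last by rewrite mulr0.
  by rewrite inE mulr1 => /hd /= /ltW.
have := integral_reflect_le e0 (moment_measurable pW) (moment_measurable pw) mk FW0 Fw0 k0 H.
rewrite -/(moment w) -/(moment W).
have -> : (\int[mu]_y (k y)%:E = (gap x / 2 * (2 * d) ^+ n)%:E)%E.
  rewrite EFinM -(lebesgue_ball x d0).
  transitivity (\int[mu]_(y in ball x d) (gap x / 2)%:E)%E; last by rewrite integral_cst.
  by rewrite [RHS]integral_indicM; apply: eq_integral => y _; rewrite -EFinM.
have c0 : 0 < gap x / 2 * (2 * d) ^+ n by rewrite mulr_gt0 ?divr_gt0// exprn_gt0// mulr_gt0.
have := moment_fin pw; have := moment_fin pW; have := wmin _ pW; rewrite -/W.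
case: (moment w) => [a| |] //; case: (moment W) => [b| |] //.
by rewrite -!EFinD !lee_fin => + _ _; lra.
Qed.

(** Two points y, z of equal norm are exchanged by the reflection with e = y - z. Hence on each
    sphere w does not increase with the first coordinate: its value 1 is found at -r e_1 and its
    value 0 at r e_1. *)
Lemma minimizer_axis w : profile w -> (forall v, profile v -> (moment w <= moment v)%E) ->
  (forall r, 0 <= r <= 1 -> w (- r *: (@e1 R n)) = 1) /\ (forall r, t <= r -> 0 <= r -> w (r *: (@e1 R n)) = 0).
Proof.
move=> pw wmin.
have w1 := profile_le1 pw.
have e11 : (@e1 R n) ord0 ord0 = 1 by rewrite mxE.
have de1 (y : Rn) : dot y (@e1 R n) = y ord0 ord0.
  rewrite /dot big_ord_recl e11 mulr1 big1 ?addr0// => i _.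
  by rewrite !mxE/= mulr0.
have key (y z : Rn) : enorm y = enorm z -> y ord0 ord0 < z ord0 ord0 -> w z <= w y.
  move=> yz hyz; pose e := y - z.
  have en : e ord0 ord0 < 0 by rewrite !mxE subr_lt0.
  have yy : dot y y = dot z z by rewrite -!enorm_sqr yz.
  have e0 : 0 < dot e e.
    rewrite -enorm_sqr exprn_gt0// enorm_gt0 subr_eq0; apply/eqP => E.
    by move: hyz; rewrite E ltxx.
  have ye : 2 * dot y e = dot e e by rewrite /e !dotDr !dotNr !dotDl !dotNl (dotC z y) -yy; ring.
  have -> : z = reflect e y by rewrite /reflect ye divff ?gt_eqF// scale1r /e opprB addrC subrK.
  by apply: minimizer_reflect => //; lra.
have ne1 r : enorm (r *: (@e1 R n)) = `|r|.
  by rewrite enormZ (_ : enorm e1 = 1) ?mulr1//; apply/eqP; rewrite -(@eqrXn2 _ 2) ?enorm_ge0// enorm_sqr de1 e11 expr1n.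
have c1 r : (r *: (@e1 R n)) ord0 ord0 = r by rewrite mxE e11 mulr1.
have extr (x : Rn) r : enorm x = `|r| -> x ord0 ord0 = r -> x = r *: (@e1 R n).
  move=> xr x0; apply/eqP; rewrite -subr_eq0 -enorm_eq0.
  rewrite -sqrf_eq0 enorm_sqr dotDl dotNl !dotDr !dotNr !dotZl !dotZr (dotC e1 x) !de1 x0 e11 -enorm_sqr xr real_normK ?num_real//.
  by apply/eqP; ring.
split=> r.
  move=> /[dup] /andP[r0 _] /(profile_one pw)[x xr wx].
  have xe : enorm x = `|- r| by rewrite normrN ger0_norm.
  have := coord_le_enorm x ord0; rewrite xr ler_norml => /andP[xl _].
  move: xl; rewrite le_eqVlt => /orP[/eqP xl|xl]; first by rewrite -(extr x).
  apply/eqP; rewrite eq_le w1/= -wx; apply: key; last by rewrite c1.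
  by rewrite ne1.
move=> /(profile_zero pw)[x xr wx] r0.
have xe : enorm x = `|r| by rewrite ger0_norm.
have := coord_le_enorm x ord0; rewrite xr ler_norml => /andP[_ xl].
move: xl; rewrite le_eqVlt => /orP[/eqP xl|xl]; first by rewrite -(extr x).
apply/eqP; rewrite eq_le; have /andP[-> _] := profile_itv pw (r *: e1); rewrite andbT.
by rewrite -wx; apply: key; [rewrite ne1|rewrite c1].
Qed.
End symmetrization.

(** * Comparison with the Teichmuller ring *)

Section teichmuller.

Definition segment : set (Rbar R n) := Some @` [set u *: (@e1 R n) | u in [set u : R | -1 <= u <= 0]].

(** The density is the one-sided difference quotient of w at scale h. It sees increases only, so
    curves are run from the ray, where w = 0, to the segment, where w = 1. Division by a = 1 - 2 K h
    compensates the error of [difference_quotient_bound]. *)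
Let symmetrized_step (K B t h : R) (D : \bar R) (w : Rn -> R) : 0 <= K -> 0 < t -> 0 < h -> 2 * K * h < 1 ->
  profile K B t h D w -> (forall r, 0 <= r <= 1 -> w (- r *: (@e1 R n)) = 1) ->
  (forall r, t <= r -> 0 <= r -> w (r *: (@e1 R n)) = 0) ->
  (modulus (ring_curves segment (ray t)) <= ((h * (1 - 2 * K * h)) ^- n)%:E * D)%E.
Proof.
move=> K0 t0 h0 Kh pw wneg wpos; have w1 := profile_le1 pw.
pose a := 1 - 2 * K * h; have a0 : 0 < a by rewrite subr_gt0.
pose c := h * a; have c0 : 0 < c by rewrite mulr_gt0.
pose rho (x : Bn) : \bar R := ((dilation h w x - w x) / c)%:E.
have d0 x : 0 <= dilation h w x - w x by rewrite subr_ge0 le_dilation ?(ltW h0).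
have rho0 x : (0 <= rho x)%E by rewrite lee_fin divr_ge0// ltW.
have mrho : measurable_fun setT rho.
  apply/measurable_EFinP; apply: measurable_funM; last exact: measurable_cst.
  apply: measurable_funB; apply: continuous_rV_measurable; apply: (@lipschitz_rV_continuous R n _ K);
    last exact: (profile_lipschitz pw).
  exact: dilation_lipschitz (ltW h0) w1 (profile_lipschitz pw).
have adm : admissible (ring_curves (ray t) segment) rho.
  apply: (admissible_arcs mrho rho0) => gamma L L0 lg.
  have N (y : Rn) (A : set Rn) : (Some @` A) (Some y : Rbar R n) -> A y by move=> [z Az [<-]].
  case=> [/N [r /= tr gr]|//] /N [q /= q1 gq] _.
  pose F s := w (gamma s) / a.
  have lF s s' : `|F s - F s'| <= K / a * `|s - s'|.
    rewrite -mulrBl normrM (gtr0_norm (_ : 0 < a^-1)) ?invr_gt0// mulrAC ler_wpM2r ?invr_ge0 ?(ltW a0)//.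
    by apply: le_trans (profile_lipschitz pw _ _) _; rewrite ler_wpM2l.
  have mG := measurable_along mrho lg.
  have FG s : 0 <= s <= L -> ((F (s + h) - F s)%:E <= h%:E * rho (gamma s))%E.
    move=> _; rewrite -EFinM lee_fin /F -mulrBl.
    rewrite (_ : h * ((dilation h w (gamma s) - w (gamma s)) / c) = (dilation h w (gamma s) - w (gamma s)) / a); last first.
      by rewrite /c; field; rewrite !gt_eqF.
    rewrite ler_wpM2r ?invr_ge0 ?(ltW a0)// lerB// dilation_ge//.
    by apply: le_trans (lg _ _) _; rewrite addrAC subrr add0r gtr0_norm.
  have := difference_quotient_bound h0 L0 (divr_ge0 K0 (ltW a0)) lF mG (fun s => rho0 _) FG.
  apply: le_trans; rewrite lee_fin /F -gr -gq wpos//; last by apply: le_trans tr; exact: ltW.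
  rewrite -[q]opprK wneg; last by case/andP: q1 => *; apply/andP; split; lra.
  rewrite le_eqVlt; apply/orP; left; apply/eqP.
  by rewrite /a; field; rewrite gt_eqF.
rewrite ring_curvesC; apply: (@le_trans _ _ (\int[mu]_x (rho x ^+ n))%E).
  by apply: ereal_inf_lbound; exists rho.
have o0 := oscillation_ge0 h0 w1.
have -> : (\int[mu]_x (rho x ^+ n) = (c ^- n)%:E * \int[mu]_x (oscillation h w x)%:E)%E.
  rewrite -ge0_integralZl//; last 3 first.
  - by apply/measurable_EFinP; exact: (oscillation_measurable h0 (profile_lipschitz pw) w1).
  - by move=> x _; rewrite lee_fin.
  - by rewrite lee_fin invr_ge0 exprn_ge0// ltW.
  by apply: eq_integral => x _; rewrite -EFin_expe -EFinM expr_div_n mulrC.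
apply: lee_wpmul2l; last exact: profile_energy pw.
by rewrite lee_fin invr_ge0 exprn_ge0// ltW.
Qed.

(** The profile to start from is 1 - u: below the scale of the upper gradient its oscillation is at
    most (h g)^n. The factor (1 - 2 K h)^-n of [symmetrized_step] disappears as h tends to 0. *)
Lemma spherical_symmetrization (u g : Rn -> R) (t : R) : 0 < t -> upper_gradient u g ->
  (forall x, 0 <= u x <= 1) -> (exists Rb, forall x, Rb <= enorm x -> u x = 1) ->
  (forall r, 0 <= r <= 1 -> exists2 x, enorm x = r & u x = 0) ->
  (forall r, t <= r -> exists2 x, enorm x = r & u x = 1) ->
  (modulus (ring_curves segment (ray t)) <= energy g)%E.
Proof.
move=> t0 [[K K0 lu] mg g0 [h1 h10 loc]] u01 [Rb uout] uzero uone.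
have En0 : (0 <= energy g)%E by apply: integral_ge0 => x _; rewrite lee_fin exprn_ge0.
have [->|Efin] := eqVneq (energy g) +oo%E; first by rewrite leey.
have {}Efin : energy g \is a fin_num by rewrite ge0_fin_numE// ltey.
pose B := Num.max Rb 1; have B1 : 1 <= B by rewrite le_max lexx orbT.
have step h : 0 < h -> h < h1 -> 2 * K * h < 1 ->
    (modulus (ring_curves segment (ray t)) <= ((h * (1 - 2 * K * h)) ^- n)%:E * ((h ^+ n)%:E * energy g))%E.
  move=> h0 hh Kh; pose v0 x := 1 - u x.
  have v1 x : v0 x <= 1 by have := u01 x; rewrite /v0; lra.
  have lv x y : `|v0 x - v0 y| <= K * enorm (x - y).
    by have := lu x y; rewrite /v0 !ler_norml; lra.
  have p0 : profile K B t h ((h ^+ n)%:E * energy g)%E v0.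
    split=> //.
    - by move=> x; have := u01 x; rewrite /v0; lra.
    - by move=> x; rewrite /B ge_max => /andP[xR _]; rewrite /v0 uout// subrr.
    - by move=> r /uzero[x xr ux]; exists x => //; rewrite /v0 ux subr0.
    - by move=> r /uone[x xr ux]; exists x => //; rewrite /v0 ux subrr.
    rewrite /energy -ge0_integralZl//; last 3 first.
    - by apply/measurable_EFinP; exact: measurable_funX.
    - by move=> x _; rewrite lee_fin exprn_ge0.
    - by rewrite lee_fin exprn_ge0// ltW.
    apply: ge0_le_integral => //.
    - by move=> x _; rewrite lee_fin oscillation_ge0.
    - by apply/measurable_EFinP; exact: (oscillation_measurable h0 lv v1).
    - by apply: measurable_funeM; apply/measurable_EFinP; exact: measurable_funX.
    move=> x _; rewrite -EFinM lee_fin /oscillation -exprMn lerXn2r ?nnegrE ?subr_ge0 ?le_dilation ?(ltW h0) ?mulr_ge0 ?(ltW h0)//.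
    rewrite lerBlDr; apply: dilation_le => [|y hy]; first exact: ltW.
    have yh : enorm (y - x) < h1 by exact: le_lt_trans hy hh.
    have xh : enorm (x - x) < h1 by rewrite subrr enorm0.
    have := loc x y x yh xh.
    have : g x * enorm (y - x) <= g x * h by rewrite ler_wpM2l.
    by rewrite ler_norml /v0; lra.
  have [w pw wmin] := profile_minimizer K0 B1 h0 p0.
  have [wneg wpos] := minimizer_axis K0 B1 h0 pw wmin.
  exact: symmetrized_step pw wneg wpos.
have K2 : 0 < 2 * n%:R * K + 1 by rewrite ltr_wpDl// !mulr_ge0.
have low d : 0 < d < 1 -> (modulus (ring_curves segment (ray t)) * (1 - d)%:E <= energy g)%E.
  move=> /andP[d0 d1]; pose h := Num.min (h1 / 2) (d / (2 * n%:R * K + 1)).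
  have h0 : 0 < h by rewrite lt_min !divr_gt0.
  have hh : h < h1 by rewrite gt_min; apply/orP; left; lra.
  have hd : 2 * n%:R * K * h <= d.
    have : h <= d / (2 * n%:R * K + 1) by rewrite ge_min lexx orbT.
    by rewrite ler_pdivlMr//; lra.
  have Kh0 : 0 <= K * h by rewrite mulr_ge0// ltW.
  have Kh : 2 * K * h < 1.
    have : K * h <= n%:R * (K * h) by rewrite ler_peMl// ler1n.
    by lra.
  pose a := 1 - 2 * K * h; have a0 : 0 < a by rewrite subr_gt0.
  have an : 1 - d <= a ^+ n.
    have := @tangent_line_power R m 1 a ler01 (ltW a0); rewrite !expr1n !mulr1.
    rewrite {1}/a -natr1; move: hd; rewrite -natr1; lra.
  have := step h h0 hh Kh; rewrite muleA -EFinM exprMn invfM mulrAC mulVf ?expf_neq0 ?gt_eqF// mul1r -/a => H.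
  apply: (@le_trans _ _ ((a ^- n)%:E * energy g * (a ^+ n)%:E)%E).
    by apply: lee_pmul => //; [exact: modulus_ge0|rewrite lee_fin; lra].
  by rewrite muleAC -EFinM mulVf ?expf_neq0 ?gt_eqF// mul1e.
move: low En0 (@modulus_ge0 R m (ring_curves segment (ray t))); rewrite -(fineK Efin).
case: modulus => [M| |] //.
  move=> low E0 M0; rewrite lee_fin leNgt; apply/negP => EM.
  rewrite !lee_fin in E0 M0.
  have Mp : 0 < M by exact: le_lt_trans EM.
  pose d := (M - fine (energy g)) / (2 * M).
  have dM : M * d = (M - fine (energy g)) / 2 by rewrite /d; field; rewrite gt_eqF.
  have d0 : 0 < d by rewrite divr_gt0 ?subr_gt0// mulr_gt0.
  have d1 : d < 1 by rewrite /d ltr_pdivrMr ?mulr_gt0//; lra.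
  have := low d; rewrite d0 d1 -EFinM lee_fin => /(_ isT); rewrite mulrBr mulr1 dM; lra.
move=> low _ _; have := low 2^-1; rewrite gt0_mulye ?lte_fin; last by lra.
by apply; apply/andP; split; lra.
Qed.
End teichmuller.

(** * Extremality of the Teichmuller ring *)

Section ring_potential.
Local Notation w := (@sphere_areaR R m).

(** A connected set that leaves a cube crosses its boundary, which is a level set of the supremum
    norm; a coordinate of maximal deviation tells the face. *)
Lemma connected_meets_cubes (C : set Rb) (r0 : R) : connected C ->
  (forall p, C (Some p) -> exists2 q, C q & forall y, q = Some y -> r0 <= `|y - p|) ->
  meets_cubes [set x : Rn | C (Some x)] r0.
Proof.
move=> cC far p Cp s /andP[s0 sr].
have cphi : continuous (fun x : Rn => `|x - p|).
  apply: (@lipschitz_rV_continuous R n _ 1) => x y; rewrite mul1r.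
  apply: le_trans (ler_dist_dist _ _) _; rewrite opprB addrA subrK; exact: norm_le_enorm.
have cK : compact [set x : Rn | `|x - p| <= s].
  apply: (@compact_enorm R n _ (enorm p + n%:R * s)).
    by apply: (@closed_comp _ _ (fun x : Rn => `|x - p|) [set y | y <= s]) => [x _|]; [exact: cphi|exact: closed_le].
  move=> x /= hx; have := enormD p (x - p); rewrite addrC subrK.
  have := enorm_le_norm (x - p); have : n%:R * `|x - p| <= n%:R * s by rewrite ler_wpM2l.
  by lra.
have [||x Cx xs] := connected_level cphi cK cC Cp _ _.
- by rewrite subrr normr0.
- have [q Cq hq] := far p Cp; exists q => // -[y /= ys qy].
  by have := hq y (esym qy); lra.
exists x; split=> //.
pose i := [arg max_(i > ord0) `|x ord0 i - p ord0 i|]%O.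
have imax j : `|x ord0 j - p ord0 j| <= `|x ord0 i - p ord0 i|.
  by rewrite /i; case: arg_maxP => // k _; apply.
have iE : `|x ord0 i - p ord0 i| = s.
  apply/eqP; rewrite eq_le -{1 2}xs; apply/andP; split.
    by have := coord_le_norm (x - p) i; rewrite !mxE.
  by apply: norm_le_coord => // j; rewrite !mxE.
by exists i => // j; rewrite -iE.
Qed.

Lemma ring_potential (C0 C1 : set Rb) (X : R) (x y : Rn) : connected C0 -> connected C1 ->
  closed C0 -> closed C1 -> C0 `&` C1 = set0 -> C1 None -> C0 (Some x) -> C0 (Some y) -> x != y ->
  0 < X -> (X%:E < ring_mod C0 C1)%E ->
  exists u g : Rn -> R, [/\ upper_gradient u g, (forall x, 0 <= u x <= 1), (forall x, C0 (Some x) -> u x = 0),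
    (forall x, C1 (Some x) -> u x = 1) &
    (exists Rb, forall x, Rb <= enorm x -> u x = 1) /\ (energy g <= (w / X ^+ m)%:E)%E].
Proof.
move=> c0 c1 cl0 cl1 dis C1N C0x C0y xy X0 hX.
have [rho adm Irho] := ring_mod_gt m0 X0 hX.
have C0N : ~ C0 None by move=> C0N; have : (C0 `&` C1) None by []; rewrite dis.
have [b hb] := closed_bounded cl0 C0N.
have d0 : 0 < `|x - y| by rewrite normr_gt0 subr_eq0.
(* Every point is at distance at least [r0] from x or from y, so C0 leaves every cube of smaller
   radius; C1 does so because it contains infinity. *)
pose r0 := `|x - y| / 2; have r00 : 0 < r0 by rewrite divr_gt0.
have mE0 : meets_cubes [set x : Rn | C0 (Some x)] r0.
  apply: connected_meets_cubes c0 _ => p _.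
  have [h|h] := leP r0 `|x - p|; first by exists (Some x) => // _ [<-].
  exists (Some y) => // _ [<-]; have := ler_normB (x - p) (y - p).
  by rewrite opprB addrA subrK; rewrite /r0 in h *; lra.
have mE1 : meets_cubes [set x : Rn | C1 (Some x)] r0.
  by apply: connected_meets_cubes c1 _ => p _; exists None.
have Ioo : (\int[@lebesgue_rV R n]_x (rho x ^+ n) < +oo)%E by apply: lt_trans Irho (ltry _).
exact: (regularization cl0 cl1 dis r00 mE0 mE1 adm Ioo hb Irho).
Qed.

(** After the similarity that sends x to 0 with ratio 1/a, connectedness puts points of C0 on all
    spheres of radius at most 1 and points of C1 on all spheres of radius at least b/a, which is
    what symmetrization asks for. *)
Lemma ring_teichmuller (C0 C1 : set Rb) (X a b : R) (x y z : Rn) : connected C0 -> connected C1 ->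
  closed C0 -> closed C1 -> C0 `&` C1 = set0 -> C1 None -> C0 (Some x) -> C0 (Some y) -> C1 (Some z) ->
  0 < a -> 0 < b -> a <= enorm (y - x) -> enorm (z - x) <= b -> 0 < X -> (X%:E < ring_mod C0 C1)%E ->
  (X%:E <= @teichmuller_mod R n (b / a))%E.
Proof.
move=> c0 c1 cl0 cl1 dis C1N C0x C0y C1z a0 b0 ay zb X0 hX.
have xy : x != y by apply/eqP => xy; move: ay; rewrite xy subrr enorm0; lra.
have [u [g [ug u01 uE0 uE1 [[Rb hR] eg]]]] := ring_potential c0 c1 cl0 cl1 dis C1N C0x C0y xy X0 hX.
have ai : 0 < a^-1 by rewrite invr_gt0.
have E (p : Rn) : (a^-1)^-1 *: (p - - (a^-1 *: x)) = a *: p + x.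
  by rewrite invrK opprK scalerDr scalerA divff ?gt_eqF// scale1r.
have := upper_gradient_affine (- (a^-1 *: x)) ai ug; have := energy_affine (- (a^-1 *: x)) ai (ug_ge0 ug) (ug_measurable ug).
under [X in energy X]eq_fun do rewrite E.
under [X in upper_gradient X _]eq_fun do rewrite E.
under [X in upper_gradient _ X]eq_fun do rewrite E.
move=> Eg ug'.
have cphi : continuous (fun p : Rn => enorm (p - x)) by exact: enorm_sub_continuous.
have cK s : compact [set p : Rn | enorm (p - x) <= s].
  apply: (@compact_enorm R n _ (enorm x + s)); first exact: closed_enorm_le.
  by move=> p /= hp; have := enormD x (p - x); rewrite addrC subrK; lra.
have scale r (p : Rn) : enorm (p - x) = a * r -> enorm (a^-1 *: (p - x)) = r /\ a *: (a^-1 *: (p - x)) + x = p.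
  move=> hp; rewrite enormZ gtr0_norm// hp mulrA mulVf ?gt_eqF// mul1r; split=> //.
  by rewrite scalerA divff ?gt_eqF// scale1r subrK.
rewrite /teichmuller_mod; apply: (ring_mod_ge m0 X0); apply: le_trans eg; rewrite -Eg.
apply: spherical_symmetrization ug' _ _ _ _ => //.
- by rewrite divr_gt0.
- exists ((Num.max Rb 0 + enorm x) / a) => p hp; apply: hR.
  have := enormD (a *: p + x) (- x); rewrite addrK enormN enormZ gtr0_norm//.
  have : Rb <= Num.max Rb 0 by rewrite le_max lexx.
  by move: hp; rewrite ler_pdivrMr// mulrC; lra.
- move=> r /andP[r0 r1].
  have [p Cp pr] : exists2 p, C0 (Some p) & enorm (p - x) = a * r.
    move: r0; rewrite le_eqVlt => /orP[/eqP <-|r0]; first by exists x; rewrite ?subrr ?enorm0 ?mulr0.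
    have [pE|pE] := eqVneq (enorm (y - x)) (a * r); first by exists y.
    apply: (connected_level cphi (cK _) c0 C0x); first by rewrite subrr enorm0 mulr_gt0.
    exists (Some y) => // -[y' /= hy' [yy]]; rewrite yy in hy'.
    have : a * r <= a by rewrite ler_piMr// ltW.
    by move=> h; move/eqP: pE; apply; apply/eqP; rewrite eq_le hy'/=; lra.
  have [h1 h2] := scale r p pr.
  by exists (a^-1 *: (p - x)) => //; rewrite h2 uE0.
- move=> r rt.
  have br : b <= a * r by move: rt; rewrite ler_pdivrMr// mulrC.
  have [p Cp pr] : exists2 p, C1 (Some p) & enorm (p - x) = a * r.
    have [pE|pE] := eqVneq (enorm (z - x)) (a * r); first by exists z.
    apply: (connected_level cphi (cK _) c1 C1z); first by rewrite lt_neqAle pE; lra.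
    by exists None => // -[].
  have [h1 h2] := scale r p pr.
  by exists (a^-1 *: (p - x)) => //; rewrite h2 uE1.
Qed.
End ring_potential.

(** * Segments and rays on an axis as filled continua *)

Section axis.

Definition axis_segment (c : Rn) (a b : R) : set Rb := Some @` [set c + u *: (@e1 R n) | u in [set u : R | a <= u <= b]].
Definition axis_ray (c : Rn) (a : R) : set Rb := Some @` [set c + u *: (@e1 R n) | u in [set u : R | a <= u]] `|` [set None].

Lemma segmentE : segment = axis_segment 0 (-1) 0.
Proof. by rewrite /segment /axis_segment; congr (_ @` _); apply/seteqP; split=> x [u hu <-]; exists u => //; rewrite add0r. Qed.

Lemma rayE t : ray t = axis_ray 0 t.
Proof. by rewrite /ray /axis_ray; congr (_ @` _ `|` _); apply/seteqP; split=> x [u hu <-]; exists u => //; rewrite add0r. Qed.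

Lemma axis_segmentP c a b x : axis_segment c a b (Some x) <-> exists2 u, a <= u <= b & x = c + u *: (@e1 R n).
Proof.
split; first by case=> y [u hu <-] [<-]; exists u.
by move=> [u hu ->]; exists (c + u *: (@e1 R n)) => //; exists u.
Qed.

Lemma axis_rayP c a x : axis_ray c a (Some x) <-> exists2 u, a <= u & x = c + u *: (@e1 R n).
Proof.
split; first by case=> [[y [u hu <-] [<-]]|//]; exists u.
by move=> [u hu ->]; left; exists (c + u *: (@e1 R n)) => //; exists u.
Qed.

Lemma enorm_e1 : enorm (@e1 R n) = 1.
Proof.
rewrite /enorm big_ord_recl mxE/= expr1n big1 ?addr0 ?sqrtr1// => i _.
by rewrite mxE/= expr0n.
Qed.

Lemma e1_neq0 : (@e1 R n) != 0.
Proof. by rewrite -enorm_eq0 enorm_e1 oner_eq0. Qed.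

Lemma axis_closed (c : Rn) (D : set R) : closed D -> closed [set c + u *: (@e1 R n) | u in D].
Proof.
move=> cD; pose f (x : Rn) := (x - c) ord0 ord0; pose phi (x : Rn) := enorm (x - c - f x *: (@e1 R n)).
have cf : continuous f.
  apply: (@lipschitz_rV_continuous R n _ 1) => x y; rewrite mul1r.
  by have := coord_le_enorm (x - y) ord0; rewrite /f !mxE opprB addrA subrK.
have cphi : continuous phi.
  apply: (@lipschitz_rV_continuous R n _ 2) => x y.
  apply: le_trans (enorm_dist _ _) _.
  have -> : x - c - f x *: e1 - (y - c - f y *: e1) = (x - y) - ((x - y) ord0 ord0) *: (@e1 R n).
    by apply/rowP => i; rewrite /f !mxE; ring.
  apply: le_trans (enormD _ _) _; rewrite enormN enormZ enorm_e1 mulr1 mulrDl mul1r lerD2l.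
  exact: coord_le_enorm.
have -> : [set c + u *: (@e1 R n) | u in D] = f @^-1` D `&` phi @^-1` [set 0].
  apply/seteqP; split=> x.
    move=> [u Du <-]; have fu : f (c + u *: e1) = u by rewrite /f !mxE mulr1 addrAC subrr add0r.
    by split; rewrite /= /phi fu// (addrC c) addrK subrr enorm0.
  move=> [/= Dx /eqP]; rewrite /phi enorm_eq0 subr_eq0 => /eqP xE.
  by exists (f x) => //; rewrite -xE addrC subrK.
by apply: closedI; apply: closed_comp => //; exact: closed_eq.
Qed.

(** Each point of the complement is joined to infinity by a ray parallel to the axis; on the axis
    itself the direction is chosen away from the segment. *)
Lemma axis_segment_filled c a b : a <= b -> filled_continuum (axis_segment c a b).
Proof.
move=> ab; have iE : [set u : R | a <= u <= b] = [set` `[a, b]%R] by apply/seteqP; split=> x /=; rewrite in_itv.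
have cl : closed [set c + u *: (@e1 R n) | u in [set u : R | a <= u <= b]].
  by apply: axis_closed; rewrite iE; exact: itv_closed.
split.
- apply: (@continuum_closed_bounded R n _ (enorm c + (`|a| + `|b|))) => //.
  + by exists (c + a *: e1), a => //=; rewrite lexx.
  + move=> _ [u /= /andP[au ub] <-]; apply: le_trans (enormD _ _) _; rewrite lerD2l enormZ enorm_e1 mulr1.
    have := ler_norm b; have := ler_norm (- a); rewrite normrN => h1 h2.
    by rewrite ler_norml; have := normr_ge0 a; have := normr_ge0 b; lra.
  + by rewrite iE; exact: connected_affine.
- by move=> E; have : axis_segment c a b None; [rewrite E|case].
- rewrite /axis_segment setC_some; apply: connected_star_none => x Fx.
  have [[u xE]|off] := pselect (exists u, x = c + u *: (@e1 R n)).
    have [ua|au] := ltP u a.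
      exists (- e1); rewrite ?oppr_eq0 ?e1_neq0// => t t0 [v /= hv].
      rewrite xE scalerN -addrA -scalerBl => /addrI /eqP; rewrite -subr_eq0 -scalerBl scaler_eq0 (negPf e1_neq0) orbF => /eqP.
      by lra.
    exists e1; rewrite ?e1_neq0// => t t0 [v /= hv].
    rewrite xE -addrA -scalerDl => /addrI /eqP; rewrite -subr_eq0 -scalerBl scaler_eq0 (negPf e1_neq0) orbF => /eqP E.
    by apply: Fx; exists u => //=; rewrite au; lra.
  exists e1; rewrite ?e1_neq0// => t t0 [v /= hv E]; apply: off; exists (v - t).
  by rewrite scalerBl addrA E addrK.
Qed.

(** The complement is star-shaped about a point of the axis in front of the ray. *)
Lemma axis_ray_filled c a : filled_continuum (axis_ray c a).
Proof.
have cl : closed [set c + u *: (@e1 R n) | u in [set u : R | a <= u]] by apply: axis_closed; exact: closed_ge.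
split.
- by apply: continuum_some_none => //; exact: connected_affine_ray e1_neq0.
- move=> E; have : axis_ray c a (Some (c + (a - 1) *: e1)) by rewrite E.
  move=> /axis_rayP[u au /addrI /eqP]; rewrite -subr_eq0 -scalerBl scaler_eq0 (negPf e1_neq0) orbF => /eqP; lra.
- rewrite /axis_ray setC_some_none; apply: (@connected_star_some R n _ (c + (a - 1) *: e1)) => x t Fx /andP[t0 t1] [u /= au].
  have [->|tn] := eqVneq t 0.
    rewrite scale0r addr0 => /addrI /eqP; rewrite -subr_eq0 -scalerBl scaler_eq0 (negPf e1_neq0) orbF => /eqP; lra.
  have {t0}tp : 0 < t by rewrite lt_neqAle eq_sym tn.
  move=> E; apply: Fx; exists (a - 1 + t^-1 * (u - a + 1)) => /=.
    have : u - a + 1 <= t^-1 * (u - a + 1) by rewrite ler_peMl ?invf_ge1//; lra.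
    by lra.
  have : x - (c + (a - 1) *: e1) = t^-1 *: (u *: e1 - (a - 1) *: (@e1 R n)).
    rewrite (_ : u *: e1 - _ = t *: (x - (c + (a - 1) *: e1))); first by rewrite scalerA mulVf// scale1r.
    by apply: (@addrI _ (c + (a - 1) *: e1)); rewrite -E addrCA addrA addrA addrK addrC.
  rewrite -scalerBl scalerA => /eqP; rewrite subr_eq => /eqP ->.
  by rewrite addrCA -scalerDl; congr (_ + _ *: _); ring.
Qed.
End axis.

(** * Odd reflection and the Groetzsch ring *)

Section groetzsch.
Local Notation w := (@sphere_areaR R m).

Definition energy_on (A : set Rn) (g : Rn -> R) : \bar R := (\int[mu]_x (g x ^+ n * \1_A x)%:E)%E.

Lemma energy_on_ge0 A g : (forall x, 0 <= g x) -> (0 <= energy_on A g)%E.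
Proof. by move=> g0; apply: integral_ge0 => x _; rewrite lee_fin mulr_ge0// exprn_ge0. Qed.

Lemma energy_on_le A g : (forall x, 0 <= g x) -> measurable_fun setT (g : Bn -> R) ->
  measurable (A : set Bn) -> (energy_on A g <= energy g)%E.
Proof.
move=> g0 mg mA; apply: ge0_le_integral => //.
- by move=> x _; rewrite lee_fin mulr_ge0// exprn_ge0.
- by apply/measurable_EFinP; apply: measurable_funM; [exact: measurable_funX|exact: measurable_indic].
- by apply/measurable_EFinP; exact: measurable_funX.
- by move=> x _; rewrite lee_fin ler_piMr ?exprn_ge0// indicE lern1 leq_b1.
Qed.

Lemma energy_onU A B g : (forall x, 0 <= g x) -> measurable_fun setT (g : Bn -> R) ->
  measurable (A : set Bn) -> measurable (B : set Bn) -> A `&` B = set0 ->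
  (energy_on A g + energy_on B g <= energy g)%E.
Proof.
move=> g0 mg mA mB AB.
have mI C : measurable (C : set Bn) -> measurable_fun setT (fun x : Bn => (g x ^+ n * \1_C x)%:E).
  by move=> mC; apply/measurable_EFinP; apply: measurable_funM; [exact: measurable_funX|exact: measurable_indic].
rewrite /energy_on -ge0_integralD//; do ?[by move=> x _; rewrite lee_fin mulr_ge0// exprn_ge0];
  do ?[exact: mI].
apply: ge0_le_integral => //.
- by move=> x _; rewrite -EFinD lee_fin addr_ge0// mulr_ge0// exprn_ge0.
- by apply: emeasurable_funD; exact: mI.
- by apply/measurable_EFinP; exact: measurable_funX.
move=> x _; rewrite -EFinD lee_fin -mulrDr ler_piMr ?exprn_ge0//.
rewrite !indicE; have [/set_mem Ax|_] := boolP (x \in A); have [/set_mem Bx|_] := boolP (x \in B);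
  rewrite ?addr0 ?add0r ?lexx ?ler01//.
by have : (A `&` B) x by []; rewrite AB.
Qed.

(** Adding the tangent inequalities at the mean of g1 and g2 gives (g1 + g2)^n <= 2^m (g1^n + g2^n).
    The factor 2^m is the source of the factor 2 between the two moduli. *)
Lemma energy_onD A g1 g2 : (forall x, 0 <= g1 x) -> (forall x, 0 <= g2 x) ->
  measurable_fun setT (g1 : Bn -> R) -> measurable_fun setT (g2 : Bn -> R) ->
  measurable (A : set Bn) ->
  (energy_on A (fun x => g1 x + g2 x)%R <= (2 ^+ m)%:E * (energy_on A g1 + energy_on A g2))%E.
Proof.
move=> g10 g20 mg1 mg2 mA.
have mI (g : Rn -> R) : measurable_fun setT (g : Bn -> R) -> measurable_fun setT (fun x : Bn => (g x ^+ n * \1_A x)%:E).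
  by move=> mg; apply/measurable_EFinP; apply: measurable_funM; [exact: measurable_funX|exact: measurable_indic].
have I0 (g : Rn -> R) : (forall x, 0 <= g x) -> forall x, setT x -> (0 <= (g x ^+ n * \1_A x)%:E)%E.
  by move=> g0 x _; rewrite lee_fin mulr_ge0// exprn_ge0.
rewrite /energy_on -ge0_integralD//; do ?[exact: I0]; do ?[exact: mI].
rewrite -ge0_integralZl//; do ?[by apply: emeasurable_funD; exact: mI];
  do ?[by move=> x _; rewrite adde_ge0 ?I0]; do ?[by rewrite lee_fin exprn_ge0].
apply: ge0_le_integral => //.
- by apply: I0 => x; rewrite addr_ge0.
- by apply: mI; exact: measurable_funD.
- by apply: measurable_funeM; apply: emeasurable_funD; exact: mI.
move=> x _; rewrite -EFinD -EFinM lee_fin -mulrDl mulrA ler_wpM2r//.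
pose c := (g1 x + g2 x) / 2; have c0 : 0 <= c by rewrite divr_ge0// addr_ge0.
have := tangent_line_power m c0 (g10 x); have := tangent_line_power m c0 (g20 x).
have -> : g1 x + g2 x = 2 * c by rewrite /c; field.
have e2 : n%:R * c ^+ m * g1 x + n%:R * c ^+ m * g2 x = 2 * n%:R * c ^+ n.
  by rewrite -mulrDr (_ : g1 x + g2 x = 2 * c) ?exprS; [ring|rewrite /c; field].
have -> : (2 * c) ^+ n = 2 ^+ m * (2 * c ^+ n) by rewrite exprMn exprS; ring.
by move=> h2 h1; rewrite ler_wpM2l ?exprn_ge0//; lra.
Qed.

Lemma measurable_inversion (p q : Rn) (k : R) (f : Bn -> \bar R) : measurable_fun setT f ->
  measurable_fun setT (fun x : Bn => f (inversion p q k x) * ((k / enorm ((x : Rn) - p) ^+ 2) ^+ n)%:E)%E.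
Proof.
move=> mf.
have mx := measurable_rV_sub p.
have mc : measurable_fun setT (fun x : Bn => k / enorm ((x : Rn) - p) ^+ 2).
  apply: measurable_funM; first exact: measurable_cst.
  apply: (measurableT_comp measurable_invr).
  by apply: measurable_funX; exact: (measurableT_comp enorm_measurable mx).
apply: emeasurable_funM; last by apply/measurable_EFinP; exact: measurable_funX.
apply: (measurableT_comp mf); apply: measurable_rVD; first exact: measurable_cst.
exact: measurable_rVZ.
Qed.

(* Conformal invariance of the energy, up to the factor lost in the construction
   of the upper gradient of a composition. *)
Lemma inversion_energy (u g : Rn -> R) (p q : Rn) (k r c e : R) : 0 < k -> 0 < r -> 0 < e ->
  upper_gradient u g -> (forall y, r <= enorm (y - q) -> u y = c) ->
  exists v g', [/\ upper_gradient v g', v p = c, forall x, x != p -> v x = u (inversion p q k x) &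
    forall A B, measurable (A : set Bn) -> measurable (B : set Bn) ->
      (forall x, A x -> x != p -> B (inversion p q k x)) ->
      (energy_on A g' <= ((1 + e) ^+ n)%:E * energy_on B g)%E].
Proof.
move=> k0 r0 e0 ug uc.
have [v [g' [vg' vp vT hg']]] := upper_gradient_inversion p k0 r0 e0 ug uc.
exists v, g'; split=> // A B mA mB AB.
have g0 := ug_ge0 ug; have mg := ug_measurable ug; have g'0 := ug_ge0 vg'; have mg' := ug_measurable vg'.
have mf : measurable_fun setT (fun x : Bn => (g x ^+ n * \1_B x)%:E).
  by apply/measurable_EFinP; apply: measurable_funM; [exact: measurable_funX|exact: measurable_indic].
have f0 x : (0 <= (g x ^+ n * \1_B x)%:E)%E by rewrite lee_fin mulr_ge0// exprn_ge0.
have k20 x : 0 <= k / enorm (x - p) ^+ 2 by rewrite divr_ge0 ?exprn_ge0 ?enorm_ge0// ltW.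
rewrite /energy_on -(ge0_integral_inversion p q k0 mf f0) -ge0_integralZl//; last 3 first.
- exact: (measurable_inversion p q k mf).
- by move=> x _; rewrite mule_ge0// lee_fin exprn_ge0.
- by rewrite lee_fin exprn_ge0// addr_ge0// ltW.
apply: ge0_le_integral => //.
- by move=> x _; rewrite lee_fin mulr_ge0// exprn_ge0.
- by apply/measurable_EFinP; apply: measurable_funM; [exact: measurable_funX|exact: measurable_indic].
- by apply: measurable_funeM; exact: (measurable_inversion p q k mf).
move=> x _; rewrite -!EFinM lee_fin.
have R0 : 0 <= (1 + e) ^+ n * (g (inversion p q k x) ^+ n * \1_B (inversion p q k x) * (k / enorm (x - p) ^+ 2) ^+ n).
  by rewrite !mulr_ge0 ?exprn_ge0 ?addr_ge0// ?ltW.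
rewrite [in leLHS]indicE; case: (boolP (x \in A)) => [|_]; last by rewrite mulr0.
rewrite inE mulr1 => Ax; have [xp|xp] := eqVneq x p.
  have h : g' x <= 0.
    by have := hg' x; rewrite xp subrr enorm0 expr0n/= invr0 !mulr0.
  have -> : g' x = 0 by apply/eqP; rewrite eq_le h g'0.
  by rewrite expr0n.
rewrite indicE mem_set ?mulr1; last exact: AB.
apply: (@le_trans _ _ (((1 + e) * (g (inversion p q k x) * (k / enorm (x - p) ^+ 2))) ^+ n)); last by rewrite !exprMn.
apply: lerXn2r; [by rewrite nnegrE| |exact: hg'].
rewrite nnegrE; apply: mulr_ge0; first by rewrite addr_ge0// ltW.
by apply: mulr_ge0; [exact: g0|exact: k20].
Qed.

(** An odd potential has no sign inside the ball, so it is used on the sphere and outside. The inner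
    points of an arc of the family lie outside the closed ball; by continuity the arc starts on the
    sphere. *)
Lemma upper_gradient_admissible_sphere u g (C1 : set Rb) : upper_gradient u g ->
  (forall x, enorm x = 1 -> u x <= 0) -> (forall x, C1 (Some x) -> 1 <= u x /\ 1 < enorm x) ->
  admissible (ring_curves (Some @` [set x : Rn | enorm x <= 1]) C1)
    (fun x => (g x * \1_[set x : Rn | 1 < enorm x] x)%:E).
Proof.
move=> ug u0 u1; have mg := ug_measurable ug; have g0 := ug_ge0 ug.
have oA : open [set x : Rn | 1 < enorm x].
  have -> : [set x : Rn | 1 < enorm x] = [set x : Rn | 1 < enorm (x - 0)] by apply/seteqP; split=> x /=; rewrite subr0.
  exact: open_enorm_gt.
have mA := open_rV_measurable oA.
have mgE : measurable_fun setT (EFin \o (g : Bn -> R)) by exact/measurable_EFinP.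
have mr : measurable_fun setT (fun x : Bn => (g x * \1_[set x : Rn | 1 < enorm x] x)%:E).
  by apply/measurable_EFinP; apply: measurable_funM => //; exact: measurable_indic.
have r0 x : (0 <= (g x * \1_[set x : Rn | (1 < enorm x)%R] x)%:E)%E by rewrite lee_fin mulr_ge0.
apply: (admissible_arcs mr r0) => gamma L L0 lg h0 h1 inn.
have inA s : 0 < s < L -> 1 < enorm (gamma s).
  by move=> /inn h; rewrite ltNge; apply/negP => h2; apply: h; left; exists (gamma s).
have [u1L n1L] := u1 _ h1.
have n0 : enorm (gamma 0) <= 1 by case: h0 => x /= hx [<-].
have {}L0 : 0 < L.
  by rewrite lt_neqAle L0 andbT; apply/eqP => L0'; move: n1L; rewrite -L0'; lra.
have e0 : enorm (gamma 0) = 1.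
  apply/eqP; rewrite eq_le n0/=; apply/ler_addgt0Pr => e e0.
  pose s := Num.min e (L / 2).
  have s0 : 0 < s by rewrite lt_min e0 divr_gt0.
  have sL : s < L by rewrite gt_min; apply/orP; right; lra.
  have se : s <= e by rewrite ge_min lexx.
  have := inA s; rewrite s0 sL => /(_ isT).
  have := lg s 0; rewrite subr0 gtr0_norm//; have := enorm_dist (gamma s) (gamma 0); rewrite ler_norml; lra.
have := upper_gradient_path ug (ltW L0) lg; rewrite !path_cost_itvoo//.
rewrite (_ : (\int[_]_(s in _) _)%E = (\int[lebesgue_measure]_(s in [set` `]0%R, L[%R]) (g (gamma s) * \1_[set x : Rn | (1 < enorm x)%R] (gamma s))%:E)%E).
  apply: le_trans; rewrite lee_fin; have := u0 _ e0; lra.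
apply: eq_integral => s /[!inE] /=; rewrite in_itv/= => hs.
by rewrite indicE mem_set ?mulr1//=; exact: inA.
Qed.

Lemma exists_between (X : R) (M : \bar R) : (X%:E < M)%E -> exists2 Y, X < Y & (Y%:E < M)%E.
Proof.
case: M => [y| |]//; last by exists (X + 1); rewrite ?ltrDl ?ltry.
by rewrite lte_fin => h; exists ((X + y) / 2); rewrite ?lte_fin; lra.
Qed.

(** The passage from Y down to X pays for the factor (1 + e)^n lost in an inversion. *)
Lemma slack (X Y : R) : 0 < X -> X < Y -> exists2 e, 0 < e & (1 + e) ^+ n * (w / Y ^+ m) <= w / X ^+ m.
Proof.
move=> X0 XY; have Y0 : 0 < Y by exact: lt_trans XY.
have Q1 : 1 < Y / X by rewrite ltr_pdivlMr// mul1r.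
have [c c0 cE] := nth_root m (ltW (lt_trans ltr01 Q1)).
have c1 : 1 < c.
  by rewrite -(@ltr_pXn2r _ n)// ?nnegrE ?ler01// expr1n cE.
exists (c - 1); first by rewrite subr_gt0.
have w0 : 0 < w := @sphere_areaR_gt0 R m.
rewrite addrC subrK cE mulrCA ler_pM2l// ler_pdivrMr ?exprn_gt0//.
have -> : X ^- m * Y ^+ m = (Y / X) ^+ m by rewrite expr_div_n mulrC.
by rewrite -[leLHS]expr1 ler_weXn2l// ltW.
Qed.

Lemma ray_scale (s : R) (x : Rn) : @ray R n s (Some x) <-> exists2 r, s <= r & x = r *: (@e1 R n).
Proof. by rewrite rayE axis_rayP; split=> -[r sr ->]; exists r; rewrite ?add0r. Qed.

Lemma segment_scale (x : Rn) : @segment (Some x) <-> exists2 r, -1 <= r <= 0 & x = r *: (@e1 R n).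
Proof. by rewrite segmentE axis_segmentP; split=> -[r sr ->]; exists r; rewrite ?add0r. Qed.

Lemma teichmuller_potential (t X : R) : 0 < t -> 0 < X -> (X%:E < @teichmuller_mod R n t)%E ->
  exists u g : Rn -> R, [/\ upper_gradient u g, (forall x, 0 <= u x <= 1), (forall x, @segment (Some x) -> u x = 0),
    (forall x, @ray R n t (Some x) -> u x = 1) &
    (exists Rb, forall x, Rb <= enorm x -> u x = 1) /\ (energy g <= (w / X ^+ m)%:E)%E].
Proof.
move=> t0 X0 hX.
have [[_ cn0 cp0] _ _] : filled_continuum (@segment) by rewrite segmentE; apply: axis_segment_filled; lra.
have [[_ cn1 cp1] _ _] : filled_continuum (@ray R n t) by rewrite rayE; exact: axis_ray_filled.
have dis : @segment `&` ray t = set0.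
  rewrite -subset0 => -[x|] []; last by case.
  move=> /segment_scale[r /andP[_ r0] xr] /ray_scale[q tq xq].
  move: xr; rewrite xq => /eqP; rewrite -subr_eq0 -scalerBl scaler_eq0 (negPf e1_neq0) orbF => /eqP; lra.
apply: (@ring_potential (@segment) (ray t) X 0 (- e1)) => //.
- exact/compact_Rbar.
- exact/compact_Rbar.
- by right.
- by apply/segment_scale; exists 0; rewrite ?scale0r//; lra.
- by apply/segment_scale; exists (-1); rewrite ?scaleN1r//; lra.
- by rewrite eq_sym oppr_eq0 e1_neq0.
Qed.

(** Rescaled by s = sqrt (1 + t) about -e_1, the sphere of reflection is the unit sphere, the
    segment is [0, e_1 / s] and the ray is [s e_1, oo]; the inversion x / |x|^2 exchanges them. The
    potential minus its reflection is 0 on the sphere and 1 on the ray. *)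
Lemma teichmuller_groetzsch (t X : R) : 0 < t -> 0 < X -> (X%:E < @teichmuller_mod R n t)%E ->
  ((X / 2)%:E <= @groetzsch_mod R n (Num.sqrt (1 + t)))%E.
Proof.
move=> t0 X0 hX; have [Y XY hY] := exists_between hX.
have Y0 : 0 < Y by exact: lt_trans XY.
have [e e0 he] := slack X0 XY.
have t1 : 0 < 1 + t by rewrite addr_gt0.
have [s [s1 s0 sE]] : exists s, [/\ 1 < s, Num.sqrt (1 + t) = s & s ^+ 2 = 1 + t].
  exists (Num.sqrt (1 + t)); split=> //; last by rewrite sqr_sqrtr// ltW.
  by rewrite -{1}sqrtr1 ltr_sqrt// ltrDl.
rewrite s0; have sp : 0 < s by exact: lt_trans s1.
have si0 : 0 < s^-1 by rewrite invr_gt0.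
have [u [g [ug u01 uE0 uE1 [[Rb hR] eg]]]] := teichmuller_potential t0 Y0 hY.
pose a := s^-1 *: (@e1 R n).
pose u1 x := u ((s^-1)^-1 *: (x - a)); pose g1 x := (s^-1)^-1 * g ((s^-1)^-1 *: (x - a)).
have ug1 : upper_gradient u1 g1 by exact: upper_gradient_affine.
have eg1 : energy g1 = energy g by exact: energy_affine (ug_ge0 ug) (ug_measurable ug).
have E (p : Rn) : (s^-1)^-1 *: (p - a) = s *: p - e1.
  by rewrite invrK scalerBr /a scalerA divff ?gt_eqF// scale1r.
have E1 c : s *: (c *: (@e1 R n)) - e1 = (s * c - 1) *: e1 by rewrite scalerA scalerBl scale1r.
have u1seg c : 0 <= c <= s^-1 -> u1 (c *: e1) = 0.
  move=> /andP[c0 cs]; rewrite /u1 E E1; apply: uE0.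
  have : s * c <= 1 by rewrite -(divff (_ : s != 0)) ?gt_eqF// ler_pM2l.
  have : 0 <= s * c by rewrite mulr_ge0// ltW.
  by move=> *; exists ((s * c - 1) *: e1) => //; exists (s * c - 1) => //=; lra.
have u1ray c : s <= c -> u1 (c *: e1) = 1.
  move=> sc; rewrite /u1 E E1; apply: uE1; apply/ray_scale; exists (s * c - 1) => //.
  have : s * s <= s * c by rewrite ler_pM2l.
  by move: sE; rewrite expr2; lra.
pose r := (Num.max Rb 0 + 2) / s.
have r0 : 0 < r by rewrite divr_gt0// ltr_wpDl// le_max lexx orbT.
have u1far y : r <= enorm (y - 0) -> u1 y = 1.
  rewrite subr0 => hy; rewrite /u1 E; apply: hR.
  have := enormD (s *: y - e1) e1; rewrite subrK enormZ gtr0_norm// enorm_e1.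
  have : Num.max Rb 0 + 2 <= s * enorm y by rewrite mulrC -ler_pdivrMr.
  have : Rb <= Num.max Rb 0 by rewrite le_max lexx.
  by lra.
have [v [g' [vg' v0 vT hv]]] := inversion_energy (0 : Rn) ltr01 r0 e0 ug1 u1far.
have UG := upper_gradient_linear 1 (-1) 0 ug1 vg'.
have T0 (x : Rn) : inversion 0 0 1 x = (enorm x ^- 2) *: x by rewrite /inversion !subr0 add0r mul1r.
have n0 (x : Rn) : 0 < enorm x -> x != 0 by rewrite enorm_gt0.
pose A := [set x : Rn | 1 < enorm x]; pose B := [set x : Rn | enorm x < 1].
have mA : measurable (A : set Bn) := measurable_enorm_gt 1.
have mB : measurable (B : set Bn) := measurable_enorm_lt 1.
have AB : A `&` B = set0 by rewrite -subset0 => x [h1 h2]; have := lt_trans h1 h2; rewrite ltxx.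
pose G x := `|1| * g1 x + `|-1| * g' x.
have adm : admissible (ring_curves (Some @` [set x : Rn | enorm x <= 1]) (ray s)) (fun x => (G x * \1_A x)%:E).
  apply: upper_gradient_admissible_sphere UG _ _.
    move=> x x1; rewrite vT ?n0 ?x1// T0 x1 expr1n invr1 scale1r; lra.
  move=> x /ray_scale[c sc ->]; have c0 : 0 < c by exact: lt_le_trans sc.
  rewrite enormZ enorm_e1 mulr1 gtr0_norm//; split; last exact: lt_le_trans sc.
  rewrite vT ?n0 ?enormZ ?enorm_e1 ?mulr1 ?gtr0_norm//.
  rewrite u1ray// T0 enormZ enorm_e1 !mulr1 gtr0_norm// scalerA.
  rewrite (_ : c ^- 2 * c = c^-1) ?u1seg; first lra.
    by rewrite invr_ge0 (ltW c0)/= lef_pV2.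
  by field; rewrite gt_eqF.
rewrite /groetzsch_mod; apply: (ring_mod_adm m0 _ adm); first by rewrite divr_gt0.
have g10 := ug_ge0 ug1; have mg1 := ug_measurable ug1; have g'0 := ug_ge0 vg'; have mg' := ug_measurable vg'.
have -> : (\int[mu]_x ((G x * \1_A x)%:E ^+ n) = energy_on A (fun x => (g1 x + g' x)%R))%E.
  apply: eq_integral => x _; rewrite -EFin_expe /G normr1 normrN1 !mul1r exprMn; congr (_ * _)%:E.
  by rewrite indicE; case: (_ \in _); rewrite ?expr1n ?expr0n.
apply: (le_trans (energy_onD g10 g'0 mg1 mg' mA)).
have e10 : 0 <= (1 + e) ^+ n by rewrite exprn_ge0// addr_ge0// ltW.
have -> : w / (X / 2) ^+ m = 2 ^+ m * (w / X ^+ m).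
  by rewrite expr_div_n invf_div mulrCA.
rewrite EFinM; apply: lee_wpmul2l; first by rewrite lee_fin exprn_ge0.
apply: (@le_trans _ _ (((1 + e) ^+ n)%:E * energy g1)%E); last first.
  apply: (@le_trans _ _ (((1 + e) ^+ n)%:E * (w / Y ^+ m)%:E)%E); last by rewrite -EFinM lee_fin.
  by apply: lee_wpmul2l; rewrite ?lee_fin// eg1.
(* The reflected potential outside the sphere has the energy of the original one inside, up to the
   factor lost in the inversion; the two halves add up to at most the whole energy. *)
apply: (@le_trans _ _ (((1 + e) ^+ n)%:E * (energy_on A g1 + energy_on B g1))%E); last first.
  by apply: lee_wpmul2l; rewrite ?lee_fin//; exact: energy_onU.
rewrite ge0_muleDr ?energy_on_ge0//; apply: leeD; last first.
  apply: hv => // x; rewrite /A /B /= T0 => x1 _.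
  have x0 : 0 < enorm x by exact: lt_trans x1.
  rewrite enormZ ger0_norm ?invr_ge0 ?exprn_ge0 ?enorm_ge0//.
  by rewrite (_ : _ * _ = (enorm x)^-1) ?invf_lt1//; field; rewrite gt_eqF.
rewrite -[leLHS]mul1e; apply: lee_wpmul2r; first exact: energy_on_ge0.
by rewrite lee_fin exprn_ege1// lerDl ltW.
Qed.
End groetzsch.

(** * The Groetzsch constant *)

Section inner_potentials.
Local Notation w := (@sphere_areaR R m).
Local Notation e1 := (@e1 R n).

(** A potential certifying that the ring between [-a e_1, a e_1] and the unit sphere has modulus at
    least X; it is 1 on the sphere and beyond. *)
Definition inner_potential (a X : R) := exists u g : Rn -> R,
  [/\ upper_gradient u g, forall c, `|c| <= a -> u (c *: e1) = 0,
      forall x, 1 <= enorm x -> u x = 1 & (energy g <= (w / X ^+ m)%:E)%E].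

(** For 0 < a < 1 the factor 1 - |x|^2 shows that this inversion preserves the unit sphere and
    exchanges its inside and outside. *)
Lemma inversion_sphere (a : R) (x : Rn) : x != - a *: e1 ->
  enorm (inversion (- a *: e1) (a *: e1) (1 - a ^+ 2) x) ^+ 2 - 1 =
  (1 - a ^+ 2) * (1 - enorm x ^+ 2) / enorm (x - - a *: e1) ^+ 2.
Proof.
move=> xp; pose y := x - - a *: e1.
have y0 : enorm y ^+ 2 != 0 by rewrite sqrf_eq0 enorm_eq0 subr_eq0.
have de : dot e1 e1 = 1 by rewrite -enorm_sqr enorm_e1 expr1n.
have xE : x = y - a *: e1 by rewrite /y scaleNr opprK addrK.
have nD z c : enorm (c *: e1 + z) ^+ 2 = enorm z ^+ 2 + 2 * c * dot z e1 + c ^+ 2.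
  by rewrite !enorm_sqr dotDl !dotDr !dotZl !dotZr (dotC e1 z) de; ring.
have nx : enorm x ^+ 2 = enorm y ^+ 2 - 2 * a * dot y e1 + a ^+ 2.
  by rewrite {1}xE addrC -scaleNr nD; ring.
rewrite /inversion -/y nx nD enormZ exprMn dotZl real_normK ?num_real//.
by move: (enorm y ^+ 2) y0 (dot y e1) => N N0 d; field.
Qed.

(** c = a goes to (a + 1/a) / 2, and c tending to -a from the right goes to infinity: the segment
    becomes the ray of the Groetzsch ring. *)
Lemma inversion_axis (a c : R) : c != - a ->
  inversion (- a *: e1) (a *: e1) (1 - a ^+ 2) (c *: e1) = (a + (1 - a ^+ 2) / (c + a)) *: e1.
Proof.
move=> ca; rewrite /inversion scaleNr opprK -scalerDl enormZ enorm_e1 mulr1 real_normK ?num_real//.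
rewrite scalerA -scalerDl; congr (_ *: _); congr (_ + _); field.
by rewrite addr_eq0.
Qed.

(** The point p corresponds to infinity and receives the value 1, but it lies in the component on
    which the new potential should vanish; hence 1 - v. *)
Lemma inversion_flip (u g : Rn -> R) (p q : Rn) (k r X X' : R) : 0 < k -> 0 < r -> 0 < X' -> X' < X ->
  upper_gradient u g -> (forall y, r <= enorm (y - q) -> u y = 1) -> (energy g <= (w / X ^+ m)%:E)%E ->
  exists v g', [/\ upper_gradient (fun x => 1 - v x) g', v p = 1,
    forall x, x != p -> v x = u (inversion p q k x) & (energy g' <= (w / X' ^+ m)%:E)%E].
Proof.
move=> k0 r0 X'0 XX ug far eg; have [e e0 he] := @slack _ _ X'0 XX.
have [v [g' [vg' vp vT hv]]] := inversion_energy p k0 r0 e0 ug far.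
exists v, g'; split=> //.
  have lip (a b : R) : `|(1 - a) - (1 - b)| <= `|a - b| by rewrite distrC (_ : _ - _ = a - b)//; ring.
  exact: (upper_gradient_comp lip).
apply: (@le_trans _ _ (energy_on setT g')).
  rewrite /energy /energy_on le_eqVlt; apply/orP; left; apply/eqP; apply: eq_integral => x _.
  by rewrite indicT mulr1.
apply: (le_trans (hv setT setT measurableT measurableT (fun _ _ _ => I))).
apply: (@le_trans _ _ (((1 + e) ^+ n)%:E * (w / X ^+ m)%:E)%E); last by rewrite -EFinM lee_fin.
apply: lee_wpmul2l; first by rewrite lee_fin exprn_ge0// addr_ge0// ltW.
apply: le_trans eg; apply: energy_on_le => //; [exact: ug_ge0 ug|exact: ug_measurable ug].
Qed.

Lemma inner_of_groetzsch (a X X' : R) : 0 < a < 1 -> 0 < X' -> X' < X ->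
  (X%:E < @groetzsch_mod R n ((a + a^-1) / 2))%E -> inner_potential a X'.
Proof.
move=> /andP[a0 a1] X'0 XX hX; have X0 : 0 < X by exact: lt_trans XX.
pose s := (a + a^-1) / 2.
have sa : s - a = (1 - a ^+ 2) / (2 * a) by rewrite /s; field; rewrite gt_eqF.
have k0 : 0 < 1 - a ^+ 2 by rewrite subr_gt0 expr_lt1// ltW.
have s1 : 1 < s.
  rewrite /s ltr_pdivlMr// mul1r -subr_gt0 (_ : _ - 2 = (1 - a) ^+ 2 / a); last by field; rewrite gt_eqF.
  by rewrite divr_gt0// exprn_gt0// subr_gt0.
pose C0 : set Rb := Some @` [set x : Rn | enorm x <= 1].
have C0E : C0 = closed_eball (0 : Rn) 1.
  by rewrite /C0 /closed_eball; congr (_ @` _); apply/seteqP; split=> x /=; rewrite subr0.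
have C0P x : C0 (Some x) <-> enorm x <= 1.
  by split=> [[y /= yx [<-]]//|h]; exists x.
have [[fc0 _ _] _] := @ball_exterior_ring R n 0 1 2 (ltn0Sn _) ltac:(lra).
have [[_ cn0 cp0] _ _] : filled_continuum C0 by rewrite C0E.
have [[_ cn1 cp1] _ _] : filled_continuum (@ray R n s) by rewrite rayE; exact: axis_ray_filled.
have dis : C0 `&` ray s = set0.
  rewrite -subset0 => -[x|] []; last by case.
  move=> /C0P x1 /ray_scale[c sc xc]; move: x1; rewrite xc enormZ enorm_e1 mulr1.
  by have := ler_norm c; lra.
have [u [g [ug u01 uE0 uE1 [[Rb' hR] eg]]]] : exists u g : Rn -> R, [/\ upper_gradient u g, (forall x, 0 <= u x <= 1),
    (forall x, C0 (Some x) -> u x = 0), (forall x, @ray R n s (Some x) -> u x = 1) &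
    (exists Rb', forall x, Rb' <= enorm x -> u x = 1) /\ (energy g <= (w / X ^+ m)%:E)%E].
  apply: (@ring_potential C0 (ray s) X 0 e1) => //.
  - exact/compact_Rbar.
  - exact/compact_Rbar.
  - by right.
  - by apply/C0P; rewrite enorm0.
  - by apply/C0P; rewrite enorm_e1.
  - by rewrite eq_sym e1_neq0.
pose r := Num.max Rb' 0 + a + 1.
have r0 : 0 < r by rewrite ltr_wpDl// addr_ge0 ?(ltW a0)// le_max lexx orbT.
have far y : r <= enorm (y - a *: e1) -> u y = 1.
  move=> hy; apply: hR; have := enormD y (- (a *: e1)); rewrite enormN enormZ enorm_e1 mulr1 gtr0_norm//.
  by have : Rb' <= Num.max Rb' 0 by [rewrite le_max lexx]; rewrite /r in hy; lra.
have [v [g' [UG vp vT EG]]] := inversion_flip (- a *: e1) k0 r0 X'0 XX ug far eg.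
exists (fun x => 1 - v x), g'; split=> //.
- move=> c ca.
  have -> : v (c *: e1) = 1; last by rewrite subrr.
  have [->|cn] := eqVneq c (- a); first exact: vp.
  rewrite vT; last by rewrite -subr_eq0 -scalerBl scaler_eq0 (negPf e1_neq0) orbF subr_eq0.
  rewrite inversion_axis//; apply: uE1; apply/ray_scale.
  exists (a + (1 - a ^+ 2) / (c + a)) => //; rewrite -lerBlDl sa.
  have ca0 : 0 < c + a.
    have : - a <= c by move: ca; rewrite ler_norml; lra.
    by rewrite le_eqVlt eq_sym (negPf cn)/=; lra.
  rewrite ler_pM2l// lef_pV2 ?posrE ?mulr_gt0//.
  by move: ca; rewrite ler_norml; lra.
- move=> x x1.
  have xp : x != - a *: e1.
    apply/eqP => xE; move: x1; rewrite xE enormZ enorm_e1 mulr1 normrN gtr0_norm//; lra.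
  have -> : v x = 0; last by rewrite subr0.
  rewrite vT//; apply: uE0; apply/C0P.
  rewrite -(ler_pXn2r (ltn0Sn 1)) ?nnegrE ?enorm_ge0// expr1n -subr_le0 inversion_sphere//.
  have h2 : 0 <= enorm x ^+ 2 - 1 by rewrite subr_ge0 exprn_ege1.
  have h3 : 0 <= (enorm (x - - a *: e1) ^+ 2)^-1 by rewrite invr_ge0 exprn_ge0// enorm_ge0.
  by rewrite -oppr_ge0 -mulNr -mulrN opprB !mulr_ge0// ltW.
Qed.

Lemma groetzsch_of_inner (a X X' : R) : 0 < a < 1 -> 0 < X' -> X' < X -> inner_potential a X ->
  (X'%:E <= @groetzsch_mod R n ((a + a^-1) / 2))%E.
Proof.
move=> /andP[a0 a1] X'0 XX [u [g [ug u0 u1 eg]]].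
pose s := (a + a^-1) / 2; rewrite -/s.
have sa : s - a = (1 - a ^+ 2) / (2 * a) by rewrite /s; field; rewrite gt_eqF.
have k0 : 0 < 1 - a ^+ 2 by rewrite subr_gt0 expr_lt1// ltW.
have far y : 2 <= enorm (y - - a *: e1) -> u y = 1.
  move=> hy; apply: u1; have := enormD y (- (- a *: e1)); rewrite enormN enormZ enorm_e1 mulr1 normrN gtr0_norm//.
  lra.
have kE : 1 - a ^+ 2 = 1 - (- a) ^+ 2 by rewrite sqrrN.
have [v [g' [UG vp vT EG]]] := inversion_flip (a *: e1) k0 (ltr0n _ 2) X'0 XX ug far eg.
apply: (ring_mod_ge m0 X'0); apply: le_trans EG; apply: (upper_gradient_modulus UG).
- move=> x [y /= y1 [<-]] {x}.
  have -> : v y = 1; last lra.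
  have [->|yp] := eqVneq y (a *: e1); first exact: vp.
  rewrite vT//; apply: u1.
  rewrite -(ler_pXn2r (ltn0Sn 1)) ?nnegrE ?enorm_ge0// expr1n -subr_ge0 kE.
  have := @inversion_sphere (- a) y; rewrite opprK => -> //.
  have h2 : 0 <= 1 - enorm y ^+ 2 by rewrite subr_ge0 exprn_ile1// enorm_ge0.
  by rewrite -kE !mulr_ge0 ?(ltW k0)// invr_ge0 exprn_ge0// enorm_ge0.
move=> x /ray_scale[c sc ->].
have ca : 0 < c - a.
  have : 0 < s - a by rewrite sa divr_gt0// mulr_gt0.
  lra.
have -> : v (c *: e1) = 0; last lra.
rewrite vT; last by rewrite -subr_eq0 -scalerBl scaler_eq0 (negPf e1_neq0) orbF gt_eqF.
rewrite kE; have := @inversion_axis (- a) c; rewrite opprK => ->; last by rewrite -subr_eq0 gt_eqF.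
apply: u0; rewrite -kE.
have h1 : 0 < (1 - a ^+ 2) / (c - a) by rewrite divr_gt0.
have h2 : (1 - a ^+ 2) / (c - a) <= 2 * a.
  rewrite ler_pdivrMr// mulrC -ler_pdivrMr ?mulr_gt0// -sa; lra.
by rewrite ler_norml; lra.
Qed.

Lemma inner_log (a X : R) : 0 < a < 1 -> 0 < X < ln a^-1 -> inner_potential a X.
Proof.
move=> /andP[a0 a1] hX.
have [|u [g [ug u01 uE _ eg]]] := @log_potential 0 a 1 X a0 a1; first by rewrite div1r.
exists u, g; split=> //.
- by move=> c ca; have [+ _] := uE (c *: e1); apply; rewrite subr0 enormZ enorm_e1 mulr1.
- by move=> x x1; have [_] := uE x; apply; rewrite subr0.
Qed.

(** Series rule: the inner potential is shrunk to the ball of radius r and combined with a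
    logarithmic potential outside. The gradients have disjoint supports, and with weights X / (X +
    Y) and Y / (X + Y) the energies add up to w / (X + Y)^m. *)
Lemma inner_chain (a r X Y : R) : 0 < a < 1 -> 0 < r < 1 -> 0 < X -> 0 < Y < ln r^-1 ->
  inner_potential a X -> inner_potential (a * r) (X + Y).
Proof.
move=> /andP[a0 a1] /andP[r0 r1] X0 /andP[Y0 Yr] [u [g [ug u0 u1 eg]]].
have rY : r < expR (- Y).
  rewrite -[ltLHS](lnK (_ : r \is Num.pos)) ?posrE// ltr_expR.
  by move: Yr; rewrite lnV ?posrE//; lra.
(* The gap between r and [r'] separates the supports of the two gradients at a uniform scale, and
   the annulus beyond [r'] is still thicker than Y. *)
pose r' := (r + expR (- Y)) / 2.
have rr : r < r' by rewrite /r'; lra.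
have r'0 : 0 < r' by exact: lt_trans rr.
have r'Y : r' < expR (- Y) by rewrite /r'; lra.
have r'1 : r' < 1.
  by apply: lt_trans r'Y _; rewrite -[ltRHS]expR0 ltr_expR; lra.
have Yr' : 0 < Y < ln (1 / r').
  rewrite Y0 div1r lnV ?posrE//= -ltrN2 opprK -[ltRHS]expRK ltr_ln ?posrE ?expR_gt0//.
have [u2 [g2 [ug2 u201 u2E g2E eg2]]] := log_potential (0 : Rn) r'0 r'1 Yr'.
pose u1' x := u (r^-1 *: (x - 0)); pose g1 x := r^-1 * g (r^-1 *: (x - 0)).
have ug1 : upper_gradient u1' g1 by exact: upper_gradient_affine.
have eg1 : energy g1 = energy g by exact: energy_affine (ug_ge0 ug) (ug_measurable ug).
pose A := [set x : Rn | enorm x < r'].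
have mA : measurable (A : set Bn) := measurable_enorm_lt r'.
have u1far x : r <= enorm x -> u1' x = 1.
  move=> hx; rewrite /u1' subr0; apply: u1; rewrite enormZ gtr0_norm ?invr_gt0//.
  by rewrite mulrC ler_pdivlMr// mul1r.
have ug1A : upper_gradient u1' (fun x => g1 x * \1_A x).
  apply: (upper_gradient_restrict ug1 (_ : 0 < r' - r) mA); first by rewrite subr_gt0.
  move=> x y z /negP; rewrite -leNgt => hx yx zx; rewrite !u1far//.
    by have := enorm_dist x z; rewrite enormC ler_norml; lra.
  by have := enorm_dist x y; rewrite enormC ler_norml; lra.
pose al := X / (X + Y).
have XY : 0 < X + Y by rewrite addr_gt0.
have al0 : 0 <= al by rewrite divr_ge0// ltW.
have alE : 1 - al = Y / (X + Y) by rewrite /al; field; rewrite gt_eqF.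
have al1 : 0 <= 1 - al by rewrite alE divr_ge0// ltW.
have UG := upper_gradient_linear al (1 - al) 0 ug1A ug2.
exists (fun x => al * u1' x + (1 - al) * u2 x + 0), (fun x => `|al| * (g1 x * \1_A x) + `|1 - al| * g2 x).
split=> //.
- move=> c ca.
have [u20 _] := u2E (c *: e1).
  rewrite u20.
    rewrite /u1' subr0 scalerA u0 ?mulr0 ?addr0//.
    by rewrite normrM (gtr0_norm (_ : 0 < r^-1)) ?invr_gt0// mulrC ler_pdivrMr.
  rewrite subr0 enormZ enorm_e1 mulr1; apply: (le_trans ca); apply: le_trans (ltW rr).
  exact: ler_piMl (ltW r0) (ltW a1).
- move=> x x1; have [_ u21] := u2E x; rewrite u21 ?subr0// u1far ?(le_trans (ltW r1))//; ring.
have g10 := ug_ge0 ug1; have mg1 := ug_measurable ug1; have g20 := ug_ge0 ug2; have mg2 := ug_measurable ug2.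
have I1 : measurable_fun setT (fun x : Bn => (g1 x ^+ n)%:E) by apply/measurable_EFinP; exact: measurable_funX.
have I2 : measurable_fun setT (fun x : Bn => (g2 x ^+ n)%:E) by apply/measurable_EFinP; exact: measurable_funX.
apply: (@le_trans _ _ ((al ^+ n)%:E * energy g1 + ((1 - al) ^+ n)%:E * energy g2)%E).
  rewrite /energy -!ge0_integralZl//; do ?[by rewrite lee_fin exprn_ge0];
    do ?[by move=> x _; rewrite lee_fin exprn_ge0].
  rewrite -ge0_integralD//; do ?[exact: measurable_funeM]; do ?[by move=> x _; rewrite mule_ge0// lee_fin exprn_ge0].
  apply: ge0_le_integral => //.
  - by move=> x _; rewrite lee_fin exprn_ge0//; exact: (ug_ge0 UG x).
  - apply/measurable_EFinP; apply: measurable_funX; exact: (ug_measurable UG).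
  - by apply: emeasurable_funD; exact: measurable_funeM.
  move=> x _; rewrite -!EFinM -EFinD lee_fin !ger0_norm// -!exprMn indicE.
  case: (boolP (x \in A)) => [/set_mem xA|_].
    have -> : g2 x = 0.
      by apply: g2E => /andP[+ _]; rewrite subr0; move: xA; rewrite /A /=; lra.
    by rewrite mulr1 !mulr0 addr0 expr0n addr0.
  by rewrite !mulr0 add0r lerDr exprn_ge0// mulr_ge0.
apply: (@le_trans _ _ ((al ^+ n)%:E * (w / X ^+ m)%:E + ((1 - al) ^+ n)%:E * (w / Y ^+ m)%:E)%E).
  by apply: leeD; apply: lee_wpmul2l; rewrite ?lee_fin ?exprn_ge0// eg1.
rewrite -!EFinM -EFinD lee_fin alE /al !expr_div_n le_eqVlt; apply/orP; left; apply/eqP.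
rewrite !exprS; field.
by rewrite !expf_neq0 ?gt_eqF.
Qed.
End inner_potentials.

(** * Energy of potentials vanishing on an axis segment *)

Section axis_energy.
Local Notation Rm := 'rV[R]_m.
Local Notation leb := (@lebesgue_measure R).
Local Notation w := (@sphere_areaR R m).
Local Notation e1 := (@e1 R n).
Local Open Scope ereal_scope.
Variables u g : Rn -> R.
Hypothesis ug : upper_gradient u g.

Let g0 : forall x, (0 <= g x)%R := ug_ge0 ug.
Let mg : measurable_fun setT (g : Bn -> R) := ug_measurable ug.
Let mgE : measurable_fun setT (EFin \o (g : Bn -> R)).
Proof. exact/measurable_EFinP. Qed.
Let gE0 (x : Bn) : 0 <= (EFin \o (g : Bn -> R)) x.
Proof. by rewrite lee_fin. Qed.
Let cu : continuous (u : Rn -> R).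
Proof. by case: ug => [[K _ lu] _ _ _]; exact: lipschitz_rV_continuous lu. Qed.
Let mu_ : measurable_fun setT (u : Bn -> R).
Proof. exact: continuous_rV_measurable. Qed.

Lemma segment_increment x y : (`|u y - u x|)%:E <= segment_cost (EFin \o (g : Bn -> R)) x y.
Proof.
have H a b : (u b - u a)%:E <= segment_cost (EFin \o (g : Bn -> R)) a b.
  have [f [L [uf cf]]] := upath_straight a b; rewrite -cf//.
  case: uf => L0 f0 fL lf _; rewrite -{1}f0 -{1}fL.
  exact: upper_gradient_path ug L0 lf.
have [h|h] := leP 0%R (u y - u x)%R; first by rewrite ger0_norm.
by rewrite ltr0_norm// opprB segment_costC.
Qed.

Lemma radial_increment (v : Rn) (s t : R) : enorm v = 1%R -> (s <= t)%R ->
  (u (t *: v)%R - u (s *: v)%R)%:E <= \int[leb]_(r in [set` `[s, t]%R]) (g (r *: v)%R)%:E.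
Proof.
move=> v1 st.
have lf a b : (enorm ((a + s) *: v - (b + s) *: v) <= `|a - b|)%R.
  by rewrite -scalerBl enormZ v1 mulr1 opprD addrACA subrr addr0.
have L0 : (0 <= t - s)%R by rewrite subr_ge0.
have := @upper_gradient_path R n u g (fun a => ((a + s) *: v)%R) (t - s)%R ug L0 lf.
rewrite subrK add0r => /le_trans; apply.
have mr : measurable_fun [set: R] (fun r : R => (g (r *: v))%:E).
  apply: (measurableT_comp mgE); apply: measurable_rVZ; [exact: measurable_id|exact: measurable_cst].
have := ge0_integral_itv_shift mr (fun r => gE0 (r *: v)%R) 0 (t - s)%R s.
by rewrite add0r subrK => <-.
Qed.

Lemma segment_cost_slice (rho : Rn -> \bar R) s (x y : Rm) :
  segment_cost rho (rVcons s x) (rVcons s y) = segment_cost (fun z => rho (rVcons s z)) x y.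
Proof.
rewrite /segment_cost rVcons_opp rVcons_add subrr enorm_rVcons0; congr (_ * _); apply: eq_integral => t _.
by rewrite rVcons_scale rVcons_add mulr0 addr0.
Qed.

Lemma axis_rVcons (c : R) : (c *: e1 = rVcons c (0 : Rm))%R.
Proof.
by apply/rowP => i; rewrite !mxE; case: unliftP => [j ->|->] /=; rewrite ?mxE ?mulr1 ?mulr0.
Qed.

(** In each slice orthogonal to the axis u vanishes where the slice meets the axis, so |u| is at
    most the cost of the segment from that point. The Morrey estimate bounds the mean of this cost
    in the slice. *)
Lemma axis_potential_cube (a k : R) : (0 < a)%R -> (0 < k)%R ->
  (forall c, (`|c| <= a)%R -> u (c *: e1)%R = 0%R) ->
  \int[mu]_(x in cube (0 : Rn)%R a) (`|u x|)%:E <=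
    (4 * m%:R ^+ 2 * a ^+ n)%:E * ((2 ^+ n * k)%:E + (k ^- m)%:E * \int[mu]_(x in cube (0 : Rn)%R a) (g x ^+ n)%:E).
Proof.
move=> a0 k0 u0.
have mau : measurable_fun setT (fun x : Bn => (`|u x|)%:E).
  by apply/measurable_EFinP; exact: measurableT_comp.
have mgn : measurable_fun setT (fun x : Bn => (g x ^+ n)%:E).
  by apply/measurable_EFinP; exact: measurable_funX.
have gn0 x : 0 <= (g x ^+ n)%:E by rewrite lee_fin exprn_ge0.
rewrite (ge0_integral_cube _ a0 mau); last by move=> x; rewrite lee_fin.
rewrite (ge0_integral_cube _ a0 mgn)// mxE sub0r add0r.
have -> : rVtail (0 : Rn)%R = (0 : Rm)%R by apply/rowP => j; rewrite !mxE.
pose J : set R := [set` `](- a)%R, a[%R].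
have mJ : measurable J by exact: measurable_itv.
pose G (s : R) := \int[@lebesgue_rV R m]_(y in cube (0 : Rm)%R a) (g (rVcons s y) ^+ n)%:E.
have mG : measurable_fun [set: R] G.
  exact: (ge0_measurable_slice_cube (0 : Rm)%R a0 mgn gn0).
have G0 s : 0 <= G s by exact: integral_ge0.
pose D := (m%:R * (2 * a) * (2 * m)%:R)%R.
have D0 : (0 <= D)%R by rewrite !mulr_ge0// ltW.
(* Dividing the splitting scale by a lets the common factor a^n come out of both terms. *)
pose q := (k / a)%R; have q0 : (0 < q)%R by rewrite divr_gt0.
have qm : (0 <= q ^- m)%R by rewrite invr_ge0 exprn_ge0// ltW.
have mQ' := cube_measurable (0 : Rm)%R a0.
have step s : J s -> \int[@lebesgue_rV R m]_(y in cube (0 : Rm)%R a) (`|u (rVcons s y)|)%:E <=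
    D%:E * ((q * (2 * a) ^+ m)%:E + (q ^- m)%:E * G s).
  rewrite /J /= in_itv/= => /andP[s1 s2].
  have ms : measurable_fun setT (fun y : borel_rV R m => (EFin \o (g : Bn -> R)) (rVcons s y)) by exact: measurable_slice.
  have Q0 : cube (0 : Rm)%R a (0 : Rm)%R by move=> i; rewrite !mxE subrr normr0.
  have := cube_segment_cost m0 ms (fun=> gE0 _) a0 q0 Q0.
  rewrite /G; under [X in _ <= _ * (_ + _ * X)]eq_integral do rewrite -EFin_expe.
  apply: le_trans; apply: ge0_le_integral => //.
  - exact: measurable_funTS (measurable_slice s mau).
  - by apply: measurable_funTS; exact: segment_cost_measurable.
  move=> y _; rewrite -segment_cost_slice -axis_rVcons.
  have := segment_increment (s *: e1)%R (rVcons s y); rewrite u0 ?subr0//.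
  by rewrite ler_norml; lra.
have lJ : lebesgue_measure J = (2 * a)%:E.
  rewrite /J lebesgue_measure_itv/= lte_fin ifT; last lra.
  by rewrite -EFinB; congr (_%:E); ring.
apply: (@le_trans _ _ (\int[leb]_(s in J) (D%:E * ((q * (2 * a) ^+ m)%:E + (q ^- m)%:E * G s)))).
  apply: ge0_le_integral => //.
  - by move=> s _; exact: integral_ge0.
  - apply: measurable_funTS; apply: (ge0_measurable_slice_cube (0 : Rm)%R a0 mau) => x; by rewrite lee_fin.
  apply: measurable_funTS; apply: measurable_funeM; apply: emeasurable_funD; [exact: measurable_cst|exact: measurable_funeM].
have c0 : (0 <= q * (2 * a) ^+ m)%R by apply: mulr_ge0; [exact: ltW|apply: exprn_ge0; rewrite mulr_ge0// ltW].
rewrite ge0_integralZl//; do ?[by apply: measurable_funTS; apply: emeasurable_funD; [exact: measurable_cst|exact: measurable_funeM]];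
  do ?[by move=> s _; rewrite adde_ge0 ?mule_ge0// lee_fin].
rewrite ge0_integral_cstDZ//; do ?[exact: measurable_funTS].
rewrite [X in _ * (_ * X + _)]lJ.
have km : (0 <= k ^- m)%R by rewrite invr_ge0 exprn_ge0// ltW.
pose GI := \int[leb]_(s in J) G s; have GI0 : 0 <= GI by exact: integral_ge0.
rewrite -/GI ge0_muleDr; do ?[by rewrite mule_ge0// lee_fin]; last first.
  by rewrite mule_ge0 ?lee_fin// mulr_ge0// ltW.
rewrite [leRHS]ge0_muleDr; do ?[by rewrite mule_ge0// lee_fin]; last first.
  by rewrite lee_fin mulr_ge0 ?exprn_ge0// ltW.
rewrite !muleA -!EFinM le_eqVlt; apply/orP; left; apply/eqP; congr (_%:E + _%:E * _).
  by rewrite /D /q natrM !exprS exprMn; field; rewrite gt_eqF.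
rewrite /D /q natrM expr_div_n invfM invrK !exprS; field.
by rewrite expf_neq0 ?gt_eqF.
Qed.

(** For each s in [a, 2a], 1 - |u (s v)| is at most the integral of g along the radius from s to 1.
    Averaging over s replaces the unknown initial value by a mean, which can be integrated over all
    directions. *)
Lemma radial_average (a b : R) (v : Rn) : (0 < a)%R -> (a < b)%R -> (b < 1)%R -> enorm v = 1%R -> u v = 1%R ->
  (2 * a <= b)%R ->
  1 <= (a^-1)%:E * \int[leb]_(s in [set` `[a, 2 * a]%R]) (`|u (s *: v)|)%:E +
    (\int[leb]_(s in [set` `[a, b]%R]) (g (s *: v)%R)%:E + \int[leb]_(s in [set` `[b, 1%R]%R]) (g (s *: v)%R)%:E).
Proof.
move=> a0 ab b1 v1 uv ab2.
have mv (f : Bn -> R) : measurable_fun setT f -> measurable_fun [set: R] (fun r : R => (f (r *: v)%R)%:E).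
  move=> mf; apply/measurable_EFinP; apply: (measurableT_comp mf).
  by apply: measurable_rVZ; [exact: measurable_id|exact: measurable_cst].
rewrite -(ge0_integral_itv_cat (mv _ mg) (fun r => gE0 (r *: v)%R) (ltW ab) (ltW b1)).
set I := (X in _ <= _ + X).
have I0 : 0 <= I by apply: integral_ge0 => s _; rewrite lee_fin.
have [->|If] := eqVneq I +oo.
  by rewrite addey ?leey// gt_eqF// (@lt_le_trans _ _ 0)// mule_ge0 ?lee_fin ?invr_ge0 ?(ltW a0)//; apply: integral_ge0 => s _; rewrite lee_fin.
have {}If : I \is a fin_num by rewrite ge0_fin_numE// ltey.
rewrite -(fineK If); pose c := fine I.
have mau : measurable_fun [set: R] (fun s : R => (`|u (s *: v)|)%:E).
  by apply: (mv (fun x => `|u x|%R)); exact: measurableT_comp.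
have h : ((1 - c) * a)%:E <= \int[leb]_(s in [set` `[a, (2 * a)%R]%R]) (`|u (s *: v)|)%:E.
  have [c1|c1] := leP 1%R c.
    apply: (@le_trans _ _ 0); last by apply: integral_ge0 => s _; rewrite lee_fin.
    by rewrite lee_fin mulr_le0_ge0 ?(ltW a0)// subr_le0.
  have -> : ((1 - c) * a)%:E = \int[leb]_(s in [set` `[a, (2 * a)%R]%R]) (1 - c)%:E.
    by rewrite integral_cst_itv; [congr (_%:E); ring|lra].
  apply: ge0_le_integral => //.
  - by move=> s _; rewrite lee_fin subr_ge0 ltW.
  - exact: measurable_funTS.
  move=> s; rewrite /= in_itv/= => /andP[s1 s2]; rewrite lee_fin lerBlDr.
  have sl : (s <= 1)%R by lra.
  have := radial_increment v1 sl; rewrite scale1r uv => h1.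
  have h2 : \int[leb]_(r in [set` `[s, 1%R]%R]) (g (r *: v)%R)%:E <= c%:E.
    rewrite /c fineK//; apply: ge0_subset_integral => //; do ?[exact: measurable_funTS (mv _ mg)];
      do ?[by move=> r _; rewrite lee_fin].
    by move=> r; rewrite /= !in_itv/= => /andP[r1 ->]; rewrite andbT; lra.
  have := le_trans h1 h2; rewrite lee_fin; have := ler_norm (u (s *: v)%R); lra.
have : (a^-1)%:E * ((1 - c) * a)%:E <= (a^-1)%:E * \int[leb]_(s in [set` `[a, (2 * a)%R]%R]) (`|u (s *: v)|)%:E.
  by apply: lee_wpmul2l => //; rewrite lee_fin invr_ge0 ltW.
rewrite -EFinM mulrCA mulVf ?gt_eqF// mulr1 => h1.
by rewrite -leeBlDr//.
Qed.

(** [radial_tangent] is applied with k on [b, 1] and with 2 k on [a, b]. Doubling leaves at most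
    half of the inner energy in use, because 2^-m <= 1/2, at the price of counting log (b/a)
    twice. *)
Lemma radial_budget (a b k : R) (v : Rn) : (0 < a)%R -> (2 * a <= b)%R -> (b < 1)%R -> (0 < k)%R ->
  enorm v = 1%R -> u v = 1%R ->
  (n%:R * k ^+ m - m%:R * k ^+ n * (2 * ln (b / a) - ln b))%:E <=
  (n%:R * k ^+ m / a)%:E * \int[leb]_(s in [set` `[a, (2 * a)%R]%R]) (`|u (s *: v)|)%:E +
  ((2^-1)%:E * \int[leb]_(s in [set` `[a, b]%R]) (g (s *: v) ^+ n * s ^+ m)%:E +
   \int[leb]_(s in [set` `[b, 1%R]%R]) (g (s *: v) ^+ n * s ^+ m)%:E).
Proof.
move=> a0 ab2 b1 k0 v1 uv.
have b0 : (0 < b)%R by lra.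
have mgv : measurable_fun [set: R] (fun r : R => (g (r *: v)%R)%:E).
  apply/measurable_EFinP; apply: (measurableT_comp mg).
  by apply: measurable_rVZ; [exact: measurable_id|exact: measurable_cst].
have key := radial_average a0 (ltac:(lra) : (a < b)%R) b1 v1 uv ab2.
have t1 := @radial_tangent R m (fun s => (g (s *: v))%:E) b 1%R k b0 (ltW b1) (ltW k0) mgv (fun s => gE0 (s *: v)%R).
have k20 : (0 <= 2 * k)%R by rewrite mulr_ge0// ltW.
have t2 := @radial_tangent R m (fun s => (g (s *: v))%:E) a b (2 * k)%R a0 (ltac:(lra) : (a <= b)%R) k20 mgv (fun s => gE0 (s *: v)%R).
have E c d : \int[leb]_(s in [set` `[c, d]%R]) ((g (s *: v))%:E ^+ n * (s ^+ m)%:E) =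
    \int[leb]_(s in [set` `[c, d]%R]) (g (s *: v) ^+ n * s ^+ m)%:E.
  by apply: eq_integral => s _; rewrite -EFin_expe -EFinM.
rewrite E in t1; rewrite E in t2.
rewrite ln1 sub0r in t1.
move: key t1 t2.
set I1 := \int[leb]_(s in [set` `[a, b]%R]) _; set I2 := \int[leb]_(s in [set` `[b, 1%R]%R]) _.
set V := integral _ _ _; set J2 := integral _ _ _; set J1 := integral _ _ _ => key t1 t2.
have V0 : 0 <= V by apply: integral_ge0 => s _; rewrite lee_fin.
have nk0 : (0 <= n%:R * k ^+ m)%R by rewrite mulr_ge0// exprn_ge0// ltW.
have h2 : (0 <= 2 ^- m :> R)%R by rewrite invr_ge0 exprn_ge0.
have J10 : 0 <= J1.
  apply: integral_ge0 => s; rewrite /= in_itv/= => /andP[s1 _].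
  by rewrite lee_fin mulr_ge0 ?exprn_ge0//; lra.
have I10 : 0 <= I1 by apply: integral_ge0 => s _; rewrite lee_fin.
have I20 : 0 <= I2 by apply: integral_ge0 => s _; rewrite lee_fin.
have {}t2 : (n%:R * k ^+ m)%:E * I1 <= (2^-1)%:E * J1 + (m%:R * k ^+ n * (2 * (ln b - ln a)))%:E.
  have : (2 ^- m)%:E * ((n%:R * (2 * k) ^+ m)%:E * I1) <= (2 ^- m)%:E * (J1 + (m%:R * (2 * k) ^+ n * (ln b - ln a))%:E).
    by apply: lee_wpmul2l => //; rewrite lee_fin.
  have lab : (0 <= ln b - ln a)%R by rewrite subr_ge0 ler_ln ?posrE//; lra.
  have e2 : (0 <= m%:R * (2 * k) ^+ n * (ln b - ln a))%R by rewrite mulr_ge0// mulr_ge0// exprn_ge0.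
  have -> : (2 ^- m)%:E * ((n%:R * (2 * k) ^+ m)%:E * I1) = (n%:R * k ^+ m)%:E * I1.
    by rewrite muleA -EFinM exprMn mulrCA mulKf// expf_neq0.
  have -> : (2 ^- m)%:E * (J1 + (m%:R * (2 * k) ^+ n * (ln b - ln a))%:E) =
      (2 ^- m)%:E * J1 + (m%:R * k ^+ n * (2 * (ln b - ln a)))%:E.
    rewrite ge0_muleDr ?lee_fin// -EFinM; congr (_ + _%:E).
    by rewrite exprMn (exprS 2); field; rewrite expf_neq0.
  move/le_trans; apply; apply: leeD2r; apply: lee_wpmul2r => //.
  rewrite lee_fin lef_pV2 ?posrE ?exprn_gt0// -[leLHS]expr1; apply: ler_weXn2l => //; by rewrite ler1n.
have : (n%:R * k ^+ m)%:E * 1 <= (n%:R * k ^+ m)%:E * ((a^-1)%:E * V + (I1 + I2)).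
  by apply: lee_wpmul2l; rewrite ?lee_fin.
have -> : (n%:R * k ^+ m)%:E * ((a^-1)%:E * V + (I1 + I2)) =
    (n%:R * k ^+ m / a)%:E * V + ((n%:R * k ^+ m)%:E * I1 + (n%:R * k ^+ m)%:E * I2).
  have aV0 : 0 <= (a^-1)%:E * V by rewrite mule_ge0// lee_fin invr_ge0 ltW.
  rewrite (ge0_muleDr _ aV0 (adde_ge0 I10 I20)) (ge0_muleDr _ I10 I20).
  by rewrite muleA.
rewrite mule1 => h.
have {}h := le_trans h (leeD2l _ (leeD t2 t1)).
rewrite addeACA -EFinD addeA in h.
have rE : (m%:R * k ^+ n * (2 * ln (b / a) - ln b) = m%:R * k ^+ n * (2 * (ln b - ln a)) + m%:R * k ^+ n * - ln b)%R.
  by rewrite lnM ?posrE ?invr_gt0// lnV ?posrE//; ring.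
by rewrite rE EFinB leeBlDr.
Qed.

(** Half of the energy in the ball of radius b pays for the mean of |u| over the shell a <= |x| <= 2
    a, by the choice of c; the other half and the energy outside that ball pay for the radial part.
    So no energy is counted twice. *)
Lemma axis_energy_ge (a k c : R) : (0 < a)%R -> (4 * n%:R * a < 1)%R -> (0 < k)%R -> (0 < c)%R ->
  (n%:R * 3 ^+ n * (4 * m%:R ^+ 2) <= 2^-1 * c ^+ m)%R ->
  (forall t, (`|t| <= 3 * a)%R -> u (t *: e1)%R = 0%R) -> (forall x, (1 <= enorm x)%R -> u x = 1%R) ->
  ((n%:R * k ^+ m - m%:R * k ^+ n * (2 * ln (4 * n%:R) - ln (4 * n%:R * a))) * w -
    n%:R * 3 ^+ n * (4 * m%:R ^+ 2) * 2 ^+ n * c * k ^+ n)%:E <= energy g.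
Proof.
move=> a0 na1 k0 c0 hc u0 u1.
(* The Euclidean norm is at most n times the supremum norm, so the ball of radius [b] contains the
   cube of radius 3 a, which itself contains the shell. *)
pose b := (4 * n%:R * a)%R.
have n1 : (1 <= n%:R :> R)%R by rewrite ler1n.
have ab2 : (2 * a <= b)%R by rewrite /b; nra.
have b0 : (0 < b)%R by lra.
have nk0 : (0 <= n%:R * k ^+ m)%R by rewrite mulr_ge0// exprn_ge0// ltW.
pose Q := cube (0 : Rn)%R (3 * a)%R.
have a40 : (0 < 3 * a)%R by rewrite mulr_gt0.
have mQ : measurable (Q : set Bn) by exact: cube_measurable.
pose S := [set x : Rn | (a <= enorm x <= 2 * a)%R].
pose Bb := [set x : Rn | (enorm x < b)%R].
have mS : measurable (S : set Bn).
  rewrite (_ : S = ~` ([set x | (enorm x < a)%R] `|` [set x | (2 * a < enorm x)%R])).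
    by apply: measurableC; apply: measurableU; [exact: measurable_enorm_lt|exact: measurable_enorm_gt].
  apply/seteqP; split=> x; rewrite /S /=; first by move=> ? []; lra.
  by move=> h; apply/andP; split; rewrite leNgt; apply/negP => h'; apply: h; [left|right].
have mB : measurable (Bb : set Bn) := measurable_enorm_lt b.
(* On the shell s >= a, so d s^m is at least the coefficient n k^m / a of [radial_budget]. *)
pose d := (n%:R * k ^+ m * a ^- n)%R.
have d0 : (0 <= d)%R by rewrite mulr_ge0// invr_ge0 exprn_ge0// ltW.
pose F1 (x : Bn) := (d * (`|u x| * \1_S x))%:E.
pose h (x : Bn) : R := (1 - 2^-1 * \1_Bb x)%R.
pose F2 (x : Bn) := (g x ^+ n * h x)%:E.
have hE x : (h x = if x \in Bb then 2^-1 else 1)%R.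
  by rewrite /h indicE; case: (_ \in _); rewrite ?mulr1 ?mulr0 ?subr0//; lra.
have h0 x : (0 <= h x)%R by rewrite hE; case: ifP.
have mF1 : measurable_fun setT F1.
  apply/measurable_EFinP; apply: measurable_funM => //; apply: measurable_funM; last exact: measurable_indic.
  exact: measurableT_comp.
have mh : measurable_fun setT h.
  by apply: measurable_funB => //; apply: measurable_funM => //; exact: measurable_indic.
have mF2 : measurable_fun setT F2 by apply/measurable_EFinP; apply: measurable_funM => //; exact: measurable_funX.
have F10 x : 0 <= F1 x by rewrite lee_fin mulr_ge0// mulr_ge0.
have F20 x : 0 <= F2 x by rewrite lee_fin mulr_ge0 ?exprn_ge0.
pose cc := (n%:R * k ^+ m - m%:R * k ^+ n * (2 * ln (4 * n%:R) - ln b))%R.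
have baE : (b / a = 4 * n%:R)%R by rewrite /b mulfK ?gt_eqF.
have radial (v : Rn) : enorm v = 1%R ->
    cc%:E <= \int[leb]_(s in [set` `]0%R, +oo[%R]) ((F1 (s *: v)%R + F2 (s *: v)%R) * (s ^+ m)%:E).
  move=> v1.
  have uv : u v = 1%R by apply: u1; rewrite v1.
  have := radial_budget a0 ab2 na1 k0 v1 uv; rewrite baE -/cc => /le_trans; apply.
  have mv (f : Bn -> \bar R) : measurable_fun setT f -> measurable_fun [set: R] (fun r : R => f (r *: v)%R * (r ^+ m)%:E).
    move=> mf; apply: emeasurable_funM; last by apply/measurable_EFinP; exact: measurable_funX.
    by apply: (measurableT_comp mf); apply: measurable_rVZ; [exact: measurable_id|exact: measurable_cst].
  pose P : set R := [set` `]0%R, +oo[%R].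
  have inP s : P s -> (0 <= s)%R by rewrite /P /= in_itv/= andbT; exact: ltW.
  have P0 (f : Bn -> \bar R) : (forall x, 0 <= f x) -> forall s, P s -> 0 <= f (s *: v)%R * (s ^+ m)%:E.
    by move=> f0 s /inP s0; rewrite mule_ge0// lee_fin exprn_ge0.
  have sub (f : Bn -> \bar R) (p q : R) : measurable_fun setT f -> (forall x, 0 <= f x) -> (0 < p)%R ->
      \int[leb]_(s in [set` `[p, q]%R]) (f (s *: v)%R * (s ^+ m)%:E) <= \int[leb]_(s in P) (f (s *: v)%R * (s ^+ m)%:E).
    move=> mf f0 p0; apply: ge0_subset_integral => //; do ?[exact: measurable_itv]; do ?[exact: measurable_funTS (mv _ mf)]; do ?[exact: P0].
    by move=> s; rewrite /P /= !in_itv/= andbT => /andP[ps _]; lra.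
  rewrite (_ : \int[leb]_(s in P) _ = \int[leb]_(s in P) (F1 (s *: v)%R * (s ^+ m)%:E) + \int[leb]_(s in P) (F2 (s *: v)%R * (s ^+ m)%:E)); last first.
    rewrite -ge0_integralD//; do ?[exact: measurable_itv]; do ?[exact: P0]; do ?[exact: measurable_funTS (mv _ mF1)]; do ?[exact: measurable_funTS (mv _ mF2)].
    by apply: eq_integral => s _; rewrite ge0_muleDl.
  have nv s : (0 <= s)%R -> enorm (s *: v) = s by move=> s0; rewrite enormZ v1 mulr1 ger0_norm.
  have mgv : measurable_fun [set: R] (fun r : R => g (r *: v)%R).
    by apply: (measurableT_comp mg); apply: measurable_rVZ; [exact: measurable_id|exact: measurable_cst].
  apply: leeD.
    apply: le_trans (sub F1 a (2 * a)%R mF1 F10 a0).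
    rewrite -ge0_integralZl//; do ?[by rewrite lee_fin divr_ge0// ltW]; last first.
      apply: measurable_funTS; apply/measurable_EFinP; apply: measurableT_comp => //.
      apply: (measurableT_comp mu_); apply: measurable_rVZ; [exact: measurable_id|exact: measurable_cst].
    apply: ge0_le_integral => //.
    - by move=> s _; rewrite -EFinM lee_fin mulr_ge0// divr_ge0// ltW.
    - apply: measurable_funTS; apply/measurable_EFinP; apply: measurable_funM => //; apply: measurableT_comp => //.
      apply: (measurableT_comp mu_); apply: measurable_rVZ; [exact: measurable_id|exact: measurable_cst].
    - exact: measurable_funTS (mv _ mF1).
    move=> s; rewrite /= in_itv/= => /andP[s1 s2]; have s0 : (0 <= s)%R by lra.
    rewrite /F1 -!EFinM lee_fin indicE mem_set ?mulr1; last by rewrite /S /= nv// s1.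
    rewrite (mulrAC d); apply: ler_wpM2r => //.
    rewrite /d (_ : n%:R * k ^+ m / a = n%:R * k ^+ m * a ^- n * a ^+ m)%R; last by rewrite exprS; field; rewrite expf_neq0 ?gt_eqF.
    by apply: ler_wpM2l => //; apply: lerXn2r; rewrite ?nnegrE ?(ltW a0).
  have a1 : (a <= b)%R by lra.
  have mF2v := mv _ mF2.
  apply: (@le_trans _ _ (\int[leb]_(s in [set` `[a, 1%R]%R]) (F2 (s *: v)%R * (`|s| ^+ m)%:E))); last first.
    apply: le_trans (sub F2 a 1%R mF2 F20 a0); rewrite le_eqVlt; apply/orP; left; apply/eqP; apply: eq_integral => s.
    by rewrite inE /= in_itv/= => /andP[s1 _]; rewrite ger0_norm//; lra.
  have mF2a : measurable_fun [set: R] (fun s : R => F2 (s *: v)%R * (`|s| ^+ m)%:E).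
    apply: emeasurable_funM; first by apply: (measurableT_comp mF2); apply: measurable_rVZ; [exact: measurable_id|exact: measurable_cst].
    by apply/measurable_EFinP; apply: measurable_funX; exact: normr_measurable.
  have F2a0 s : 0 <= F2 (s *: v)%R * (`|s| ^+ m)%:E by rewrite mule_ge0// lee_fin exprn_ge0.
  rewrite (ge0_integral_itv_cat mF2a F2a0 a1 (ltW na1)).
  have mJ : measurable_fun [set: R] (fun s : R => (g (s *: v)%R ^+ n * s ^+ m)%:E).
    by apply/measurable_EFinP; apply: measurable_funM; apply: measurable_funX.
  apply: leeD.
    have J0 s : s \in `[a, b]%R -> (0 <= g (s *: v)%R ^+ n * s ^+ m)%R.
      by rewrite in_itv/= => /andP[s1 _]; rewrite mulr_ge0 ?exprn_ge0//; lra.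
    rewrite -ge0_integralZl//; do ?[exact: measurable_funTS mJ]; do ?[by move=> s /J0; rewrite lee_fin].
    apply: ge0_le_integral => //.
    - by move=> s /J0 hs; rewrite -EFinM lee_fin mulr_ge0.
    - by apply: measurable_funTS; exact: measurable_funeM.
    - exact: measurable_funTS.
    move=> s hs; have := J0 s hs; move: hs; rewrite /= in_itv/= => /andP[s1 s2] hJ; have s0 : (0 <= s)%R by lra.
    rewrite /F2 -!EFinM lee_fin ger0_norm// mulrAC mulrC; apply: ler_wpM2l => //.
    by rewrite hE; case: ifP => // _; lra.
  apply: ge0_le_integral => //.
  - by move=> s; rewrite /= in_itv/= => /andP[s1 _]; rewrite lee_fin mulr_ge0 ?exprn_ge0//; lra.
  - exact: measurable_funTS.
  - exact: measurable_funTS.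
  move=> s; rewrite /= in_itv/= => /andP[s1 s2]; have s0 : (0 <= s)%R by lra.
  rewrite /F2 -!EFinM lee_fin ger0_norm// hE memNset ?mulr1//.
  by rewrite /Bb /= nv//; apply/negP; rewrite -leNgt.
have [cc0|/ltW cc0] := leP cc 0%R.
  apply: (@le_trans _ _ 0); last by apply: integral_ge0 => x _; rewrite lee_fin exprn_ge0.
  have w0 : (0 < w)%R := @sphere_areaR_gt0 R m.
  have c1 : (0 <= n%:R * 3 ^+ n * (4 * m%:R ^+ 2) * 2 ^+ n * c * k ^+ n)%R.
    by rewrite mulr_ge0 ?exprn_ge0 ?(ltW k0)// mulr_ge0 ?(ltW c0)// !mulr_ge0 ?exprn_ge0.
  have c2 : (cc * w <= 0)%R by rewrite mulr_le0_ge0// ltW.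
  by rewrite lee_fin; move: c1 c2; rewrite /cc; lra.
have mF : measurable_fun setT (fun x => F1 x + F2 x) by exact: emeasurable_funD.
have F0 x : 0 <= F1 x + F2 x by rewrite adde_ge0.
have := @ge0_integral_spherical_ge R m (fun x => F1 x + F2 x) cc%:E mF F0 cc0 radial.
rewrite sphere_areaRE -EFinM ge0_integralD// => main.
have mgn : measurable_fun setT (fun x : Bn => (g x ^+ n)%:E).
  by apply/measurable_EFinP; exact: measurable_funX.
pose EQ := \int[mu]_(x in Q) (g x ^+ n)%:E.
have EQ0 : 0 <= EQ by apply: integral_ge0 => x _; rewrite lee_fin exprn_ge0.
pose M : R := (n%:R * 3 ^+ n * (4 * m%:R ^+ 2))%R.
have M0 : (0 <= M)%R by rewrite !mulr_ge0 ?exprn_ge0.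
have mau : measurable_fun setT (fun x : Bn => (`|u x|)%:E).
  by apply/measurable_EFinP; exact: measurableT_comp.
have hF1 : \int[mu]_x F1 x <= (M * 2 ^+ n * c * k ^+ n)%:E + (2^-1)%:E * EQ.
  apply: (@le_trans _ _ (d%:E * \int[mu]_(x in Q) (`|u x|)%:E)).
    have -> : \int[mu]_(x in Q) (`|u x|)%:E = \int[mu]_x ((`|u x| * \1_Q x)%:E).
      by rewrite [LHS]integral_indicM; apply: eq_integral => x _; rewrite -EFinM.
    have mQi : measurable_fun setT (fun x : Bn => (`|u x| * \1_Q x)%:E).
      apply/measurable_EFinP; apply: measurable_funM; last exact: measurable_indic.
      exact: measurableT_comp.
    rewrite -ge0_integralZl//; do ?[by move=> x _; rewrite lee_fin mulr_ge0]; do ?[by rewrite lee_fin].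
    apply: ge0_le_integral => //.
      exact: measurable_funeM.
    move=> x _; rewrite /F1 -EFinM lee_fin; apply: ler_wpM2l => //; apply: ler_wpM2l => //.
    rewrite !indicE; case: (boolP (x \in S)) => [/set_mem /andP[_ Sx]|_]; last by rewrite ler0n.
    rewrite mem_set// => i; rewrite mxE subr0; apply: le_lt_trans (coord_le_enorm x i) _; lra.
  have ck0 : (0 < c * k)%R by rewrite mulr_gt0.
  apply: (le_trans (lee_wpmul2l _ (axis_potential_cube a40 ck0 u0))); first by rewrite lee_fin.
  have ckm : (0 <= (c * k) ^- m)%R by rewrite invr_ge0 exprn_ge0// ltW.
  rewrite -/EQ muleA -EFinM ge0_muleDr; last 2 first.
  - by rewrite lee_fin mulr_ge0 ?exprn_ge0// ltW.
  - by rewrite mule_ge0// lee_fin.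
  have dE : (d * (4 * m%:R ^+ 2 * (3 * a) ^+ n) = M * k ^+ m)%R.
    by rewrite /d /M exprMn; field; rewrite expf_neq0 ?gt_eqF.
  rewrite dE muleA -!EFinM; apply: leeD.
    by rewrite lee_fin le_eqVlt; apply/orP; left; apply/eqP; rewrite (exprS k); ring.
  apply: lee_wpmul2r => //; rewrite lee_fin.
  rewrite (_ : M * k ^+ m * (c * k) ^- m = M / c ^+ m)%R; last first.
    by rewrite exprMn; field; rewrite !expf_neq0 ?gt_eqF.
  by rewrite ler_pdivrMr ?exprn_gt0.
have QB : Q `<=` Bb.
  move=> x Qx; rewrite /Bb /=; apply: (le_lt_trans (enorm_le_norm x)).
  have : (`|x| <= 3 * a)%R.
    by apply: norm_le_coord => [|i]; [exact: ltW|have := Qx i; rewrite mxE subr0; exact: ltW].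
  by rewrite /b => xa; nra.
have hF2 : (2^-1)%:E * EQ + \int[mu]_x F2 x <= energy g.
  have -> : (2^-1)%:E * EQ = \int[mu]_x ((2^-1 * (g x ^+ n * \1_Q x))%:E).
    have mQi : measurable_fun setT (fun x : Bn => (g x ^+ n * \1_Q x)%:E).
      by apply/measurable_EFinP; apply: measurable_funM; [exact: measurable_funX|exact: measurable_indic].
    have -> : EQ = \int[mu]_x (g x ^+ n * \1_Q x)%:E.
      by rewrite /EQ integral_indicM; apply: eq_integral => x _; rewrite -EFinM.
    rewrite -ge0_integralZl//; do ?[by move=> x _; rewrite lee_fin mulr_ge0 ?exprn_ge0].
  have mQi : measurable_fun setT (fun x : Bn => (2^-1 * (g x ^+ n * \1_Q x))%:E).
    apply/measurable_EFinP; apply: measurable_funM => //; apply: measurable_funM; [exact: measurable_funX|exact: measurable_indic].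
  rewrite -ge0_integralD//; do ?[by move=> x _; rewrite lee_fin !mulr_ge0 ?exprn_ge0].
  apply: ge0_le_integral => //.
  - by move=> x _; rewrite adde_ge0// lee_fin !mulr_ge0 ?exprn_ge0.
  - exact: emeasurable_funD.
  move=> x _; rewrite /F2 -EFinD lee_fin mulrCA -mulrDr ler_piMr ?exprn_ge0// hE indicE.
  case: (boolP (x \in Q)) => [/set_mem /QB Bx|_]; first by rewrite mem_set//= mulr1; lra.
  by rewrite mulr0 add0r; case: ifP => _; lra.
rewrite EFinB leeBlDr//; apply: (le_trans main); apply: le_trans (leeD2r _ hF1) _.
by rewrite -/M -addeA addeC; apply: leeD2r.
Qed.
End axis_energy.

(** * An upper bound for slit balls *)

Section inner_bound.
Local Notation w := (@sphere_areaR R m).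

(** This bound is what makes the Groetzsch constant finite; [groetzsch_bound] extends it to all
    radii below 1. *)
Lemma inner_bound : exists2 C : R, 0 < C & forall A X : R, 0 < A -> 4 * n%:R * A < 3 -> 0 < X ->
  @inner_potential A X -> X <= ln A^-1 + C.
Proof.
have w0 : 0 < w := @sphere_areaR_gt0 R m.
have mr0 : 0 < m%:R :> R by rewrite ltr0n.
pose M : R := n%:R * 3 ^+ n * (4 * m%:R ^+ 2).
have M0 : 0 <= M by rewrite !mulr_ge0 ?exprn_ge0.
pose c := 1 + 2 * M; have c0 : 0 < c by rewrite ltr_pwDl// mulr_ge0.
have hc : M <= 2^-1 * c ^+ m.
  have c1 : 1 <= c by rewrite lerDl mulr_ge0.
  have : c <= c ^+ m by rewrite -[leLHS]expr1 ler_weXn2l.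
  by rewrite /c; lra.
pose D1 := M * 2 ^+ n * c.
have D10 : 0 <= D1 by rewrite !mulr_ge0 ?exprn_ge0// ltW.
pose D0 := 2 * ln (4 * n%:R : R).
have n1 : 1 <= n%:R :> R by rewrite ler1n.
have D00 : 0 < D0 by rewrite mulr_gt0// ln_gt0//; lra.
pose C := D0 + D1 / (w * m%:R).
have C0 : 0 < C by rewrite ltr_pwDl// divr_ge0// mulr_ge0// ltW.
exists C => // A X A0 nA X0 [u [g [ug u0 u1 eg]]].
pose a := A / 3; have a0 : 0 < a by rewrite divr_gt0.
have na1 : 4 * n%:R * a < 1 by rewrite /a; lra.
pose L := - ln (4 * n%:R * a).
have na0 : 0 < 4 * n%:R * a by rewrite !mulr_gt0// ltr0n.
have L0 : 0 < L by rewrite oppr_gt0 ln_lt0// na0.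
(* With this k, and C absorbing the error [D1], the lower bound of [axis_energy_ge] is exactly w
   k^m; comparison with w / X^m then reads X <= L + C. *)
pose k := (L + C)^-1; have LC : 0 < L + C by rewrite addr_gt0.
have k0 : 0 < k by rewrite invr_gt0.
have u0' t : `|t| <= 3 * a -> u (t *: (@e1 R n)) = 0 by rewrite /a mulrC divfK//; exact: u0.
have := axis_energy_ge ug a0 na1 k0 c0 hc u0' u1.
move=> /le_trans /(_ eg); rewrite lee_fin -/M -/D1 -/D0 -[ln (4 * n%:R * a)]opprK -/L => h.
have E : (n%:R * k ^+ m - m%:R * k ^+ n * (D0 - - L)) * w - D1 * k ^+ n = w * k ^+ m.
  have kE : k * (L + C) = 1 by rewrite /k mulVf ?gt_eqF.
  have CE : w * m%:R * (C - D0) = D1 by rewrite /C; field; rewrite !gt_eqF.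
  rewrite -natr1 exprS -CE.
  have -> : ((m%:R + 1) * k ^+ m - m%:R * (k * k ^+ m) * (D0 - - L)) * w - w * m%:R * (C - D0) * (k * k ^+ m) =
    w * k ^+ m + w * m%:R * k ^+ m * (1 - k * (L + C)) by ring.
  by rewrite kE subrr mulr0 addr0.
have XLC : X <= L + C.
  rewrite leNgt; apply/negP => hX.
  have : w / X ^+ m < w * k ^+ m.
    rewrite ltr_pM2l// /k exprVn ltf_pV2 ?posrE ?exprn_gt0//.
    by rewrite ltr_pXn2r// ?nnegrE ?ltW.
  by move: h; rewrite [X in X <= _]E; lra.
apply: (le_trans XLC); rewrite lerD2r /L -lnV ?posrE// ler_ln ?posrE ?invr_gt0// lef_pV2 ?posrE//.
by rewrite /a; nra.
Qed.
End inner_bound.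

Section dense.
Local Open Scope ereal_scope.

Lemma le_from_below (x : R) (M : \bar R) : (0 < x)%R -> (forall y, (0 < y < x)%R -> y%:E <= M) -> x%:E <= M.
Proof.
move=> x0 H; rewrite leNgt; apply/negP => Mx.
have M0 : 0 <= M.
  apply: le_trans (H (x / 2)%R _); first by rewrite lee_fin divr_ge0// ltW.
  by rewrite divr_gt0//= ltr_pdivrMr// ltr_pMr// ltr1n.
case: M H Mx M0 => [r| |]// H; rewrite lte_fin lee_fin => rx r0.
by have := H ((r + x) / 2)%R; rewrite lee_fin => H'; have := H' ltac:(lra); lra.
Qed.

(** Moduli are compared through the positive reals strictly below them, since potentials are
    available only for those. *)
Lemma le_above (M N : \bar R) : 0 <= N -> (forall y, (0 < y)%R -> y%:E < M -> y%:E <= N) -> M <= N.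
Proof.
move=> N0 H; case: M H => [x| |] H; last by rewrite leNye.
  have [x0|x0] := leP x 0%R; first by apply: le_trans N0; rewrite lee_fin.
  by apply: le_from_below => // y /andP[y0 yx]; apply: H; rewrite ?lte_fin.
case: N N0 H => [r| |]// r0 H; rewrite lee_fin in r0.
have r10 : (0 < r + 1)%R by lra.
by have := H (r + 1)%R r10 (ltry _); rewrite lee_fin => h; exfalso; lra.
Qed.
End dense.

(** * The limit defining the Groetzsch constant *)

Section groetzsch_constant.
Local Open Scope ereal_scope.
Local Notation G a := (@groetzsch_mod R n ((a + a^-1) / 2)).

Let G_inner (a X : R) : (0 < a < 1)%R -> (0 < X)%R -> (forall Y, (0 < Y < X)%R -> @inner_potential a Y) -> X%:E <= G a.
Proof.
move=> a01 X0 H; apply: le_from_below => // y /andP[y0 yX].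
have yy : (y < (y + X) / 2)%R by lra.
by apply: (groetzsch_of_inner a01 y0 yy); apply: H; lra.
Qed.

Let inner_G (a X : R) : (0 < a < 1)%R -> (0 < X)%R -> X%:E < G a -> @inner_potential a X.
Proof.
move=> a01 X0 /exists_between[Y XY hY].
exact: (inner_of_groetzsch a01 X0 XY hY).
Qed.

Lemma groetzsch_log (a : R) : (0 < a < 1)%R -> (ln a^-1)%:E <= G a.
Proof.
move=> a01; have /andP[a0 a1] := a01.
apply: G_inner => //; first by rewrite ln_gt0// invf_gt1.
by move=> Y hY; exact: inner_log.
Qed.

(** The series rule for rings. It makes a exp (G a) grow as a decreases, so that its limit at 0 is a
    supremum. *)
Lemma groetzsch_chain (a r : R) : (0 < a < 1)%R -> (0 < r < 1)%R -> G a + (ln r^-1)%:E <= G (a * r)%R.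
Proof.
move=> a01 r01; have /andP[a0 a1] := a01; have /andP[r0 r1] := r01.
have ar01 : (0 < a * r < 1)%R.
  by rewrite mulr_gt0//= (le_lt_trans _ r1)// ler_piMl// ltW.
have lr : (0 < ln r^-1)%R by rewrite ln_gt0// invf_gt1.
rewrite -leeBrDr//; apply: le_above.
  rewrite leeBrDr// add0r; apply: le_trans (groetzsch_log ar01).
  rewrite lee_fin ler_ln ?posrE ?invr_gt0//; last by case/andP: ar01.
  by rewrite lef_pV2 ?posrE ?mulr_gt0// ler_piMl// ltW.
move=> X X0 hX; rewrite leeBrDr// -EFinD.
apply: G_inner => //; first by rewrite addr_gt0.
move=> Y /andP[Y0 YX].
have [YL|LY] := ltP Y (ln r^-1)%R; first by apply: inner_log => //; rewrite Y0/=; apply: lt_le_trans YL _;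
  rewrite ler_ln ?posrE ?invr_gt0//; [rewrite lef_pV2 ?posrE ?mulr_gt0// ler_piMl// ltW|case/andP: ar01].
(* Y is split as (Y - (ln r^-1 - e)) + (ln r^-1 - e). The bound by [d] keeps the first part below X,
   and e > 0 keeps the second below ln r^-1. *)
pose d := ((X + ln r^-1 - Y) / 2)%R.
have d0 : (0 < d)%R by rewrite divr_gt0// subr_gt0.
pose e := Num.min d (ln r^-1 / 2)%R.
have e0 : (0 < e)%R by rewrite lt_min d0 divr_gt0.
have ed : (e <= d)%R by rewrite ge_min lexx.
have el : (e <= ln r^-1 / 2)%R by rewrite ge_min lexx orbT.
have -> : (Y = (Y - (ln r^-1 - e)) + (ln r^-1 - e))%R by rewrite subrK.
apply: (inner_chain a01 r01); [lra|lra|].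
apply: inner_G => //; first lra.
apply: le_lt_trans hX; rewrite lee_fin; rewrite /d in ed; lra.
Qed.

Lemma groetzsch_bound : exists C : R, forall a, (0 < a < 1)%R -> G a <= (ln a^-1 + C)%:E.
Proof.
have [C C0 HC] := @inner_bound.
exists C => a a01; have /andP[a0 a1] := a01.
have n1 : (1 <= n%:R :> R)%R by rewrite ler1n.
(* Shrinking by r brings a r into the range of [inner_bound]; the term log (1/r) gained by the
   series rule cancels the one in the bound. *)
pose r : R := (2^-1 / n%:R)%R.
have r0 : (0 < r)%R by rewrite divr_gt0// invr_gt0.
have nr : (n%:R * r = 2^-1)%R by rewrite /r mulrCA divff ?mulr1// pnatr_eq0.
have r1 : (r < 1)%R by nra.
have ar0 : (0 < a * r)%R by rewrite mulr_gt0.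
have ar1 : (a * r < 1)%R by nra.
have small : G (a * r)%R <= (ln (a * r)^-1 + C)%:E.
  apply: le_above.
    by rewrite lee_fin addr_ge0 ?(ltW C0)// ltW// ln_gt0// invf_gt1.
  move=> X X0 hX; rewrite lee_fin; apply: HC => //.
    have : (n%:R * (a * r) < 2^-1)%R by rewrite mulrCA nr; lra.
    by lra.
  by apply: inner_G => //; rewrite ar0.
have := groetzsch_chain a01 (_ : 0 < r < 1)%R; rewrite r0 r1 => /(_ isT) h.
have := le_trans h small; rewrite -leeBrDr// -EFinB => /le_trans; apply.
rewrite lee_fin invfM lnM ?posrE ?invr_gt0//; lra.
Qed.

Lemma groetzsch_fin a : (0 < a < 1)%R -> G a \is a fin_num.
Proof.
move=> a01; have [C hC] := groetzsch_bound; have /andP[a0 a1] := a01.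
rewrite ge0_fin_numE; first by apply: le_lt_trans (hC a a01) (ltry _).
by apply: le_trans (groetzsch_log a01); rewrite lee_fin ltW// ln_gt0// invf_gt1.
Qed.

(* The inner radius of the ring conjugate to the Groetzsch ring of [s]. *)
Definition inner_radius (s : R) : R := (s + Num.sqrt (s ^+ 2 - 1))^-1.

Lemma inner_radiusP s : (1 < s)%R -> (0 < inner_radius s < 1)%R /\ ((inner_radius s + (inner_radius s)^-1) / 2 = s)%R.
Proof.
move=> s1; have q0 : (0 < s ^+ 2 - 1)%R by rewrite subr_gt0 exprn_egt1.
pose q := Num.sqrt (s ^+ 2 - 1); have qE : (q ^+ 2 = s ^+ 2 - 1)%R by rewrite sqr_sqrtr// ltW.
have qp : (0 < q)%R by rewrite sqrtr_gt0.
have sq : (0 < s + q)%R by lra.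
rewrite /inner_radius -/q; split.
  by rewrite invr_gt0 sq/= invf_lt1//; lra.
rewrite invrK; have -> : ((s + q)^-1 = s - q)%R.
  have h : ((s + q) * (s - q) = 1)%R by rewrite mulrC -subr_sqr qE; ring.
  by rewrite -[RHS](mulKf (_ : s + q != 0)%R) ?gt_eqF// h mulr1.
by field.
Qed.

(** This is a exp (G a). With a = [inner_radius s], 1/a = s + sqrt (s^2 - 1) is asymptotic to 2 s,
    so the supremum [l] of psi is half the Groetzsch constant. *)
Let psi (a : R) : R := expR (fine (G a) - ln a^-1)%R.

Let psi_chain a r : (0 < a < 1)%R -> (0 < r < 1)%R -> (psi a <= psi (a * r))%R.
Proof.
move=> a01 r01; have /andP[a0 a1] := a01; have /andP[r0 r1] := r01.
have ar01 : (0 < a * r < 1)%R.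
  by rewrite mulr_gt0//= (le_lt_trans _ r1)// ler_piMl// ltW.
have := groetzsch_chain a01 r01.
rewrite -(fineK (groetzsch_fin a01)) -(fineK (groetzsch_fin ar01)) -EFinD lee_fin => h.
have E : (ln (a * r)^-1 = ln a^-1 + ln r^-1)%R by rewrite invfM lnM ?posrE ?invr_gt0.
by rewrite /psi ler_expR E; lra.
Qed.

Let Psi := [set psi a | a in [set a : R | (0 < a < 1)%R]].
Let l := sup Psi.

Let Psi_sup : has_sup Psi.
Proof.
split; first by exists (psi 2^-1), 2^-1%R => //=; lra.
have [C hC] := groetzsch_bound; exists (expR C) => _ [a a01 <-].
by have := hC a a01; rewrite -(fineK (groetzsch_fin a01)) lee_fin /psi ler_expR; lra.
Qed.

Let psi_le a : (0 < a < 1)%R -> (psi a <= l)%R.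
Proof. by move=> a01; apply: ub_le_sup; [case: Psi_sup|exists a]. Qed.

Let psi_ge1 a : (0 < a < 1)%R -> (1 <= psi a)%R.
Proof.
move=> a01; have := groetzsch_log a01; rewrite -(fineK (groetzsch_fin a01)) lee_fin.
by rewrite /psi -expR0 ler_expR; lra.
Qed.

Let l1 : (1 <= l)%R.
Proof.
have h1 : (0 < 2^-1 :> R)%R by lra.
have h2 : (2^-1 < 1 :> R)%R by lra.
have h : (0 < (2^-1 : R) < 1)%R by rewrite h1 h2.
exact: le_trans (psi_ge1 h) (psi_le h).
Qed.

Let Phi_psi s : (1 < s)%R ->
  groetzsch_Phi n s / s%:E = (psi (inner_radius s) * ((s + Num.sqrt (s ^+ 2 - 1)) / s))%:E.
Proof.
move=> s1; have [a01 sE] := inner_radiusP s1; have /andP[a0 a1] := a01.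
have s0 : (0 < s)%R by lra.
rewrite /groetzsch_Phi -{1}sE -(fineK (groetzsch_fin a01)) /= inver gt_eqF// -EFinM; congr (_%:E).
have -> : (s + Num.sqrt (s ^+ 2 - 1) = (inner_radius s)^-1)%R by rewrite /inner_radius invrK.
have -> : psi (inner_radius s) = (expR (fine (G (inner_radius s))) * inner_radius s)%R.
  have la : (expR (ln (inner_radius s)^-1) = (inner_radius s)^-1)%R by rewrite lnK// posrE invr_gt0.
  by rewrite /psi expRD expRN la invrK.
by rewrite mulrA mulfK// gt_eqF.
Qed.

Lemma groetzsch_constantP : exists2 l : R, (1 <= l)%R &
  groetzsch_constant R n = (2 * l)%R /\
  forall s, (1 < s)%R -> @groetzsch_mod R n s <= (ln (l * (s + Num.sqrt (s ^+ 2 - 1))))%:E.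
Proof.
exists l; first exact: l1.
have root (s : R) : (1 < s)%R -> (s - 1 <= Num.sqrt (s ^+ 2 - 1) <= s)%R.
  move=> s1; have q0 : (0 < s ^+ 2 - 1)%R by rewrite subr_gt0 exprn_egt1.
  apply/andP; split.
    rewrite -(ler_pXn2r (ltn0Sn 1)) ?nnegrE ?sqrtr_ge0 ?subr_ge0 ?(ltW s1)// sqr_sqrtr ?ltW//.
    by nra.
  have s0 : (0 <= s)%R by lra.
  by rewrite -(ler_pXn2r (ltn0Sn 1)) ?nnegrE ?sqrtr_ge0// sqr_sqrtr ?ltW//; lra.
split; last first.
  move=> s s1; have [a01 sE] := inner_radiusP s1; have /andP[a0 a1] := a01.
  rewrite -{1}sE -(fineK (groetzsch_fin a01)) lee_fin.
  have -> : (s + Num.sqrt (s ^+ 2 - 1) = (inner_radius s)^-1)%R by rewrite /inner_radius invrK.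
  have l0 : (0 < l)%R by exact: lt_le_trans l1.
  have lp : l \is Num.pos by rewrite posrE.
  have ap : ((inner_radius s)^-1 \is Num.pos)%R by rewrite posrE invr_gt0.
  rewrite (lnM lp ap).
  rewrite -lerBlDr -ler_expR lnK ?posrE//.
  exact: psi_le.
rewrite /groetzsch_constant.
suff h : (groetzsch_Phi n s / s%:E) @[s --> +oo%R] --> (2 * l)%:E by rewrite (cvg_lim _ h).
apply/fine_cvgP; split.
  near=> s; have s1 : (1 < s)%R by near: s; apply: nbhs_pinfty_gt; exact: num_real.
  by rewrite Phi_psi.
apply/cvgrPdist_le => e e0; have l0 : (0 < l)%R by exact: lt_le_trans l1.
have e4 : (0 < e / 4)%R by rewrite divr_gt0.
(* Once [inner_radius s] is below [a0], monotonicity keeps psi between [psi a0] and [l]. *)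
have [_ [a0 /= a001 <-] ha] := sup_adherent e4 Psi_sup.
have /andP[a00 a01'] := a001.
near=> s.
have s1 : (1 < s)%R by near: s; apply: nbhs_pinfty_gt; exact: num_real.
have sa : (a0^-1 < s)%R by near: s; apply: nbhs_pinfty_gt; exact: num_real.
have sl : (2 * l / e < s)%R by near: s; apply: nbhs_pinfty_gt; exact: num_real.
have s0 : (0 < s)%R by lra.
rewrite /= Phi_psi//=.
have [a01 _] := inner_radiusP s1; have /andP[r0 r1] := a01.
have /andP[q1 q2] := root s s1.
have hq : (2 - s^-1 <= (s + Num.sqrt (s ^+ 2 - 1)) / s <= 2)%R.
  rewrite ler_pdivrMr// ler_pdivlMr// mulrBl mulVf ?gt_eqF//; lra.
have ra : (inner_radius s < a0)%R.
  rewrite /inner_radius -[ltRHS]invrK ltf_pV2 ?posrE ?invr_gt0//; lra.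
have pa : (psi a0 <= psi (inner_radius s))%R.
  have -> : (inner_radius s = a0 * (inner_radius s / a0))%R by field; rewrite gt_eqF.
  by apply: psi_chain => //; rewrite divr_gt0//= ltr_pdivrMr// mul1r.
have pl := psi_le a01.
have p1 := psi_ge1 a01.
have se : (l / s <= e / 2)%R.
  by rewrite ler_pdivrMr//; move: sl; rewrite ltr_pdivrMr//; lra.
have si : (0 < s^-1 < 1)%R by rewrite invr_gt0 s0 invf_lt1.
move: hq si se; set t := (_ / s)%R; set si := (s^-1)%R => hq hsi se.
set p := psi (inner_radius s) in pa pl p1 *.
have up : (p * t <= l * 2)%R by apply: ler_pM; lra.
have low : (p * (2 - si) <= p * t)%R by apply: ler_wpM2l; lra.
have low2 : (p * si <= l * si)%R by apply: ler_wpM2r; lra.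
rewrite ler_norml; apply/andP; split; first lra.
by move: ha; rewrite -/l; lra.
Unshelve. all: by end_near. Qed.

End groetzsch_constant.

(** * The estimate of the Teichmuller constant *)

Section teichmuller_constant.
Local Open Scope ereal_scope.

Lemma teichmuller_mod_le : exists2 l : R, (1 <= l)%R & groetzsch_constant R n = (2 * l)%R /\
  forall t, (1 < t)%R -> @teichmuller_mod R n t <= (2 * ln (l * (1 + Num.sqrt 2)) + ln t)%:E.
Proof.
have [l l1 [lE hl]] := @groetzsch_constantP; exists l => //; split=> // t t1.
have t0 : (0 < t)%R by lra.
have s2 : (0 <= Num.sqrt 2 :> R)%R by exact: sqrtr_ge0.
have B0 : (1 <= l * (1 + Num.sqrt 2))%R by nra.
apply: le_above; first by rewrite lee_fin addr_ge0 ?ln_ge0 ?mulr_ge0// ?ln_ge0// ltW.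
move=> X X0 /(teichmuller_groetzsch t0 X0) hX.
pose s := Num.sqrt (1 + t); have t10 : (0 <= 1 + t)%R by lra.
have sE : (s ^+ 2 = 1 + t)%R by rewrite sqr_sqrtr.
have s1 : (1 < s)%R by rewrite -{1}sqrtr1 ltr_sqrt; lra.
have := le_trans hX (hl s s1); rewrite lee_fin sE addrAC subrr add0r => h.
pose q := Num.sqrt t; have qE : (q ^+ 2 = t)%R by rewrite sqr_sqrtr// ltW.
have q0 : (0 < q)%R by rewrite sqrtr_gt0.
have sq : (s <= Num.sqrt 2 * q)%R.
  by rewrite -sqrtrM// ler_sqrt ?mulr_ge0//; lra.
have lt : (ln t = 2 * ln q)%R by rewrite -qE expr2 lnM ?posrE//; ring.
have h2 : (ln (l * (s + q)) <= ln (l * (1 + Num.sqrt 2) * q))%R.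
  rewrite ler_ln ?posrE; [|by rewrite mulr_gt0//; lra|by rewrite !mulr_gt0//; lra].
  by rewrite -mulrA ler_pM2l//; lra.
have h3 : (ln (l * (1 + Num.sqrt 2) * q) = ln (l * (1 + Num.sqrt 2)) + ln q)%R.
  by rewrite lnM ?posrE//; lra.
by rewrite lee_fin lt; move: h; rewrite -/q; lra.
Qed.

Lemma teichmuller_constant_le :
  teichmuller_constant R n <= (2 * ln ((1 + Num.sqrt 2) * groetzsch_constant R n / 2))%:E.
Proof.
have [l l1 [-> hl]] := teichmuller_mod_le.
apply: ge_ereal_sup => _ [t /= t1 <-].
apply: (le_trans (leeD2r (- (ln t)%:E) (hl t t1))).
rewrite (_ : (1 + Num.sqrt 2) * (2 * l) / 2 = l * (1 + Num.sqrt 2))%R; last by field.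
by rewrite -EFinB lee_fin addrK.
Qed.

(** Allows the constant to be moved across inequalities in the extended reals. *)
Lemma teichmuller_constant_fin : teichmuller_constant R n \is a fin_num.
Proof.
rewrite fin_numElt; apply/andP; split; last by apply: le_lt_trans teichmuller_constant_le (ltry _).
have lt12 : (1 < 2 :> R)%R by rewrite ltr1n.
have : (@teichmuller_mod R n 2 - (ln 2)%:E)%E <= teichmuller_constant R n by apply: ereal_sup_ubound; exists 2%R.
apply: lt_le_trans; have : 0 <= @teichmuller_mod R n 2 by exact: poweR_ge0.
by case: teichmuller_mod => [x| |]//; rewrite ltNyr.
Qed.
End teichmuller_constant.

(** * Annular subrings *)

Section annuli.
Local Notation e1 := (@e1 R n).

Lemma ball_exterior_mod_ge (x0 : Rn) (C0 C1 : set Rb) (r0 r1 : R) : 0 < r0 < r1 ->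
  (forall x, C0 (Some x) -> enorm (x - x0) <= r0) -> (forall x, C1 (Some x) -> r1 <= enorm (x - x0)) ->
  ((ln (r1 / r0))%:E <= ring_mod C0 C1)%E.
Proof.
move=> /andP[r00 r01] h0 h1.
have L0 : 0 < ln (r1 / r0) by rewrite ln_gt0// ltr_pdivlMr// mul1r.
apply: le_from_below => // X hX; have /andP[X0 _] := hX.
have [u [g [ug _ uE _ eg]]] := log_potential x0 r00 r01 hX.
apply: (ring_mod_ge m0 X0); apply: le_trans eg; apply: (upper_gradient_modulus ug).
  by move=> x /h0 hx; have [-> //] := uE x.
by move=> x /h1 hx; have [_ -> //] := uE x.
Qed.

Lemma connected_sub_closed (T : topologicalType) (A D0 D1 : set T) : connected A -> closed D0 -> closed D1 ->
  D0 `&` D1 = set0 -> A `<=` D0 `|` D1 -> A `<=` D0 \/ A `<=` D1.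
Proof.
move=> cA c0 c1 dis sub.
have [[x [Ax D0x]]|none] := pselect (exists x, A x /\ D0 x); last first.
  by right=> x Ax; case: (sub x Ax) => // D0x; exfalso; apply: none; exists x.
left; have E : A `&` D0 = A.
  apply: cA; first by exists x.
    exists (~` D1); first exact/closed_openC.
    apply/seteqP; split=> y [Ay Dy]; split=> //; first by move=> D1y; have : (D0 `&` D1) y by []; rewrite dis.
    by case: (sub y Ay).
  by exists D0.
by rewrite -E => y [].
Qed.

(** [ring_dom] forgets the two components and their order. The ball and the exterior are connected,
    so each lies in D0 or in D1; they cannot share one, because the other is nonempty. *)
Lemma annulus_complements (x0 : Rn) (r0 r1 : R) (D0 D1 : set Rb) : 0 < r0 < r1 -> ring_pair D0 D1 ->
  ring_dom D0 D1 = annulus x0 r0 r1 ->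
  (D0 = closed_eball x0 r0 /\ D1 = exterior x0 r1) \/ (D1 = closed_eball x0 r0 /\ D0 = exterior x0 r1).
Proof.
move=> r01 [[[n0 c0 k0] _ _] [[n1 c1 k1] _ _] dis] dom.
have [[[[_ cB _] _ _] [[_ cE _] _ _] disBE] domBE] := ball_exterior_ring x0 (ltn0Sn m) r01.
set B := closed_eball x0 r0 in cB disBE domBE *; set E := exterior x0 r1 in cE disBE domBE *.
have un : B `|` E = D0 `|` D1 by apply: setC_inj; rewrite -/(ring_dom B E) -/(ring_dom D0 D1) domBE dom.
have cl0 : closed D0 by exact/compact_Rbar.
have cl1 : closed D1 by exact/compact_Rbar.
have subB : B `<=` D0 `|` D1 by rewrite -un; left.
have subE : E `<=` D0 `|` D1 by rewrite -un; right.
have eqs (F0 F1 : set Rb) : F0 `&` F1 = set0 -> B `|` E = F0 `|` F1 -> B `<=` F0 -> E `<=` F1 -> F0 = B /\ F1 = E.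
  move=> dF uF BF EF; split; apply/seteqP; split=> // x Fx.
    have : (B `|` E) x by rewrite uF; left.
    by case=> // /EF F1x; have : (F0 `&` F1) x by []; rewrite dF.
  have : (B `|` E) x by rewrite uF; right.
  by case=> // /BF F0x; have : (F0 `&` F1) x by []; rewrite dF.
have one (F0 F1 : set Rb) : F0 `&` F1 = set0 -> F1 !=set0 -> B `|` E = F0 `|` F1 -> B `<=` F0 -> ~ E `<=` F0.
  move=> dF [x F1x] uF BF EF; have : (B `|` E) x by rewrite uF; right.
  by move=> [/BF|/EF] F0x; have : (F0 `&` F1) x by []; rewrite dF.
have [B0|B1] := connected_sub_closed cB cl0 cl1 dis subB; have [E0|E1] := connected_sub_closed cE cl0 cl1 dis subE.
- by have := one D0 D1 dis n1 un B0.
- by left; exact: eqs.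
- by right; apply: eqs => //; rewrite ?[D1 `&` _]setIC ?[D1 `|` _]setUC.
- by have := one D1 D0; rewrite [D1 `&` _]setIC [D1 `|` _]setUC => /(_ dis n0 un B1).
Qed.

(** Admissible densities are tested on the radial segments between the two spheres. *)
Lemma ball_exterior_mod_le (x0 : Rn) (r0 r1 : R) : 0 < r0 < r1 ->
  (ring_mod (closed_eball x0 r0) (exterior x0 r1) <= (ln (r1 / r0))%:E)%E.
Proof.
move=> r01; have /andP[r00 r0r1] := r01.
have L0 : 0 < ln (r1 / r0) by rewrite ln_gt0// ltr_pdivlMr// mul1r.
have [[[[_ _ kB] _ _] [[_ _ kE] _ _] dis] _] := ball_exterior_ring x0 (ltn0Sn m) r01.
apply: (ring_mod_le m0 L0); apply: le_ereal_inf_tmp => _ [rho arho <-].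
have [mrho rho0 _] := arho.
have mrn : measurable_fun setT (fun x => rho x ^+ n)%E by exact: measurable_fun_expe.
have mf : measurable_fun setT (fun x : Bn => rho ((x : Rn) + x0)).
  by apply: (measurableT_comp mrho); apply: measurable_rVD; [exact: measurable_id|exact: measurable_cst].
have key (v : Rn) : enorm v = 1 -> (1 <= \int[lebesgue_measure]_(s in [set` `[r0, r1]]) rho (s *: v + x0)%R)%E.
  move=> v1; have [f [L [uf cf]]] := upath_straight (r0 *: v + x0) (r1 *: v + x0).
  have nv s : 0 <= s -> enorm (s *: v + x0 - x0) = s by move=> s0; rewrite addrK enormZ v1 mulr1 ger0_norm.
  have := @admissible_upath R n _ _ rho f L _ _ (iffLR (compact_Rbar _) kB) (iffLR (compact_Rbar _) kE) dis arho uf.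
  rewrite cf// => h; apply: le_trans (h _ _) _.
  - by exists (r0 *: v + x0) => //=; rewrite nv// ltW.
  - by left; exists (r1 *: v + x0) => //=; rewrite nv//; lra.
  have d0 : 0 < r1 - r0 by rewrite subr_gt0.
  have mv : measurable_fun [set: R] (fun s : R => rho ((s + r0) *: v + x0)).
    apply: (measurableT_comp mrho); apply: measurable_rVD; last exact: measurable_cst.
    by apply: measurable_rVZ; [exact: measurable_funD|exact: measurable_cst].
  have mv' : measurable_fun [set: R] (fun s : R => rho (s *: v + x0)).
    apply: (measurableT_comp mrho); apply: measurable_rVD; last exact: measurable_cst.
    by apply: measurable_rVZ; [exact: measurable_id|exact: measurable_cst].
  rewrite /segment_cost (_ : r1 *: v + x0 - (r0 *: v + x0) = (r1 - r0) *: v); last first.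
    by rewrite opprD addrACA subrr addr0 scalerBl.
  rewrite enormZ v1 mulr1 gtr0_norm//.
  have e : (\int[lebesgue_measure]_(t in [set` `[0%R, 1%R]%R]) rho (r0 *: v + x0 + t *: ((r1 - r0) *: v))%R =
    \int[lebesgue_measure]_(t in [set` `[0%R, 1%R]%R]) rho (((r1 - r0) * t + r0) *: v + x0)%R)%E.
    apply: eq_integral => t _; congr rho; rewrite scalerA scalerDl addrAC; congr (_ + _).
    by rewrite addrC (mulrC t).
  rewrite e (ge0_integral_itv_scale mv (fun s => rho0 _) d0).
  have := ge0_integral_itv_shift mv' (fun s => rho0 _) 0 (r1 - r0) r0.
  by rewrite add0r subrK => ->.
have := radial_energy_ge r00 r0r1 mf (fun x => rho0 _) key.
rewrite (@ge0_integral_rVD R n _ x0 mrn (fun x => expe_ge0 _ (rho0 x))).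
by rewrite sphere_areaRE -EFinM mulrC.
Qed.

Local Notation A := (teichmuller_constant R n).

Lemma ring_mod_pinfty (C0 C1 : set Rb) : (forall X, 0 < X -> (X%:E <= ring_mod C0 C1)%E) -> ring_mod C0 C1 = +oo%E.
Proof.
move=> H; have := H 1 ltr01; have := fun X => H X; case: ring_mod => [x| |]// H' h1; exfalso.
by have := H' (Num.max x 0 + 1); rewrite !lee_fin => H2; have h3 := H2 (ltr_wpDl (_ : 0 <= Num.max x 0) ltr01);
  have : x <= Num.max x 0 by [rewrite le_max lexx]; move: (h3 ltac:(by rewrite le_max lexx orbT)); lra.
Qed.

Let annular_subring (x0 : Rn) (C0 C1 : set Rb) : ring_pair C0 C1 -> C0 (Some x0) -> C1 None ->
  (ring_mod C0 C1 < +oo)%E -> (A < ring_mod C0 C1)%E ->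
  exists r0 r1 : R, exists D0 D1 : set Rb,
      [/\ 0 < r0 < r1, ring_pair D0 D1, ring_dom D0 D1 = annulus x0 r0 r1,
          subring_dom (ring_dom D0 D1) (ring_dom C0 C1) & (ring_mod C0 C1 - A <= ring_mod D0 D1)%E].
Proof.
move=> [[[n0 c0 k0] _ _] [[n1 c1 k1] _ _] dis] C0x C1N Moo AM.
have cl0 : closed C0 by exact/compact_Rbar.
have cl1 : closed C1 by exact/compact_Rbar.
have C0N : ~ C0 None by move=> C0N; have : (C0 `&` C1) None by []; rewrite dis.
have C1x : ~ C1 (Some x0) by move=> C1x; have : (C0 `&` C1) (Some x0) by []; rewrite dis.
have Mfin : ring_mod C0 C1 \is a fin_num by rewrite ge0_fin_numE//; exact: poweR_ge0.
pose N0 := [set enorm (x - x0) | x in [set x : Rn | C0 (Some x)]].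
pose N1 := [set enorm (x - x0) | x in [set x : Rn | C1 (Some x)]].
(* The distances to x0 form a closed set, because near r only a compact part of C matters; the
   extremal distances r0 and r1 are therefore attained. *)
have clN (C : set Rb) : closed C -> closed [set enorm (x - x0) | x in [set x : Rn | C (Some x)]].
  move=> cC r hr; have cE : closed [set x : Rn | C (Some x)] by exact: closed_preimage_some.
  have cK : compact ([set x : Rn | C (Some x)] `&` [set x : Rn | enorm (x - x0) <= r + 1]).
    apply: (@compact_enorm R n _ (enorm x0 + (r + 1))); first by apply: closedI => //; exact: closed_enorm_le.
    by move=> x [_ /= hx]; have := enormD x0 (x - x0); rewrite addrC subrK; lra.
  have cI : compact [set enorm (x - x0) | x in [set x : Rn | C (Some x)] `&` [set x : Rn | enorm (x - x0) <= r + 1]].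
    apply: continuous_compact cK; apply: continuous_subspaceT; exact: enorm_sub_continuous.
  have cI' := compact_closed (@norm_hausdorff _ _) cI.
  have [x [Cx _] <-] : [set enorm (x - x0) | x in [set x : Rn | C (Some x)] `&` [set x : Rn | enorm (x - x0) <= r + 1]] r.
    apply: cI' => U /[dup] hU /nbhs_ballP[d /= d0 dU].
    have nb : nbhs r (U `&` [set y | y < r + 1]).
      by apply: filterI => //; apply: open_nbhs_nbhs; split; [exact: open_lt|rewrite /= ltrDl].
    by have [_ [[x Cx <-] [Ux /= hx]]] := hr _ nb; exists (enorm (x - x0)); split=> //; exists x => //; split=> //=; exact: ltW.
  by exists x.
have [b hb] := closed_bounded cl0 C0N.
have s0 : has_sup N0.
  split; first by exists (enorm (x0 - x0)), x0.
  by exists (b + enorm x0) => _ [x /hb hx <-]; have := enormD x (- x0); rewrite enormN; lra.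
pose r0 := sup N0; have [y C0y yr] : N0 r0 by apply: closed_sup s0; exact: clN.
have hr0 x : C0 (Some x) -> enorm (x - x0) <= r0 by move=> Cx; apply: ub_le_sup; [case: s0|exists x].
(* If C1 is reduced to infinity, the ring contains annuli of every modulus around C0, against the
   finiteness of its own modulus. *)
have [[z0 C1z0]|noE1] := pselect (exists z, C1 (Some z)); last first.
  exfalso; move: Moo; rewrite (ring_mod_pinfty _) ?ltxx// => X X0.
  apply: (@le_trans _ _ (ln (expR X * (r0 + 1) / (r0 + 1)))%:E).
    have r10 : 0 < r0 + 1 by rewrite ltr_wpDl// -yr enorm_ge0.
    by rewrite mulfK ?gt_eqF// expRK.
  have r10 : 0 < r0 + 1 by rewrite ltr_wpDl// -yr enorm_ge0.
  apply: (@ball_exterior_mod_ge x0).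
  - by rewrite r10/= ltr_pMl// expR_gt1.
  - by move=> x /hr0; lra.
  - by move=> x Cx; exfalso; apply: noE1; exists x.
have i1 : has_inf N1.
  split; first by exists (enorm (z0 - x0)), z0.
  by exists 0 => _ [x _ <-]; exact: enorm_ge0.
pose r1 := inf N1; have [z C1z zr] : N1 r1 by apply: closed_inf i1; exact: clN.
have hr1 x : C1 (Some x) -> r1 <= enorm (x - x0) by move=> Cx; apply: ge_inf; [case: i1|exists x].
have r10 : 0 < r1.
  rewrite -zr enorm_gt0 subr_eq0; apply/eqP => zx; apply: C1x; by rewrite -zx.
(* If C0 is reduced to x0, arbitrarily small inner spheres again give annuli of every modulus. *)
have r00 : 0 < r0.
  rewrite lt_neqAle -{2}yr enorm_ge0 andbT; apply/eqP => r0E.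
  move: Moo; rewrite (ring_mod_pinfty _) ?ltxx// => X X0.
  apply: (@le_trans _ _ (ln (r1 / (r1 * expR (- X))))%:E).
    by rewrite invfM mulrA divff ?gt_eqF// mul1r expRN invrK expRK.
  apply: (@ball_exterior_mod_ge x0) => //.
  - have eX : expR (- X) < 1 by rewrite -[ltRHS]expR0 ltr_expR; lra.
    by rewrite mulr_gt0 ?expR_gt0//= gtr_pMr.
  - by move=> x /hr0; rewrite -r0E => hx; apply: le_trans hx _; rewrite mulr_ge0 ?expR_ge0// ltW.
have toT t : r1 <= r0 * t -> 0 < t -> (ring_mod C0 C1 <= @teichmuller_mod R n t)%E.
  move=> ht t0; apply: le_above; first exact: poweR_ge0.
  move=> X X0 hX.
  have := @ring_teichmuller C0 C1 X r0 (r0 * t) x0 y z c0 c1 cl0 cl1 dis C1N C0x C0y C1z r00.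
  rewrite mulr_gt0// yr zr lexx => /(_ isT isT ht X0 hX).
  by rewrite mulrAC divff ?gt_eqF// mul1r.
have Tle t : 1 < t -> (@teichmuller_mod R n t <= A + (ln t)%:E)%E.
  by move=> t1; rewrite -leeBlDr//; apply: ereal_sup_ubound; exists t.
have Afin := @teichmuller_constant_fin.
(* If r1 <= r0, the comparison with the Teichmuller ring holds for every t > 1, and t -> 1 bounds
   the modulus by A, against the hypothesis. *)
have r01 : r0 < r1.
  rewrite ltNge; apply/negP => r10'; move: AM; apply/negP; rewrite -leNgt.
  apply/lee_addgt0Pr => e e0.
  have t1 : 1 < expR e by rewrite expR_gt1.
  have := le_trans (toT (expR e) _ (expR_gt0 _)) (Tle _ t1); rewrite expRK; apply.
  by apply: (le_trans r10'); rewrite ler_peMr ?ltW.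
have hr : 0 < r0 < r1 by rewrite r00.
have [rp domE] := @ball_exterior_ring R n x0 r0 r1 (ltn0Sn m) hr.
exists r0, r1, (closed_eball x0 r0), (exterior x0 r1); split=> //.
- rewrite domE; split.
    move=> _ [x /= /andP[h1 h2] <-] [/hr0|/hr1]; lra.
  move=> q; rewrite -domE setCK => -[Bq|Eq].
    exists (Some x0); split; last by rewrite setCK; left.
    have [[[_ cB _] _ _] _ _] := rp.
    have sub : closed_eball x0 r0 `<=` closed_eball x0 r0 `|` exterior x0 r1 by left.
    apply: (connected_component_max Bq sub cB).
    by exists x0 => //=; rewrite subrr enorm0 ltW.
  exists None; split; last by rewrite setCK; right.
  have [_ [[_ cE _] _ _] _] := rp.
  have sub : exterior x0 r1 `<=` closed_eball x0 r0 `|` exterior x0 r1 by right.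
  by apply: (connected_component_max Eq sub cE); right.
have t1 : 1 < r1 / r0 by rewrite ltr_pdivlMr// mul1r.
apply: (@le_trans _ _ (ln (r1 / r0))%:E).
  rewrite leeBlDr// addeC; apply: le_trans (Tle _ t1); apply: toT; last by rewrite divr_gt0.
  by rewrite mulrC divfK// gt_eqF.
apply: (@ball_exterior_mod_ge x0) => //.
  by move=> x [x' /= hx [<-]].
by move=> x [[x' /= hx [<-]]|].
Qed.

Lemma annular_subring_teichmuller (x0 : Rn) : annular_subring_property x0 A.
Proof.
move=> C0 C1 rp [sepE [p0 [C0p p0E]] [p1 [C1p p1E]]] Moo AM.
have [_ _ dis] := rp.
case: p0E C0p => -> C0p; case: p1E C1p => -> C1p.
- by have : (C0 `&` C1) (Some x0) by []; rewrite dis.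
- exact: annular_subring.
- have rp' : ring_pair C1 C0 by case: rp => f0 f1 _; split=> //; rewrite setIC.
  rewrite ring_modC in Moo AM.
  have [r0 [r1 [D0 [D1 [h1 h2 h3 h4 h5]]]]] := annular_subring rp' C1p C0p Moo AM.
  exists r0, r1, D0, D1; split=> //; last by rewrite ring_modC.
  by have -> : ring_dom C0 C1 = ring_dom C1 C0 by rewrite /ring_dom setUC.
- by have : (C0 `&` C1) None by []; rewrite dis.
Qed.

(** Take t with mod R_T(t) - log t > c and move the Teichmuller ring to x0. An annulus centered at
    x0 inside it avoids both pieces of the axis, so 1 <= r0 and r1 <= t, and its modulus is at most
    log t. *)
Lemma annular_subring_sharp (x0 : Rn) (c : R) : (c%:E < A)%E -> ~ annular_subring_property x0 c%:E.
Proof.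
move=> cA prop; have [_ [t /= t1 <-] ct] := ereal_sup_gt cA.
have t0 : 0 < t by lra.
have lt0 : 0 < ln t by rewrite ln_gt0.
pose C0 := axis_segment x0 (-1) 0; pose C1 := axis_ray x0 t.
have f0 : filled_continuum C0 by apply: axis_segment_filled; lra.
have f1 : filled_continuum C1 by exact: axis_ray_filled.
have dis : C0 `&` C1 = set0.
  rewrite -subset0 => -[x|] []; last by case.
  move=> /axis_segmentP[r /andP[_ r0] ->] /axis_rayP[q tq /addrI /eqP].
  rewrite -subr_eq0 -scalerBl scaler_eq0 (negPf e1_neq0) orbF => /eqP; lra.
have C0x s : 0 <= s <= 1 -> C0 (Some (x0 - s *: e1)).
  by move=> s01; apply/axis_segmentP; exists (- s); rewrite ?scaleNr//; lra.
have C0x0 : C0 (Some x0) by have := C0x 0; rewrite scale0r subr0; apply; lra.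
have C1N : C1 None by right.
have C1t s : t <= s -> C1 (Some (x0 + s *: e1)) by move=> ts; apply/axis_rayP; exists s.
have TM : (@teichmuller_mod R n t <= ring_mod C0 C1)%E.
  apply: le_above; first exact: poweR_ge0.
  move=> X X0 hX.
  have [u [g [ug u01 uE0 uE1 [_ eg]]]] := teichmuller_potential t0 X0 hX.
  have ug1 := upper_gradient_affine x0 ltr01 ug.
  apply: (ring_mod_ge m0 X0); apply: le_trans eg.
  rewrite -(energy_affine x0 ltr01 (ug_ge0 ug) (ug_measurable ug)); apply: (upper_gradient_modulus ug1).
    move=> x /axis_segmentP[r r01 ->]; rewrite invr1 scale1r addrAC subrr add0r uE0//.
    by apply/segment_scale; exists r.
  move=> x /axis_rayP[r tr ->]; rewrite invr1 scale1r addrAC subrr add0r uE1//.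
  by apply/ray_scale; exists r.
have Afin := @teichmuller_constant_fin.
have Tfin : (@teichmuller_mod R n t < +oo)%E.
  have : (@teichmuller_mod R n t <= A + (ln t)%:E)%E by rewrite -leeBlDr//; apply: ereal_sup_ubound; exists t.
  by move/le_lt_trans; apply; rewrite -(fineK Afin) -EFinD ltry.
have Moo : (ring_mod C0 C1 < +oo)%E.
  apply: le_lt_trans Tfin; apply: le_above; first exact: poweR_ge0.
  move=> X X0 hX.
  have [[_ c0 k0] _ _] := f0; have [[_ c1 k1] _ _] := f1.
  have := @ring_teichmuller C0 C1 X 1 t x0 (x0 - 1 *: e1) (x0 + t *: e1) c0 c1 _ _ dis C1N C0x0 _ _ ltr01 t0.
  rewrite divr1; apply => //.
  - exact/compact_Rbar.
  - exact/compact_Rbar.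
  - by apply: C0x; rewrite ler01 lexx.
  - exact: C1t.
  - by rewrite addrAC subrr add0r enormN enormZ enorm_e1 normr1 mulr1.
  - by rewrite addrAC subrr add0r enormZ enorm_e1 gtr0_norm// mulr1.
have T0 : (0 <= @teichmuller_mod R n t)%E by exact: poweR_ge0.
have M0 : (0 <= ring_mod C0 C1)%E by exact: poweR_ge0.
have := prop C0 C1 _ _ Moo; move: ct TM Tfin T0 Moo M0.
case: teichmuller_mod => [T| |]//; case ME : (ring_mod C0 C1) => [M| |]// ct TM _ T0 _ M0.
move: ct TM; rewrite -EFinB lte_fin lee_fin => ct TM.
move=> /(_ _ _ _)[||| r0 [r1 [D0 [D1 [r01 rpD domD [sub _] hM]]]]].
- by split.
- split; [|by exists (Some x0); split=> //; left|by exists None; split=> //; right].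
  by rewrite -subset0 => p [hp [pE|pE]]; apply: hp; rewrite pE; [left|right].
- by rewrite lte_fin; lra.
have /andP[r00 r0r1] := r01.
rewrite domD in sub.
have inA (x : Rn) : r0 < enorm (x - x0) < r1 -> ~ C0 (Some x) /\ ~ C1 (Some x).
  by move=> hx; have := sub (Some x) (ex_intro2 _ _ x hx erefl); split=> h; apply: H; [left|right].
have r0ge : 1 <= r0.
  rewrite leNgt; apply/negP => r01'.
  (* A radius of the annulus below 1: the point x0 - s e_1 would lie both in the annulus and in
     C0. *)
  pose s := (r0 + Num.min r1 1) / 2.
  have m1 : r0 < Num.min r1 1 by rewrite lt_min r0r1.
  have m2 : Num.min r1 1 <= r1 by rewrite ge_min lexx.
  have m3 : Num.min r1 1 <= 1 by rewrite ge_min lexx orbT.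
  have hs : r0 < enorm (x0 - s *: e1 - x0) < r1.
    rewrite addrAC subrr add0r enormN enormZ enorm_e1 mulr1 gtr0_norm /s; lra.
  have [h _] := inA _ hs; apply: h; apply: C0x; rewrite /s; lra.
have r1le : r1 <= t.
  rewrite leNgt; apply/negP => tr1.
  pose s := (Num.max r0 t + r1) / 2.
  have m1 : Num.max r0 t < r1 by rewrite gt_max r0r1.
  have m2 : r0 <= Num.max r0 t by rewrite le_max lexx.
  have m3 : t <= Num.max r0 t by rewrite le_max lexx orbT.
  have hs : r0 < enorm (x0 + s *: e1 - x0) < r1.
    rewrite addrAC subrr add0r enormZ enorm_e1 mulr1 gtr0_norm /s; lra.
  have [_ h] := inA _ hs; apply: h; apply: C1t; rewrite /s; lra.
have : (ring_mod D0 D1 <= (ln (r1 / r0))%:E)%E.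
  have [[-> ->]|[-> ->]] := annulus_complements r01 rpD domD; last rewrite ring_modC.
    exact: ball_exterior_mod_le.
  exact: ball_exterior_mod_le.
move/(le_trans hM); rewrite -EFinB lee_fin => h.
have : ln (r1 / r0) <= ln t.
  rewrite ler_ln ?posrE ?divr_gt0//; last by lra.
  by rewrite ler_pdivrMr//; nra.
lra.
Qed.
End annuli.
End extremal_rings.

Theorem theorem3p4 (R : realType) (n : nat) (hn : (2 <= n)%N)
    (x0 : 'rV[R]_n) :
  [/\ annular_subring_property x0 (teichmuller_constant R n),
      forall c : R, (c%:E < teichmuller_constant R n)%E ->
        ~ annular_subring_property x0 c%:E,
      (teichmuller_constant R n <=
         (2 * ln ((1 + Num.sqrt 2) * groetzsch_constant R n / 2))%:E)%E &
      2 * ln ((1 + Num.sqrt 2) * groetzsch_constant R n / 2) =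
        ln ((3 + 2 * Num.sqrt 2) * groetzsch_constant R n ^+ 2 / 4)].
Proof.
case: n hn x0 => [//|m] m0 x0; split.
- exact: annular_subring_teichmuller.
- exact: annular_subring_sharp.
- exact: teichmuller_constant_le.
(* The Groetzsch constant is 2 l with l >= 1, so the argument of the logarithm is positive and its
   square can be taken inside. *)
have [l l1 [-> _]] := @teichmuller_mod_le R m m0.
have s2 : Num.sqrt 2 ^+ 2 = 2 :> R by rewrite sqr_sqrtr.
have s0 : 0 <= Num.sqrt 2 :> R by exact: sqrtr_ge0.
rewrite mulr_natl -lnXn; last by nra.
by congr ln; move: s2; rewrite !expr2 => s2; nra.
Qed.
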